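(* Fix a complete, proper, and discrete Iwasawa CF algorithm on an Iwasawa inversion space $\mathbb X$, with associated hyperbolic space $\mathbb H$, modular group $\mathcal M$, inversion $\iota$, shift map $T$, and fundamental domain $K\subset\mathbb X$ for the lattice $\mathcal Z=\mathrm{Stab}_{\mathcal M}(\infty)$. There exist a constant $h_0>1$ and a codimension-one set $\mathcal C_{\mathbb W}\subset T^1\mathbb H$, namely the set $\mathcal C_{\mathbb W}$ associated to $h_0$ in the context, and a marking that assigns to every markable geodesic $\gamma$ satisfying $\gamma(0)\in\mathcal C_{\mathbb W}$ - digits $a_i\in\mathcal Z$ and mappings $M_i\in\mathcal M$ for each $i\in\mathbb Z$, - increasing indices $i_j\in\mathbb Z$ and times $t_j$ for each $j\in\mathbb Z$, with $i_0=0$, $t_0=0$, such that: 1. (Full Coverage) The segments $[t_{j-1},t_j]$ have length uniformly bounded below and hence cover all of $\mathbb R$. 2. (Relation to Shift Map) For each $i\ge1$, $a_i$ is the $i$-th CF digit of $\gamma_+$, and $M_i=\iota^{-1}a_1\iota^{-1}a_2\cdots\iota^{-1}a_i$ is the branch of $T^{-i}$ associated to $T$ at $\gamma_+$. 3. (Cusp Detection) If for some $t\in[t_{j-1},t_j]$ and $M\in\mathcal M$ one has $\mathrm{ht}_{M\infty}(\gamma(t))>h_0$ and $M^{-1}\gamma_+\in K$, then $M=M_{i_j}$. 4. (Intersection Detection) Let $M\in\mathcal M$ and $t\in\mathbb R$. Then $\gamma(t)\in M\mathcal C_{\mathbb W}$ if and only if for some $j$ one has $t=t_j$ and $M=M_{i_j}$.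 5. (Shifted Gauss Equivariance) Let $l\in\mathbb Z$. The marking $\{a'_i,M'_i,i'_j,t'_j\}$ associated to the markable geodesic $\gamma'(t):=M_{i_l}^{-1}\gamma(t+t_l)$ satisfies $t'_j=t_{j+l}-t_l$, $i'_j=i_{j+l}-i_l$, $a'_i=a_{i+i_l}$, and $M'_i=M_{i_l}^{-1}M_{i+i_l}$.
   Context: **Spaces.** $k$ is $\mathbb R$, $\mathbb C$ or the quaternions, $n\ge1$; $\mathrm{Im}(k)\subset k$ is the set of purely imaginary elements; $\|\cdot\|$ is the standard norm. $\mathbb X=\mathbb X^n_k=k^n\times\mathrm{Im}(k)$ with group law $(z,t)*(z',t')=(z+z',t+t'+2\,\mathrm{Im}\langle z,z'\rangle)$, $\langle z,z'\rangle=\sum_i\overline{z_i}z'_i$. The same formula defines a group law on $k^n\times k$, with gauge $|(z,w)|=\big\|\|z\|^2+|\mathrm{Re}\,w|+\mathrm{Im}\,w\big\|^{1/2}$ and $d((z,w),(z',w'))=|(-z,-w)*(z',w')|$ (on $\mathbb X$: the Cygan metric). $\mathbb H=\{(z,w)\in k^n\times k:\mathrm{Re}\,w>0\}$, $\partial\mathbb H=\mathbb X$. Let $\phi(z,w)=(1,\sqrt2 z,w+\|z\|^2)\in k^{n+2}$, $\infty$ correspond to $(0,0,1)$, $J=\begin{bmatrix}0&0&-1\\0&\mathrm{id}_n&0\\-1&0&0\end{bmatrix}$. Via $\phi$, $G=\mathbb PU(J)$ acts on $\mathbb H$ and $\mathbb X\cup\{\infty\}$ (Möbius transformations); $d_{\mathbb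 H}$ is the $G$-invariant Riemannian metric on $\mathbb H$ with sectional curvature pinched in $[-1,-1/4]$ (equal to $-1$ if $k=\mathbb R$). $\mathrm{Isom}(\mathbb X)$: isometries of $(\mathbb X,d)$ that are restrictions of elements of $\mathrm{Stab}_G(\infty)$, viewed in $G$. An inversion is a Möbius transformation $\iota$ of $\mathbb X\setminus\{0\}$ exchanging $0,\infty$ with $|\iota h|=1/|h|$ and $d(\iota h,\iota h')=\frac{d(h,h')}{|h||h'|}$ for $h\in(\mathbb H\cup\mathbb X)\setminus\{0\}$, $h'\in\mathbb X\setminus\{0\}$. **Iwasawa CF algorithm.** Data: an inversion $\iota$; a lattice $\mathcal Z\subset\mathrm{Isom}(\mathbb X)$; a fundamental domain $K$ (measurable, $\mathbb X=\bigcup_{a\in\mathcal Z}aK$, with $E:=K\cap\bigcup_{a\in\mathcal Z\setminus\{\mathrm{id}\}}aK$ of measure $0$); a rounding mapping $[\cdot]:\mathbb X\to\mathcal Z$ with $[y]^{-1}(y)\in K$. $\mathcal M=\langle\iota,\mathcal Z\rangle$. Shift map $T:K\to K$, $T(0)=0$, $T(x)=[\iota x]^{-1}(\iota x)$. CF digits of $x\in K$: $x_0=x$, $a_{i+1}=[\iota(x_i)]$, $x_{i+1}=T(x_i)$. *Discrete*: $\mathcal M$ discrete in $G$. *Proper*: $\mathrm{rad}(K)=\sup_{x\in K}|x|<1$. *Complete*: $\mathrm{Stab}_{\mathcal M}(\infty)=\mathcal Z$. **Walls and sections.** $\mathrm{ht}_\infty(z,w)=\mathrm{Re}\,w$, $\mathrm{ht}_{M\infty}(h)=\mathrm{ht}_\infty(M^{-1}h)$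 for $M\in\mathcal M$. $\mathbb S=\{h\in\mathbb H:|h|=1\}$. Geodesics are unit-speed for $d_{\mathbb H}$, with forward/backward endpoints $\gamma_\pm\in\mathbb X\cup\{\infty\}$. Fix $\epsilon>0$ with $1+\epsilon<\mathrm{rad}(K)^{-1}$, and fix $h_2\in(0,1)$ (it exists) such that any geodesic ray $\gamma$ with $|\gamma(0)|\ge1+\epsilon$ and $\gamma_+\in K$ meets $\mathbb S$ only at points with $\mathrm{ht}_\infty\ge h_2$. $\mathbb W=\{h\in\mathbb S:\mathrm{ht}_\infty(h)\ge h_2\}$. Given $h_0>1$, $\mathcal C_{\mathbb W}\subset T^1\mathbb H$ is the set of unit vectors based at points of $\mathbb W$ whose geodesic line $\gamma$ satisfies: (i) $\gamma(0)\in\mathbb W$ and $\gamma(t)\notin\mathbb W$ for $t>0$; (ii) $\gamma_+\in K\setminus\mathcal M(\{\infty\}\cup E)$; (iii) there is $\hat t<0$ with $\mathrm{ht}_\infty(\gamma(\hat t))>h_0$. Writing $\gamma(t)\in M\mathcal C_{\mathbb W}$ means that the tangent vector of $\gamma$ at time $t$ lies in $M\mathcal C_{\mathbb W}$. A geodesic is *markable* if it intersects $\mathcal M$-translates of $\mathcal C_{\mathbb W}$ infinitely many times in both the past and the future. *)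

(* Defs.v *)
From HB Require Import structures.
From mathcomp Require Import all_boot all_order all_algebra.
From mathcomp Require Import generic_quotient.
From mathcomp Require Import all_classical all_reals all_analysis.
From mathcomp Require Import ring lra.

Set Implicit Arguments.
Unset Strict Implicit.
Unset Printing Implicit Defensive.

Import Order.TTheory GRing.Theory Num.Theory.
Import numFieldNormedType.Exports.

Local Open Scope classical_set_scope.
Local Open Scope ring_scope.
Local Open Scope quotient_scope.

(* Real, complex and quaternionic scalars are treated uniformly, as the
   subrings R, R + Ri and R + Ri + Rj + Rk of Hamilton's quaternions. *)

Record quat (R : Type) := Quat { qr : R; qi : R; qj : R; qk : R }.

Section Quaternions.
Context (R : realType).
Local Notation H := (quat R).

Definition quat_tuple (x : H) := (qr x, qi x, qj x, qk x).
Definition tuple_quat (t : R * R * R * R) : H :=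
  let: (a, b, c, d) := t in Quat a b c d.
Lemma quat_tupleK : cancel quat_tuple tuple_quat. Proof. by case. Qed.
HB.instance Definition _ := Choice.copy H (can_type quat_tupleK).

Definition qadd (x y : H) :=
  Quat (qr x + qr y) (qi x + qi y) (qj x + qj y) (qk x + qk y).
Definition qopp (x : H) := Quat (- qr x) (- qi x) (- qj x) (- qk x).
Definition qmul (x y : H) := Quat
  (qr x * qr y - qi x * qi y - qj x * qj y - qk x * qk y)
  (qr x * qi y + qi x * qr y + qj x * qk y - qk x * qj y)
  (qr x * qj y - qi x * qk y + qj x * qr y + qk x * qi y)
  (qr x * qk y + qi x * qj y - qj x * qi y + qk x * qr y).
Definition qreal (a : R) : H := Quat a 0 0 0.

Fact qaddA : associative qadd.
Proof. by move=> [????] [????] [????]; rewrite /qadd /=; congr Quat; ring. Qed.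
Fact qaddC : commutative qadd.
Proof. by move=> [????] [????]; rewrite /qadd /=; congr Quat; ring. Qed.
Fact qadd0 : left_id (qreal 0) qadd.
Proof. by move=> [????]; rewrite /qadd /=; congr Quat; ring. Qed.
Fact qaddN : left_inverse (qreal 0) qopp qadd.
Proof. by move=> [????]; rewrite /qadd /qreal /=; congr Quat; ring. Qed.
Fact qmulA : associative qmul.
Proof. by move=> [????] [????] [????]; rewrite /qmul /=; congr Quat; ring. Qed.
Fact qmul1l : left_id (qreal 1) qmul.
Proof. by move=> [????]; rewrite /qmul /=; congr Quat; ring. Qed.
Fact qmul1r : right_id (qreal 1) qmul.
Proof. by move=> [????]; rewrite /qmul /=; congr Quat; ring. Qed.
Fact qmulDl : left_distributive qmul qadd.
Proof.
by move=> [????] [????] [????]; rewrite /qmul /qadd /=; congr Quat; ring.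
Qed.
Fact qmulDr : right_distributive qmul qadd.
Proof.
by move=> [????] [????] [????]; rewrite /qmul /qadd /=; congr Quat; ring.
Qed.
Fact qone_neq0 : qreal 1 != qreal 0.
Proof. by apply/eqP => -[] /eqP; rewrite oner_eq0. Qed.

HB.instance Definition _ := GRing.isNzRing.Build H
  qaddA qaddC qadd0 qaddN qmulA qmul1l qmul1r qmulDl qmulDr qone_neq0.

Definition qconj (x : H) : H := Quat (qr x) (- qi x) (- qj x) (- qk x).
Definition qnormsq (x : H) : R := qr x ^+ 2 + qi x ^+ 2 + qj x ^+ 2 + qk x ^+ 2.

End Quaternions.

Variant scalars := RealScalars | ComplexScalars | QuaternionScalars.

Definition kdim (k : scalars) : nat :=
  match k with RealScalars => 1 | ComplexScalars => 2 | QuaternionScalars => 4 end.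

Section Scalars.
Context (R : realType) (k : scalars).

Definition qproj (x : quat R) : quat R :=
  match k with
  | RealScalars => Quat (qr x) 0 0 0
  | ComplexScalars => Quat (qr x) (qi x) 0 0
  | QuaternionScalars => x
  end.

Definition qin : pred (quat R) := [pred x | qproj x == x].

Fact qin_subring : subring_closed qin.
Proof.
rewrite /qin /qproj; split => [|[????] [????]|[????] [????]]; rewrite !inE /=;
  case: k => //=.
- by move=> /eqP[<- <- <-] /eqP[<- <- <-]; apply/eqP; congr Quat => /=; ring.
- by move=> /eqP[<- <-] /eqP[<- <-]; apply/eqP; congr Quat => /=; ring.
- by move=> /eqP[<- <- <-] /eqP[<- <- <-]; apply/eqP; congr Quat => /=; ring.
- by move=> /eqP[<- <-] /eqP[<- <-]; apply/eqP; congr Quat => /=; ring.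
Qed.

Record scalar := Scalar { sval : quat R; _ : qin sval }.
HB.instance Definition _ := [isSub for sval].
HB.instance Definition _ := [Choice of scalar by <:].
HB.instance Definition _ :=
  GRing.SubChoice_isSubNzRing.Build (quat R) qin scalar qin_subring.

Fact qproj_in x : qin (qproj x).
Proof. by rewrite /qin /qproj /=; case: k. Qed.
Definition kproj (x : quat R) : scalar := Scalar (qproj_in x).

Definition kreal (a : R) : scalar := kproj (qreal a).
Definition kconj (x : scalar) : scalar := kproj (qconj (sval x)).
Definition kre (x : scalar) : R := qr (sval x).
Definition kim (x : scalar) : scalar := x - kreal (kre x).
Definition knorm (x : scalar) : R := Num.sqrt (qnormsq (sval x)).
Definition kinv (x : scalar) : scalar := kreal (qnormsq (sval x))^-1 * kconj x.

Lemma sval_kconj x : sval (kconj x) = qconj (sval x).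
Proof.
case: x => -[a b c d] /=; rewrite /qin /qproj /qconj /=.
by case: k => //= /eqP[]; do ?[move=> <-]; rewrite ?oppr0.
Qed.
Lemma sval_inj : injective sval. Proof. exact: val_inj. Qed.
Lemma svalM (x y : scalar) : sval (x * y) = sval x * sval y. Proof. by []. Qed.
Lemma svalD (x y : scalar) : sval (x + y) = sval x + sval y. Proof. by []. Qed.

Lemma kconjK : involutive kconj.
Proof.
move=> x; apply: sval_inj; rewrite !sval_kconj.
by case: (sval x) => a b c d; rewrite /qconj /= !opprK.
Qed.
Lemma kconjM x y : kconj (x * y) = kconj y * kconj x.
Proof.
apply: sval_inj; rewrite sval_kconj !svalM !sval_kconj.
case: (sval x) (sval y) => [a b c d] [a' b' c' d'].
rewrite /qconj -![_ * _]/(qmul _ _) /qmul /=; congr Quat; ring.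
Qed.
Lemma kconjD : {morph kconj : x y / x + y}.
Proof.
move=> x y; apply: sval_inj; rewrite sval_kconj !svalD !sval_kconj.
case: (sval x) (sval y) => [a b c d] [a' b' c' d'].
rewrite /qconj -![_ + _]/(qadd _ _) /qadd /=; congr Quat; ring.
Qed.
Lemma kconj0 : kconj 0 = 0.
Proof. by apply: sval_inj; rewrite sval_kconj /qconj /= oppr0. Qed.
Lemma kconj1 : kconj 1 = 1.
Proof. by apply: sval_inj; rewrite sval_kconj /qconj /= oppr0. Qed.
Lemma kconjN x : kconj (- x) = - kconj x.
Proof. by apply: (addrI (kconj x)); rewrite -kconjD !subrr kconj0. Qed.

Definition adjmx m p (A : 'M[scalar]_(m, p)) : 'M[scalar]_(p, m) :=
  (map_mx kconj A)^T.

Lemma adjmxK m p (A : 'M[scalar]_(m, p)) : adjmx (adjmx A) = A.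
Proof. by apply/matrixP => i j; rewrite !mxE kconjK. Qed.
Lemma adjmxM m p q (A : 'M[scalar]_(m, p)) (B : 'M[scalar]_(p, q)) :
  adjmx (A *m B) = adjmx B *m adjmx A.
Proof.
apply/matrixP => i j; rewrite !mxE (big_morph _ kconjD kconj0).
by apply: eq_bigr => l _; rewrite kconjM !mxE.
Qed.
Lemma adjmx1 m : adjmx (1%:M : 'M[scalar]_m) = 1%:M.
Proof.
by apply/matrixP => i j; rewrite !mxE eq_sym; case: eqP => _;
  rewrite ?mulr0n ?mulr1n ?kconj0 ?kconj1.
Qed.

End Scalars.

Section Unitary.
Context (R : realType) (k : scalars) (n : nat).
Local Notation K := (scalar R k).
(* The blocks 1, n, 1 of k^(n+2). *)
Local Notation N := (1 + (n + 1))%N.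

Definition formJ : 'M[K]_N :=
  block_mx 0 (row_mx 0 (- 1%:M)) (col_mx 0 (- 1%:M)) (block_mx 1%:M 0 0 0).

Lemma formJJ : formJ *m formJ = 1%:M.
Proof.
rewrite /formJ mulmx_block mul_row_col mul_col_row !mulmx0 !mul0mx.
rewrite mulmx_block mul_row_block mul_block_col.
rewrite !(mulmx0, mul0mx, addr0, add0r, mul1mx, mulmx1, mulNmx, mulmxN, opprK).
rewrite add_block_mx !addr0 !add0r row_mx0 col_mx0.
by rewrite -!scalar_mx_block.
Qed.

Lemma adj_formJ : adjmx formJ = formJ.
Proof.
have e0 m p : (map_mx (@kconj R k) (0 : 'M[K]_(m, p)))^T = 0.
  by apply/matrixP => i j; rewrite !mxE kconj0.
have eN m : (map_mx (@kconj R k) (- 1%:M : 'M[K]_m))^T = - 1%:M.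
  by rewrite -[in RHS](adjmx1 R k) /adjmx; apply/matrixP => i j; rewrite !mxE kconjN.
rewrite /adjmx /formJ map_block_mx tr_block_mx map_row_mx map_col_mx tr_row_mx.
rewrite tr_col_mx map_block_mx tr_block_mx !e0 !eN.
by rewrite -[(map_mx _ 1%:M)^T]/(adjmx 1%:M) adjmx1.
Qed.

(* Either condition implies the other; both are kept so that inverses are
   immediate over a noncommutative ring. *)
Definition unitaryJ : pred 'M[K]_N := [pred A |
  (adjmx A *m formJ *m A == formJ) && (A *m formJ *m adjmx A == formJ)].

Record UJ := UMx { umx : 'M[K]_N; _ : unitaryJ umx }.
HB.instance Definition _ := [isSub for umx].
HB.instance Definition _ := [Choice of UJ by <:].

Lemma umxP (A : UJ) : adjmx (umx A) *m formJ *m umx A = formJ /\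
  umx A *m formJ *m adjmx (umx A) = formJ.
Proof. by case: A => A /= /andP[/eqP ? /eqP ?]. Qed.

Fact unitaryJ_one : unitaryJ 1%:M.
Proof. by rewrite /unitaryJ /= adjmx1 !mul1mx !mulmx1 !eqxx. Qed.
Definition UJone := UMx unitaryJ_one.

Fact unitaryJ_mul (A B : UJ) : unitaryJ (umx A *m umx B).
Proof.
have [A1 A2] := umxP A; have [B1 B2] := umxP B.
rewrite /unitaryJ /= adjmxM; apply/andP; split; apply/eqP.
  by rewrite -[RHS]B1 -[in RHS]A1 !mulmxA.
by rewrite -[RHS]A2 -[in RHS]B2 !mulmxA.
Qed.
Definition UJmul (A B : UJ) := UMx (unitaryJ_mul A B).

Fact unitaryJ_inv (A : UJ) : unitaryJ (formJ *m adjmx (umx A) *m formJ).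
Proof.
have [A1 A2] := umxP A.
have e (X Y : 'M[K]_N) : X *m formJ *m formJ *m Y = X *m Y.
  by rewrite -(mulmxA X) formJJ mulmx1.
rewrite /unitaryJ /= !adjmxM adjmxK adj_formJ; apply/andP; split; apply/eqP.
  rewrite !mulmxA e -!mulmxA !(mulmxA (umx A)) (mulmxA _ (adjmx _)) A2.
  by rewrite mulmxA formJJ mul1mx.
rewrite !mulmxA e -!mulmxA !(mulmxA (adjmx _)) (mulmxA _ (umx A)) A1.
by rewrite mulmxA formJJ mul1mx.
Qed.
Definition UJinv (A : UJ) := UMx (unitaryJ_inv A).

Fact UJmulA : associative UJmul.
Proof. by move=> A B C; apply: val_inj; rewrite /= mulmxA. Qed.
Fact UJmul1l : left_id UJone UJmul.
Proof. by move=> A; apply: val_inj; rewrite /= mul1mx. Qed.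
Fact UJmul1r : right_id UJone UJmul.
Proof. by move=> A; apply: val_inj; rewrite /= mulmx1. Qed.
Fact UJmulVl : left_inverse UJone UJinv UJmul.
Proof.
move=> A; apply: val_inj; have [A1 _] := umxP A.
by rewrite /= -!mulmxA (mulmxA (adjmx _)) A1 formJJ.
Qed.
Fact UJmulVr : right_inverse UJone UJinv UJmul.
Proof.
move=> A; apply: val_inj; have [_ A2] := umxP A.
by rewrite /= !mulmxA A2 formJJ.
Qed.
HB.instance Definition _ :=
  isGroup.Build UJ UJmulA UJmul1l UJmul1r UJmulVl UJmulVr.

(* The unitary matrices acting trivially on lines (with scalars on the right)
   are the scalar matrices c with c in the center of k. *)
Definition central (c : K) := forall x, c * x = x * c.
Definition projeq (A B : UJ) : bool :=
  `[< exists c : K, central c /\ umx B = umx A *m c%:M >].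

Lemma mulmx_scalE (A : 'M[K]_N) (c : K) i j : (A *m c%:M) i j = A i j * c.
Proof.
rewrite mxE (bigD1 j) //= big1 => [|l /negPf lj]; first by rewrite mxE eqxx addr0.
by rewrite mxE lj mulr0.
Qed.
Lemma central_comm (c : K) (A : 'M[K]_N) : central c -> c%:M *m A = A *m c%:M.
Proof.
move=> cc; apply/matrixP => i j.
by rewrite mulmx_scalE mul_scalar_mx mxE; exact: cc.
Qed.
Lemma scalM (c e : K) : (c%:M : 'M[K]_N) *m e%:M = (c * e)%:M.
Proof. by rewrite -scalar_mxM. Qed.

Lemma central_unit (A : UJ) (B : UJ) (c : K) :
  central c -> umx B = umx A *m c%:M -> umx (A^-1 * B)%g = c%:M.
Proof.
move=> cc e; rewrite /= e mulmxA.
by rewrite -[X in X *m _]/(umx (A^-1 * A)%g) mulVg mul1mx.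
Qed.

Fact projeq_refl : reflexive projeq.
Proof.
by move=> A; apply/asboolP; exists 1; split=> [x|]; rewrite ?mul1r ?mulr1 ?mulmx1.
Qed.
Fact projeq_trans : transitive projeq.
Proof.
move=> B A C /asboolP[c [cc eB]] /asboolP[e [ce eC]]; apply/asboolP.
exists (c * e); split=> [x|]; first by rewrite -mulrA ce mulrA cc mulrA.
by rewrite eC eB -mulmxA scalM.
Qed.
Fact projeq_sym : symmetric projeq.
Proof.
suff imp A B : projeq A B -> projeq B A by move=> A B; apply/idP/idP; exact: imp.
move=> /asboolP[c [cc eB]]; apply/asboolP.
have c1 : umx (A^-1 * B)%g = c%:M by exact: central_unit.
have cc' x : kconj c * x = x * kconj c.
  by apply: (can_inj (@kconjK R k)); rewrite !kconjM kconjK cc.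
exists (kconj c); split=> //.
have -> : (kconj c)%:M = umx (B^-1 * A)%g.
  have -> : (B^-1 * A = (A^-1 * B)^-1)%g by rewrite invgM invgK.
  rewrite -[RHS]/(formJ *m adjmx (umx (A^-1 * B)%g) *m formJ) c1.
  have -> : adjmx (c%:M : 'M[K]_N) = (kconj c)%:M.
    by apply/matrixP => i j; rewrite !mxE eq_sym; case: eqP => _;
       rewrite ?mulr0n ?mulr1n ?kconj0.
  by rewrite -central_comm // -mulmxA formJJ mulmx1.
by rewrite -[RHS]/(umx (B * (B^-1 * A))%g) mulgA mulgV mul1g.
Qed.
Canonical projeq_equiv := EquivRel projeq projeq_refl projeq_sym projeq_trans.

Definition PUJ := {eq_quot projeq}.
HB.instance Definition _ := EqQuotient.on PUJ.
HB.instance Definition _ := Choice.on PUJ.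

Lemma piE_PUJ (A B : UJ) (c : K) :
  central c -> umx B = umx A *m c%:M -> \pi_PUJ A = \pi_PUJ B.
Proof. by move=> cc e; apply/eqmodP/asboolP; exists c. Qed.

Lemma repr_piP (A : UJ) :
  exists c : K, central c /\ umx (repr (\pi_PUJ A)) = umx A *m c%:M.
Proof.
have /eqmodP/asboolP : A = repr (\pi_PUJ A) %[mod PUJ] by rewrite reprK.
by [].
Qed.

Definition PUJmul (a b : PUJ) : PUJ := \pi_PUJ (repr a * repr b)%g.
Definition PUJinv (a : PUJ) : PUJ := \pi_PUJ (repr a)^-1%g.
Definition PUJone : PUJ := \pi_PUJ 1%g.

Lemma pi_mul (A B : UJ) : PUJmul (\pi_PUJ A) (\pi_PUJ B) = \pi_PUJ (A * B)%g.
Proof.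
have [c [cc ec]] := repr_piP A; have [e [ce ee]] := repr_piP B.
symmetry; apply: (@piE_PUJ _ _ (c * e)) => [x|].
  by rewrite -mulrA ce mulrA cc mulrA.
by rewrite /= ec ee -scalM -!mulmxA (mulmxA c%:M) central_comm // !mulmxA.
Qed.

Fact PUJmulA : associative PUJmul.
Proof.
move=> a b c; rewrite -[a]reprK -[b]reprK -[c]reprK.
move: (repr a) (repr b) (repr c) => A B C.
by rewrite (pi_mul B C) (pi_mul A B) !pi_mul mulgA.
Qed.
Fact PUJmul1l : left_id PUJone PUJmul.
Proof. by move=> a; rewrite -[a]reprK pi_mul mul1g. Qed.
Fact PUJmul1r : right_id PUJone PUJmul.
Proof. by move=> a; rewrite -[a]reprK pi_mul mulg1. Qed.
Fact PUJmulVl : left_inverse PUJone PUJinv PUJmul.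
Proof. by move=> a; rewrite -[X in PUJmul _ X]reprK pi_mul mulVg. Qed.
Fact PUJmulVr : right_inverse PUJone PUJinv PUJmul.
Proof. by move=> a; rewrite -[X in PUJmul X _]reprK pi_mul mulgV. Qed.
HB.instance Definition _ :=
  isGroup.Build PUJ PUJmulA PUJmul1l PUJmul1r PUJmulVl PUJmulVr.

End Unitary.

Section Geometry.
Context (R : realType) (k : scalars) (n : nat).
Local Notation K := (scalar R k).
Local Notation G := (PUJ R k n).

Definition kpoint : Type := ('cV[K]_n * K)%type.
HB.instance Definition _ := GRing.Zmodule.on kpoint.

(* [None] is the point at infinity. *)
Definition xkpoint : Type := option kpoint.
HB.instance Definition _ := Choice.on xkpoint.

Definition in_X (p : kpoint) : Prop := kre p.2 = 0.
Definition in_H (p : kpoint) : Prop := 0 < kre p.2.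

Definition hdot (z z' : 'cV[K]_n) : K := \sum_i kconj (z i 0) * z' i 0.
Definition normsq (z : 'cV[K]_n) : R := \sum_i knorm (z i 0) ^+ 2.

Definition pmul (p q : kpoint) : kpoint :=
  (p.1 + q.1, p.2 + q.2 + kim (hdot p.1 q.1) *+ 2).
Definition gauge (p : kpoint) : R :=
  Num.sqrt (knorm (kreal k (normsq p.1 + `|kre p.2|) + kim p.2)).
Definition cdist (p q : kpoint) : R := gauge (pmul (- p) q).

Definition phi (p : kpoint) : 'cV[K]_(1 + (n + 1)) :=
  col_mx 1%:M (col_mx (kreal k (Num.sqrt 2) *: p.1)
                      (p.2 + kreal k (normsq p.1))%:M).
Definition homog (x : xkpoint) : 'cV[K]_(1 + (n + 1)) :=
  if x is Some p then phi p else col_mx 0 (col_mx 0 1%:M).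

(* The inverse of [homog] on lines spanned by nonzero vectors of nonpositive
   square; scalars act on the right. *)
Definition dehomog (v : 'cV[K]_(1 + (n + 1))) : xkpoint :=
  let v0 := usubmx v 0 0 in
  if v0 == 0 then None else
  let z := map_mx (fun a => kreal k (Num.sqrt 2)^-1 * (a * kinv v0))
             (usubmx (dsubmx v)) in
  Some (z, dsubmx (dsubmx v) 0 0 * kinv v0 - kreal k (normsq z)).

Definition xmob (g : G) (x : xkpoint) : xkpoint :=
  dehomog (umx (repr g) *m homog x).
(* [xmob] at points whose image is finite *)
Definition mob (g : G) (p : kpoint) : kpoint := odflt 0 (xmob g (Some p)).

Lemma qmul_conj (x : K) : x * kconj x = kreal k (qnormsq (sval x)).
Proof.
apply: sval_inj; rewrite svalM sval_kconj /=.
case: (sval x) => a b c d; rewrite -[_ * _]/(qmul _ _) /qmul /qconj /qnormsq /=.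
by rewrite /qproj /qreal; case: k => /=; congr Quat; ring.
Qed.
Lemma kreal_central (a : R) (x : K) : kreal k a * x = x * kreal k a.
Proof.
apply: sval_inj; rewrite !svalM /=.
case: (sval x) => b c d e; rewrite -![_ * _]/(qmul _ _) /qmul.
by rewrite /qproj /qreal; case: k => /=; congr Quat; ring.
Qed.
Lemma krealM (a b : R) : kreal k a * kreal k b = kreal k (a * b).
Proof.
apply: sval_inj; rewrite !svalM /= -[_ * _]/(qmul _ _) /qmul /qproj /qreal.
by case: k => /=; congr Quat; ring.
Qed.
Lemma qnormsq_gt0 (x : K) : x != 0 -> qnormsq (sval x) != 0.
Proof.
apply: contraNneq => h; apply/eqP/sval_inj; move: h; rewrite /qnormsq.
case: (sval x) => a b c d /= /eqP.
rewrite !paddr_eq0 ?addr_ge0 ?sqr_ge0 // !sqrf_eq0.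
by move=> /andP[/andP[/andP[/eqP-> /eqP->] /eqP->] /eqP->].
Qed.
Lemma kmulVr (x : K) : x != 0 -> x * kinv x = 1.
Proof.
move=> x0; rewrite /kinv kreal_central mulrA qmul_conj krealM.
rewrite divff ?qnormsq_gt0 //; apply: sval_inj => /=.
by rewrite /qproj; case: k.
Qed.
Lemma kmulr_eq0 (x y : K) : x * y = 0 -> x = 0 \/ y = 0.
Proof.
move=> xy; have [->|y0] := eqVneq y 0; [by right | left].
by rewrite -[x]mulr1 -(kmulVr y0) mulrA xy mul0r.
Qed.
Lemma kmulVl (x : K) : x != 0 -> kinv x * x = 1.
Proof.
move=> x0; have : x * (kinv x * x - 1) = 0.
  by rewrite mulrBr mulr1 mulrA kmulVr // mul1r subrr.
by move=> /kmulr_eq0[/eqP|/eqP]; rewrite ?(negPf x0) // subr_eq0 => /eqP.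
Qed.

Lemma dehomog_scale (v : 'cV[K]_(1 + (n + 1))) (c : K) :
  c != 0 -> dehomog (\col_i (v i 0 * c)) = dehomog v.
Proof.
move=> c0; rewrite /dehomog.
have -> : usubmx (\col_i (v i 0 * c)) 0 0 = usubmx v 0 0 * c by rewrite !mxE.
set v0 := usubmx v 0 0.
have [->|v00] := eqVneq v0 0; first by rewrite mul0r eqxx.
have vc0 : v0 * c != 0.
  by apply/eqP => /kmulr_eq0[] /eqP; rewrite ?(negPf v00) ?(negPf c0).
have e a : (a * c) * kinv (v0 * c) = a * kinv v0.
  rewrite -mulrA; congr (_ * _); rewrite -[LHS]mul1r -(kmulVl v00) -mulrA.
  by rewrite (mulrA v0) kmulVr // mulr1.
rewrite (negPf vc0).
have ez : map_mx (fun a => kreal k (Num.sqrt 2)^-1 * (a * kinv (v0 * c)))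
    (usubmx (dsubmx (\col_i (v i 0 * c)))) =
  map_mx (fun a => kreal k (Num.sqrt 2)^-1 * (a * kinv v0)) (usubmx (dsubmx v)).
  by apply/matrixP => i j; rewrite !mxE (ord1 j) e.
by rewrite ez; congr (Some (_, _ - _)); rewrite !mxE e.
Qed.

(* The action does not depend on the representative. *)
Lemma xmob_pi (A : UJ R k n) (x : xkpoint) :
  xmob (\pi_G A) x = dehomog (umx A *m homog x).
Proof.
have [c [cc e]] := repr_piP A.
rewrite /xmob e -mulmxA -[RHS](@dehomog_scale _ c); last first.
  apply/eqP => c0; move: e; rewrite c0; have [+ _] := umxP (repr (\pi_G A)).
  move=> + h; rewrite h; have -> : (0%:M : 'M[K]_(1 + (n + 1))) = 0.
    by apply/matrixP => i j; rewrite !mxE mul0rn.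
  rewrite !mulmx0 => /(congr1 (mulmx (formJ R k n))); rewrite mulmx0 formJJ.
  by move=> /matrixP/(_ 0 0)/eqP; rewrite !mxE eqxx eq_sym oner_eq0.
congr dehomog; apply/matrixP => i j; rewrite !mxE (ord1 j) mulr_suml.
apply: eq_bigr => l _; rewrite -mulrA; congr (_ * _).
by rewrite mul_scalar_mx mxE; exact: cc.
Qed.

Definition hform (u v : 'cV[K]_(1 + (n + 1))) : K :=
  (adjmx u *m formJ R k n *m v) 0 0.

Definition acosh (x : R) : R := ln (x + Num.sqrt (x ^+ 2 - 1)).

(* The Riemannian distance. With the factor 1 the Hermitian form gives curvature
   -1 if k is real and curvature in [-4, -1] otherwise, whence the factor 2. *)
Definition hdist (p q : kpoint) : R :=
  (if k is RealScalars then 1 else 2) *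
  acosh (knorm (hform (phi p) (phi q)) /
         Num.sqrt (knorm (hform (phi p) (phi p)) * knorm (hform (phi q) (phi q)))).

Definition ht (p : kpoint) : R := kre p.2.
Definition ht_cusp (M : G) (p : kpoint) : R := ht (mob M^-1%g p).

(* H is a Hadamard manifold: its unit-speed geodesic lines and rays are the
   isometric embeddings of the line and of the half-line. *)
Definition geodesic (gam : R -> kpoint) : Prop :=
  (forall t, in_H (gam t)) /\ forall s t, hdist (gam s) (gam t) = `|s - t|.
Definition geodesic_ray (gam : R -> kpoint) : Prop :=
  (forall t, 0 <= t -> in_H (gam t)) /\
  forall s t, 0 <= s -> 0 <= t -> hdist (gam s) (gam t) = `|s - t|.

Definition enormsq (p : kpoint) : R := normsq p.1 + knorm p.2 ^+ 2.

Definition ends_at (gam : R -> kpoint) (x : xkpoint) : Prop :=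
  match x with
  | Some p => Num.sqrt (enormsq (gam t - p)) @[t --> +oo] --> (0 : R)
  | None => gauge (gam t) @[t --> +oo] --> +oo
  end.
Definition forward_end (gam : R -> kpoint) : xkpoint := xget None (ends_at gam).

Definition kderive (f : R -> K) (t : R) : K :=
  let D (c : quat R -> R) : R := derive1 (fun s => c (sval (f s))) t in
  kproj k (Quat (D (@qr R)) (D (@qi R)) (D (@qj R)) (D (@qk R))).

(* a tangent vector of H, as a base point and a direction in k^n * k *)
Definition tvector : Type := (kpoint * kpoint)%type.
Definition tangent (gam : R -> kpoint) (t : R) : tvector :=
  (gam t, (\col_i kderive (fun s => (gam s).1 i 0) t,
           kderive (fun s => (gam s).2) t)).
Definition T1H : set tvector := [set tangent gam 0 | gam in geodesic].

(* the image of a set of unit tangent vectors under the differential of [M] *)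
Definition ttranslate (M : G) (V : set tvector) : set tvector :=
  [set tangent (fun t => mob M (gam t)) 0 |
     gam in [set gam | geodesic gam /\ V (tangent gam 0)]].

(* Hausdorff dimension for the Euclidean distance of (k^n * k)^2, which is
   locally bi-Lipschitz to any Riemannian distance on the tangent bundle. *)
Definition tdist (u v : tvector) : R :=
  Num.sqrt (enormsq (u.1 - v.1) + enormsq (u.2 - v.2)).
Definition hausdorff_content (s : R) (A : set tvector) : \bar R :=
  ereal_inf [set x : \bar R | exists (c : nat -> tvector) (r : nat -> R),
    [/\ forall m, 0 < r m,
        A `<=` \bigcup_m [set v | tdist (c m) v < r m]
      & x = (\sum_(0 <= m <oo) (r m `^ s)%:E)%E]].
Definition hausdorff_dim (A : set tvector) : \bar R :=
  ereal_inf [set s%:E | s in [set s : R | 0 <= s /\ hausdorff_content s A = 0%E]].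

Definition dim_T1H : nat := (2 * (kdim k * n.+1) - 1)%N.
Definition codimension_one (A : set tvector) : Prop :=
  A `<=` T1H /\ (hausdorff_dim A + 1%:E = dim_T1H%:R%:E)%E.

(* Lebesgue measure of X = k^n * Im(k). A real coordinate is given by [Some i],
   i < n, or [None], for the component in k^n or in Im(k), and by c < 4 for the
   component along 1, i, j, k; [active] selects those that X really has. *)
Definition coord_index : Type := (option 'I_n * 'I_4)%type.
HB.instance Definition _ := Finite.on coord_index.
Definition active (ic : coord_index) : bool :=
  (ic.2 < kdim k)%N && ((ic.1 != None) || (0 < ic.2)%N).
Definition coord (p : kpoint) (ic : coord_index) : R :=
  let x := sval (if ic.1 is Some i then p.1 i 0 else p.2) in
  nth 0 [:: qr x; qi x; qj x; qk x] ic.2.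
Definition box (lo hi : coord_index -> R) : set kpoint :=
  [set p | in_X p /\ forall ic, active ic -> lo ic <= coord p ic <= hi ic].
Definition box_volume (lo hi : coord_index -> R) : R :=
  \prod_(ic | active ic) Num.max 0 (hi ic - lo ic).
(* +oo for a set not included in X *)
Definition lebesgue_outer (A : set kpoint) : \bar R :=
  ereal_inf [set x : \bar R | exists lo hi : nat -> coord_index -> R,
    A `<=` \bigcup_m box (lo m) (hi m) /\
    x = (\sum_(0 <= m <oo) (box_volume (lo m) (hi m))%:E)%E].
Definition lebesgue_measurable (A : set kpoint) : Prop :=
  A `<=` in_X /\ lebesgue_outer.-caratheodory A.

Definition subgroup (S : set G) : Prop :=
  S 1%g /\ forall a b, S a -> S b -> S (a * b^-1)%g.
Definition generated (S : set G) : set G := smallest subgroup S.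

(* [S] is a discrete subset for the quotient topology of PU(J). *)
Definition discrete_in_G (S : set G) : Prop :=
  forall A : UJ R k n, S (\pi_G A) -> exists2 e : R, 0 < e &
  forall B : UJ R k n, S (\pi_G B) ->
    (forall i j, knorm (umx B i j - umx A i j) < e) -> \pi_G B = \pi_G A.

Definition IsomX : set G := [set g | xmob g None = None /\
  forall x y, in_X x -> in_X y -> cdist (mob g x) (mob g y) = cdist x y].

(* Stabilizers of points being compact, the covolume may be computed in X. *)
Definition lattice_IsomX (Z : set G) : Prop :=
  [/\ subgroup Z, Z `<=` IsomX, discrete_in_G Z
    & exists F, [/\ lebesgue_measurable F, (lebesgue_outer F < +oo)%E
        & in_X `<=` \bigcup_(a in Z) (mob a @` F)]].

Definition is_inversion (iota : G) : Prop :=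
  [/\ xmob iota (Some 0) = None, xmob iota None = Some 0 &
    forall h, in_H h \/ in_X h -> h != 0 ->
      gauge (mob iota h) = (gauge h)^-1 /\
      forall h', in_X h' -> h' != 0 ->
        cdist (mob iota h) (mob iota h') = cdist h h' / (gauge h * gauge h')].

Definition overlap (Z : set G) (D : set kpoint) : set kpoint :=
  D `&` \bigcup_(a in Z `\ 1%g) (mob a @` D).
Definition fundamental_domain (Z : set G) (D : set kpoint) : Prop :=
  [/\ lebesgue_measurable D, in_X = \bigcup_(a in Z) (mob a @` D)
    & lebesgue_outer (overlap Z D) = 0%E].

Record iwasawa_cf := IwasawaCF {
  cf_inv : G;
  cf_lattice : set G;
  cf_domain : set kpoint;
  cf_round : kpoint -> G;
  cf_invP : is_inversion cf_inv;
  cf_latticeP : lattice_IsomX cf_lattice;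
  cf_domainP : fundamental_domain cf_lattice cf_domain;
  cf_roundP : forall y, in_X y ->
    cf_lattice (cf_round y) /\ cf_domain (mob (cf_round y)^-1%g y) }.

Definition sphere : set kpoint := [set h | in_H h /\ gauge h = 1].

Section Algorithm.
Context (A : iwasawa_cf).
Local Notation iota := (cf_inv A).
Local Notation Z := (cf_lattice A).
Local Notation K := (cf_domain A).

Definition cf_modular : set G := generated (iota |` Z).
Definition cf_shift (x : kpoint) : kpoint :=
  if x == 0 then 0 else mob (cf_round A (mob iota x))^-1%g (mob iota x).
(* the [i]-th digit, for [i >= 1] *)
Definition cf_digit (i : nat) (x : kpoint) : G :=
  cf_round A (mob iota (iter i.-1 cf_shift x)).

Definition cf_rad : \bar R := ereal_sup [set (gauge x)%:E | x in K].

Definition cf_discrete : Prop := discrete_in_G cf_modular.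
Definition cf_proper : Prop := (cf_rad < 1%:E)%E.
Definition cf_complete : Prop := [set M | cf_modular M /\ xmob M None = None] = Z.

(* [M] is the inverse branch of the [i]-th iterate of the shift at [x]: the
   iterate is [M^-1] on the points with the same first [i] digits as [x]. *)
Definition is_branch (i : nat) (M : G) (x : kpoint) : Prop :=
  forall y, K y ->
    (forall j, (0 < j <= i)%N -> iter j.-1 cf_shift y != 0 /\
                                cf_digit j y = cf_digit j x) ->
  mob M (iter i cf_shift y) = y.

Definition cf_wall (h2 : R) : set kpoint := [set h | sphere h /\ h2 <= ht h].

Definition wall_height (eps h2 : R) : Prop :=
  0 < h2 < 1 /\
  forall gam, geodesic_ray gam -> 1 + eps <= gauge (gam 0) ->
    (Some @` K) (forward_end gam) ->
    forall t, 0 <= t -> sphere (gam t) -> h2 <= ht (gam t).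

Definition section_W (h2 h0 : R) : set tvector :=
  [set tangent gam 0 | gam in [set gam | [/\ geodesic gam,
    cf_wall h2 (gam 0) /\ (forall t, 0 < t -> ~ cf_wall h2 (gam t)),
    ((Some @` K) `\` \bigcup_(M in cf_modular)
        (xmob M @` (None |` Some @` overlap Z K))) (forward_end gam)
    & exists2 t, t < 0 & h0 < ht (gam t)]]].

Definition crossing_times (h2 h0 : R) (gam : R -> kpoint) : set R :=
  [set t | exists2 M, cf_modular M & ttranslate M (section_W h2 h0) (tangent gam t)].
Definition markable (h2 h0 : R) (gam : R -> kpoint) : Prop :=
  [/\ geodesic gam,
      infinite_set (crossing_times h2 h0 gam `&` [set t | t < 0])
    & infinite_set (crossing_times h2 h0 gam `&` [set t | 0 < t])].

End Algorithm.

Record marking := Marking {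
  mk_a : int -> G;
  mk_M : int -> G;
  mk_i : int -> int;
  mk_t : int -> R }.

End Geometry.

(* Main.v *)
(* Write a geodesic as the line of t |-> X e^t + Y e^-t with X and Y null vectors of the
   Hermitian form (up to the speed). If it ends at a finite point, its height is
   proportional to 1 / (T + 2 a + b / T) with T = e^(2 t), hence unimodal, and it crosses
   the unit sphere exactly once after any point outside of the sphere. So a visit to the
   horoball of height h0 at the cusp M oo, where M^-1 maps the end into K, is followed by
   exactly one crossing of the wall M W, and the crossing remembers the visit.
     Let nu N x be the norm of the scalar by which N multiplies the normalised lift of x.
   Discreteness gives a lower bound kp for nu N oo over all N that do not fix oo:
   otherwise conjugates of arbitrarily many elements of the cusp group would move a point
   by a bounded amount. Hence ht(p) ht(N^-1 p) <= kp^-2, and for large h0 the time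
   intervals from a visit to the following crossing are disjoint for distinct cusps; this
   gives the spacing and cusp detection. As for the approximation by convergents of
   continued fractions, a cusp that is visited after a crossing is the image of oo under a
   branch of an iterate of the shift map at the end, and completeness together with the
   genericity of the end makes the Moebius map itself equal to this branch. The marking
   lists the crossings in increasing order with these branches. It is determined by the
   geodesic, whence equivariance.
     The section is parametrised by the pairs (q, x), where the base point is the point of
   the unit sphere above q in X and x is the forward end, and this parametrisation is
   Lipschitz in both directions. With d = dim X the dimension is thus at most 2 d. For the
   lower bound, all pairs near the diagonal with x in K outside a countable union of
   Moebius images of null sets occur. If balls of radii r_m cover the section, then for fixed
   q the balls that meet the slice cover a set of x of positive outer measure, and
   integrating over q bounds the sum of the r_m^(2 d) from below. *)
From HB Require Import structures.
From mathcomp Require Import all_boot all_order all_algebra.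
From mathcomp Require Import generic_quotient finmap.
From mathcomp Require Import all_classical all_reals all_analysis.
From mathcomp Require Import measurable_realfun.
From mathcomp Require Import zify ring lra.
Require Import Defs.

Set Implicit Arguments.
Unset Strict Implicit.
Unset Printing Implicit Defensive.

Import Order.TTheory GRing.Theory Num.Theory.
Import numFieldNormedType.Exports.

Local Open Scope classical_set_scope.
Local Open Scope ring_scope.
Local Open Scope quotient_scope.

(** * Scalars and vectors *)

Section ScalarTheory.
Context {R : realType} {k : scalars}.
Local Notation K := (scalar R k).
Implicit Types (x y : K) (a b : R).

(** Everything rests on two identities for normalised lifts: [pr (g x) (g y)] times the multipliers
    [nu g x] and [nu g y] is [pr x y], and [ht (g x) * nu g x ^ 2] is [ht x]. Since [pr] is the
    squared Cygan distance to a point of X and is 1 between oo and a finite point, they replace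
    explicit formulas for Moebius maps, which noncommuting scalars make awkward. Geodesics are given
    as isometric embeddings and the section as a set of vectors, so rigidity precedes dynamics: an
    isometric embedding is a line of the Hermitian model and is determined by its initial vector.
    Membership of vectors thus becomes a condition on geodesics. The height [h0] is a sum of three
    terms: [(1 + eps)^2] puts visits where [wall_height] applies, [1 / (h2 kp^2)] separates visits
    to distinct cusps, and [4 / (delta^2 kp^2)] drives the continued fraction argument, with [delta]
    small against [kp (1 - rho)] and [h2 kp]. Digits of negative index do not come from an expansion
    of the end itself. They are read in the frame of an earlier crossing, where they are ordinary
    digits; the cocycle rule for branches makes the choice of that crossing irrelevant. *)

Lemma kext x y : qr (sval x) = qr (sval y) -> qi (sval x) = qi (sval y) ->
  qj (sval x) = qj (sval y) -> qk (sval x) = qk (sval y) -> x = y.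
Proof.
move=> e1 e2 e3 e4; apply: sval_inj; move: e1 e2 e3 e4.
by case: (sval x) (sval y) => [????] [????] /= -> -> -> ->.
Qed.

Lemma sval_kreal (a : R) : sval (kreal k a) = Quat a 0 0 0.
Proof. by rewrite /kreal /kproj /= /qproj /qreal; case: k. Qed.

Definition knsq x : R := qnormsq (sval x).

Lemma sval_cD x y : sval (x + y) = qadd (sval x) (sval y). Proof. by []. Qed.
Lemma sval_cN x : sval (- x) = qopp (sval x). Proof. by []. Qed.
Lemma sval_cM x y : sval (x * y) = qmul (sval x) (sval y). Proof. by []. Qed.
Lemma sval_c0 : sval (0 : K) = Quat 0 0 0 0. Proof. by []. Qed.
Lemma sval_c1 : sval (1 : K) = Quat 1 0 0 0. Proof. by []. Qed.
Lemma sval_kim x : sval (kim x) = Quat 0 (qi (sval x)) (qj (sval x)) (qk (sval x)).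
Proof. by rewrite /kim sval_cD sval_cN sval_kreal /kre /qadd /=; congr Quat; ring. Qed.
Lemma kreE x : kre x = qr (sval x). Proof. by []. Qed.
Lemma knsqE x : knsq x = qr (sval x) ^+ 2 + qi (sval x) ^+ 2 + qj (sval x) ^+ 2
  + qk (sval x) ^+ 2.
Proof. by []. Qed.
Hint Rewrite kreE knsqE sval_cD sval_cN sval_cM sval_c0 sval_c1 (@sval_kconj R k) sval_kreal sval_kim : kdb.

(** After [kext] has split a scalar equation, this leaves polynomial identities between real
    components for [ring] or [field], uniformly in the three kinds of scalars. *)
Ltac kcomp := autorewrite with kdb;
  cbv beta iota delta [qadd qopp qmul qconj qr qi qj qk].

Lemma kreD x y : kre (x + y) = kre x + kre y. Proof. by []. Qed.
Lemma kreN x : kre (- x) = - kre x. Proof. by []. Qed.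
Lemma kreB x y : kre (x - y) = kre x - kre y. Proof. by []. Qed.
Lemma kre0 : kre (0 : K) = 0. Proof. by []. Qed.
Lemma kre_kreal a : kre (kreal k a) = a. Proof. by kcomp. Qed.
Lemma kre_conj x : kre (kconj x) = kre x. Proof. by kcomp. Qed.
Lemma kreMC x y : kre (x * y) = kre (y * x). Proof. by kcomp; ring. Qed.
Lemma kreZl a x : kre (kreal k a * x) = a * kre x. Proof. by kcomp; ring. Qed.
Lemma kreZr a x : kre (x * kreal k a) = a * kre x. Proof. by kcomp; ring. Qed.

Lemma krealD a b : kreal k (a + b) = kreal k a + kreal k b.
Proof. by apply: kext; kcomp; ring. Qed.
Lemma krealN a : kreal k (- a) = - kreal k a.
Proof. by apply: kext; kcomp; ring. Qed.
Lemma krealB a b : kreal k (a - b) = kreal k a - kreal k b.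
Proof. by rewrite krealD krealN. Qed.
Lemma kreal0 : kreal k 0 = 0 :> K. Proof. by apply: kext; kcomp. Qed.
Lemma kreal1 : kreal k 1 = 1 :> K. Proof. by apply: kext; kcomp. Qed.
Lemma kreal_sum I r (P : pred I) (F : I -> R) :
  kreal k (\sum_(i <- r | P i) F i) = \sum_(i <- r | P i) kreal k (F i).
Proof. exact: (big_morph (kreal k) krealD kreal0). Qed.
Lemma kreal_inj : injective (@kreal R k).
Proof. by move=> a b e; rewrite -(kre_kreal a) e kre_kreal. Qed.
Lemma kconj_kreal a : kconj (kreal k a) = kreal k a.
Proof. by apply: kext; kcomp; ring. Qed.
Lemma kconjB x y : kconj (x - y) = kconj x - kconj y.
Proof. by rewrite kconjD kconjN. Qed.
Lemma kconj_sum I r (P : pred I) (F : I -> K) :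
  kconj (\sum_(i <- r | P i) F i) = \sum_(i <- r | P i) kconj (F i).
Proof. exact: (big_morph (@kconj R k) (@kconjD R k) (@kconj0 R k)). Qed.
Lemma kconj_mul x : kconj x * x = kreal k (knsq x).
Proof. by apply: kext; kcomp; ring. Qed.
Lemma addk_conj x : x + kconj x = kreal k (2 * kre x).
Proof. by apply: kext; kcomp; ring. Qed.

Lemma kimD x y : kim (x + y) = kim x + kim y.
Proof. by apply: kext; kcomp; ring. Qed.
Lemma kimN x : kim (- x) = - kim x.
Proof. by apply: kext; kcomp; ring. Qed.
Lemma kimB x y : kim (x - y) = kim x - kim y.
Proof. by rewrite kimD kimN. Qed.
Lemma kim_kreal a : kim (kreal k a) = 0.
Proof. by apply: kext; kcomp; ring. Qed.
Lemma kimZl a x : kim (kreal k a * x) = kreal k a * kim x.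
Proof. by apply: kext; kcomp; ring. Qed.
Lemma kre_kim x : kre (kim x) = 0. Proof. by kcomp; ring. Qed.
Lemma kreimE x : x = kreal k (kre x) + kim x.
Proof. by rewrite /kim addrC subrK. Qed.
Lemma kim_conj x : kim (kconj x) = - kim x.
Proof. by apply: kext; kcomp; ring. Qed.
Lemma kim_id x : kre x = 0 -> kim x = x.
Proof. by rewrite /kim => ->; rewrite kreal0 subr0. Qed.

Lemma kconj_im x : kre x = 0 -> kconj x = - x.
Proof. by kcomp => h; apply: kext; kcomp; rewrite ?h ?oppr0. Qed.
Lemma knsqM x y : knsq (x * y) = knsq x * knsq y. Proof. by kcomp; ring. Qed.
Lemma knsq_conj x : knsq (kconj x) = knsq x. Proof. by kcomp; ring. Qed.
Lemma knsqN x : knsq (- x) = knsq x. Proof. by kcomp; ring. Qed.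
Lemma knsq_kreal a : knsq (kreal k a) = a ^+ 2. Proof. by kcomp; ring. Qed.
Lemma knsqD x y : knsq (x + y) = knsq x + knsq y + 2 * kre (kconj x * y).
Proof. by kcomp; ring. Qed.
Lemma knsq_reim x : knsq x = kre x ^+ 2 + knsq (kim x). Proof. by kcomp; ring. Qed.
Lemma knsq_ge0 x : 0 <= knsq x.
Proof. by rewrite /knsq /qnormsq !addr_ge0 ?sqr_ge0. Qed.
Lemma knsq0 : knsq 0 = 0. Proof. by kcomp; ring. Qed.
Lemma knsq1 : knsq 1 = 1. Proof. by kcomp; ring. Qed.
Lemma knsq_eq0 x : (knsq x == 0) = (x == 0).
Proof.
apply/idP/idP => [h|/eqP->]; last by rewrite knsq0.
by apply: contraTT h; exact: qnormsq_gt0.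
Qed.
Lemma kre_sqr_le x : kre x ^+ 2 <= knsq x.
Proof. by rewrite knsq_reim lerDl knsq_ge0. Qed.

Lemma knorm_ge0 x : 0 <= knorm x. Proof. exact: sqrtr_ge0. Qed.
Lemma knorm_sqr x : knorm x ^+ 2 = knsq x. Proof. by rewrite sqr_sqrtr ?knsq_ge0. Qed.
Lemma knormE x : knorm x = Num.sqrt (knsq x). Proof. by []. Qed.
Lemma knormM x y : knorm (x * y) = knorm x * knorm y.
Proof. by rewrite !knormE knsqM sqrtrM ?knsq_ge0. Qed.
Lemma knorm_conj x : knorm (kconj x) = knorm x.
Proof. by rewrite !knormE knsq_conj. Qed.
Lemma knormN x : knorm (- x) = knorm x. Proof. by rewrite !knormE knsqN. Qed.
Lemma knormB x y : knorm (x - y) = knorm (y - x).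
Proof. by rewrite -knormN opprB. Qed.
Lemma knorm_kreal a : knorm (kreal k a) = `|a|.
Proof. by rewrite knormE knsq_kreal sqrtr_sqr. Qed.
Lemma knorm0 : knorm (0 : K) = 0. Proof. by rewrite knormE knsq0 sqrtr0. Qed.
Lemma knorm1 : knorm (1 : K) = 1. Proof. by rewrite knormE knsq1 sqrtr1. Qed.
Lemma knorm_eq0 x : (knorm x == 0) = (x == 0).
Proof. by rewrite -knsq_eq0 -knorm_sqr sqrf_eq0. Qed.
Lemma knorm_gt0 x : (0 < knorm x) = (x != 0).
Proof. by rewrite lt_def knorm_ge0 andbT knorm_eq0. Qed.
Lemma kreal_neq0 a : a != 0 -> kreal k a != 0.
Proof. by move=> a0; rewrite -knorm_gt0 knorm_kreal normr_gt0. Qed.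
Lemma kre_le x : `|kre x| <= knorm x.
Proof. by rewrite -sqrtr_sqr ler_sqrt ?knsq_ge0 // kre_sqr_le. Qed.
Lemma kre_ler x : kre x <= knorm x.
Proof. exact: le_trans (ler_norm _) (kre_le x). Qed.
Lemma knorm_triangle x y : knorm (x + y) <= knorm x + knorm y.
Proof.
rewrite -(@ler_pXn2r _ 2) ?nnegrE ?addr_ge0 ?knorm_ge0 //.
rewrite knorm_sqr knsqD sqrrD !knorm_sqr.
have := kre_ler (kconj x * y); rewrite knormM knorm_conj; lra.
Qed.
Lemma knorm_triangleB x y : knorm (x - y) <= knorm x + knorm y.
Proof. by rewrite -(knormN y) knorm_triangle. Qed.
Lemma knorm_triangle2 x y : knorm x - knorm y <= knorm (x - y).
Proof. by have := knorm_triangle (x - y) y; rewrite subrK; lra. Qed.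
Lemma kim_le x : knorm (kim x) <= knorm x.
Proof. by rewrite !knormE ler_sqrt ?knsq_ge0 // [leRHS]knsq_reim lerDr sqr_ge0. Qed.

Lemma kinv0 : kinv (0 : K) = 0.
Proof. by rewrite /kinv kconj0 mulr0. Qed.
Lemma knorm_kinv x : knorm (kinv x) = (knorm x)^-1.
Proof.
have [->|x0] := eqVneq x 0; first by rewrite kinv0 knorm0 invr0.
have n0 : knorm x != 0 by rewrite knorm_eq0.
apply: (mulIf n0); rewrite mulVf // -knormM kmulVl // knorm1 //.
Qed.
Lemma kinv_neq0 x : x != 0 -> kinv x != 0.
Proof. by move=> x0; rewrite -knorm_gt0 knorm_kinv invr_gt0 knorm_gt0. Qed.
Lemma kmulf_neq0 x y : x != 0 -> y != 0 -> x * y != 0.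
Proof. by move=> x0 y0; rewrite -knorm_gt0 knormM mulr_gt0 ?knorm_gt0. Qed.
Lemma kmulIf x y z : x != 0 -> y * x = z * x -> y = z.
Proof. by move=> x0 e; rewrite -(mulr1 y) -(mulr1 z) -(kmulVr x0) !mulrA e. Qed.
Lemma kinvE x : kinv x = kreal k (knsq x)^-1 * kconj x. Proof. by []. Qed.
Lemma knsq_kinv x : knsq (kinv x) = (knsq x)^-1.
Proof. by rewrite -!knorm_sqr knorm_kinv exprVn. Qed.

End ScalarTheory.

#[global] Hint Rewrite @kreE @knsqE @sval_cD @sval_cN @sval_cM @sval_c0 @sval_c1
  @sval_kconj @sval_kreal @sval_kim : kdb.
Ltac kcomp := autorewrite with kdb;
  cbv beta iota delta [qadd qopp qmul qconj qr qi qj qk].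

(* Vectors are columns with scalars acting on the right. *)
HB.lock Definition rsc (R : realType) (k : scalars) (m : nat)
  (v : 'cV[scalar R k]_m) (c : scalar R k) : 'cV[scalar R k]_m := v *m c%:M.

Section VectorTheory.
Context {R : realType} {k : scalars}.
Local Notation K := (scalar R k).
Implicit Types (c d : K) (a : R).

Lemma rsc_def m (v : 'cV[K]_m) c : rsc v c = v *m c%:M.
Proof. by rewrite rsc.unlock. Qed.
Lemma rscE m (v : 'cV[K]_m) c i j : rsc v c i j = v i j * c.
Proof. by rewrite rsc_def mxE big_ord1 mxE !ord1 eqxx mulr1n. Qed.
Lemma rscA m (v : 'cV[K]_m) c d : rsc (rsc v c) d = rsc v (c * d).
Proof. by apply/matrixP => i j; rewrite !rscE mulrA. Qed.
Lemma rscDl m (v w : 'cV[K]_m) c : rsc (v + w) c = rsc v c + rsc w c.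
Proof. by rewrite !rsc_def mulmxDl. Qed.
Lemma rscDr m (v : 'cV[K]_m) c d : rsc v (c + d) = rsc v c + rsc v d.
Proof. by apply/matrixP => i j; rewrite rscE mxE !rscE mulrDr. Qed.
Lemma rscNl m (v : 'cV[K]_m) c : rsc (- v) c = - rsc v c.
Proof. by rewrite !rsc_def mulNmx. Qed.
Lemma rscNr m (v : 'cV[K]_m) c : rsc v (- c) = - rsc v c.
Proof. by apply/matrixP => i j; rewrite rscE mxE rscE mulrN. Qed.
Lemma rscBl m (v w : 'cV[K]_m) c : rsc (v - w) c = rsc v c - rsc w c.
Proof. by rewrite rscDl rscNl. Qed.
Lemma rsc1 m (v : 'cV[K]_m) : rsc v 1 = v.
Proof. by apply/matrixP => i j; rewrite !rscE mulr1. Qed.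
Lemma rsc0 m (v : 'cV[K]_m) : rsc v 0 = 0.
Proof. by apply/matrixP => i j; rewrite !rscE mulr0 mxE. Qed.
Lemma rsc0l m (c : K) : rsc (0 : 'cV_m) c = 0.
Proof. by apply/matrixP => i j; rewrite !rscE mxE mul0r. Qed.
Lemma mul_rsc m p (A : 'M[K]_(p, m)) (v : 'cV[K]_m) c :
  A *m rsc v c = rsc (A *m v) c.
Proof. by rewrite !rsc_def mulmxA. Qed.
Lemma krscC m (v : 'cV[K]_m) a : kreal k a *: v = rsc v (kreal k a).
Proof. by apply/matrixP => i j; rewrite rscE mxE kreal_central. Qed.
Lemma rsc_eq0 m (v : 'cV[K]_m) c : c != 0 -> rsc v c = 0 -> v = 0.
Proof.
by move=> c0 e; rewrite -(rsc1 v) -(kmulVr c0) -rscA e rsc0l.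
Qed.

Lemma hdot_sum m (z w : 'cV[K]_m) : hdot z w = \sum_i kconj (z i 0) * w i 0.
Proof. by []. Qed.
Lemma hdotE m (z w : 'cV[K]_m) : hdot z w = (adjmx z *m w) 0 0.
Proof. by rewrite mxE; apply: eq_bigr => i _; rewrite !mxE. Qed.
Lemma hdotDr m (z w w' : 'cV[K]_m) : hdot z (w + w') = hdot z w + hdot z w'.
Proof. by rewrite !hdotE mulmxDr mxE. Qed.
Lemma hdot_conj m (z w : 'cV[K]_m) : kconj (hdot z w) = hdot w z.
Proof.
by rewrite /hdot kconj_sum; apply: eq_bigr => i _; rewrite kconjM kconjK.
Qed.
Lemma hdotDl m (z w w' : 'cV[K]_m) : hdot (w + w') z = hdot w z + hdot w' z.
Proof. by rewrite -hdot_conj hdotDr kconjD !hdot_conj. Qed.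
Lemma hdotNr m (z w : 'cV[K]_m) : hdot z (- w) = - hdot z w.
Proof. by rewrite !hdotE mulmxN mxE. Qed.
Lemma hdotNl m (z w : 'cV[K]_m) : hdot (- w) z = - hdot w z.
Proof. by rewrite -hdot_conj hdotNr kconjN !hdot_conj. Qed.
Lemma hdotBr m (z w w' : 'cV[K]_m) : hdot z (w - w') = hdot z w - hdot z w'.
Proof. by rewrite hdotDr hdotNr. Qed.
Lemma hdotBl m (z w w' : 'cV[K]_m) : hdot (w - w') z = hdot w z - hdot w' z.
Proof. by rewrite hdotDl hdotNl. Qed.
Lemma hdotZr m (z w : 'cV[K]_m) c : hdot z (rsc w c) = hdot z w * c.
Proof.
by rewrite /hdot mulr_suml; apply: eq_bigr => i _; rewrite rscE mulrA.
Qed.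
Lemma hdotZl m (z w : 'cV[K]_m) c : hdot (rsc w c) z = kconj c * hdot w z.
Proof. by rewrite -hdot_conj hdotZr kconjM hdot_conj. Qed.
Lemma hdot0r m (z : 'cV[K]_m) : hdot z 0 = 0.
Proof. by rewrite hdotE mulmx0 mxE. Qed.
Lemma hdot0l m (z : 'cV[K]_m) : hdot 0 z = 0.
Proof. by rewrite -hdot_conj hdot0r kconj0. Qed.
Lemma normsqE m (z : 'cV[K]_m) : normsq z = \sum_i knsq (z i 0).
Proof. by apply: eq_bigr => i _; rewrite knorm_sqr. Qed.
Lemma hdot_normsq m (z : 'cV[K]_m) : hdot z z = kreal k (normsq z).
Proof.
by rewrite normsqE kreal_sum; apply: eq_bigr => i _; rewrite kconj_mul.
Qed.
Lemma kre_hdot m (z : 'cV[K]_m) : kre (hdot z z) = normsq z.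
Proof. by rewrite hdot_normsq kre_kreal. Qed.
Lemma normsq_ge0 m (z : 'cV[K]_m) : 0 <= normsq z.
Proof. by rewrite sumr_ge0 // => i _; exact: sqr_ge0. Qed.
Lemma normsq_eq0 m (z : 'cV[K]_m) : normsq z = 0 -> z = 0.
Proof.
rewrite normsqE => /eqP; rewrite psumr_eq0 => [/allP h|i _]; last exact: knsq_ge0.
apply/matrixP => i j; rewrite (ord1 j) mxE; apply/eqP.
by rewrite -knsq_eq0; apply: h; rewrite mem_index_enum.
Qed.
Lemma normsqD m (z w : 'cV[K]_m) :
  normsq (z + w) = normsq z + normsq w + 2 * kre (hdot z w).
Proof.
rewrite -!kre_hdot hdotDr !hdotDl !kreD -(hdot_conj z w) kre_conj; ring.
Qed.
Lemma normsqN m (z : 'cV[K]_m) : normsq (- z) = normsq z.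
Proof. by rewrite -!kre_hdot hdotNl hdotNr opprK. Qed.
Lemma normsqB m (z w : 'cV[K]_m) :
  normsq (z - w) = normsq z + normsq w - 2 * kre (hdot z w).
Proof. by rewrite normsqD normsqN hdotNr kreN; ring. Qed.
Lemma normsqBC m (z w : 'cV[K]_m) : normsq (z - w) = normsq (w - z).
Proof. by rewrite -normsqN opprB. Qed.
Lemma normsqZ m (z : 'cV[K]_m) c : normsq (rsc z c) = normsq z * knsq c.
Proof. by rewrite !normsqE mulr_suml; apply: eq_bigr => i _; rewrite rscE knsqM. Qed.
Lemma normsq0 m : normsq (0 : 'cV[K]_m) = 0.
Proof. by rewrite -kre_hdot hdot0l. Qed.
Lemma normsq_coord m (z : 'cV[K]_m) i : knsq (z i 0) <= normsq z.
Proof.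
by rewrite normsqE (bigD1 i) //= lerDl sumr_ge0 // => j _; exact: knsq_ge0.
Qed.

Lemma hdot_CS m (z w : 'cV[K]_m) : knsq (hdot z w) <= normsq z * normsq w.
Proof.
have [->|z0] := eqVneq z 0; first by rewrite hdot0l normsq0 knsq0 mul0r.
have N0 : 0 < normsq z.
  by rewrite lt_def normsq_ge0 andbT; apply: contra_neqN z0 => /eqP /normsq_eq0.
have := normsq_ge0 (rsc w (kreal k (normsq z)) - rsc z (hdot z w)).
rewrite normsqB !normsqZ knsq_kreal hdotZl hdotZr kconj_kreal kreZl.
rewrite -(hdot_conj z w) kconj_mul kre_kreal => h.
rewrite -subr_ge0 -(pmulr_rge0 _ N0); move: h; lra.
Qed.
Lemma hdot_norm m (z w : 'cV[K]_m) :
  knorm (hdot z w) <= Num.sqrt (normsq z) * Num.sqrt (normsq w).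
Proof.
by rewrite -sqrtrM ?normsq_ge0 // ler_sqrt ?mulr_ge0 ?normsq_ge0 // hdot_CS.
Qed.

End VectorTheory.

#[global] Opaque kreal kconj kre kim knorm kinv knsq hdot normsq.

(** * Moebius transformations *)

(* The norm of the scalar c with v = h c, where h is the normalized lift of the
   point of [v]; and the multiplier of a Moebius transformation at a point. *)
Definition vscale (R : realType) (k : scalars) (n : nat)
  (v : 'cV[scalar R k]_(1 + (n + 1))) : R :=
  if usubmx v 0 0 == 0 then knorm (dsubmx (dsubmx v) 0 0) else knorm (usubmx v 0 0).
HB.lock Definition nu (R : realType) (k : scalars) (n : nat) (g : PUJ R k n)
  (x : xkpoint R k n) : R := vscale (umx (repr g) *m homog x).
(** By [pr_cdist] this is the square of the Cygan distance as soon as one of the points lies on X.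
    It also makes sense at oo, where its value against a finite point is 1. *)
HB.lock Definition pr (R : realType) (k : scalars) (n : nat) (x y : xkpoint R k n) : R :=
  knorm (hform (homog x) (homog y)).

Section Moebius.
Context {R : realType} {k : scalars} {n : nat}.
Local Notation K := (scalar R k).
Local Notation G := (PUJ R k n).
Local Notation V := 'cV[K]_(1 + (n + 1)).
Local Notation J := (formJ R k n).
Implicit Types (u v w : V) (c d : K) (g h : G) (p q : kpoint R k n)
  (x y : xkpoint R k n).

Definition vc0 v : K := usubmx v 0 0.
Definition vc1 v : 'cV[K]_n := usubmx (dsubmx v).
Definition vc2 v : K := dsubmx (dsubmx v) 0 0.
Definition vec (a : K) (z : 'cV[K]_n) (b : K) : V :=
  col_mx a%:M (col_mx z b%:M).

Lemma vc0_vec a z b : vc0 (vec a z b) = a.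
Proof. by rewrite /vc0 /vec col_mxKu mxE. Qed.
Lemma vc1_vec a z b : vc1 (vec a z b) = z.
Proof. by rewrite /vc1 /vec col_mxKd col_mxKu. Qed.
Lemma vc2_vec a z b : vc2 (vec a z b) = b.
Proof. by rewrite /vc2 /vec !col_mxKd mxE. Qed.
Definition vc_vec := (vc0_vec, vc1_vec, vc2_vec).
Lemma vecE v : v = vec (vc0 v) (vc1 v) (vc2 v).
Proof.
rewrite /vec /vc0 /vc1 /vc2.
have e (m : 'M[K]_1) : (m 0 0)%:M = m by rewrite -mx11_scalar.
by rewrite !e !vsubmxK.
Qed.
Lemma vec_inj u v : vc0 u = vc0 v -> vc1 u = vc1 v -> vc2 u = vc2 v -> u = v.
Proof. by move=> e0 e1 e2; rewrite (vecE u) (vecE v) e0 e1 e2. Qed.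

Lemma vc0D u v : vc0 (u + v) = vc0 u + vc0 v. Proof. by rewrite /vc0 !mxE. Qed.
Lemma vc1D u v : vc1 (u + v) = vc1 u + vc1 v.
Proof. by apply/matrixP => i j; rewrite !mxE. Qed.
Lemma vc2D u v : vc2 (u + v) = vc2 u + vc2 v. Proof. by rewrite /vc2 !mxE. Qed.
Lemma vc0N u : vc0 (- u) = - vc0 u. Proof. by rewrite /vc0 !mxE. Qed.
Lemma vc1N u : vc1 (- u) = - vc1 u.
Proof. by apply/matrixP => i j; rewrite !mxE. Qed.
Lemma vc2N u : vc2 (- u) = - vc2 u. Proof. by rewrite /vc2 !mxE. Qed.
Lemma vc0Z u c : vc0 (rsc u c) = vc0 u * c.
Proof. by rewrite /vc0 mxE rscE mxE. Qed.
Lemma vc1Z u c : vc1 (rsc u c) = rsc (vc1 u) c.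
Proof. by apply/matrixP => i j; rewrite mxE mxE rscE rscE !mxE. Qed.
Lemma vc2Z u c : vc2 (rsc u c) = vc2 u * c.
Proof. by rewrite /vc2 mxE mxE rscE !mxE. Qed.
Definition vcE := (vc0D, vc1D, vc2D, vc0N, vc1N, vc2N, vc0Z, vc1Z, vc2Z).

Lemma hdot_vec u v :
  hdot u v = kconj (vc0 u) * vc0 v + hdot (vc1 u) (vc1 v) + kconj (vc2 u) * vc2 v.
Proof.
rewrite !hdot_sum big_split_ord big_ord1 big_split_ord big_ord1 /= addrA.
rewrite /vc0 /vc1 /vc2; congr (_ + _ + _); rewrite ?mxE //.
by apply: eq_bigr => i _; rewrite !mxE.
Qed.

Lemma formJ_vec v : J *m v = vec (- vc2 v) (vc1 v) (- vc0 v).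
Proof.
rewrite {1}(vecE v) /formJ /vec mul_block_col mul_row_col mul_col_mx.
rewrite mul_block_col add_col_mx !mul0mx !addr0 !add0r !mul1mx !mulNmx !mul1mx.
by rewrite !raddfN.
Qed.

Lemma hformE u v : hform u v =
  hdot (vc1 u) (vc1 v) - kconj (vc0 u) * vc2 v - kconj (vc2 u) * vc0 v.
Proof.
rewrite /hform -mulmxA -hdotE hdot_vec formJ_vec !vc_vec !mulrN.
by rewrite addrAC addrC addrA addrC addrA.
Qed.

Lemma hformDr u v w : hform u (v + w) = hform u v + hform u w.
Proof. by rewrite /hform mulmxDr mxE. Qed.
Lemma hform_conj u v : kconj (hform u v) = hform v u.
Proof.
rewrite !hformE !kconjB !kconjM !kconjK hdot_conj addrAC //.
Qed.
Lemma hformDl u v w : hform (v + w) u = hform v u + hform w u.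
Proof. by rewrite -hform_conj hformDr kconjD !hform_conj. Qed.
Lemma hformNr u v : hform u (- v) = - hform u v.
Proof. by rewrite /hform mulmxN mxE. Qed.
Lemma hformNl u v : hform (- u) v = - hform u v.
Proof. by rewrite -hform_conj hformNr kconjN !hform_conj. Qed.
Lemma hformBr u v w : hform u (v - w) = hform u v - hform u w.
Proof. by rewrite hformDr hformNr. Qed.
Lemma hformBl u v w : hform (v - w) u = hform v u - hform w u.
Proof. by rewrite hformDl hformNl. Qed.
Lemma hformZr u v c : hform u (rsc v c) = hform u v * c.
Proof. by rewrite /hform mul_rsc rscE. Qed.
Lemma hformZl u v c : hform (rsc u c) v = kconj c * hform u v.
Proof. by rewrite -hform_conj hformZr kconjM hform_conj. Qed.
Lemma hform0r u : hform u 0 = 0.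
Proof. by rewrite /hform mulmx0 mxE. Qed.

Lemma hform_self u :
  hform u u = kreal k (normsq (vc1 u) - 2 * kre (kconj (vc0 u) * vc2 u)).
Proof.
rewrite hformE hdot_normsq krealB -addk_conj kconjM kconjK opprD addrA //.
Qed.
Lemma kre_hform u :
  kre (hform u u) = normsq (vc1 u) - 2 * kre (kconj (vc0 u) * vc2 u).
Proof. by rewrite hform_self kre_kreal. Qed.
Lemma hform_selfE u : hform u u = kreal k (kre (hform u u)).
Proof. by rewrite kre_hform hform_self. Qed.
Lemma hform_umx (A : UJ R k n) u v : hform (umx A *m u) (umx A *m v) = hform u v.
Proof.
have [e _] := umxP A.
rewrite /hform adjmxM !mulmxA -(mulmxA (adjmx u)) -(mulmxA (adjmx u)) e.
by rewrite -mulmxA.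
Qed.
Lemma umx_eq0 (A : UJ R k n) u : umx A *m u = 0 -> u = 0.
Proof.
move=> e; have : umx (A^-1 * A)%g *m u = u by rewrite mulVg mul1mx.
by rewrite /= -mulmxA e mulmx0 => <-.
Qed.

Lemma vc_phi p : (vc0 (phi p) = 1) * (vc1 (phi p) = kreal k (Num.sqrt 2) *: p.1) *
  (vc2 (phi p) = p.2 + kreal k (normsq p.1)).
Proof.
rewrite -[phi p]/(vec 1 (kreal k (Num.sqrt 2) *: p.1) (p.2 + kreal k (normsq p.1))).
by rewrite !vc_vec.
Qed.
Lemma vc_inf : (vc0 (homog (None : xkpoint R k n)) = 0) *
  (vc1 (homog (None : xkpoint R k n)) = 0) * (vc2 (homog (None : xkpoint R k n)) = 1).
Proof.
have e : homog (None : xkpoint R k n) = vec 0 0 1.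
  by rewrite /= /vec; congr col_mx; apply/matrixP => i j; rewrite !mxE mul0rn.
by rewrite !e !vc_vec.
Qed.

Lemma sqrt2_neq0 : Num.sqrt 2 != 0 :> R.
Proof. by rewrite sqrtr_eq0 -ltNge ltr0n. Qed.
Lemma sqrt2_sqr : Num.sqrt 2 * Num.sqrt 2 = 2 :> R.
Proof. by rewrite -expr2 sqr_sqrtr ?ler0n. Qed.

Lemma hform_phi p q : hform (phi p) (phi q) =
  hdot p.1 q.1 *+ 2 - (q.2 + kreal k (normsq q.1)) - kconj (p.2 + kreal k (normsq p.1)).
Proof.
rewrite hformE !vc_phi kconj1 mul1r mulr1 !krscC hdotZl hdotZr kconj_kreal.
rewrite mulrA kreal_central -mulrA krealM -expr2 sqr_sqrtr ?ler0n //.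
by rewrite (natrD R 1 1) krealD kreal1 mulrDr mulr1 -mulr2n addrAC.
Qed.
Lemma hform_phi_self p : hform (phi p) (phi p) = kreal k (- 2 * kre p.2).
Proof.
by rewrite hform_phi hdot_normsq kconjD kconj_kreal mulr2n; apply: kext; kcomp; ring.
Qed.
Lemma hform_inf p : hform (homog None) (phi p) = -1.
Proof.
by rewrite hformE !vc_inf !vc_phi hdot0l kconj0 kconj1 mul0r mulr1 subr0 sub0r.
Qed.
Lemma hform_infinf : hform (homog (None : xkpoint R k n)) (homog None) = 0.
Proof. by rewrite hformE !vc_inf hdot0l kconj0 !mul0r !mulr0 !subr0. Qed.

Lemma dehomog_rsc v c : c != 0 -> dehomog (rsc v c) = dehomog v.
Proof.
move=> c0; rewrite -(dehomog_scale v c0); congr dehomog.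
by apply/matrixP => i j; rewrite rscE !mxE (ord1 j).
Qed.

Lemma dehomogE v : dehomog v = if vc0 v == 0 then None else
  let z := kreal k (Num.sqrt 2)^-1 *: rsc (vc1 v) (kinv (vc0 v)) in
  Some (z, vc2 v * kinv (vc0 v) - kreal k (normsq z)).
Proof.
rewrite /dehomog -/(vc0 v) -/(vc2 v); case: ifP => // _ /=.
have -> : map_mx (fun a => kreal k (Num.sqrt 2)^-1 * (a * kinv (vc0 v)))
    (usubmx (dsubmx v)) =
  kreal k (Num.sqrt 2)^-1 *: rsc (vc1 v) (kinv (vc0 v)).
  by apply/matrixP => i j; rewrite [LHS]mxE [RHS]mxE rscE.
by [].
Qed.

Lemma dehomog_homog x : dehomog (homog x) = x.
Proof.
rewrite dehomogE; case: x => [p|]; last by rewrite vc_inf eqxx.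
rewrite /= !vc_phi oner_eq0 (_ : kinv 1 = 1); last first.
  by rewrite -[RHS](@kmulVr _ _ 1) ?oner_eq0 // mul1r.
rewrite rsc1 scalerA krealM mulVf ?sqrt2_neq0 // kreal1 scale1r mulr1 addrK.
by case: p.
Qed.

Lemma vscaleE v : vscale v = if vc0 v == 0 then knorm (vc2 v) else knorm (vc0 v).
Proof. by []. Qed.

(** If the first coordinate of [v] vanishes, the form of [v] reduces to the norm of the middle
    block. Nonpositivity then kills that block, and [v] is a multiple of the lift of oo. *)
Lemma homog_dehomog v : v != 0 -> kre (hform v v) <= 0 ->
  exists c, [/\ v = rsc (homog (dehomog v)) c, knorm c = vscale v & 0 < vscale v].
Proof.
move=> v0 hv; rewrite dehomogE vscaleE; have [e|ne] := eqVneq (vc0 v) 0.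
  have e1 : vc1 v = 0.
    apply: normsq_eq0; apply: le_anti; rewrite normsq_ge0 andbT.
    by move: hv; rewrite kre_hform e kconj0 mul0r kre0 mulr0 subr0.
  exists (vc2 v); split=> //.
    by apply: vec_inj; rewrite !vcE !vc_inf ?mul0r ?mul1r ?rsc0l.
  rewrite knorm_gt0; apply: contra_neq v0 => e2.
  by rewrite (vecE v) e e1 e2; apply: vec_inj; rewrite ?vc_vec;
     [rewrite /vc0 | rewrite /vc1 | rewrite /vc2]; rewrite ?linear0 ?mxE //;
     apply/matrixP => i j; rewrite !mxE.
exists (vc0 v); rewrite knorm_gt0 ne; split=> //.
apply: vec_inj; rewrite !vcE /= !vc_phi ?mul1r //=.
  rewrite scalerA krealM divff ?sqrt2_neq0 // kreal1 scale1r rscA.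
  by rewrite kmulVl // rsc1.
by rewrite subrK -mulrA kmulVl // mulr1.
Qed.

Lemma nuE g x : nu g x = vscale (umx (repr g) *m homog x).
Proof. by rewrite nu.unlock. Qed.
Lemma prE_hform x y : pr x y = knorm (hform (homog x) (homog y)).
Proof. by rewrite pr.unlock. Qed.
(** The closed half-space together with oo. These are the points whose lifts have nonpositive
    square, on which [dehomog] inverts [homog] and the action law [xmobM] holds. *)
Definition good x : Prop := if x is Some p then 0 <= kre p.2 else True.

Lemma homog_neq0 x : homog x != 0.
Proof.
case: x => [p|]; apply/eqP => /(congr1 (fun v => (vc0 v, vc2 v))) /=.
  by rewrite !vc_phi {1}/vc0 linear0 mxE => -[/eqP]; rewrite oner_eq0.
by rewrite !vc_inf /vc2 !linear0 mxE => -[_ /eqP]; rewrite oner_eq0.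
Qed.
Lemma goodP x : good x <-> kre (hform (homog x) (homog x)) <= 0.
Proof.
case: x => [p|] /=; last by rewrite hform_infinf.
by rewrite hform_phi_self kre_kreal; split=> ?; lra.
Qed.
Lemma hform_homogZ x c :
  kre (hform (rsc (homog x) c) (rsc (homog x) c)) =
  knsq c * kre (hform (homog x) (homog x)).
Proof.
by rewrite hformZl hformZr hform_selfE kreal_central mulrA kconj_mul krealM !kre_kreal.
Qed.

Lemma umxP_xmob (A : UJ R k n) x : good x ->
  exists c, [/\ umx A *m homog x = rsc (homog (dehomog (umx A *m homog x))) c,
    knorm c = vscale (umx A *m homog x) & 0 < vscale (umx A *m homog x)].
Proof.
move=> /goodP gx; apply: homog_dehomog; last by rewrite hform_umx.
by apply: contra_neq (homog_neq0 x) => /umx_eq0.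
Qed.

Lemma xmobP g x : good x -> exists c,
  [/\ umx (repr g) *m homog x = rsc (homog (xmob g x)) c, knorm c = nu g x,
      0 < nu g x & good (xmob g x)].
Proof.
move=> gx; have [c [e nc n0]] := umxP_xmob (repr g) gx; exists c; rewrite nuE; split=> //.
apply/goodP; have := gx => /goodP; rewrite -(hform_umx (repr g)) e hform_homogZ.
by rewrite pmulr_rle0 // -knorm_sqr exprn_gt0 // nc.
Qed.
Lemma nu_gt0 g x : good x -> 0 < nu g x. Proof. by case/(xmobP g) => c []. Qed.
Lemma good_xmob g x : good x -> good (xmob g x). Proof. by case/(xmobP g) => c []. Qed.

Lemma pr_ge0 x y : 0 <= pr x y. Proof. by rewrite prE_hform knorm_ge0. Qed.
Lemma prC x y : pr x y = pr y x.
Proof. by rewrite !prE_hform -hform_conj knorm_conj. Qed.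
(** Invariance of the Hermitian form, once both image vectors are renormalised. Together with
    [xht_xmob] this is the main tool for Moebius maps. *)
Lemma pr_xmob g x y : good x -> good y ->
  pr (xmob g x) (xmob g y) * (nu g x * nu g y) = pr x y.
Proof.
move=> /(xmobP g)[c [ec nc _ _]] /(xmobP g)[d [ed nd _ _]].
rewrite [RHS]prE_hform -(hform_umx (repr g)) ec ed hformZl hformZr !knormM knorm_conj.
by rewrite nc nd prE_hform; ring.
Qed.

Definition xht x : R := if x is Some p then kre p.2 else 0.
Lemma xhtE x : kre (hform (homog x) (homog x)) = - 2 * xht x.
Proof.
by case: x => [p|] /=; rewrite ?hform_infinf ?mulr0 // hform_phi_self kre_kreal.
Qed.
Lemma xht_xmob g x : good x -> xht (xmob g x) * nu g x ^+ 2 = xht x.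
Proof.
move=> /(xmobP g)[c [ec nc _ _]].
have := xhtE x; rewrite -(hform_umx (repr g)) ec hform_homogZ xhtE -knorm_sqr nc.
by move=> h; apply: (@mulfI _ (-2)); [rewrite oppr_eq0 pnatr_eq0 | rewrite -h; ring].
Qed.

(** Evaluating the preserved form on the lifts of oo and 0, where it is -1, gives [knsq c = 1].
    Hence [nu] does not depend on the representing matrix. *)
Lemma umx_scal_norm (A B : UJ R k n) c : umx B = umx A *m c%:M -> knorm c = 1.
Proof.
move=> e; have [eB _] := umxP B; have [eA _] := umxP A.
set o := homog (None : xkpoint R k n).
have h0 : hform o (phi 0) = -1 by rewrite hform_inf.
have cu (v : V) : c%:M *m v = \col_i (c * v i 0).
  by apply/matrixP => i j; rewrite mul_scalar_mx !mxE (ord1 j).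
have h1 : hform (c%:M *m o) (c%:M *m (phi 0)) = -1.
  by rewrite -h0 -(hform_umx A) !mulmxA -e hform_umx.
move: h1; rewrite hformE !cu.
have e0 (v : V) : vc0 (\col_i (c * v i 0)) = c * vc0 v by rewrite /vc0 !mxE.
have e2 (v : V) : vc2 (\col_i (c * v i 0)) = c * vc2 v by rewrite /vc2 !mxE.
have e1 (v : V) : vc1 (\col_i (c * v i 0)) = c *: vc1 v.
  by apply/matrixP => i j; rewrite !mxE (ord1 j).
rewrite !e0 !e1 !e2 !vc_inf !vc_phi scaler0 hdot0l !mulr0 !mulr1 kconj0 mul0r !sub0r.
rewrite oppr0 sub0r kconj_mul => /eqP; rewrite eqr_opp => /eqP h.
have: knsq c = 1 by apply: (@kreal_inj R k); rewrite h kreal1.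
by rewrite knormE => ->; rewrite sqrtr1.
Qed.

Lemma nu_pi (A : UJ R k n) x : good x -> nu (\pi A) x = vscale (umx A *m homog x).
Proof.
move=> gx; have [c [cc e]] := repr_piP A; have nc := umx_scal_norm e.
have c0 : c != 0 by rewrite -knorm_gt0 nc.
rewrite nuE e -mulmxA -[c%:M *m _](_ : rsc (homog x) c = _); last first.
  by apply/matrixP => i j; rewrite mul_scalar_mx rscE mxE cc.
rewrite mul_rsc !vscaleE !vcE !knormM nc !mulr1.
have -> : (vc0 (umx A *m homog x) * c == 0) = (vc0 (umx A *m homog x) == 0).
  by rewrite -!knorm_eq0 knormM nc mulr1.
by [].
Qed.

Lemma vscale_homog x c : c != 0 -> vscale (rsc (homog x) c) = knorm c.
Proof.
move=> c0; rewrite vscaleE vc0Z vc2Z; case: x => [p|].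
  by rewrite [homog _]/(phi p) (vc_phi p).1.1 mul1r (negPf c0).
by rewrite (vc_inf).1.1 (vc_inf).2 mul0r mul1r eqxx.
Qed.

Lemma xmobM_nuM g h x : good x ->
  xmob (g * h)%g x = xmob g (xmob h x) /\
  nu (g * h)%g x = nu g (xmob h x) * nu h x.
Proof.
move=> gx; have [c [ec nc n0 gy]] := xmobP h gx.
have [d [ed nd d0 gz]] := xmobP g gy.
have -> : (g * h)%g = \pi_(PUJ R k n) (repr g * repr h)%g by [].
have e : umx (repr g * repr h)%g *m homog x = rsc (homog (xmob g (xmob h x))) (d * c).
  by rewrite /= -mulmxA ec mul_rsc ed rscA.
have dc0 : d * c != 0 by rewrite -knorm_gt0 knormM nd nc mulr_gt0.
split; first by rewrite xmob_pi e dehomog_rsc // dehomog_homog.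
by rewrite nu_pi // e -nc -nd -knormM vscale_homog.
Qed.
Lemma xmobM g h x : good x -> xmob (g * h)%g x = xmob g (xmob h x).
Proof. by move/(xmobM_nuM g h) => []. Qed.
Lemma nuM g h x : good x -> nu (g * h)%g x = nu g (xmob h x) * nu h x.
Proof. by move/(xmobM_nuM g h) => []. Qed.
Lemma xmob1 x : xmob 1%g x = x.
Proof.
have -> : (1 : G)%g = \pi_(PUJ R k n) 1%g by [].
by rewrite xmob_pi mul1mx dehomog_homog.
Qed.
Lemma nu1 x : good x -> nu 1%g x = 1.
Proof.
move=> gx; have -> : (1 : G)%g = \pi_(PUJ R k n) 1%g by [].
by rewrite nu_pi // mul1mx -(rsc1 (homog x)) vscale_homog ?oner_neq0 ?knorm1.
Qed.
Lemma xmobK g x : good x -> xmob g^-1%g (xmob g x) = x.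
Proof. by move=> gx; rewrite -xmobM // mulVg xmob1. Qed.
Lemma xmobKV g x : good x -> xmob g (xmob g^-1%g x) = x.
Proof. by move=> gx; rewrite -xmobM // mulgV xmob1. Qed.
Lemma nuV g x : good x -> nu g^-1%g (xmob g x) = (nu g x)^-1.
Proof.
move=> gx; have n0 := nu_gt0 g gx.
by apply: (mulIf (lt0r_neq0 n0)); rewrite -nuM // mulVg nu1 // mulVf ?gt_eqF.
Qed.
Lemma xmob_inj g x y : good x -> good y -> xmob g x = xmob g y -> x = y.
Proof. by move=> gx gy e; rewrite -(xmobK g gx) e xmobK. Qed.

Lemma in_H_good p : in_H p -> good (Some p). Proof. exact: ltW. Qed.
Lemma in_X_good p : in_X p -> good (Some p). Proof. by rewrite /good => ->. Qed.
Lemma xmob_H g p : in_H p -> xmob g (Some p) = Some (mob g p) /\ in_H (mob g p).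
Proof.
move=> hp; have gp := in_H_good hp.
have := xht_xmob g gp; have := nu_gt0 g gp; rewrite /mob.
case: (xmob g (Some p)) => [q|] n0 /= e; last first.
  by move: hp; rewrite /in_H -e mul0r ltxx.
by split=> //; rewrite /in_H -(pmulr_lgt0 _ (exprn_gt0 2 n0)) e.
Qed.
Lemma xmob_X g p q : in_X p -> xmob g (Some p) = Some q -> in_X q.
Proof.
move=> hp e; have := xht_xmob g (in_X_good hp); rewrite e /= hp => /eqP.
have n0 := nu_gt0 g (in_X_good hp).
by rewrite mulf_eq0 expf_eq0 /= (gt_eqF n0) orbF => /eqP.
Qed.
Lemma mob_some g p q : xmob g (Some p) = Some q -> mob g p = q.
Proof. by rewrite /mob => ->. Qed.
Lemma mobM_H g h p : in_H p -> mob (g * h)%g p = mob g (mob h p).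
Proof.
move=> hp; have [e _] := xmob_H h hp.
exact: (congr1 (odflt 0) (etrans (xmobM g h (in_H_good hp)) (congr1 (xmob g) e))).
Qed.
Lemma mob1 p : mob 1%g p = p. Proof. by rewrite /mob xmob1. Qed.
Lemma mob_H g p : in_H p -> in_H (mob g p). Proof. by case/(xmob_H g). Qed.
Lemma mobK_H g p : in_H p -> mob g^-1%g (mob g p) = p.
Proof. by move=> hp; rewrite -mobM_H // mulVg mob1. Qed.
Lemma mobKV_H g p : in_H p -> mob g (mob g^-1%g p) = p.
Proof. by move=> hp; rewrite -mobM_H // mulgV mob1. Qed.

Lemma pr_inf p : pr None (Some p) = 1.
Proof. by rewrite !prE_hform hform_inf knormN knorm1. Qed.

Lemma pr_phi p q : pr (Some p) (Some q) = knorm (hform (phi p) (phi q)).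
Proof. exact: prE_hform. Qed.
Lemma homog_some p : homog (Some p) = phi p. Proof. by []. Qed.

End Moebius.

#[global] Opaque hform vc0 vc1 vc2 phi homog dehomog vscale nu pr xmob.

(** * The metric and geodesics *)

Section Metric.
Context {R : realType} {k : scalars} {n : nat}.
Local Notation K := (scalar R k).
Local Notation G := (PUJ R k n).
Local Notation V := 'cV[K]_(1 + (n + 1)).
Implicit Types (u v w : V) (c d : K) (g h : G) (p q : kpoint R k n)
  (x y : xkpoint R k n).

Lemma kre_hform_phi p q :
  - kre (hform (phi p) (phi q)) = normsq (p.1 - q.1) + kre p.2 + kre q.2.
Proof.
rewrite hform_phi normsqB mulr2n !kreB !kreD kre_conj kreD !kre_kreal; ring.
Qed.
Lemma kim_hform_phi p q :
  kim (hform (phi p) (phi q)) = kim (hdot p.1 q.1) *+ 2 - kim q.2 + kim p.2.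
Proof.
rewrite hform_phi mulr2n !kimB !kimD kim_conj kimD !kim_kreal !addr0 opprK.
by rewrite mulr2n.
Qed.
Lemma prE p q : good (Some p) -> good (Some q) ->
  normsq (p.1 - q.1) + kre p.2 + kre q.2 <= pr (Some p) (Some q).
Proof. by move=> hp hq; rewrite -kre_hform_phi pr_phi -knormN -kreN kre_ler. Qed.
Lemma pr_htl p q : good (Some p) -> good (Some q) -> ht p <= pr (Some p) (Some q).
Proof.
move=> hp hq; apply: le_trans (prE hp hq); rewrite /ht.
by have := normsq_ge0 (p.1 - q.1); move: hp hq => /=; lra.
Qed.
Lemma pr_normsq p q : good (Some p) -> good (Some q) ->
  normsq (p.1 - q.1) <= pr (Some p) (Some q).
Proof.
by move=> hp hq; apply: le_trans (prE hp hq); move: hp hq => /=; lra.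
Qed.

Lemma knorm_reim_eq c d : kre c = kre d -> kim c = kim d -> knorm c = knorm d.
Proof.
by move=> e1 e2; rewrite !knormE (knsq_reim c) (knsq_reim d) e1 e2.
Qed.

Lemma knorm_reim_eqN c d : kre c = kre d -> kim c = - kim d -> knorm c = knorm d.
Proof. by move=> e1 e2; rewrite !knormE (knsq_reim c) (knsq_reim d) e1 e2 knsqN. Qed.

Lemma sqrt_triangle (a b P Q S T : R) : 0 <= a -> 0 <= b -> P <= a -> Q <= b ->
  S <= Num.sqrt P * Num.sqrt Q -> T <= a + b + 2 * S ->
  Num.sqrt T <= Num.sqrt a + Num.sqrt b.
Proof.
move=> a0 b0 Pa Qb hS hT.
have hS' : S <= Num.sqrt a * Num.sqrt b.
  apply: le_trans hS _; apply: ler_pM; rewrite ?sqrtr_ge0 //; exact: ler_wsqrtr.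
rewrite -[leRHS]ger0_norm ?addr_ge0 ?sqrtr_ge0 // -sqrtr_sqr; apply: ler_wsqrtr.
by rewrite sqrrD !sqr_sqrtr //; lra.
Qed.

Lemma cdist_pr p q : good (Some p) -> in_X q ->
  cdist p q = Num.sqrt (pr (Some p) (Some q)).
Proof.
move=> hp hq; rewrite /cdist /gauge pr_phi -[in RHS]knormN; congr Num.sqrt.
have hq' : kre q.2 = 0 := hq; rewrite /pmul /=.
have e : kre (- p.2 + q.2 + kim (hdot (- p.1) q.1) *+ 2) = - kre p.2.
  by rewrite mulr2n 3!kreD kre_kim hq' kreN !addr0.
apply: knorm_reim_eq.
  rewrite kreD kre_kreal kre_kim addr0 kreN kre_hform_phi hq' addr0 e.
  by rewrite normrN (ger0_norm hp) addrC normsqBC [- p.1 + _]addrC addrC.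
rewrite kimD kim_kreal add0r kimN kim_hform_phi hdotNl.
by move: (hdot _ _) (p.2) (q.2) => ???; apply: kext; rewrite !mulr2n; kcomp; ring.
Qed.
Lemma pr_cdist p q : good (Some p) -> in_X q ->
  pr (Some p) (Some q) = cdist p q ^+ 2.
Proof. by move=> hp hq; rewrite cdist_pr // sqr_sqrtr ?pr_ge0. Qed.
Lemma in_X0 : in_X (0 : kpoint R k n). Proof. by []. Qed.
Lemma gauge_pr p : good (Some p) -> gauge p = Num.sqrt (pr (Some p) (Some 0)).
Proof.
move=> hp; rewrite /gauge pr_phi -[in RHS]knormN; congr Num.sqrt.
apply: knorm_reim_eqN.
  rewrite kreD kre_kreal kre_kim addr0 kreN kre_hform_phi subr0 /= kre0 addr0.
  by rewrite (ger0_norm hp).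
rewrite kimD kim_kreal add0r kimN kim_hform_phi /= hdot0r.
by move: (p.2) => w; rewrite mulr2n; apply: kext; kcomp; ring.
Qed.
Lemma pr_gauge p : good (Some p) -> pr (Some p) (Some 0) = gauge p ^+ 2.
Proof. by move=> hp; rewrite gauge_pr // sqr_sqrtr ?pr_ge0. Qed.
Lemma gauge_ge0 p : 0 <= gauge p. Proof. exact: sqrtr_ge0. Qed.

(** For [z] on X the pairing of [p] and [q] is the sum of the pairings through [z] minus twice
    [hdot (z - p) (q - z)]. Cauchy-Schwarz and [pr_normsq] bound this cross term by the product of
    the two square roots. *)
Lemma pr_triangle p q z : good (Some p) -> in_X z -> good (Some q) ->
  Num.sqrt (pr (Some p) (Some q)) <=
  Num.sqrt (pr (Some p) (Some z)) + Num.sqrt (pr (Some z) (Some q)).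
Proof.
move=> hp hz hq; have gz := in_X_good hz.
have e : hform (phi p) (phi q) = hform (phi p) (phi z) + hform (phi z) (phi q)
   - hdot (z.1 - p.1) (q.1 - z.1) *+ 2.
  rewrite !hform_phi hdotBl !hdotBr hdot_normsq !mulr2n.
  have hz' := kconj_im (hz : kre z.2 = 0).
  move: (hdot p.1 q.1) (hdot p.1 z.1) (hdot z.1 q.1) => d1 d2 d3.
  move: (normsq p.1) (normsq q.1) (normsq z.1) => n1 n2 n3.
  rewrite (kconjD z.2) hz'; move: (p.2) (z.2) (q.2) => ???.
  by apply: kext; kcomp; ring.
apply: (sqrt_triangle _ _ _ _ (hdot_norm (z.1 - p.1) (q.1 - z.1))).
- exact: pr_ge0.
- exact: pr_ge0.
- by rewrite (normsqBC z.1); exact: pr_normsq.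
- by rewrite (normsqBC q.1); exact: pr_normsq.
rewrite !pr_phi e; apply: le_trans (knorm_triangleB _ _) _.
apply: lerD; first exact: knorm_triangle.
rewrite mulr2n; apply: le_trans (knorm_triangle _ _) _.
by rewrite mulrDl mul1r.
Qed.
End Metric.

(** The factor that normalises [hdist]. With [ex] scaled by it, [glift] below describes a geodesic
    at unit speed. *)
Definition kap (R : realType) (k : scalars) : R := if k is RealScalars then 1 else 2.
Definition ex (R : realType) (k : scalars) (t : R) : R := expR (t / kap R k).
Definition glift (R : realType) (k : scalars) (n : nat)
  (X Y : 'cV[scalar R k]_(1 + (n + 1))) (t : R) : 'cV[scalar R k]_(1 + (n + 1)) :=
  rsc X (kreal k (ex k t)) + rsc Y (kreal k (ex k t)^-1).
HB.lock Definition gline (R : realType) (k : scalars) (n : nat)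
  (X Y : 'cV[scalar R k]_(1 + (n + 1))) (t : R) : kpoint R k n :=
  odflt 0 (dehomog (glift X Y t)).

(** * Distance, geodesic lines and the positive complement of a point *)

Section Hyperbolic.
Context {R : realType} {k : scalars} {n : nat}.
Local Notation K := (scalar R k).
Local Notation G := (PUJ R k n).
Local Notation V := 'cV[K]_(1 + (n + 1)).
Implicit Types (u v w X Y : V) (c d : K) (g h : G) (p q : kpoint R k n)
  (x y : xkpoint R k n) (a b s t eta : R).

Lemma acosh_avg a : 0 < a -> acosh ((a + a^-1) / 2) = `|ln a|.
Proof.
have H b : 1 <= b -> acosh ((b + b^-1) / 2) = ln b.
  move=> b1; have b0 : 0 < b by lra.
  have e : ((b + b^-1) / 2) ^+ 2 - 1 = ((b - b^-1) / 2) ^+ 2 by field; lra.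
  rewrite /acosh e sqrtr_sqr ger0_norm; first by congr ln; field; lra.
  by rewrite divr_ge0 // subr_ge0 (le_trans _ b1) // invf_le1.
move=> a0; have [a1|a1] := leP 1 a.
  by rewrite H // ger0_norm // ln_ge0.
have a1' : 1 <= a^-1 by rewrite invf_ge1 // ltW.
have := H _ a1'; rewrite invrK addrC => ->.
by rewrite lnV ?posrE // ler0_norm // ln_le0 // ltW.
Qed.
Lemma acosh_inv a t : 1 <= a -> acosh a = t -> a = (expR t + (expR t)^-1) / 2.
Proof.
move=> a1; rewrite /acosh => <-; set s := Num.sqrt _.
have s0 : 0 <= s := sqrtr_ge0 _.
have s2 : s ^+ 2 = a ^+ 2 - 1.
  by rewrite sqr_sqrtr // subr_ge0 -[1](expr1n _ 2) ler_pXn2r ?nnegrE //; lra.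
rewrite lnK ?posrE; last lra.
have -> : (a + s)^-1 = a - s.
  by apply: (@mulfI _ (a + s)); [lra | rewrite mulfV; [by rewrite -[RHS](_ : a ^+ 2 - s ^+ 2 = _); [rewrite s2; ring | ring] | lra]].
by field.
Qed.

Lemma vneg_lift v : kre (hform v v) < 0 -> exists p,
  [/\ dehomog v = Some p, v = rsc (phi p) (vc0 v), vc0 v != 0, in_H p &
      2 * ht p * knsq (vc0 v) = - kre (hform v v)].
Proof.
move=> hv; have v0 : v != 0.
  by apply: contraTneq hv => ->; rewrite hform0r kre0 ltxx.
have [c [e nc n0]] := homog_dehomog v0 (ltW hv).
case E: (dehomog v) e => [p|] /= e; last first.
  by move: hv; rewrite e hform_homogZ hform_infinf kre0 mulr0 ltxx.
have ec : vc0 v = c by rewrite e vc0Z homog_some (vc_phi p).1.1 mul1r.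
have c0 : c != 0 by rewrite -knorm_gt0 nc.
have eh : 2 * ht p * knsq c = - kre (hform v v).
  rewrite [in RHS]e hform_homogZ homog_some hform_phi_self kre_kreal /ht; ring.
exists p; rewrite ec; split=> //; rewrite /in_H.
have : 0 < 2 * ht p * knsq c by rewrite eh oppr_gt0.
by rewrite -mulrA pmulr_rgt0 // pmulr_lgt0 // -knorm_sqr exprn_gt0 // nc.
Qed.

Local Notation kap := (kap R k).
Local Notation ex := (@ex R k).
Lemma kap_gt0 : 0 < kap. Proof. by rewrite /kap; case: k. Qed.
Lemma kap_le2 : kap <= 2. Proof. by rewrite /kap; case: k => //; rewrite ler1n. Qed.

(** The hyperbolic cosine of the distance divided by [kap], for arbitrary negative lifts instead of
    normalised ones. *)
Definition ratio u v : R :=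
  knorm (hform u v) / Num.sqrt (knorm (hform u u) * knorm (hform v v)).
Lemma ratio_rsc u v c d : c != 0 -> d != 0 ->
  ratio (rsc u c) (rsc v d) = ratio u v.
Proof.
move=> c0 d0; rewrite /ratio !hformZl !hformZr !knormM !knorm_conj.
have nc : 0 < knorm c by rewrite knorm_gt0.
have nd : 0 < knorm d by rewrite knorm_gt0.
set A := knorm (hform u v); set B := knorm (hform u u); set C := knorm (hform v v).
have -> : knorm c * (B * knorm c) * (knorm d * (C * knorm d)) =
  (knorm c * knorm d) ^+ 2 * (B * C) by ring.
rewrite sqrtrM ?sqr_ge0 // sqrtr_sqr ger0_norm ?mulr_ge0 ?ltW //.
set S := Num.sqrt _; set m := knorm c * knorm d.
have m0 : m != 0 by rewrite mulf_neq0 ?gt_eqF.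
have -> : knorm c * (A * knorm d) = m * A by rewrite /m; ring.
by rewrite -mulf_div divff // mul1r.
Qed.
Lemma hdistE p q : hdist p q = kap * acosh (ratio (phi p) (phi q)).
Proof. by []. Qed.
Lemma ratio_ge1 p q : in_H p -> in_H q -> 1 <= ratio (phi p) (phi q).
Proof.
move=> hp hq; rewrite /ratio !hform_phi_self !knorm_kreal !mulNr !normrN.
rewrite !ger0_norm ?mulr_ge0 ?(ltW hp) ?(ltW hq) //.
have -> : 2 * kre p.2 * (2 * kre q.2) = 2 ^+ 2 * (kre p.2 * kre q.2) by ring.
rewrite sqrtrM ?sqr_ge0 // sqrtr_sqr ger0_norm // sqrtrM ?(ltW hp) //.
have := prE (in_H_good hp) (in_H_good hq); rewrite pr_phi.
have := normsq_ge0 (p.1 - q.1).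
have := sqr_sqrtr (ltW hp); have := sqr_sqrtr (ltW hq).
have : 0 < Num.sqrt (kre p.2) by rewrite sqrtr_gt0.
have : 0 < Num.sqrt (kre q.2) by rewrite sqrtr_gt0.
move: (knorm _) (normsq _) (Num.sqrt (kre p.2)) (Num.sqrt (kre q.2)) => A m x y.
move=> y0 x0 <- <- m0 h; rewrite ler_pdivlMr ?mulr_gt0 // mul1r; apply: le_trans h.
by have := sqr_ge0 (x - y); nra.
Qed.

Lemma ex_gt0 t : 0 < ex t. Proof. exact: expR_gt0. Qed.
Lemma ex_neq0 t : ex t != 0. Proof. exact: lt0r_neq0 (ex_gt0 t). Qed.
Hint Resolve ex_gt0 ex_neq0 : core.
Lemma exD s t : ex (s + t) = ex s * ex t.
Proof. by rewrite /ex mulrDl expRD. Qed.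
Lemma exN t : ex (- t) = (ex t)^-1.
Proof. by rewrite /ex mulNr expRN. Qed.
Lemma exB s t : ex (s - t) = ex s / ex t. Proof. by rewrite exD exN. Qed.
Lemma ex0 : ex 0 = 1. Proof. by rewrite /ex mul0r expR0. Qed.
Lemma ex_lt s t : (ex s < ex t) = (s < t).
Proof. by rewrite /ex ltr_expR ltr_pM2r // invr_gt0 kap_gt0. Qed.
Lemma ex_le s t : (ex s <= ex t) = (s <= t).
Proof. by rewrite /ex ler_expR ler_pM2r // invr_gt0 kap_gt0. Qed.
Lemma ln_ex t : ln (ex t) = t / kap. Proof. by rewrite /ex expRK. Qed.

Lemma glineE X Y t : gline X Y t = odflt 0 (dehomog (glift X Y t)).
Proof. by rewrite gline.unlock. Qed.
(** The two null vectors lift the endpoints. Along [glift] the form is constantly [-2 * eta], so the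
    height times the square of the first coordinate of the lift is [eta]. *)
Definition ldata X Y eta :=
  [/\ hform X X = 0, hform Y Y = 0, hform X Y = kreal k (- eta) & 0 < eta].

Lemma hform_glift X Y eta s t : ldata X Y eta ->
  hform (glift X Y s) (glift X Y t) =
  kreal k (- eta * (ex s / ex t + (ex s / ex t)^-1)).
Proof.
move=> [hX hY hXY e0]; rewrite /glift hformDl !hformDr !hformZl !hformZr hX hY hXY.
rewrite -(hform_conj X) hXY !kconj_kreal !mul0r !mulr0 add0r addr0 !krealM -krealD.
by congr kreal; field; rewrite !ex_neq0.
Qed.
Lemma hform_glift_self X Y eta t : ldata X Y eta ->
  hform (glift X Y t) (glift X Y t) = kreal k (- 2 * eta).
Proof.
move=> l; rewrite (hform_glift _ _ l) divff // invr1; congr kreal; ring.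
Qed.

Lemma gline_lift X Y eta t : ldata X Y eta ->
  [/\ dehomog (glift X Y t) = Some (gline X Y t),
      glift X Y t = rsc (phi (gline X Y t)) (vc0 (glift X Y t)),
      vc0 (glift X Y t) != 0, in_H (gline X Y t) &
      ht (gline X Y t) * knsq (vc0 (glift X Y t)) = eta].
Proof.
move=> l; have [_ _ _ e0] := l.
have hs := hform_glift_self t l.
have := @vneg_lift (glift X Y t); rewrite hs kre_kreal => -[|p []]; first lra.
rewrite glineE => -> /= e v0 hp h; split=> //; lra.
Qed.

Lemma gline_geodesic X Y eta : ldata X Y eta -> geodesic (gline X Y).
Proof.
move=> l; split=> [t|s t]; first by case: (gline_lift t l).
have [_ es s0 _ _] := gline_lift s l; have [_ et t0 _ _] := gline_lift t l.
have [_ _ _ e0] := l.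
have -> : hdist (gline X Y s) (gline X Y t) =
    kap * acosh (ratio (glift X Y s) (glift X Y t)).
  by rewrite es et (ratio_rsc _ _ s0 t0).
rewrite /ratio.
rewrite (hform_glift_self s l) (hform_glift_self t l) (hform_glift s t l).
have a0 : 0 < ex s / ex t by rewrite divr_gt0.
have -> : knorm (kreal k (- 2 * eta)) = 2 * eta.
  by rewrite knorm_kreal mulNr normrN ger0_norm // mulr_ge0 // ltW.
have -> : knorm (kreal k (- eta * (ex s / ex t + (ex s / ex t)^-1))) =
   eta * (ex s / ex t + (ex s / ex t)^-1).
  rewrite knorm_kreal mulNr normrN ger0_norm // mulr_ge0 ?(ltW e0) //.
  by rewrite addr_ge0 ?invr_ge0 ?(ltW a0).
rewrite -expr2 sqrtr_sqr ger0_norm ?mulr_ge0 ?(ltW e0) //.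
have e2 : eta * (ex s / ex t + (ex s / ex t)^-1) / (2 * eta) =
  (ex s / ex t + (ex s / ex t)^-1) / 2.
  by move: (_ + _) => w; field; rewrite gt_eqF.
rewrite e2 acosh_avg // -exB ln_ex normrM normfV (gtr0_norm kap_gt0).
by rewrite mulrC divfK // gt_eqF ?kap_gt0.
Qed.

Lemma gline_mob g X Y eta : ldata X Y eta ->
  ldata (umx (repr g) *m X) (umx (repr g) *m Y) eta /\
  (fun t => mob g (gline X Y t)) = gline (umx (repr g) *m X) (umx (repr g) *m Y).
Proof.
move=> l; split; first by case: l => *; split; rewrite ?hform_umx.
apply/funext => t; have [ed e v0 hp _] := gline_lift t l.
rewrite [RHS]glineE.
have -> : glift (umx (repr g) *m X) (umx (repr g) *m Y) t =
    umx (repr g) *m glift X Y t by rewrite /glift mulmxDr !mul_rsc.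
by rewrite e mul_rsc dehomog_rsc.
Qed.

Lemma gline_shift X Y s eta : ldata X Y eta ->
  ldata (rsc X (kreal k (ex s))) (rsc Y (kreal k (ex s)^-1)) eta /\
  (fun t => gline X Y (t + s)) =
  gline (rsc X (kreal k (ex s))) (rsc Y (kreal k (ex s)^-1)).
Proof.
move=> [hX hY hXY e0]; split.
  split=> //; rewrite hformZl hformZr ?hX ?hY ?mul0r ?mulr0 // hXY kconj_kreal !krealM.
  by congr kreal; field.
apply/funext => t; rewrite !glineE; apply: (congr1 (fun v => odflt 0 (@dehomog R k n v))).
rewrite /glift !rscA !krealM.
by rewrite exD invfM [ex t * ex s]mulrC [(ex t)^-1 * _]mulrC.
Qed.

Lemma gline_rsc X Y c eta : c != 0 -> ldata X Y eta ->
  ldata (rsc X c) (rsc Y c) (eta * knsq c) /\ gline (rsc X c) (rsc Y c) = gline X Y.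
Proof.
move=> c0 [hX hY hXY e0]; split.
  split=> //; rewrite ?hformZl ?hformZr ?hX ?hY ?mul0r ?mulr0 //.
    rewrite hXY kreal_central mulrA kconj_mul krealM; congr kreal; ring.
  by rewrite mulr_gt0 // -knorm_sqr exprn_gt0 // knorm_gt0.
apply/funext => t; rewrite !glineE; apply: (congr1 (odflt 0)).
rewrite -(dehomog_rsc (glift X Y t) c0); apply: (congr1 (@dehomog R k n)).
by rewrite /glift rscDl !rscA !(kreal_central _ c).
Qed.

(** Solving the orthogonality relation for [vc2 u] exhibits the form on the orthogonal complement of
    [phi p] as a sum of squares: the form has a single negative direction. *)
Lemma perp_pos p u : in_H p -> hform (phi p) u = 0 ->
  kre (hform u u) = normsq (vc1 u - rsc (kreal k (Num.sqrt 2) *: p.1) (vc0 u))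
    + 2 * ht p * knsq (vc0 u).
Proof.
move=> hp; rewrite hformE !(vc_phi p) kconj1 mul1r => h.
have e2 : vc2 u = hdot (kreal k (Num.sqrt 2) *: p.1) (vc1 u) -
   kconj (p.2 + kreal k (normsq p.1)) * vc0 u.
  by apply/eqP; rewrite -subr_eq0 -oppr_eq0 opprB -[X in _ == X]h addrAC.
rewrite kre_hform e2 normsqB normsqZ krscC normsqZ knsq_kreal sqr_sqrtr ?ler0n //.
rewrite hdotZl !hdotZr kconj_kreal -(hdot_conj (vc1 u)) /ht.
move: (vc0 u) (hdot (vc1 u) p.1) (normsq (vc1 u)) (normsq p.1) (p.2) => c d A B w.
by move: (Num.sqrt 2) => r2; kcomp; ring.
Qed.
Lemma perp_ge0 p u : in_H p -> hform (phi p) u = 0 -> 0 <= kre (hform u u).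
Proof.
move=> hp h; rewrite (perp_pos hp h) addr_ge0 ?normsq_ge0 //.
by rewrite !mulr_ge0 ?knsq_ge0 // ltW.
Qed.
Lemma perp_eq0 p u : in_H p -> hform (phi p) u = 0 -> kre (hform u u) = 0 -> u = 0.
Proof.
move=> hp h; rewrite (perp_pos hp h) => /eqP.
rewrite paddr_eq0 ?normsq_ge0 ?mulr_ge0 ?knsq_ge0 //; last exact: ltW.
move=> /andP[/eqP/normsq_eq0 e1].
rewrite mulf_eq0 gt_eqF ?mulr_gt0 //= knsq_eq0 => /eqP e0.
move: e1; rewrite e0 rsc0 subr0 => e1.
move: h; rewrite hformE e0 e1 hdot0r mulr0 subr0 sub0r (vc_phi p).1.1 kconj1 mul1r.
move=> /eqP; rewrite oppr_eq0 => /eqP e2.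
by apply: vec_inj; rewrite ?e0 ?e1 ?e2 -(rsc0 u) !vcE ?mulr0 ?rsc0.
Qed.
Lemma perp_CS p u v : in_H p -> hform (phi p) u = 0 -> hform (phi p) v = 0 ->
  knsq (hform u v) <= kre (hform u u) * kre (hform v v).
Proof.
move=> hp hu hv; have u0 := perp_ge0 hp hu; have v0 := perp_ge0 hp hv.
have [e|ne] := eqVneq (kre (hform u u)) 0.
  by rewrite e mul0r (perp_eq0 hp hu e) -hform_conj hform0r kconj0 knsq0.
have A0 : 0 < kre (hform u u) by rewrite lt_def ne.
have hw : hform (phi p) (rsc v (kreal k (kre (hform u u))) - rsc u (hform u v)) = 0.
  by rewrite hformBr !hformZr hu hv !mul0r subr0.
have := perp_ge0 hp hw; rewrite hformBr !hformBl !hformZl !hformZr kconj_kreal.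
rewrite (hform_selfE u) (hform_selfE v) -(hform_conj u v) !kre_kreal.
move: A0; move: (kre (hform u u)) (kre (hform v v)) (hform u v) => A B c A0 h.
rewrite -subr_ge0 -(pmulr_rge0 _ A0); move: h; congr (_ <= _); kcomp; ring.
Qed.
End Hyperbolic.

(** * Isometric embeddings of the line are lines of the Hermitian model *)

Section Classification.
Context {R : realType} {k : scalars} {n : nat}.
Local Notation K := (scalar R k).
Local Notation G := (PUJ R k n).
Local Notation V := 'cV[K]_(1 + (n + 1)).
Local Notation ex := (@ex R k).
Implicit Types (u v w X Y e : V) (c d : K) (g h : G) (p q : kpoint R k n)
  (x y : xkpoint R k n) (a b s t eta : R)
  (gam : R -> kpoint R k n).

Definition ch t : R := (ex t + (ex t)^-1) / 2.
Definition sh t : R := (ex t - (ex t)^-1) / 2.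
Lemma ch_gt0 t : 0 < ch t.
Proof. by rewrite /ch divr_gt0 // addr_gt0 ?invr_gt0 ?ex_gt0. Qed.
Lemma ch_sqr t : ch t ^+ 2 = 1 + sh t ^+ 2.
Proof. by rewrite /ch /sh; field; rewrite ex_neq0. Qed.
Lemma chB s t : ch (s - t) = ch s * ch t - sh s * sh t.
Proof. by rewrite /ch /sh exB; field; rewrite !ex_neq0. Qed.
Lemma ch0 : ch 0 = 1. Proof. by rewrite /ch ex0; field. Qed.
Lemma sh0 : sh 0 = 0. Proof. by rewrite /sh ex0; field. Qed.
Lemma ch_norm t : ch `|t| = ch t.
Proof.
rewrite /ch; case: (ger0P t) => _ //; rewrite exN invrK addrC //.
Qed.
Lemma sh_neq0 t : t != 0 -> sh t != 0.
Proof.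
move=> t0; have h : ex t != ex (- t).
  apply: contra_neq t0 => h; have := ln_ex (k := k) t; rewrite h ln_ex mulNr.
  move=> e; have : t / kap R k = 0 by lra.
  by move/eqP; rewrite mulf_eq0 invr_eq0 (gt_eqF (@kap_gt0 R k)) orbF => /eqP.
by rewrite /sh mulf_neq0 ?invr_eq0 ?pnatr_eq0 // subr_eq0 -exN.
Qed.

Lemma hdist_ratio gam s t : geodesic gam ->
  ratio (phi (gam s)) (phi (gam t)) = ch (s - t).
Proof.
move=> [hH hd]; rewrite -ch_norm -hd hdistE.
have r1 := ratio_ge1 (hH s) (hH t).
have := hd s t; rewrite hdistE => e.
rewrite {1}(acosh_inv r1 erefl) /ch /ex mulrAC divff ?mul1r //.
by rewrite gt_eqF // kap_gt0.
Qed.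

(** The equation says [N = m^2 + 2 D (x - m)]. Then [N <= m^2] gives [x <= m], and [x^2 <= N] gives
    [(m - x) (2 D - x - m) <= 0], where the second factor is positive. *)
Lemma CS_equality (D m x N : R) : `|m| < D -> N <= m ^+ 2 -> x ^+ 2 <= N ->
  D ^+ 2 - 2 * D * x + N = (D - m) ^+ 2 -> x = m :> R.
Proof.
rewrite ltr_norml => /andP[m1 m2] hN hx e.
have eN : N = m ^+ 2 + 2 * D * (x - m) by move: e; rewrite sqrrB; lra.
have D0 : 0 < D by lra.
have xm : x <= m.
  rewrite -subr_le0 -(pmulr_rle0 _ D0); move: hN; rewrite eN; lra.
have h : (m - x) * (2 * D - (x + m)) <= 0.
  by move: hx; rewrite eN; lra.
apply/eqP; rewrite -subr_eq0 -oppr_eq0 opprB; apply/eqP.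
move: h; rewrite pmulr_lle0; last lra.
by lra.
Qed.

(** A direction at [p]: orthogonal to [phi p] and of opposite square, so that [phi p + e] and
    [phi p - e] are null and lift the two endpoints. *)
Definition pedata p e :=
  [/\ in_H p, hform (phi p) e = 0 & hform e e = kreal k (2 * ht p)].
Definition peX p e : V := rsc (phi p + e) (kreal k 2^-1).
Definition peY p e : V := rsc (phi p - e) (kreal k 2^-1).
Definition pel p e : R -> kpoint R k n := gline (peX p e) (peY p e).

Lemma pe_ldata p e : pedata p e -> ldata (peX p e) (peY p e) (ht p).
Proof.
move=> [hp hpe he]; have hep : hform e (phi p) = 0 by rewrite -hform_conj hpe kconj0.
split=> //; rewrite hformZl hformZr kconj_kreal.
- rewrite hformDl !hformDr hpe hep he hform_phi_self add0r addr0 -krealD.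
  by rewrite !krealM; rewrite -kreal0; congr kreal; rewrite /ht; ring.
- rewrite hformBl !hformBr hpe hep he hform_phi_self sub0r subr0 opprK -krealD.
  by rewrite !krealM; rewrite -kreal0; congr kreal; rewrite /ht; ring.
rewrite hformDl !hformBr hpe hep he hform_phi_self sub0r subr0 -krealB.
by rewrite !krealM; congr kreal; rewrite /ht; field.
Qed.
Lemma rscBr m (v : 'cV[K]_m) c d : rsc v (c - d) = rsc v c - rsc v d.
Proof. by rewrite rscDr rscNr. Qed.
Lemma pe_glift p e t :
  glift (peX p e) (peY p e) t = rsc (phi p) (kreal k (ch t)) + rsc e (kreal k (sh t)).
Proof.
rewrite /glift /peX /peY !rscA !krealM rscDl rscBl addrACA -rscDr -rscBr.
by rewrite -krealD -krealB /ch /sh; congr (rsc _ (kreal k _) + rsc _ (kreal k _)); ring.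
Qed.

Lemma rsc_half m (v : 'cV[K]_m) : rsc (v + v) (kreal k 2^-1) = v.
Proof.
rewrite -[v in v + v]rsc1 -rscDr -kreal1 -krealD rscA krealM mulfV ?pnatr_eq0 //.
by rewrite kreal1 rsc1.
Qed.

Section PerpComponent.
Variables (p : kpoint R k n) (H : R).
Hypotheses (hp : in_H p) (H0 : 0 < H) (hPP : hform (phi p) (phi p) = kreal k (- H)).

Lemma perp_hform u v a b : hform (phi p) u = kreal k (- (H * a)) ->
  hform (phi p) v = kreal k (- (H * b)) ->
  hform (u - rsc (phi p) (kreal k a)) (v - rsc (phi p) (kreal k b)) =
  hform u v + kreal k (H * (a * b)).
Proof.
move=> hu hv; rewrite hformBl !hformBr !hformZl !hformZr -(hform_conj (phi p) u).
rewrite hu hv hPP !kconj_kreal !krealM.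
by move: (hform u v) => c; apply: kext; kcomp; ring.
Qed.
Lemma perp_comp u a : hform (phi p) u = kreal k (- (H * a)) ->
  hform (phi p) (u - rsc (phi p) (kreal k a)) = 0.
Proof. by move=> hu; rewrite hformBr hformZr hu hPP krealM mulNr subrr. Qed.
Lemma perp_comp_self u a b : a ^+ 2 = 1 + b ^+ 2 ->
  hform (phi p) u = kreal k (- (H * a)) -> hform u u = kreal k (- H) ->
  kre (hform (u - rsc (phi p) (kreal k a)) (u - rsc (phi p) (kreal k a))) = H * b ^+ 2.
Proof.
move=> e hu huu; rewrite perp_hform // huu -krealD kre_kreal -expr2 e; ring.
Qed.
(** Here [u] and [v] lift two points whose distances from [p] have hyperbolic cosines [a], [c] and
    sines [b], [d]. Their prescribed mutual distance turns Cauchy-Schwarz in the complement of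
    [phi p] into an equality, through [CS_equality]. *)
Lemma perp_comp_key u v a b (c d : R) :
  a ^+ 2 = 1 + b ^+ 2 -> c ^+ 2 = 1 + d ^+ 2 -> 0 < a -> 0 < c ->
  hform (phi p) u = kreal k (- (H * a)) -> hform u u = kreal k (- H) ->
  hform (phi p) v = kreal k (- (H * c)) -> hform v v = kreal k (- H) ->
  knsq (hform u v) = (a * c - b * d) ^+ 2 * (H * H) ->
  kre (hform (u - rsc (phi p) (kreal k a)) (v - rsc (phi p) (kreal k c))) = H * (b * d).
Proof.
move=> eab ecd a0 c0 hu huu hv hvv nB.
have CS := perp_CS hp (perp_comp hu) (perp_comp hv).
rewrite (perp_comp_self eab hu huu) (perp_comp_self ecd hv hvv) in CS.
have eE := perp_hform hu hv.
move: CS eE; move: (hform (u - _) _) => x CS eE.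
have {}nB : knsq (x - kreal k (H * (a * c))) = (a * c - b * d) ^+ 2 * (H * H).
  by rewrite eE addrK.
apply: (@CS_equality (H * (a * c)) _ _ (knsq x)).
- rewrite normrM (gtr0_norm H0) ltr_pM2l // -[ltRHS]gtr0_norm ?mulr_gt0 //.
  rewrite -(@ltr_pXn2r _ 2) ?nnegrE // !real_normK ?num_real // !exprMn eab ecd.
  by have := sqr_ge0 b; have := sqr_ge0 d; nra.
- by apply: le_trans CS _; rewrite le_eqVlt; apply/orP; left; apply/eqP; ring.
- exact: kre_sqr_le.
- transitivity ((a * c - b * d) ^+ 2 * (H * H)); last ring.
  by rewrite -nB; move: x {CS eE nB} => x; kcomp; ring.
Qed.
End PerpComponent.

(** Normalised lifts [B t] of [gam t] have components [E t] orthogonal to [phi p] whose mutual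
    products are those of [sh t] times a fixed vector. In a positive definite space this forces
    [E t] to be such a multiple. *)
Lemma geodesic_pel gam : geodesic gam ->
  exists e, pedata (gam 0) e /\ gam = pel (gam 0) e.
Proof.
move=> gg; have [hH _] := gg; set p := gam 0; have hp : in_H p := hH 0.
have [H eH] : exists H, H = 2 * ht p by exists (2 * ht p).
have H0 : 0 < H by rewrite eH mulr_gt0.
have hPP : hform (phi p) (phi p) = kreal k (- H).
  by rewrite hform_phi_self; congr kreal; rewrite eH mulNr.
have ratioE u v A B : hform u u = kreal k (- A) -> hform v v = kreal k (- B) ->
    0 < A -> 0 < B -> knsq (hform u v) = ratio u v ^+ 2 * (A * B).
  move=> eA eB A0 B0; rewrite /ratio eA eB !knorm_kreal !normrN !gtr0_norm //.
  have AB : 0 < A * B by rewrite mulr_gt0.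
  rewrite exprMn exprVn knorm_sqr sqr_sqrtr ?(ltW AB) // mulfVK //.
  by rewrite gt_eqF.
have /choice[B hB] : forall t, exists v, [/\ dehomog v = Some (gam t),
    exists2 c, c != 0 & v = rsc (phi (gam t)) c,
    hform (phi p) v = kreal k (- (H * ch t)) & hform v v = kreal k (- H)].
  move=> t; set q := gam t; have hq : in_H q := hH t.
  have hQ : hform (phi q) (phi q) = kreal k (- (2 * ht q)).
    by rewrite hform_phi_self; congr kreal; rewrite mulNr.
  have q0 : 0 < 2 * ht q by rewrite mulr_gt0.
  have nD := ratioE _ _ _ _ hPP hQ H0 q0.
  rewrite hdist_ratio // sub0r in nD.
  have chN : ch (- t) = ch t by rewrite -ch_norm normrN ch_norm.
  rewrite chN in nD.
  set D := hform _ _ in nD; have c0 := ch_gt0 t.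
  have D0 : D != 0.
    have D2 : 0 < knsq D by rewrite nD; exact: mulr_gt0 (exprn_gt0 2 c0) (mulr_gt0 H0 q0).
    by rewrite -knsq_eq0 (gt_eqF D2).
  (* This scalar gives the lift of [gam t] the required pairing with [phi p]. By the distance
     equation [nD] its square is then [- H] as well. *)
  pose c := kinv D * kreal k (- (H * ch t)).
  have n3 : H * ch t != 0 by rewrite gt_eqF // mulr_gt0.
  have h3 : kreal k (- (H * ch t)) != 0.
    by rewrite -knorm_gt0 knorm_kreal normrN normr_gt0.
  have hc : c != 0 by exact: kmulf_neq0 (kinv_neq0 D0) h3.
  exists (rsc (phi q) c); split.
  - by rewrite dehomog_rsc // -homog_some dehomog_homog.
  - by exists c.
  - by rewrite hformZr -/D /c mulrA kmulVr // mul1r.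
  - rewrite hformZl hformZr hQ kreal_central mulrA kconj_mul krealM.
    apply: (congr1 (kreal k)); rewrite /c knsqM knsq_kinv knsq_kreal nD; field.
    by rewrite !gt_eqF.
have [E eqE] : exists E : R -> V, forall t, E t = B t - rsc (phi p) (kreal k (ch t)).
  by exists (fun t => B t - rsc (phi p) (kreal k (ch t))).
have hPE t : hform (phi p) (E t) = 0.
  by have [_ _ h _] := hB t; rewrite eqE; exact: perp_comp hPP _ _ h.
have key s t : kre (hform (E s) (E t)) = H * (sh s * sh t).
  have [_ [c c0 ec] h1 h2] := hB s; have [_ [d d0 ed] h3 h4] := hB t.
  rewrite !eqE; apply: (perp_comp_key hp H0 hPP) => //; rewrite ?ch_sqr ?ch_gt0 //.
  rewrite (ratioE _ _ _ _ h2 h4 H0 H0) -chB -(hdist_ratio s t gg).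
  by rewrite ec ed (ratio_rsc _ _ c0 d0).
have s1 : sh 1 != 0 by rewrite sh_neq0 ?oner_eq0.
pose e := rsc (E 1) (kreal k (sh 1)^-1).
have hPe : hform (phi p) e = 0 by rewrite /e hformZr hPE mul0r.
have eE t : E t = rsc e (kreal k (sh t)).
  (* By [key] the difference has square 0, and the complement of [phi p] is positive definite. *)
  apply/eqP; rewrite -subr_eq0; apply/eqP; apply: (perp_eq0 hp).
    by rewrite hformBr hformZr hPE hPe mul0r subr0.
  rewrite /e rscA krealM hformBl !hformBr !hformZl !hformZr !kconj_kreal !kreB.
  by rewrite !kreZl !kreZr !key; field.
have he : hform e e = kreal k H.
  rewrite hform_selfE; congr kreal.
  by rewrite /e hformZl hformZr kconj_kreal kreZl kreZr key; field.
have pe : pedata p e by split; rewrite -?eH.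
exists e; split=> //; apply/funext => t; rewrite /pel glineE pe_glift -eE eqE.
have [hd _ _ _] := hB t.
by rewrite addrC subrK hd.
Qed.
End Classification.

(** * Forward ends of geodesic lines *)

Section Ends.
Context {R : realType} {k : scalars} {n : nat}.
Local Notation K := (scalar R k).
Local Notation G := (PUJ R k n).
Local Notation V := 'cV[K]_(1 + (n + 1)).
Local Notation ex := (@ex R k).
Implicit Types (u v w X Y e : V) (c d : K) (g h : G) (p q : kpoint R k n)
  (x y : xkpoint R k n) (a b s t eta : R) (gam : R -> kpoint R k n).

(** The sum of squares of [perp_pos], with the pairing against [phi p] kept as an additional term.
    It also serves for [p] on the boundary. *)
Lemma hform_decomp p u :
  kre (hform u u) = normsq (vc1 u - rsc (kreal k (Num.sqrt 2) *: p.1) (vc0 u))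
    + 2 * ht p * knsq (vc0 u) + 2 * kre (kconj (vc0 u) * hform (phi p) u).
Proof.
have [D eD] : exists D, hform (phi p) u = D by exists (hform (phi p) u).
rewrite eD.
have e2 : vc2 u = hdot (kreal k (Num.sqrt 2) *: p.1) (vc1 u) -
   kconj (p.2 + kreal k (normsq p.1)) * vc0 u - D.
  rewrite -eD hformE !(vc_phi p) kconj1 mul1r.
  move: (hdot _ _) (kconj _ * _) (vc2 u) => A B C.
  by apply: kext; kcomp; ring.
rewrite kre_hform e2 normsqB normsqZ krscC normsqZ knsq_kreal sqr_sqrtr ?ler0n //.
rewrite hdotZl !hdotZr kconj_kreal -(hdot_conj (vc1 u)) /ht.
move: D {eD e2} (vc0 u) (hdot (vc1 u) p.1) (normsq (vc1 u)) (normsq p.1) (p.2) => D c d A B w.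
by move: (Num.sqrt 2) => r2; kcomp; ring.
Qed.

Lemma null_in_X p : hform (phi p) (phi p) = 0 -> in_X p.
Proof.
rewrite hform_phi_self -kreal0 => /kreal_inj/eqP.
by rewrite mulNr oppr_eq0 mulf_eq0 pnatr_eq0 /= => /eqP.
Qed.

Lemma ldata_end X Y eta : ldata X Y eta ->
  exists x Y' eta', [/\ dehomog X = x, ldata (homog x) Y' eta',
    gline X Y = gline (homog x) Y' & if x is Some q then in_X q else True].
Proof.
move=> l; have [hX hY hXY e0] := l.
have X0 : X != 0.
  apply/eqP => eX; move: hXY; rewrite eX -hform_conj hform0r kconj0 -kreal0.
  by move/kreal_inj/eqP; rewrite eq_sym oppr_eq0 gt_eqF.
have hX' : kre (hform X X) <= 0 by rewrite hX kre0.
have [c [eX nc n0]] := homog_dehomog X0 hX'.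
have c0 : c != 0 by rewrite -knorm_gt0 nc.
have [l' eg] := gline_rsc (kinv_neq0 c0) l.
move: eX l' eg; move: (dehomog X) => x eX l' eg.
have eX' : rsc X (kinv c) = homog x by rewrite eX rscA kmulVr ?rsc1.
rewrite eX' in l' eg.
exists x, (rsc Y (kinv c)), (eta * knsq (kinv c)); split; [by []|exact: l'|exact: esym|].
by case: x l' {eX eX' eg} => // q [] /null_in_X.
Qed.

Section FiniteEnd.
Variables (q : kpoint R k n) (Y : V) (eta : R).
Hypotheses (l : ldata (phi q) Y eta).
Let a := kre (vc0 Y).
Let b := knsq (vc0 Y).

Lemma end_in_X : in_X q. Proof. by case: l => /null_in_X. Qed.
(** For the null vector [Y], the decomposition at the boundary point [q] equates a square norm with
    [2 * eta * a]. *)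
Lemma end_re_ge0 : 0 <= a.
Proof.
have [_ hY hXY e0] := l.
have := hform_decomp q Y; rewrite hY hXY kre0 kreMC kreZl kre_conj.
have -> : ht q = 0 by exact: end_in_X.
move=> h; have := normsq_ge0 (vc1 Y - rsc (kreal k (Num.sqrt 2) *: q.1) (vc0 Y)).
have : normsq (vc1 Y - rsc (kreal k (Num.sqrt 2) *: q.1) (vc0 Y)) = 2 * eta * a.
  by rewrite /a; move: h; rewrite mulr0 mul0r addr0; lra.
by move=> ->; rewrite pmulr_rge0 // mulr_gt0.
Qed.

Definition vden s : R := s ^+ 2 + 2 * a + b / s ^+ 2.
Lemma vc0_glift t :
  knsq (vc0 (glift (phi q) Y t)) = vden (ex t).
Proof.
rewrite /glift vc0D !vc0Z (vc_phi q).1.1 mul1r knsqD knsqM !knsq_kreal kconj_kreal.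
rewrite kreZl kreZr /vden -/a -/b; field; exact: ex_neq0.
Qed.
Lemma vden_ge s : s ^+ 2 <= vden s.
Proof.
have h1 := end_re_ge0; have h2 : 0 <= b / s ^+ 2.
  by rewrite divr_ge0 ?sqr_ge0 // knsq_ge0.
by rewrite /vden; lra.
Qed.
Lemma ht_gline t : ht (gline (phi q) Y t) * vden (ex t) = eta.
Proof. by have [_ _ _ _] := gline_lift t l; rewrite vc0_glift. Qed.

Lemma pr_end t : pr (Some q) (Some (gline (phi q) Y t)) ^+ 2 * (vden (ex t) * ex t ^+ 2)
  = eta ^+ 2.
Proof.
have [_ eL _ _ _] := gline_lift t l; have [hX _ hXY _] := l.
have : hform (phi q) (glift (phi q) Y t) = kreal k (- eta / ex t).
  by rewrite /glift hformDr !hformZr hX hXY mul0r add0r krealM.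
rewrite eL hformZr => /(congr1 (@knsq R k)).
rewrite knsqM vc0_glift knsq_kreal pr_phi knorm_sqr mulrA => ->.
by field; exact: ex_neq0.
Qed.
Lemma pr_end_le t : pr (Some q) (Some (gline (phi q) Y t)) * ex t ^+ 2 <= eta.
Proof.
have e0 : 0 < eta by case: l.
have p0 := pr_ge0 (Some q) (Some (gline (phi q) Y t)).
have := pr_end t; have := vden_ge (ex t); have := exprn_gt0 2 (ex_gt0 (k := k) t).
move: (vden _) (ex t ^+ 2) p0 => D E; move: (pr _ _) => P P0 E0 DE h.
rewrite -(@ler_pXn2r _ 2) ?nnegrE ?mulr_ge0 ?(ltW e0) ?(ltW E0) //.
rewrite exprMn -h ler_wpM2l ?sqr_ge0 // expr2 ler_wpM2r // ltW //.
Qed.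
End FiniteEnd.

Lemma enormsq_ge0 p : 0 <= enormsq p.
Proof. by rewrite addr_ge0 ?normsq_ge0 ?sqr_ge0. Qed.
Lemma enormsq_triangle p q : enormsq (p + q) <= 2 * enormsq p + 2 * enormsq q.
Proof.
rewrite /enormsq /= !knorm_sqr.
have := normsq_ge0 (p.1 - q.1); rewrite normsqB normsqD knsqD.
have := knsq_ge0 (p.2 - q.2); rewrite knsqD knsqN.
rewrite mulrN kreN; lra.
Qed.
Lemma enormsq_eq0 p : enormsq p = 0 -> p = 0.
Proof.
rewrite /enormsq => /eqP; rewrite paddr_eq0 ?normsq_ge0 ?sqr_ge0 //.
rewrite knorm_sqr knsq_eq0 => /andP[/eqP/normsq_eq0 e1 /eqP e2].
by case: p e1 e2 => z w /= -> ->.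
Qed.
Lemma enormsqN p : enormsq (- p) = enormsq p.
Proof. by rewrite /enormsq /= normsqN knormN. Qed.

(** Ends are defined by Euclidean convergence, while the computations control [pr]. This converts
    decay of the one into decay of the other. *)
Lemma enormsq_pr p q : in_X q -> good (Some p) ->
  Num.sqrt (enormsq (p - q)) <= Num.sqrt (pr (Some q) (Some p)) *
    (1 + 2 * Num.sqrt (normsq q.1)) + 2 * pr (Some q) (Some p).
Proof.
move=> hq hp; have gq := in_X_good hq.
have h1 := pr_normsq gq hp.
have hq' := kconj_im (hq : kre q.2 = 0).
have e : p.2 - q.2 = - hform (phi q) (phi p) - kreal k (normsq (q.1 - p.1))
    + kim (hdot q.1 (p.1 - q.1)) *+ 2.
  rewrite hform_phi normsqB hdotBr kimB hdot_normsq kim_kreal subr0 kconjD hq'.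
  move: (hdot q.1 p.1) (normsq q.1) (normsq p.1) (p.2) (q.2) => *.
  by rewrite !mulr2n kconj_kreal; apply: kext; kcomp; ring.
set P := pr _ _ in h1 *; have P0 : 0 <= P := pr_ge0 _ _.
set S := Num.sqrt P; set N := Num.sqrt (normsq q.1).
have S0 : 0 <= S := sqrtr_ge0 _; have N0 : 0 <= N := sqrtr_ge0 _.
have S2 : S ^+ 2 = P by rewrite sqr_sqrtr.
have h2 : knorm (p.2 - q.2) <= 2 * P + 2 * (N * S).
  have h3 : knorm (kim (hdot q.1 (p.1 - q.1))) <= N * S.
    apply: le_trans (kim_le _) _; apply: le_trans (hdot_norm _ _) _.
    apply: ler_wpM2l => //; apply: ler_wsqrtr; rewrite normsqBC; exact: h1.
  rewrite e mulr2n; apply: le_trans (knorm_triangle _ _) _.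
  have := knorm_triangle (kim (hdot q.1 (p.1 - q.1))) (kim (hdot q.1 (p.1 - q.1))).
  have := knorm_triangleB (- hform (phi q) (phi p)) (kreal k (normsq (q.1 - p.1))).
  rewrite knormN knorm_kreal (ger0_norm (normsq_ge0 _)) -pr_phi -/P.
  lra.
have T0 : 0 <= S * (1 + 2 * N) + 2 * P.
  by rewrite addr_ge0 ?mulr_ge0 // addr_ge0 // mulr_ge0.
rewrite -[leRHS]ger0_norm // -sqrtr_sqr; apply: ler_wsqrtr.
rewrite /enormsq /= normsqBC.
apply: (@le_trans _ _ (P + (2 * P + 2 * (N * S)) ^+ 2)).
  by apply: lerD => //; rewrite ler_pXn2r ?nnegrE ?knorm_ge0 // (le_trans (knorm_ge0 _) h2).
have NS : 0 <= N * S by rewrite mulr_ge0.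
by rewrite -S2; nra.
Qed.
End Ends.

Section EndsAt.
Context {R : realType} {k : scalars} {n : nat}.
Local Notation K := (scalar R k).
Local Notation V := 'cV[K]_(1 + (n + 1)).
Local Notation ex := (@ex R k).
Implicit Types (X Y : V) (p q : kpoint R k n) (gam : R -> kpoint R k n) (t eta : R).

Lemma ex_lin t : 0 <= t -> t / 2 <= ex t.
Proof.
move=> t0; have h : t / 2 <= t / kap R k.
  by rewrite ler_wpM2l // lef_pV2 ?posrE ?kap_gt0 ?kap_le2.
apply: le_trans h _; rewrite /ex; have := expR_ge1Dx (t / kap R k); lra.
Qed.

Lemma pinfty_witness (P Q : R -> Prop) :
  (\forall t \near +oo, P t) -> (\forall t \near +oo, Q t) ->
  (exists M, forall t, M < t -> P t /\ Q t).
Proof.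
move=> [A [_ hA]] [B [_ hB]]; exists (Num.max A B) => t; rewrite gt_max => /andP[h1 h2].
by split; [exact: hA | exact: hB].
Qed.

Lemma above2 (M A : R) : exists t, M < t /\ A <= t.
Proof.
by exists (`|M| + `|A| + 1); have := ler_norm M; have := ler_norm A;
  have := normr_ge0 M; have := normr_ge0 A; split; lra.
Qed.
Lemma ends_at_near gam p eps : 0 < eps -> ends_at gam (Some p) ->
  \forall t \near +oo, enormsq (gam t - p) < eps.
Proof.
move=> e0 /cvgrPdist_lt /(_ (Num.sqrt eps)); rewrite sqrtr_gt0 => /(_ e0).
apply: filterS => t; rewrite sub0r normrN ger0_norm ?sqrtr_ge0 //.
by rewrite ltr_sqrt.
Qed.

Lemma ends_at_unique gam p q : ends_at gam (Some p) -> ends_at gam (Some q) -> p = q.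
Proof.
move=> hp hq; apply/eqP; rewrite -subr_eq0; apply/eqP/enormsq_eq0.
apply: le_anti; rewrite enormsq_ge0 andbT; apply/ler_addgt0Pr => e e0; rewrite add0r.
have e4 : 0 < e / 4 by rewrite divr_gt0.
have [M hM] := pinfty_witness (ends_at_near e4 hp) (ends_at_near e4 hq).
have [h1 h2] : enormsq (gam (M + 1) - p) < e / 4 /\ enormsq (gam (M + 1) - q) < e / 4.
  by apply: hM; rewrite ltrDl.
have -> : p - q = (gam (M + 1) - q) + - (gam (M + 1) - p).
  by rewrite opprB [RHS]addrC addrA subrK.
apply: le_trans (enormsq_triangle _ _) _; rewrite enormsqN; lra.
Qed.

Lemma finite_end q Y eta : ldata (phi q) Y eta ->
  ends_at (gline (phi q) Y) (Some q) /\ ~ ends_at (gline (phi q) Y) None.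
Proof.
move=> l; have [_ _ _ eta0] := l; have hq := end_in_X l.
have hg t : good (Some (gline (phi q) Y t)).
  by have [_ _ _ /in_H_good] := gline_lift t l.
have P0 t := pr_ge0 (Some q) (Some (gline (phi q) Y t)).
(* From [pr_end_le] and [t / 2 <= ex t]. The decay is exponential, but the bound [D / t] is enough
   for convergence. *)
pose D := Num.sqrt eta * 2.
have D0 : 0 < D by rewrite mulr_gt0 // sqrtr_gt0.
have bound t : 0 < t -> Num.sqrt (pr (Some q) (Some (gline (phi q) Y t))) <= D / t.
  move=> t0; have h := pr_end_le l t; have h2 := ex_lin (ltW t0).
  have E0 := ex_gt0 (k := k) t.
  have : pr (Some q) (Some (gline (phi q) Y t)) <= (D / t) ^+ 2.
    rewrite expr_div_n ler_pdivlMr ?exprn_gt0 // /D exprMn sqr_sqrtr ?(ltW eta0) //.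
    have : (t / 2) ^+ 2 <= ex t ^+ 2.
      by rewrite ler_pXn2r ?nnegrE ?(ltW E0) // divr_ge0 // ltW.
    rewrite expr_div_n => h3.
    have h4 : pr (Some q) (Some (gline (phi q) Y t)) * (t ^+ 2 / 2 ^+ 2) <= eta.
      by apply: le_trans h; exact: ler_wpM2l.
    by rewrite -ler_pdivrMr ?exprn_gt0 // -mulrA.
  by move/ler_wsqrtr; rewrite sqrtr_sqr ger0_norm // divr_ge0 ?ltW.
set N := 1 + 2 * Num.sqrt (normsq q.1).
have N0 : 0 < N by rewrite ltr_wpDr // mulr_ge0 // sqrtr_ge0.
split.
  apply/cvgrPdist_lt => e e0; rewrite /ends_at.
  pose M := Num.max D (D * (N + 2) / e).
  exists M; split; first exact: num_real.
  move=> t; rewrite gt_max => /andP[tD te].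
  have t0 : 0 < t by apply: lt_trans tD.
  rewrite sub0r normrN ger0_norm ?sqrtr_ge0 //.
  apply: le_lt_trans (enormsq_pr hq (hg t)) _; rewrite -/N.
  have b := bound t t0; set S := Num.sqrt _ in b *.
  have S0 : 0 <= S := sqrtr_ge0 _.
  have eS : pr (Some q) (Some (gline (phi q) Y t)) = S ^+ 2 by rewrite sqr_sqrtr.
  have D1 : D / t < 1 by rewrite ltr_pdivrMr // mul1r.
  have : D / t * (N + 2) < e.
    by move: te; rewrite ltr_pdivrMr // => te; rewrite mulrAC ltr_pdivrMr // [e * t]mulrC.
  rewrite eS; move: (D / t) b D1 => d b d1 d2; nra.
move=> /cvgryPgt /(_ (D + Num.sqrt (pr (Some q) (Some 0)))) h.
have [M hM] := pinfty_witness h h.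
have [t [Mt t1]] := above2 M 1.
have [h1 _] := hM t Mt; have t0 : 0 < t by lra.
have h2 := pr_triangle (hg t) hq (in_X_good (@in_X0 R k n)).
have e1 := gauge_pr (hg t); have e2 := prC (Some (gline (phi q) Y t)) (Some q).
rewrite -e1 e2 in h2.
have h3 := bound t t0.
have h4 : D / t <= D by rewrite ler_pdivrMr // ler_peMr // ltW.
move: h1; apply/negP; rewrite -leNgt; apply: le_trans h2 _; rewrite lerD2r.
exact: le_trans h3 h4.
Qed.

(** The height is proportional to [ex t ^+ 2], whereas convergence to a finite point would bound
    it. *)
Lemma infinite_end Y eta p : ldata (homog None) Y eta ->
  ~ ends_at (gline (homog None) Y) (Some p).
Proof.
move=> l; have [_ _ hXY eta0] := l.
have eh t : ht (gline (homog None) Y t) * knsq (vc0 Y) = eta * ex t ^+ 2.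
  have [_ _ _ _ <-] := gline_lift t l.
  rewrite /glift vc0D !vc0Z (vc_inf).1.1 mul0r add0r knsqM knsq_kreal.
  by field; exact: ex_neq0.
have b0 := knsq_ge0 (vc0 Y); set b := knsq (vc0 Y) in eh b0.
move=> h; have [M hM] := pinfty_witness (ends_at_near ltr01 h) (ends_at_near ltr01 h).
have [B [B0 Bp]] := above2 0 (ht p + 1).
have [t [Mt t12]] := above2 M (Num.max 2 (2 * (B * b / eta + 1))).
have [t1 t2] : 2 <= t /\ 2 * (B * b / eta + 1) <= t.
  by move: t12; rewrite ge_max => /andP.
have [h1 _] := hM t Mt.
have h2 : ht (gline (homog None) Y t) <= B.
  have : kre (gline (homog None) Y t).2 - kre p.2 <= 1.
    apply: le_trans (kre_ler ((gline (homog None) Y t).2 - p.2)) _.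
    rewrite -(@ler_pXn2r _ 2) ?nnegrE ?knorm_ge0 // expr1n.
    by apply: ltW; apply: le_lt_trans h1; rewrite /enormsq lerDr normsq_ge0.
  by move: Bp; rewrite /ht; move: (kre _) (kre _) => *; lra.
have h3 := eh t; have h4 := ex_lin (le_trans (ler0n _ 2) t1).
have h5 : ex t <= ex t ^+ 2.
  have : 1 <= ex t by lra.
  by move: (ex t) => E *; nra.
have h6 : eta * (B * b / eta + 1) <= B * b.
  apply: (@le_trans _ _ (ht (gline (homog None) Y t) * b)); last exact: ler_wpM2r.
  by rewrite h3 ler_pM2l //; lra.
have h7 : eta * (B * b / eta + 1) = B * b + eta by field; rewrite gt_eqF.
by move: h6; rewrite h7 gerDl leNgt eta0.
Qed.

(** For the end oo it suffices to exclude finite limits: [xget] then returns [None], either as a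
    limit or as its default. *)
Lemma forward_end_gline X Y eta : ldata X Y eta -> forward_end (gline X Y) = dehomog X.
Proof.
move=> /ldata_end[x [Y' [eta' [-> l -> _]]]]; rewrite /forward_end.
case: x l => [q|] l.
  have [h1 h2] := finite_end l; case: xgetP => [[p|] _ hp|/(_ (Some q))//].
    by rewrite (ends_at_unique hp h1).
  by case: (h2 hp).
by case: xgetP => // -[p|//] _ /(infinite_end l).
Qed.
End EndsAt.

(** * Initial tangent vectors determine geodesics *)

Section Tangents.
Context {R : realType} {k : scalars} {n : nat}.
Local Notation K := (scalar R k).
Local Notation V := 'cV[K]_(1 + (n + 1)).
Local Notation ex := (@ex R k).
Local Notation ch := (@ch R k).
Local Notation sh := (@sh R k).
Implicit Types (e : V) (p : kpoint R k n) (t : R) (gam : R -> kpoint R k n).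

Definition cK : R := (kap R k)^-1.
Lemma cK_gt0 : 0 < cK. Proof. by rewrite invr_gt0 kap_gt0. Qed.

Lemma is_derive_ex (x : R) : is_derive x 1 ex (cK * ex x).
Proof.
have h : is_derive x 1 (fun t : R => t / kap R k) cK.
  have -> : (fun t : R => t / kap R k) = cK \*: (@id R).
    by apply/funext => t /=; rewrite mulrC.
  by apply: is_derive_eq; rewrite /GRing.scale /= mulr1.
have := @is_derive1_comp R expR (fun t : R => t / kap R k) x _ _ (is_derive_expR _) h.
by rewrite mulrC.
Qed.
Lemma is_derive_exV (x : R) : is_derive x 1 (fun t => (ex t)^-1) (- (cK / ex x)).
Proof.
have h := is_derive_ex x.
have h2 := is_deriveV (ex_neq0 x) h.
apply: is_derive_eq; rewrite /GRing.scale /=; field; exact: ex_neq0.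
Qed.
Lemma is_derive_sh0 : is_derive (0 : R) 1 sh cK.
Proof.
have h := is_derive_ex 0; have h2 := is_derive_exV 0.
have -> : sh = 2^-1 \*: (ex - (fun t => (ex t)^-1)).
  by apply/funext => t; rewrite /sh /= mulrC.
by apply: is_derive_eq; rewrite /GRing.scale /= ex0; field.
Qed.
Lemma is_derive_ch0 : is_derive (0 : R) 1 ch 0.
Proof.
have h := is_derive_ex 0; have h2 := is_derive_exV 0.
have -> : ch = 2^-1 \*: (ex + (fun t => (ex t)^-1)).
  by apply/funext => t; rewrite /ch /= mulrC.
by apply: is_derive_eq; rewrite /GRing.scale /= ex0; field.
Qed.

Section Quotient.
Variables (rho sigma : R).
(** The square norm of [ch t + c * sh t], where [c] is the first coordinate of the direction, [rho]
    its real part and [sigma] its square norm; see [knsq_pe_den]. *)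
Definition qden t : R := ch t ^+ 2 + 2 * (ch t * sh t * rho) + sh t ^+ 2 * sigma.
Lemma qden0 : qden 0 = 1.
Proof. by rewrite /qden ch0 sh0; ring. Qed.
Lemma is_derive_qden : is_derive (0 : R) 1 qden (2 * rho * cK).
Proof.
have h1 := is_derive_ch0; have h2 := is_derive_sh0.
have -> : qden = ch * ch + (2 * rho) \*: (ch * sh) + sigma \*: (sh * sh).
  apply/funext => t; rewrite /qden.
  rewrite -[RHS]/(ch t * ch t + 2 * rho * (ch t * sh t) + sigma * (sh t * sh t)); ring.
apply: is_derive_eq; rewrite /GRing.scale /= ch0 sh0; ring.
Qed.
Lemma is_derive_qdenV : is_derive (0 : R) 1 (fun t => (qden t)^-1) (- (2 * rho * cK)).
Proof.
have h := is_derive_qden.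
have q0 : qden 0 != 0 by rewrite qden0 oner_eq0.
have h2 := is_deriveV q0 h.
by apply: is_derive_eq; rewrite /GRing.scale /= qden0; field.
Qed.
Lemma derive1_quot (A al be : R) :
  derive1 (fun t => A + sh t / qden t * (ch t * al + sh t * be)) 0 = cK * al.
Proof.
have h4 := is_deriveM is_derive_sh0 is_derive_qdenV.
have h5 := is_deriveD (is_deriveZ al is_derive_ch0) (is_deriveZ be is_derive_sh0).
have h := is_deriveD (is_derive_cst (A : R) (0 : R) 1) (is_deriveM h4 h5).
rewrite derive1E.
have -> : (fun t => A + sh t / qden t * (ch t * al + sh t * be)) =
  cst A + (sh * (fun t => (qden t)^-1)) * (al \*: ch + be \*: sh).
  apply/funext => t.
  rewrite -[RHS]/(A + sh t * (qden t)^-1 * (al * ch t + be * sh t)); ring.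
rewrite (@derive_val _ _ _ _ _ _ _ h).
rewrite -[LHS]/(0 + (sh 0 * (qden 0)^-1 * (al * 0 + be * cK) +
  (al * ch 0 + be * sh 0) * (sh 0 * (- (2 * rho * cK)) + (qden 0)^-1 * cK))).
by rewrite ch0 sh0 qden0 invr1; ring.
Qed.
Lemma derive1_inv (A : R) : derive1 (fun t => A / qden t) 0 = - (2 * A * rho * cK).
Proof.
have h3 := is_derive_qdenV.
rewrite derive1E.
have -> : (fun t => A / qden t) = A \*: (fun t => (qden t)^-1) by [].
by rewrite derive_val /GRing.scale /=; ring.
Qed.
End Quotient.

Definition pe_den e t : K := kreal k (ch t) + vc0 e * kreal k (sh t).
(** Up to the factor [cK], [pe_b1] and the imaginary part of [pe_b2] are the components of the
    velocity at [p]; see [tangent_pel]. *)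
Definition pe_b1 p e : 'cV[K]_n := kreal k (Num.sqrt 2)^-1 *: vc1 e - rsc p.1 (vc0 e).
Definition pe_b2 p e : K := vc2 e - vc2 (phi p) * vc0 e.

Lemma knsq_pe_den e t : knsq (pe_den e t) = qden (kre (vc0 e)) (knsq (vc0 e)) t.
Proof. by rewrite /pe_den /qden; kcomp; ring. Qed.

Section Pe.
Variables (p : kpoint R k n) (e : V).
Hypothesis (pe : pedata p e).
Local Notation l := (pe_den e).

Lemma pel_lift t : [/\ rsc (phi p) (kreal k (ch t)) + rsc e (kreal k (sh t)) =
    rsc (phi (pel p e t)) (l t), l t != 0, in_H (pel p e t) &
    ht (pel p e t) * knsq (l t) = ht p].
Proof.
have [_ eL l0 hp eh] := gline_lift t (pe_ldata pe).
have el : vc0 (glift (peX p e) (peY p e) t) = l t.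
  by rewrite pe_glift vc0D !vc0Z (vc_phi p).1.1 mul1r.
by rewrite el in eL l0 eh; rewrite -pe_glift.
Qed.

Lemma pel_z t : (pel p e t).1 = p.1 + rsc (pe_b1 p e) (kreal k (sh t) * kinv (l t)).
Proof.
have [eL l0 _ _] := pel_lift t.
have : rsc (pel p e t).1 (l t) = rsc p.1 (l t) + rsc (pe_b1 p e) (kreal k (sh t)).
  have := congr1 (@vc1 R k n) eL; rewrite vc1D !vc1Z (vc_phi p).1.2 (vc_phi (pel p e t)).1.2.
  rewrite !krscC !rscA => h.
  have s2 := sqrt2_neq0 (R := R).
  have sk : kreal k (Num.sqrt 2 : R) != 0 by rewrite -knorm_gt0 knorm_kreal normr_gt0.
  apply/matrixP => i j; have := congr1 (fun v : 'cV_n => v i j) h.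
  rewrite /pe_b1 /pe_den !mxE !rscE !mxE !rscE => hij.
  apply: (kmulIf sk); move: hij.
  move: ((pel p e t).1 i j) (p.1 i j) (e _ _) (vc0 e) => a b c d.
  move: s2; move: (Num.sqrt 2) (ch t) (sh t) => r2 C S s2 hij.
  transitivity (a * (kreal k r2 * (kreal k C + d * kreal k S))).
    by rewrite -mulrA (kreal_central r2).
  by rewrite -hij; apply: kext; kcomp; field.
move=> /(congr1 (fun v => rsc v (kinv (l t)))).
by rewrite rscDl !rscA !kmulVr ?rsc1.
Qed.

Lemma pel_w t : (pel p e t).2 = kreal k (ht p / qden (kre (vc0 e)) (knsq (vc0 e)) t)
  + kim (vc2 (phi p) + pe_b2 p e * (kreal k (sh t) * kinv (l t))).
Proof.
have [eL l0 _ eh] := pel_lift t.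
have : vc2 (phi (pel p e t)) * l t = vc2 (phi p) * l t + pe_b2 p e * kreal k (sh t).
  have := congr1 (@vc2 R k n) eL; rewrite vc2D !vc2Z => <-.
  rewrite /pe_b2 /pe_den mulrDr mulrBl -mulrA -addrA; congr (_ + _).
  by rewrite addrCA subrr addr0.
move=> /(congr1 (fun v => v * kinv (l t))); rewrite mulrDl -!mulrA !kmulVr // !mulr1.
move=> <-; rewrite (vc_phi (pel p e t)).2 kimD kim_kreal addr0 -knsq_pe_den -eh.
by rewrite mulfK ?knsq_eq0 // {1}[LHS]kreimE.
Qed.

Lemma kproj_sval (x : K) : kproj k (sval x) = x.
Proof. by apply: sval_inj; case: x => x /= /eqP. Qed.

Lemma quat_eta (x : quat R) : x = Quat (qr x) (qi x) (qj x) (qk x).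
Proof. by case: x. Qed.

Lemma comp_term (a b : K) t : sval (a + b * (kreal k (sh t) * kinv (l t))) =
  let s := sh t / qden (kre (vc0 e)) (knsq (vc0 e)) t in
  let d := b * kconj (vc0 e) in
  Quat (qr (sval a) + s * (ch t * qr (sval b) + sh t * qr (sval d)))
       (qi (sval a) + s * (ch t * qi (sval b) + sh t * qi (sval d)))
       (qj (sval a) + s * (ch t * qj (sval b) + sh t * qj (sval d)))
       (qk (sval a) + s * (ch t * qk (sval b) + sh t * qk (sval d))).
Proof.
rewrite -knsq_pe_den kinvE; move: (knsq (pe_den e t)) => q; rewrite /pe_den.
move: (vc0 e) (ch t) (sh t) => d C S.
have -> : b * (kreal k S * (kreal k q^-1 * kconj (kreal k C + d * kreal k S))) =
   kreal k (S / q) * (b * kreal k C + b * kconj d * kreal k S).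
  by apply: kext; kcomp; ring.
by move: (b * kconj d) => f; rewrite [LHS]quat_eta; congr Quat; kcomp; ring.
Qed.

Lemma kderive_term (a b : K) :
  kderive (fun t => a + b * (kreal k (sh t) * kinv (l t))) 0 = b * kreal k cK.
Proof.
rewrite -[RHS]kproj_sval /kderive; congr kproj.
pose g (f : quat R -> R) t : R := f (sval a) +
  sh t / qden (kre (vc0 e)) (knsq (vc0 e)) t *
  (ch t * f (sval b) + sh t * f (sval (b * kconj (vc0 e)))).
have E (f : quat R -> R) (g0 : R -> R) : (forall t, f (sval (a + b * (kreal k (sh t) * kinv (l t)))) = g0 t) ->
    derive1 (fun t => f (sval (a + b * (kreal k (sh t) * kinv (l t))))) 0 = derive1 g0 0.
  by move=> h; congr (derive1 _ 0); apply/funext.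
rewrite (E (@qr R) (g (@qr R)) (fun t => congr1 (@qr R) (comp_term a b t))) derive1_quot.
rewrite (E (@qi R) (g (@qi R)) (fun t => congr1 (@qi R) (comp_term a b t))) derive1_quot.
rewrite (E (@qj R) (g (@qj R)) (fun t => congr1 (@qj R) (comp_term a b t))) derive1_quot.
rewrite (E (@qk R) (g (@qk R)) (fun t => congr1 (@qk R) (comp_term a b t))) derive1_quot.
by rewrite [RHS]quat_eta; congr Quat; kcomp; ring.
Qed.

Lemma kderive_w (A : R) (a b : K) :
  kderive (fun t => kreal k (A / qden (kre (vc0 e)) (knsq (vc0 e)) t) +
     kim (a + b * (kreal k (sh t) * kinv (l t)))) 0 =
  kreal k (- (2 * A * kre (vc0 e) * cK)) + kim b * kreal k cK.
Proof.
rewrite -[RHS]kproj_sval /kderive; congr kproj.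
pose g (f : quat R -> R) t : R := f (sval a) +
  sh t / qden (kre (vc0 e)) (knsq (vc0 e)) t *
  (ch t * f (sval b) + sh t * f (sval (b * kconj (vc0 e)))).
have E (f : quat R -> R) (g0 : R -> R) : (forall t, f (sval (kreal k (A / qden (kre (vc0 e)) (knsq (vc0 e)) t) +
     kim (a + b * (kreal k (sh t) * kinv (l t))))) = g0 t) ->
    derive1 (fun t => f (sval (kreal k (A / qden (kre (vc0 e)) (knsq (vc0 e)) t) +
     kim (a + b * (kreal k (sh t) * kinv (l t)))))) 0 = derive1 g0 0.
  by move=> h; congr (derive1 _ 0); apply/funext.
have C (f : quat R -> R) t : (forall x : R, forall y : K, f (sval (kreal k x + kim y)) = f (sval y)) ->
   f (sval (kreal k (A / qden (kre (vc0 e)) (knsq (vc0 e)) t) +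
     kim (a + b * (kreal k (sh t) * kinv (l t))))) =
   f (sval (a + b * (kreal k (sh t) * kinv (l t)))) by [].
have Ci x (y : K) : qi (sval (kreal k x + kim y)) = qi (sval y) by kcomp; ring.
have Cj x (y : K) : qj (sval (kreal k x + kim y)) = qj (sval y) by kcomp; ring.
have Ck x (y : K) : qk (sval (kreal k x + kim y)) = qk (sval y) by kcomp; ring.
rewrite (E (@qr R) (fun t => A / qden (kre (vc0 e)) (knsq (vc0 e)) t)); last first.
  by move=> t; kcomp; ring.
rewrite derive1_inv.
rewrite (E (@qi R) (g (@qi R)) (fun t => etrans (C (@qi R) t Ci)
   (congr1 (@qi R) (comp_term a b t)))) derive1_quot.
rewrite (E (@qj R) (g (@qj R)) (fun t => etrans (C (@qj R) t Cj)
   (congr1 (@qj R) (comp_term a b t)))) derive1_quot.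
rewrite (E (@qk R) (g (@qk R)) (fun t => etrans (C (@qk R) t Ck)
   (congr1 (@qk R) (comp_term a b t)))) derive1_quot.
by rewrite [RHS]quat_eta; congr Quat; kcomp; ring.
Qed.

Lemma tangent_pel : tangent (pel p e) 0 =
  (p, (rsc (pe_b1 p e) (kreal k cK),
       kreal k (- (2 * ht p * kre (vc0 e) * cK)) + kim (pe_b2 p e) * kreal k cK)).
Proof.
rewrite /tangent; congr (_, (_, _)).
- have := pel_z 0; have h2 : (pel p e 0).2 = p.2.
    have [eL _ _ _] := pel_lift 0.
    have l1 : l 0 = 1 by rewrite /pe_den ch0 sh0 kreal0 mulr0 addr0 kreal1.
    move: eL; rewrite l1 ch0 sh0 kreal0 kreal1 rsc0 addr0 !rsc1 => eP.
    have := congr1 (fun v => dehomog v) eP; rewrite -!homog_some !dehomog_homog.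
    by case=> <-.
  rewrite sh0 kreal0 mul0r rsc0 addr0 => h1.
  by case: (pel p e 0) h1 h2 => z w /= -> ->; case: (p).
- apply/matrixP => i j; rewrite (ord1 j) mxE rscE.
  have -> : (fun s => (pel p e s).1 i 0) =
     (fun s => p.1 i 0 + (pe_b1 p e) i 0 * (kreal k (sh s) * kinv (l s))).
    by apply/funext => s; rewrite pel_z mxE rscE.
  exact: kderive_term.
have -> : (fun s => (pel p e s).2) = (fun t =>
    kreal k (ht p / qden (kre (vc0 e)) (knsq (vc0 e)) t) +
     kim (vc2 (phi p) + pe_b2 p e * (kreal k (sh t) * kinv (l t)))).
  by apply/funext => s; rewrite pel_w.
exact: kderive_w.
Qed.

Lemma pe_perp : pe_b2 p e = hdot p.1 (pe_b1 p e) *+ 2 - kreal k (2 * ht p) * vc0 e /\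
  vc2 e = hdot (kreal k (Num.sqrt 2) *: p.1) (vc1 e) - kconj (vc2 (phi p)) * vc0 e.
Proof.
have [hp hpe _] := pe; move: hpe; rewrite hformE (vc_phi p).1.1 (vc_phi p).1.2 kconj1 mul1r => h.
have e2 : vc2 e = hdot (kreal k (Num.sqrt 2) *: p.1) (vc1 e) - kconj (vc2 (phi p)) * vc0 e.
  by apply/eqP; rewrite -subr_eq0 -oppr_eq0 opprB -[X in _ == X]h addrAC.
split=> //; rewrite /pe_b2 e2 (vc_phi p).2 /pe_b1 hdotBr !krscC !hdotZr hdotZl.
rewrite hdot_normsq kconjD !kconj_kreal /ht.
have s2 := sqrt2_neq0 (R := R); have s3 := sqrt2_sqr (R := R).
move: (hdot _ _) (vc0 e) (p.2) (normsq _) s2 s3 => a b c d.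
move: (Num.sqrt 2) => r2 s2 s3.
have -> : r2^-1 = r2 / 2 by apply: (mulfI s2); rewrite mulfV // mulrA s3 divff.
by rewrite !mulr2n; apply: kext; kcomp; field.
Qed.
End Pe.

(** The vertical velocity gives the real part of [vc0 e]. Through [pe_perp] the other components
    give its imaginary part, then [pe_b1] gives [vc1 e], and orthogonality to [phi p] gives
    [vc2 e]. *)
Lemma pe_inj p e e' : pedata p e -> pedata p e' ->
  tangent (pel p e) 0 = tangent (pel p e') 0 -> e = e'.
Proof.
move=> pe pe'.
have c0 : kreal k cK != 0 by apply: kreal_neq0; rewrite gt_eqF // cK_gt0.
have [hp _ _] := pe; have h0 : 2 * ht p != 0 by rewrite mulf_neq0 ?pnatr_eq0 // gt_eqF.
have [f1 f2] := pe_perp pe; have [f1' f2'] := pe_perp pe'.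
rewrite (tangent_pel pe) (tangent_pel pe') => h.
have ez : rsc (pe_b1 p e) (kreal k cK) = rsc (pe_b1 p e') (kreal k cK).
  exact: (congr1 fst (congr1 snd h)).
have ew : kreal k (- (2 * ht p * kre (vc0 e) * cK)) + kim (pe_b2 p e) * kreal k cK =
    kreal k (- (2 * ht p * kre (vc0 e') * cK)) + kim (pe_b2 p e') * kreal k cK.
  exact: (congr1 snd (congr1 snd h)).
clear h; have eb1 : pe_b1 p e = pe_b1 p e'.
  apply/matrixP => i j; have := congr1 (fun v : 'cV_n => v i j) ez; rewrite !rscE.
  exact: kmulIf.
have er : kre (vc0 e) = kre (vc0 e').
  have := congr1 (@kre R k) ew; rewrite !kreD !kre_kreal !kreZr !kre_kim !mulr0 !addr0.
  by move/oppr_inj/(mulIf (lt0r_neq0 cK_gt0))/(mulfI h0).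
have ei : kim (pe_b2 p e) = kim (pe_b2 p e').
  by move: ew; rewrite er => /addrI/(kmulIf c0).
have e0 : vc0 e = vc0 e'.
  rewrite (kreimE (vc0 e)) (kreimE (vc0 e')) er; congr (_ + _).
  move: ei; rewrite f1 f1' eb1 !kimB !kimZl => /addrI/oppr_inj.
  rewrite !kreal_central; apply: kmulIf; exact: kreal_neq0.
have e1 : vc1 e = vc1 e'.
  have s2 : kreal k (Num.sqrt 2 : R)^-1 != 0 by rewrite kreal_neq0 // invr_eq0 sqrt2_neq0.
  apply/matrixP => i j; have := congr1 (fun v : 'cV_n => v i j) eb1.
  rewrite /pe_b1 e0 mxE [RHS]mxE => /addIr; rewrite mxE [RHS]mxE.
  by rewrite !kreal_central; exact: kmulIf.
by apply: vec_inj; [exact: e0|exact: e1|rewrite f2 f2' e0 e1].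
Qed.

Lemma tangent_shift gam t : tangent gam t = tangent (fun s => gam (s + t)) 0.
Proof.
have D (f : R -> R) : derive1 f t = derive1 (fun s => f (s + t)) 0.
  have e : (fun h : R => h^-1 *: (f (h + t) - f t)) =
      (fun h => h^-1 *: (f (h + 0 + t) - f (0 + t))).
    by apply/funext => h; rewrite addr0 add0r.
  by rewrite /derive1 e.
have Dk (f : R -> K) : kderive f t = kderive (fun s => f (s + t)) 0.
  rewrite /kderive (D (fun s => qr (sval (f s)))) (D (fun s => qi (sval (f s)))).
  by rewrite (D (fun s => qj (sval (f s)))) (D (fun s => qk (sval (f s)))).
rewrite /tangent add0r (Dk (fun s => (gam s).2)).
have -> : \col_i kderive (fun s => (gam s).1 i 0) t =
  \col_i kderive (fun s => (gam (s + t)).1 i 0) 0.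
  by apply/matrixP => i j; rewrite mxE [RHS]mxE (Dk (fun s => (gam s).1 i 0)).
by [].
Qed.
Lemma geodesic_shift gam t : geodesic gam -> geodesic (fun s => gam (s + t)).
Proof.
move=> [h1 h2]; split=> [s|s s']; first exact: h1.
by rewrite h2; congr `|_|; ring.
Qed.
(** [section_W] and [ttranslate] are images under [tangent]. Injectivity is what allows a witness
    geodesic to be replaced by the given one. *)
Lemma geodesic_tangent_inj gam gam' : geodesic gam -> geodesic gam' ->
  tangent gam 0 = tangent gam' 0 -> gam = gam'.
Proof.
move=> /geodesic_pel[e [pe eg]] /geodesic_pel[e' [pe' eg']] ht.
have ep : gam 0 = gam' 0 by case: ht.
rewrite eg eg'; rewrite -ep in pe' eg' *; congr pel.
by apply: (pe_inj pe pe'); rewrite -eg -eg'.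
Qed.
End Tangents.

(** * Discrete groups of Moebius transformations *)

Section BoundedOperators.
Context {R : realType} {k : scalars} {n : nat}.
Local Notation K := (scalar R k).
Local Notation G := (PUJ R k n).
Local Notation N := (1 + (n + 1))%N.
Local Notation V := 'cV[K]_N.
Local Notation J := (formJ R k n).
Implicit Types (u v w : V) (g h : G) (p q : kpoint R k n) (c d : K).

Lemma normsq_vec v : normsq v = knsq (vc0 v) + normsq (vc1 v) + knsq (vc2 v).
Proof.
by rewrite -kre_hdot hdot_vec !kreD !kconj_mul !kre_kreal kre_hdot.
Qed.
Lemma normsq_J v : normsq (J *m v) = normsq v.
Proof. by rewrite formJ_vec !normsq_vec !vc_vec !knsqN; ring. Qed.
Lemma hform_hdot u v : hform u v = hdot u (J *m v).
Proof. by rewrite hformE hdot_vec formJ_vec !vc_vec; apply: kext; kcomp; ring. Qed.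
Lemma hform_bound u v : knsq (hform u v) <= normsq u * normsq v.
Proof. by rewrite hform_hdot -(normsq_J v) hdot_CS. Qed.

(* The positive definite form obtained from the Hermitian form by changing the sign
   on the negative line of [q]. *)
Definition posform q u : R := kre (hform u u) + knsq (hform (phi q) u).

Lemma knsqD_le c d : knsq (c + d) <= 2 * knsq c + 2 * knsq d.
Proof. by have := knsq_ge0 (c - d); rewrite !knsqD knsqN mulrN kreN; lra. Qed.

Lemma normsqD_le m (v w : 'cV[K]_m) : normsq (v + w) <= 2 * normsq v + 2 * normsq w.
Proof. by have := normsq_ge0 (v - w); rewrite normsqB normsqD; lra. Qed.

Section Posform.
Variable q : kpoint R k n.
Hypotheses (hq : ht q = 1) (bq : pr (Some q) (Some 0) <= 4).

Lemma posform_H : in_H q. Proof. by rewrite /in_H -/(ht q) hq. Qed.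

Lemma posform_decomp u : exists c u', [/\ u = rsc (phi q) c + u', hform (phi q) u' = 0,
  posform q u = 2 * knsq c + kre (hform u' u') &
  posform q u = 2 * knsq c + 2 * knsq (vc0 u - c) +
     normsq (vc1 u - rsc (kreal k (Num.sqrt 2) *: q.1) (vc0 u))].
Proof.
pose c := hform (phi q) u * kreal k (- 2^-1).
have [u' eu'] : exists u', u' = u - rsc (phi q) c by exists (u - rsc (phi q) c).
have eQ : hform (phi q) (phi q) = kreal k (- 2).
  by rewrite hform_phi_self -/(ht q) hq mulr1.
have e0 : hform (phi q) u' = 0.
  rewrite eu' hformBr hformZr eQ /c; move: (hform _ u) => x.
  by apply: kext; kcomp; field.
have eu : u = rsc (phi q) c + u' by rewrite eu' addrC subrK.
have e0' : hform u' (phi q) = 0 by rewrite -hform_conj e0 kconj0.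
have hc : hform (phi q) u = kreal k (- 2) * c.
  by rewrite eu hformDr hformZr e0 addr0 eQ.
have huu : hform u u = kconj c * (kreal k (- 2) * c) + hform u' u'.
  rewrite eu hformDl !hformDr !hformZl !hformZr e0 e0' eQ.
  by rewrite mul0r mulr0 addr0 add0r.
have ep : posform q u = 2 * knsq c + kre (hform u' u').
  rewrite /posform hc huu kreD knsqM knsq_kreal; move: (kre (hform _ _)) => x.
  by clear; move: c => c; kcomp; ring.
exists c, u'; split; [exact: eu|exact: e0|exact: ep|].
rewrite ep (perp_pos posform_H e0) hq mulr1 eu' vc0D vc1D vc0N vc1N.
rewrite vc0Z vc1Z (vc_phi q).1.1 (vc_phi q).1.2 mul1r.
have -> : vc1 u - rsc (kreal k (Num.sqrt 2) *: q.1) c -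
   rsc (kreal k (Num.sqrt 2) *: q.1) (vc0 u - c) =
   vc1 u - rsc (kreal k (Num.sqrt 2) *: q.1) (vc0 u).
  by rewrite rscBr opprB addrA subrK.
move: (knsq c) (knsq _) (normsq _) => x y z; ring.
Qed.

Lemma posform_ge0 u : 0 <= posform q u.
Proof.
have [c [u' [_ _ _ ->]]] := posform_decomp u.
by rewrite !addr_ge0 ?mulr_ge0 ?knsq_ge0 ?normsq_ge0.
Qed.

(** [hform] and the polarisation of [posform] differ only by a sign on the line of [phi q], so
    Cauchy-Schwarz can be proved on that line and on its complement and recombined. *)
Lemma posform_CS u v : knsq (hform u v) <= posform q u * posform q v.
Proof.
have [c [u' [eu hu -> _]]] := posform_decomp u.
have [d [v' [ev hv -> _]]] := posform_decomp v.
have hu' : hform u' (phi q) = 0 by rewrite -hform_conj hu kconj0.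
have eQ : hform (phi q) (phi q) = kreal k (- 2).
  by rewrite hform_phi_self -/(ht q) hq mulr1.
have -> : hform u v = kconj c * kreal k (- 2) * d + hform u' v'.
  rewrite eu ev hformDl !hformDr !hformZl !hformZr hv hu' eQ !mul0r !mulr0 addr0 add0r.
  by rewrite mulrA.
have cs := perp_CS posform_H hu hv.
have A0 := perp_ge0 posform_H hu; have B0 := perp_ge0 posform_H hv.
move: (hform u' v') (kre (hform u' u')) (kre (hform v' v')) cs A0 B0 => x A B cs A0 B0.
rewrite -(@knorm_sqr R k); set a := knorm c; set b := knorm d.
have a0 : 0 <= a := knorm_ge0 _; have b0 : 0 <= b := knorm_ge0 _.
have t : knorm (kconj c * kreal k (- 2) * d + x) <= 2 * a * b + knorm x.
  apply: le_trans (knorm_triangle _ _) _; rewrite lerD2r !knormM knorm_conj.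
  by rewrite knorm_kreal normrN ger0_norm // -/a -/b mulrAC [a * b * 2]mulrC mulrA.
have x0 := knorm_ge0 x; have x2 : knorm x ^+ 2 <= A * B by rewrite knorm_sqr.
apply: (@le_trans _ _ ((2 * a * b + knorm x) ^+ 2)).
  by rewrite ler_pXn2r ?nnegrE ?knorm_ge0 ?addr_ge0 ?mulr_ge0.
rewrite -!knorm_sqr -/a -/b; set y := knorm x in x0 x2 *.
have h1 : ((a * b) * y) ^+ 2 <= (a ^+ 2 * B) * (b ^+ 2 * A).
  rewrite exprMn.
  have -> : a ^+ 2 * B * (b ^+ 2 * A) = (a * b) ^+ 2 * (A * B) by ring.
  by rewrite ler_wpM2l ?sqr_ge0.
have AB : 2 * (a * b * y) <= a ^+ 2 * B + b ^+ 2 * A.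
  have P0 : 0 <= a ^+ 2 * B by rewrite mulr_ge0 ?sqr_ge0.
  have Q0 : 0 <= b ^+ 2 * A by rewrite mulr_ge0 ?sqr_ge0.
  have z0 : 0 <= a * b * y by rewrite !mulr_ge0.
  move: (a ^+ 2 * B) (b ^+ 2 * A) (a * b * y) h1 P0 Q0 z0 => P Q z h1 P0 Q0 z0.
  rewrite -(@ler_pXn2r _ 2) ?nnegrE ?addr_ge0 ?mulr_ge0 //.
  have := sqr_ge0 (P - Q); rewrite !expr2 => s; rewrite expr2 in h1; nra.
clear -x2 AB; lra.
Qed.

Lemma ptq_bounds : normsq q.1 <= 4 /\ knsq (vc2 (phi q)) <= 16.
Proof.
have gq := in_H_good posform_H; have g0 := in_X_good (@in_X0 R k n).
split.
  have := pr_normsq gq g0; rewrite subr0 => h; exact: le_trans h bq.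
have -> : knsq (vc2 (phi q)) = pr (Some q) (Some 0) ^+ 2.
  rewrite prC pr_phi knorm_sqr hformE (vc_phi 0).1.2 (vc_phi 0).1.1 (vc_phi 0).2 /=.
  by rewrite normsq0 kreal0 addr0 scaler0 hdot0l kconj0 mul0r kconj1 mul1r sub0r subr0 knsqN.
have := pr_ge0 (Some q) (Some 0); move: bq; move: (pr _ _) => x; nra.
Qed.

(** The constant is [1 + 18 + 644], from the bounds for the three blocks of [u]. The hypotheses on
    [q] confine it to a bounded region, which makes the constant absolute. *)
Lemma posform_lower u : normsq u <= 663 * posform q u.
Proof.
have [zb Qb] := ptq_bounds.
have [c [u' [_ _ e1 e2]]] := posform_decomp u.
set H := posform q u in e1 e2 *; set c0 := vc0 u in e2 *.
set w := vc1 u - _ in e2.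
have h0 : knsq c0 <= H.
  have -> : c0 = c + (c0 - c) by rewrite addrC subrK.
  by rewrite e2; have := knsqD_le c (c0 - c); have := normsq_ge0 w; lra.
have hw : normsq w <= H.
  by rewrite e2; have := knsq_ge0 c; have := knsq_ge0 (c0 - c); lra.
have H0 : 0 <= H := posform_ge0 u.
have eq1 : vc1 u = w + rsc (kreal k (Num.sqrt 2) *: q.1) c0 by rewrite subrK.
have c00 := knsq_ge0 c0; have n0 := normsq_ge0 q.1; have q0 := knsq_ge0 (vc2 (phi q)).
have u0 := normsq_ge0 (vc1 u).
have nz : normsq (rsc (kreal k (Num.sqrt 2) *: q.1) c0) <= 8 * H.
  rewrite normsqZ krscC normsqZ knsq_kreal sqr_sqrtr ?ler0n //.
  by clear -zb h0 c00 n0; nra.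
have h1 : normsq (vc1 u) <= 18 * H.
  by rewrite eq1; have := normsqD_le w (rsc (kreal k (Num.sqrt 2) *: q.1) c0); lra.
have e3 : vc2 u = hdot (kreal k (Num.sqrt 2) *: q.1) (vc1 u) - kconj (vc2 (phi q)) * c0
    - hform (phi q) u.
  rewrite hformE (vc_phi q).1.1 (vc_phi q).1.2 kconj1 mul1r.
  by move: (hdot _ _) (kconj _ * _) (vc2 u) => x y z; apply: kext; kcomp; ring.
have f1 : knsq (hdot (kreal k (Num.sqrt 2) *: q.1) (vc1 u)) <= 144 * H.
  apply: le_trans (hdot_CS _ _) _; rewrite krscC normsqZ knsq_kreal sqr_sqrtr ?ler0n //.
  by clear -zb h1 n0 u0; nra.
have f2 : knsq (kconj (vc2 (phi q)) * c0) <= 16 * H.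
  by rewrite knsqM knsq_conj; clear -Qb h0 c00 q0; nra.
have f3 : knsq (hform (phi q) u) <= 2 * H.
  have eQ : knsq (hform (phi q) u) <= posform q (phi q) * H by exact: posform_CS.
  suff <- : posform q (phi q) = 2 by [].
  by rewrite /posform hform_phi_self -/(ht q) hq mulr1 kre_kreal knsq_kreal; ring.
have h2 : knsq (vc2 u) <= 644 * H.
  rewrite e3; move: (hdot _ _) (kconj (vc2 (phi q)) * c0) (hform (phi q) u) f1 f2 f3.
  move=> x y z f1 f2 f3.
  have := knsqD_le (x - y) (- z); have := knsqD_le x (- y); rewrite !knsqN.
  by clear -f1 f2 f3; lra.
by rewrite normsq_vec -/c0; clear -h0 h1 h2; lra.
Qed.

Lemma posform_upper u : posform q u <= 26 * normsq u.
Proof.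
have [zb Qb] := ptq_bounds.
have hu : kre (hform u u) <= normsq u.
  apply: le_trans (kre_ler _) _; rewrite -(@ler_pXn2r _ 2) ?nnegrE ?knorm_ge0 ?normsq_ge0 //.
  by rewrite knorm_sqr expr2 hform_bound.
have nQ : normsq (phi q) <= 25.
  rewrite normsq_vec (vc_phi q).1.1 (vc_phi q).1.2 knsq1 krscC normsqZ knsq_kreal.
  by rewrite sqr_sqrtr ?ler0n //; lra.
have hQ := hform_bound (phi q) u; rewrite /posform.
have := normsq_ge0 u; move: (normsq u) (normsq (phi q)) hQ nQ hu => x y *; nra.
Qed.
End Posform.

(** The hypothesis bounds the pairing of [phi q] with its image by 9, so the pulled-back vector has
    [posform] at most [81 - 2 = 79]. By [posform_CS] the matrix then stretches [posform q] by at
    most 80; 663 and 26 convert to the Euclidean norm. *)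
Lemma operator_bound g q : ht q = 1 -> pr (Some q) (Some 0) <= 4 ->
  pr (Some q) (xmob g (Some q)) * nu g (Some q) <= 9 ->
  forall u, normsq (umx (repr g) *m u) <= 663 * (80 * 26) * normsq u.
Proof.
move=> hq bq hg u; have hH := posform_H hq.
have [c [ec nc _ _]] := xmobP g (in_H_good hH).
set B := umx (repr g) in ec *.
have hP : knsq (hform (B *m phi q) (phi q)) <= 81.
  rewrite -homog_some ec hformZl -hform_conj knsqM knsq_conj knsq_conj -!knorm_sqr nc.
  rewrite -prE_hform -exprMn mulrC; have := pr_ge0 (Some q) (xmob g (Some q)).
  have := nu_gt0 g (in_H_good hH); move: hg; move: (pr _ _) (nu _ _) => x y h y0 x0.
  have : 0 <= x * y by rewrite mulr_ge0 // ltW.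
  by move: (x * y) h => z *; nra.
apply: le_trans (posform_lower hq bq _) _.
pose Bi := umx (repr g)^-1%g.
have BiK v : B *m (Bi *m v) = v.
  by rewrite mulmxA -[B *m Bi]/(umx (repr g * (repr g)^-1)%g) mulgV mul1mx.
have e1 : posform q (B *m u) = kre (hform u u) + knsq (hform (Bi *m phi q) u).
  by rewrite /posform hform_umx -[in X in _ + X](BiK (phi q)) hform_umx.
have e2 : posform q (Bi *m phi q) <= 79.
  rewrite /posform -(hform_umx (repr g)) -/B BiK hform_phi_self -/(ht q) hq mulr1 kre_kreal.
  by rewrite -(hform_umx (repr g)) -/B BiK; lra.
have e3 := posform_CS hq (Bi *m phi q) u.
have e4 : kre (hform u u) <= posform q u by rewrite lerDl knsq_ge0.
have e5 := posform_upper hq bq u; have e6 := posform_ge0 hq u.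
have e7 := posform_ge0 hq (Bi *m phi q).
rewrite e1; move: e2 e3 e4 e5 e6 e7.
move: (posform q (Bi *m _)) (posform q u) (knsq _) (kre _) (normsq u) => x y z s t.
move=> h1 h2 h3 h4 h5 h6.
have : x * y <= 79 * y by apply: ler_wpM2r.
by clear -h2 h3 h4 h5; lra.
Qed.
End BoundedOperators.

(** * Discrete groups contain few bounded operators *)

Section DiscreteSets.
Context {R : realType} {k : scalars} {n : nat}.
Local Notation K := (scalar R k).
Local Notation G := (PUJ R k n).
Local Notation N := (1 + (n + 1))%N.
Local Notation V := 'cV[K]_N.
Local Notation J := (formJ R k n).
Implicit Types (u v w : V) (g h : G) (S : set G) (r : R).

Lemma generated_subgroup S : subgroup (generated S).
Proof.
split=> [M [[M1 _] _]|a b ha hb M HM]; first exact: M1.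
by case: (HM) => -[_ MM] _; apply: MM; [exact: ha|exact: hb].
Qed.
Lemma generated_incl S : S `<=` generated S.
Proof. by move=> a Sa M [_]; apply. Qed.

Lemma subgroupV S : subgroup S -> forall a, S a -> S a^-1%g.
Proof. by move=> [S1 SM] a Sa; rewrite -[_^-1%g]mul1g; apply: SM. Qed.
Lemma subgroupM S : subgroup S -> forall a b, S a -> S b -> S (a * b)%g.
Proof. by move=> sS a b Sa Sb; rewrite -[b]invgK; apply: sS.2 => //; apply: subgroupV. Qed.

Definition opbd r g := forall u, normsq (umx (repr g) *m u) <= r * normsq u.

Lemma hform_J u v : hform (J *m u) v = hdot u v.
Proof. by rewrite hformE hdot_vec formJ_vec !vc_vec; apply: kext; kcomp; ring. Qed.

Lemma normsq_delta (i : 'I_N) : normsq (delta_mx i 0 : V) = 1.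
Proof.
rewrite normsqE (bigD1 i) //= big1 ?addr0 => [|j ji]; first by rewrite mxE !eqxx knsq1.
by rewrite mxE (negPf ji) knsq0.
Qed.
Lemma hdot_delta i u : hdot (delta_mx i 0) u = u i 0.
Proof.
rewrite hdot_sum (bigD1 i) //= big1 ?addr0 => [|j ji].
  by rewrite mxE !eqxx kconj1 mul1r.
by rewrite mxE (negPf ji) kconj0 mul0r.
Qed.

(** The inverse is the adjoint for the Hermitian form, so a bound for [g] bounds the entries of the
    inverse. *)
Lemma opbd_inv r g u i : opbd r g ->
  knsq ((umx (repr g)^-1%g *m u) i 0) <= r * normsq u.
Proof.
move=> hr; rewrite -hdot_delta -hform_J -(hform_umx (repr g)) mulmxA.
have -> : umx (repr g) *m (umx (repr g)^-1%g *m u) = u.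
  by rewrite mulmxA -[_ *m umx _^-1%g]/(umx (repr g * (repr g)^-1)%g) mulgV mul1mx.
rewrite -mulmxA; apply: le_trans (hform_bound _ _) _.
apply: ler_wpM2r; first exact: normsq_ge0.
by apply: le_trans (hr _) _; rewrite normsq_J normsq_delta mulr1.
Qed.

Lemma knsq_lt (c : K) (e : R) : 0 < e -> knsq c < e ^+ 2 -> knorm c < e.
Proof.
move=> e0; rewrite -(@knorm_sqr R k) ltr_pXn2r ?nnegrE ?knorm_ge0 //.
exact: ltW.
Qed.

(** Discreteness is applied at the identity only: [g^-1 h - 1] equals [g^-1 (h - g)], which is small
    when [h - g] is small, uniformly over operators bounded by [r]. *)
Lemma uniform_discrete S r : 0 < r -> subgroup S -> discrete_in_G S -> exists2 d, 0 < d &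
  forall g h, S g -> S h -> opbd r g ->
  (forall i, normsq ((umx (repr h) - umx (repr g)) *m (delta_mx i 0 : V)) <= d) -> g = h.
Proof.
move=> r0 sS dS.
have S1 : S (\pi 1%g) by exact: sS.1.
have [e e0 he] := dS 1%g S1.
have rd : r * (e ^+ 2 / r / 2) < e ^+ 2.
  have -> : r * (e ^+ 2 / r / 2) = e ^+ 2 / 2 by field; rewrite gt_eqF.
  have := exprn_gt0 2 e0; lra.
exists (e ^+ 2 / r / 2); first by rewrite !divr_gt0 ?exprn_gt0.
move=> g h Sg Sh bg hd.
have : \pi_G ((repr g)^-1 * repr h)%g = \pi_G 1%g.
  apply: he => [|i j].
    by rewrite -pi_mul reprK; apply: (subgroupM sS) => //; exact: (subgroupV sS).
  have E : umx ((repr g)^-1 * repr h)%g - umx 1%g =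
      umx (repr g)^-1%g *m (umx (repr h) - umx (repr g)).
    rewrite mulmxBr; congr (_ - _).
    by rewrite -[RHS]/(umx ((repr g)^-1 * repr g)%g) mulVg.
  apply: knsq_lt => //.
  have -> : umx ((repr g)^-1 * repr h)%g i j - umx 1%g i j =
      (umx (repr g)^-1%g *m ((umx (repr h) - umx (repr g)) *m (delta_mx j 0 : V))) i 0.
    by rewrite mulmxA -E -colE !mxE.
  apply: le_lt_trans (opbd_inv _ _ bg) _.
  by apply: le_lt_trans rd; rewrite ler_pM2l.
rewrite -pi_mul reprK => /(congr1 (fun x => g * x)%g).
by rewrite -[PUJmul _ _]/(g^-1 * h)%g -[\pi 1%g]/(1%g : G) mulgA mulgV mul1g mulg1.
Qed.

Lemma knsq_comps (c : K) (e : R) : 0 <= e ->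
  (forall l : 'I_4, `|nth 0 [:: qr (sval c); qi (sval c); qj (sval c); qk (sval c)] l| <= e) ->
  knsq c <= 4 * e ^+ 2.
Proof.
move=> e0 h.
have t (x : R) : `|x| <= e -> x ^+ 2 <= e ^+ 2.
  by move=> hx; rewrite -real_normK ?num_real // ler_pXn2r ?nnegrE.
have := t _ (h ord0); have := t _ (h (@Ordinal 4 1 isT)).
have := t _ (h (@Ordinal 4 2 isT)); have := t _ (h (@Ordinal 4 3 isT)).
by rewrite knsqE /=; lra.
Qed.
Lemma comp_le_knsq (c : K) (e : R) (l : 'I_4) : 0 <= e -> knsq c <= e ^+ 2 ->
  `|nth 0 [:: qr (sval c); qi (sval c); qj (sval c); qk (sval c)] l| <= e.
Proof.
move=> e0; rewrite knsqE => h.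
have t (x : R) := sqr_ge0 x.
have t2 (x : R) : x ^+ 2 <= e ^+ 2 -> `|x| <= e.
  by move=> hx; rewrite -(@ler_pXn2r _ 2) ?nnegrE // real_normK ?num_real.
have := t (qr (sval c)); have := t (qi (sval c)).
have := t (qj (sval c)); have := t (qk (sval c)).
by case: l => -[|[|[|[|//]]]] ? /=; move=> *; apply: t2; lra.
Qed.

(* Pigeonhole over a grid of cells in the space of matrix entries. *)
Lemma bounded_finite S r : 0 < r -> subgroup S -> discrete_in_G S ->
  exists m : nat, forall s : seq G, uniq s ->
    (forall g, g \in s -> S g /\ opbd r g) -> (size s <= m)%N.
Proof.
move=> r0 sS dS; have [d d0 hd] := uniform_discrete r0 sS dS.
have NR : 0 < 4 * N%:R :> R by rewrite mulr_gt0 // ltr0n.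
have [e e0 he] : exists2 e : R, 0 < e & N%:R * (4 * e ^+ 2) <= d.
  exists (Num.sqrt (d / (4 * N%:R))); first by rewrite sqrtr_gt0 divr_gt0.
  rewrite sqr_sqrtr ?divr_ge0 ?(ltW d0) ?(ltW NR) //.
  suff -> : N%:R * (4 * (d / (4 * N%:R))) = d by [].
  by move: NR; move: (N%:R) => x NR; field; rewrite gt_eqF //; clear -NR; lra.
pose cp (c : K) (l : 'I_4) := nth 0 [:: qr (sval c); qi (sval c); qj (sval c); qk (sval c)] l.
pose r1 := r + 1; have r10 : 0 < r1 by rewrite addr_gt0.
pose m := Num.truncn (2 * r1 / e).
pose cell (g : G) : {ffun 'I_N * 'I_N * 'I_4 -> 'I_m.+1} :=
  [ffun ijl => inord (Num.truncn ((cp (umx (repr g) ijl.1.1 ijl.1.2) ijl.2 + r1) / e))].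
have ent g i j l : opbd r g -> `|cp (umx (repr g) i j) l| <= r1.
  move=> bg; apply: comp_le_knsq; first exact: ltW.
  have -> : umx (repr g) i j = (umx (repr g) *m (delta_mx j 0 : V)) i 0.
    by rewrite -colE mxE.
  apply: le_trans (normsq_coord _ _) _; apply: le_trans (bg _) _.
  by rewrite normsq_delta mulr1 /r1; clear -r0; nra.
have cell_inj g h : S g -> S h -> opbd r g -> opbd r h -> cell g = cell h -> g = h.
  move=> Sg Sh bg bh ec; apply: hd => // j; apply: le_trans he.
  rewrite -colE normsqE.
  suff hh i : knsq (col j (umx (repr h) - umx (repr g)) i 0) <= 4 * e ^+ 2.
    apply: le_trans (ler_sum _ (fun i _ => hh i)) _.
    by rewrite sumr_const card_ord -[leLHS]mulr_natl.
  rewrite mxE mxE [X in _ + X]mxE; apply: knsq_comps; first exact: ltW.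
  move=> l.
  have -> : nth 0 [:: qr (sval (umx (repr h) i j - umx (repr g) i j));
      qi (sval (umx (repr h) i j - umx (repr g) i j));
      qj (sval (umx (repr h) i j - umx (repr g) i j));
      qk (sval (umx (repr h) i j - umx (repr g) i j))] l =
      cp (umx (repr h) i j) l - cp (umx (repr g) i j) l.
    by case: l => -[|[|[|[|//]]]].
  move: ec => /ffunP/(_ (i, j, l)); rewrite !ffunE /= => /(congr1 (@nat_of_ord _)).
  move: (ent g i j l bg) (ent h i j l bh); move: (cp _ l) (cp _ l) => x y.
  rewrite !ler_norml => /andP[y1 y2] /andP[x1 x2].
  have T (z : R) : - r1 <= z -> z <= r1 -> (Num.truncn ((z + r1) / e) < m.+1)%N /\
      (Num.truncn ((z + r1) / e))%:R * e <= z + r1 < (Num.truncn ((z + r1) / e)).+1%:R * e.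
    move=> z1 z2; split.
      rewrite ltnS; apply: le_truncn; rewrite ler_pM2r ?invr_gt0 //; clear -z2; lra.
    have z0 : 0 <= (z + r1) / e by rewrite divr_ge0 ?(ltW e0) //; clear -z1; lra.
    by have := truncn_itv z0; rewrite ler_pdivlMr // ltr_pdivrMr.
  have [tx hx] := T x x1 x2; have [ty hy] := T y y1 y2.
  rewrite !inordK // => exy; move: hx hy; rewrite exy.
  move: (Num.truncn _) => a; rewrite -natr1 mulrDl mul1r => /andP[u1 u2] /andP[v1 v2].
  by apply/andP; clear -u1 u2 v1 v2; split; lra.
exists #|{: {ffun 'I_N * 'I_N * 'I_4 -> 'I_m.+1}}| => s us hs.
rewrite -(size_map cell); have um : uniq (map cell s).
  rewrite map_inj_in_uniq // => g h gs hs'; have [Sg bg] := hs g gs.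
  by have [Sh bh] := hs h hs'; exact: cell_inj.
by move/card_uniqP: um => <-; exact: max_card.
Qed.

Lemma opbd_exists g : exists m : nat, opbd m.+1%:R g.
Proof.
pose c := \sum_i normsq (\col_j kconj (umx (repr g) i j)).
have [m hm] : exists m : nat, c <= m.+1%:R.
  exists (Num.truncn c); have c0 : 0 <= c by apply: sumr_ge0 => i _; exact: normsq_ge0.
  by have /andP[_ /ltW] := truncn_itv c0.
exists m => u; apply: (@le_trans _ _ (c * normsq u)); last first.
  by apply: ler_wpM2r => //; exact: normsq_ge0.
rewrite normsqE mulr_suml; apply: ler_sum => i _.
apply: le_trans (hdot_CS _ _); rewrite le_eqVlt; apply/orP; left; apply/eqP; congr knsq.
by rewrite hdot_sum mxE; apply: eq_bigr => j _; rewrite mxE kconjK.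
Qed.

(** Every operator has some integer bound, so [S] is a countable union of finite sets. *)
Lemma discrete_countable S : subgroup S -> discrete_in_G S -> countable S.
Proof.
move=> sS dS.
have -> : S = \bigcup_m [set g | S g /\ opbd m.+1%:R g].
  apply/seteqP; split=> [g Sg|g [m _ []] //].
  by have [m hm] := opbd_exists g; exists m.
apply: bigcup_countable => // m _; apply: finite_set_countable.
have [l hl] := @bounded_finite S m.+1%:R (ltr0Sn _ _) sS dS.
apply: contrapT => /(infinite_set_fset l.+1)[B BS sB].
have := hl (enum_fset B) (fset_uniq B); rewrite leqNgt sB => h.
by suff : false by []; apply: h => g gB; exact: BS.
Qed.
End DiscreteSets.

(** * Cusps of the modular group *)

Section CFBasics.
Context {R : realType} {k : scalars} {n : nat} (n_gt0 : (0 < n)%N).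
Local Notation K := (scalar R k).
Local Notation G := (PUJ R k n).
Implicit Types (p q : kpoint R k n) (x y : xkpoint R k n) (g : G).

(** Test points on a real line of X. The line lies in k^n because Im(k) is trivial for real scalars;
    its points are distinct since [n] is positive. *)
Definition ptX (t : R) : kpoint R k n := (const_mx (kreal k t), 0).

Lemma ptX_in t : in_X (ptX t). Proof. by rewrite /in_X kre0. Qed.
Lemma ptX_normsq s t : normsq ((ptX s).1 - (ptX t).1) = n%:R * (s - t) ^+ 2.
Proof.
rewrite normsqE (eq_bigr (fun=> (s - t) ^+ 2)) ?sumr_const ?card_ord -1?[LHS]mulr_natl //.
by move=> i _; rewrite !mxE -krealB knsq_kreal.
Qed.
Lemma ptX_pr s t : n%:R * (s - t) ^+ 2 <= pr (Some (ptX s)) (Some (ptX t)).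
Proof. by rewrite -ptX_normsq; apply: pr_normsq; apply: in_X_good; exact: ptX_in. Qed.
Lemma ptX_pr_gt0 s t : s != t -> 0 < pr (Some (ptX s)) (Some (ptX t)).
Proof.
move=> st; apply: lt_le_trans (ptX_pr s t).
by rewrite mulr_gt0 ?ltr0n // lt0r sqrf_eq0 subr_eq0 st sqr_ge0.
Qed.
Lemma ptX0 : ptX 0 = 0.
Proof. by rewrite /ptX kreal0; congr (_, _); apply/matrixP => i j; rewrite !mxE. Qed.
Lemma pr_self p : in_X p -> pr (Some p) (Some p) = 0.
Proof.
move=> pX; rewrite pr_phi hform_phi_self; move: pX; rewrite /in_X => ->.
by rewrite mulr0 kreal0; apply/eqP; rewrite -sqrf_eq0 knorm_sqr knsq0.
Qed.
Lemma ptX_neq0 s : s != 0 -> ptX s != 0.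
Proof.
by move/ptX_pr_gt0; rewrite ptX0; apply: contraTneq => ->; rewrite pr_self ?ltxx // /in_X kre0.
Qed.

Lemma good_inf : good (None : xkpoint R k n). Proof. by []. Qed.

Lemma mob_finite g p : good (Some p) -> xmob g None = None ->
  xmob g (Some p) = Some (mob g p).
Proof.
move=> gp g0; rewrite /mob; case e: (xmob g (Some p)) => [q|] //=.
by move: e; rewrite -g0 => /xmob_inj; case/(_ gp good_inf).
Qed.

Lemma nu_mul_inf g p : good (Some p) -> xmob g None = None ->
  nu g (Some p) * nu g None = 1.
Proof.
move=> gp g0; have := pr_xmob g gp good_inf.
by rewrite g0 mob_finite // [pr _ None]prC pr_inf mul1r prC pr_inf.
Qed.

(** Isometry on two test points makes the product of their multipliers 1, while pairing each with oo
    gives [nu g p * nu g oo = 1]. Hence the multiplier at oo is 1. *)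
Lemma IsomX_nu g x : IsomX g -> good x -> nu g x = 1.
Proof.
move=> [g0 gd] gx.
have X1 := in_X_good (ptX_in 1); have X2 := in_X_good (ptX_in 2).
have h12 := pr_xmob g X1 X2.
have p12 : 0 < pr (Some (ptX 1)) (Some (ptX 2)) by apply: ptX_pr_gt0; rewrite lt_eqF // ltr1n.
have i1 := mob_finite X1 g0; have i2 := mob_finite X2 g0.
have m1 := xmob_X (ptX_in 1) i1; have m2 := xmob_X (ptX_in 2) i2.
move: h12; rewrite i1 i2 (pr_cdist (in_X_good m1) m2) gd; try exact: ptX_in.
rewrite -(pr_cdist X1 (ptX_in 2)) -[RHS]mulr1 => /(mulfI (lt0r_neq0 p12)) h.
have n0 : nu g None = 1.
  have a1 := nu_mul_inf X1 g0; have a2 := nu_mul_inf X2 g0.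
  have z0 := nu_gt0 g good_inf.
  move: h a1 a2 z0; move: (nu g None) (nu g _) (nu g _) => c a b h a1 a2 z0.
  have : c * c = 1 by rewrite -[LHS]mul1r -{1}h mulrACA a1 a2 mulr1.
  by move=> cc; apply/eqP; rewrite -(@eqrXn2 _ 2) ?(ltW z0) // expr1n expr2 cc.
by case: x gx => [p gp|//]; have := nu_mul_inf gp g0; rewrite n0 mulr1.
Qed.

Section Inversion.
Variable iota : G.
Hypothesis iotaP : is_inversion iota.
Let i0 : xmob iota (Some 0) = None. Proof. by case: iotaP. Qed.
Let iinf : xmob iota None = Some 0. Proof. by case: iotaP. Qed.
Let good0 : good (Some (0 : kpoint R k n)). Proof. exact/in_X_good/in_X0. Qed.

Lemma good_HX p : good (Some p) -> in_H p \/ in_X p.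
Proof. by rewrite /good le_eqVlt => /orP[/eqP h|h]; [right|left]. Qed.

Lemma inv_finite p : good (Some p) -> p != 0 -> xmob iota (Some p) = Some (mob iota p).
Proof.
move=> gp p0; rewrite /mob; case e: (xmob iota (Some p)) => [q|] //=.
have h := xmob_inj gp good0 (etrans e (esym i0)).
by move/(congr1 (odflt 0)): h => /= /eqP h; rewrite h in p0.
Qed.

Lemma pr0_gt0 p : good (Some p) -> p != 0 -> 0 < pr (Some p) (Some 0).
Proof.
move=> gp p0; rewrite lt0r pr_ge0 andbT; apply/eqP => h.
have := prE gp good0; rewrite h subr0 kre0 addr0 => h2.
have n0 := normsq_ge0 p.1; have k0 : 0 <= kre p.2 := gp.
have hz : p.1 = 0 by apply: normsq_eq0; apply/eqP; rewrite eq_le n0 andbT; lra.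
have : hform (phi p) (phi 0) = 0.
  apply/eqP; rewrite -knsq_eq0 -(@knorm_sqr R k) sqrf_eq0.
  by rewrite -(pr_phi p 0) h.
rewrite hform_phi hz !normsq0 kreal0 !addr0 hdot0l mul0rn sub0r oppr0 sub0r => /eqP.
rewrite oppr_eq0 => /eqP/(congr1 (@kconj R k)); rewrite kconjK kconj0 => p2.
by move/eqP: p0; apply; case: p {gp h h2 n0 k0} hz p2 => a b /= -> ->.
Qed.

Lemma nu_inv_pair p : good (Some p) -> p != 0 ->
  nu iota (Some p) * nu iota None = pr (Some p) (Some 0).
Proof.
move=> gp p0; have gi := good_xmob iota gp; rewrite inv_finite // in gi.
have := pr_xmob iota gp good_inf.
rewrite iinf inv_finite // (pr_gauge gi) [pr _ None]prC pr_inf.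
have [_ _ /(_ p (good_HX gp) p0)[-> _]] := iotaP.
have pp := pr0_gt0 gp p0; rewrite exprVn -(pr_gauge gp) => h.
by rewrite -[LHS]mul1r -(divff (lt0r_neq0 pp)) -mulrA h mulr1.
Qed.

(** [nu_inv_pair] only determines the product with the multiplier at oo. The distance formula at two
    test points makes the square of that multiplier 1. *)
Lemma nu_inv_inf : nu iota None = 1.
Proof.
have X1 := in_X_good (ptX_in 1); have X2 := in_X_good (ptX_in 2).
have z1 : ptX 1 != 0 by apply: ptX_neq0; rewrite oner_eq0.
have z2 : ptX 2 != 0 by apply: ptX_neq0; rewrite pnatr_eq0.
have p12 : 0 < pr (Some (ptX 1)) (Some (ptX 2)) by apply: ptX_pr_gt0; rewrite lt_eqF // ltr1n.
have [_ _ H] := iotaP.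
have [g1 H1] := H (ptX 1) (good_HX X1) z1; have [g2 _] := H (ptX 2) (good_HX X2) z2.
have H12 := H1 (ptX 2) (ptX_in 2) z2.
have J1 := inv_finite X1 z1; have J2 := inv_finite X2 z2.
have m1 := xmob_X (ptX_in 1) J1; have m2 := xmob_X (ptX_in 2) J2.
have := pr_xmob iota X1 X2; rewrite J1 J2 (pr_cdist (in_X_good m1) m2) H12.
have a1 := nu_inv_pair X1 z1; have a2 := nu_inv_pair X2 z2.
have c0 := nu_gt0 iota good_inf.
rewrite expr_div_n -(pr_cdist X1 (ptX_in 2)) exprMn -(pr_gauge X1) -(pr_gauge X2) -a1 -a2.
have v1 := nu_gt0 iota X1; have v2 := nu_gt0 iota X2.
move: (nu iota None) (nu iota (Some (ptX 1))) (nu iota (Some (ptX 2))) (pr _ _) c0 v1 v2 p12 => c a b P c0 a0 b0 P0 h.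
have : c * c = 1.
  have X0 : a * c * (b * c) != 0 by rewrite gt_eqF ?mulr_gt0.
  have h2 : P * (a * b) = P * (a * b * (c * c)).
    have h3 : P * (a * b) = P * (a * c * (b * c)).
      by rewrite -[in RHS]h [RHS]mulrAC divfK.
    by rewrite h3; congr (_ * _); ring.
  have ab0 : a * b != 0 by rewrite gt_eqF ?mulr_gt0.
  apply: (mulfI ab0); rewrite mulr1; apply: (mulfI (lt0r_neq0 P0)); exact/esym.
by move=> cc; apply/eqP; rewrite -(@eqrXn2 _ 2) ?(ltW c0) // expr1n expr2 cc.
Qed.

Lemma nu_inv p : good (Some p) -> p != 0 -> nu iota (Some p) = pr (Some p) (Some 0).
Proof. by move=> gp p0; rewrite -nu_inv_pair // nu_inv_inf mulr1. Qed.
End Inversion.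

Section Algorithm.
#[local] Opaque gauge mob xmob cdist.
Context (A : iwasawa_cf R k n).
Local Notation iota := (cf_inv A).
Local Notation Z := (cf_lattice A).
Local Notation D := (cf_domain A).
Local Notation Mod := (cf_modular A).

Lemma Mod_subgroup : subgroup Mod. Proof. exact: generated_subgroup. Qed.
Lemma Mod_inv : Mod iota. Proof. by apply: generated_incl; left. Qed.
Lemma Mod_Z g : Z g -> Mod g. Proof. by move=> h; apply: generated_incl; right. Qed.
Lemma Mod1 : Mod 1%g. Proof. exact: Mod_subgroup.1. Qed.
Lemma ModM g h : Mod g -> Mod h -> Mod (g * h)%g.
Proof. exact: subgroupM Mod_subgroup g h. Qed.
Lemma ModV g : Mod g -> Mod g^-1%g. Proof. exact: subgroupV Mod_subgroup g. Qed.
Lemma Z_subgroup : subgroup Z. Proof. by case: (cf_latticeP A). Qed.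
Lemma ZV g : Z g -> Z g^-1%g. Proof. exact: subgroupV Z_subgroup g. Qed.
Lemma Z_isom g : Z g -> IsomX g. Proof. by case: (cf_latticeP A) => _ + _ _; apply. Qed.
Lemma Z_inf g : Z g -> xmob g None = None. Proof. by case/Z_isom. Qed.
Lemma Z_nu g x : Z g -> good x -> nu g x = 1. Proof. by move/Z_isom; exact: IsomX_nu. Qed.
Lemma Z_finite g p : Z g -> good (Some p) -> xmob g (Some p) = Some (mob g p).
Proof. by move=> /Z_inf h gp; apply: mob_finite. Qed.
Lemma Z_pr g x y : Z g -> good x -> good y -> pr (xmob g x) (xmob g y) = pr x y.
Proof. by move=> Zg gx gy; rewrite -[RHS](pr_xmob g) // !Z_nu // !mulr1. Qed.
Lemma Z_X g p : Z g -> in_X p -> in_X (mob g p).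
Proof. by move=> Zg pX; have := Z_finite Zg (in_X_good pX); exact: xmob_X. Qed.
Lemma D_X p : D p -> in_X p. Proof. by case: (cf_domainP A) => -[+ _ _ _]; apply. Qed.
Lemma D_cover p : in_X p -> exists2 g, Z g & exists2 q, D q & mob g q = p.
Proof.
case: (cf_domainP A) => _ e _ pX; have : in_X p by [].
by rewrite e => -[g Zg [q Dq <-]]; exists g => //; exists q.
Qed.
Lemma round_Z p : in_X p -> Z (cf_round A p). Proof. by case/(cf_roundP A). Qed.
Lemma round_D p : in_X p -> D (mob (cf_round A p)^-1%g p).
Proof. by case/(cf_roundP A). Qed.

Lemma gauge_isom g p : Z g -> in_X p -> gauge (mob g p) <= gauge p + gauge (mob g 0).
Proof.
move=> Zg pX; have gp := in_X_good pX; have mX := Z_X Zg pX; have zX := Z_X Zg (@in_X0 R k n).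
have g0 := in_X_good (@in_X0 R k n).
have e := Z_pr Zg gp g0; rewrite (Z_finite Zg gp) (Z_finite Zg g0) in e.
move: (mob g 0) (mob g p) zX mX e => w v wX vX e.
rewrite (gauge_pr (in_X_good vX)) (gauge_pr gp) (gauge_pr (in_X_good wX)) -e.
exact: (pr_triangle (in_X_good vX) wX g0).
Qed.

Lemma conjg_inj2 (N : G) : injective (fun g => N * g * N^-1)%g.
Proof.
move=> g1 g2 /(congr1 (fun a : G => N^-1 * a * N)%g).
by rewrite !mulgA mulVg !mul1g -!mulgA mulVg !mulg1.
Qed.

(** The displacement of [q] equals [c^2 * pr h (g h)]. Passing through [y] and [g y] bounds the
    square root of this pairing by [2 / c + (2 + b)], and [c <= 1 / (2 + b)] turns the product with
    [c] into at most 3. *)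
Lemma conj_displacement (N g : G) (h y q : kpoint R k n) (c b : R) :
  0 < c -> 0 <= b -> Z g -> good (Some h) -> in_X y -> nu N (Some h) = c^-1 ->
  xmob N (Some h) = Some q -> pr (Some h) (Some y) = c ^- 2 -> gauge y <= 1 ->
  gauge (mob g 0) <= b -> c <= (2 + b)^-1 ->
  pr (Some q) (xmob (N * g * N^-1)%g (Some q)) * nu (N * g * N^-1)%g (Some q) <= 9.
Proof.
move=> c0 b0 Zg gh yX nuh Nh prhy y1 gb cb.
have gq : good (Some q) by rewrite -Nh; exact: good_xmob.
have gy := in_X_good yX.
have Nq : xmob N^-1%g (Some q) = Some h by rewrite -Nh xmobK.
rewrite -mulgA (nuM N (g * N^-1)%g gq) (xmobM N (g * N^-1)%g gq) (nuM g N^-1%g gq).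
rewrite (xmobM g N^-1%g gq) Nq (Z_nu Zg gh) mul1r.
have -> : nu N^-1%g (Some q) = c by rewrite -Nh (nuV N gh) nuh; exact: invrK.
have gah := good_xmob g gh.
have e := pr_xmob N gh gah; rewrite Nh nuh in e.
have -> : pr (Some q) (xmob N (xmob g (Some h))) * (nu N (xmob g (Some h)) * c) =
    c ^+ 2 * pr (Some h) (xmob g (Some h)).
  rewrite -e; move: (nu N (xmob g _)) (pr (Some q) _) => u v.
  by field; rewrite gt_eqF.
have gfin := Z_finite Zg gh; have gX := Z_X Zg yX.
have p1 : Num.sqrt (pr (Some h) (Some y)) = c^-1.
  by rewrite prhy -exprVn sqrtr_sqr ger0_norm // invr_ge0 ltW.
have p2 : Num.sqrt (pr (Some (mob g y)) (Some (mob g h))) = c^-1.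
  have e2 := Z_pr Zg gy gh; rewrite (Z_finite Zg gy) gfin in e2.
  by rewrite e2 prC p1.
have t4 := gauge_isom Zg yX.
rewrite gfin in gah *.
move: (mob g y) (mob g h) (mob g 0) gah gX p2 t4 gb => v w o gah gX p2 t4 gb.
have t1 := pr_triangle gh yX gah.
have t2 := pr_triangle gy gX gah.
have t3 := pr_triangle gy (@in_X0 R k n) (in_X_good gX).
rewrite -(gauge_pr gy) [pr (Some 0) _]prC -(gauge_pr (in_X_good gX)) in t3.
rewrite p1 in t1; rewrite p2 in t2.
have p0 := pr_ge0 (Some h) (Some w).
have s0 := sqrtr_ge0 (pr (Some h) (Some w)).
rewrite -(sqr_sqrtr p0) -exprMn.
have T : Num.sqrt (pr (Some h) (Some w)) <= 2 * c^-1 + (2 + b) by lra.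
move: (Num.sqrt _) T s0 => s T s0.
have b2 : 0 < 2 + b by rewrite ltr_wpDr.
have cb' : c * (2 + b) <= 1 by rewrite -ler_pdivlMr // mul1r.
have s3 : c * s <= 3.
  apply: (@le_trans _ _ (c * (2 * c^-1 + (2 + b)))); first by rewrite ler_pM2l.
  rewrite mulrDr mulrCA (divff (lt0r_neq0 c0)); lra.
have : 0 <= c * s by rewrite mulr_ge0 // ltW.
by move: (c * s) s3 => z; nra.
Qed.

Section Proper.
Hypothesis A_proper : cf_proper A.

Lemma rad_bound : exists2 r : R, 0 < r < 1 & forall p, D p -> gauge p <= r.
Proof.
move: A_proper; rewrite /cf_proper.
have ub p : D p -> ((gauge p)%:E <= cf_rad A)%E.
  by move=> Dp; apply: ereal_sup_ubound; exists p.
case: (cf_rad A) ub => [r|//|] ub h.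
  exists (Num.max r 2^-1).
    by rewrite lt_max invr_gt0 ltr0n orbT gt_max -lte_fin h invf_lt1 // ltr1n.
  by move=> p Dp; rewrite le_max -lee_fin ub.
exists 2^-1; first by rewrite invr_gt0 ltr0n invf_lt1 // ltr1n.
by move=> p /ub; rewrite leeNy_eq.
Qed.

Lemma D_gauge_lt1 p : D p -> gauge p < 1.
Proof. by have [r /andP[_ r1] h] := rad_bound => /h/le_lt_trans; apply. Qed.

(** Finitely many translates of the bounded domain cannot cover the unbounded space X. *)
Lemma Z_infinite : infinite_set Z.
Proof.
move=> /finite_seqP[s es].
pose b := \sum_(g <- s) gauge (mob g 0 : kpoint R k n).
have hb p : in_X p -> gauge p <= 1 + b.
  move=> /D_cover[g Zg [q Dq <-]]; apply: le_trans (gauge_isom Zg (D_X Dq)) _.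
  apply: lerD; first exact/ltW/D_gauge_lt1.
  have gs : g \in s by have : [set` s] g by rewrite -es.
  rewrite /b (big_rem g) //= lerDl sumr_ge0 // => h _; exact: gauge_ge0.
have := hb (ptX (2 + b)) (ptX_in _); rewrite leNgt => /negP; apply.
have b0 : 0 <= b by apply: sumr_ge0 => g _; exact: gauge_ge0.
rewrite -(@ltr_pXn2r _ 2) ?nnegrE ?gauge_ge0 ?addr_ge0 //.
rewrite -(pr_gauge (in_X_good (ptX_in _))) -ptX0; apply: lt_le_trans (ptX_pr _ _).
rewrite subr0; apply: (@lt_le_trans _ _ ((2 + b) ^+ 2)).
  by rewrite ltr_pXn2r ?nnegrE ?addr_ge0 // ltrD2r ltr1n.
by rewrite ler_peMl ?sqr_ge0 // ler1n.
Qed.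

Hypotheses (A_complete : cf_complete A) (A_discrete : cf_discrete A).

(* A parabolic a of the cusp oo, conjugated by N, moves the point at height 1 above the
   cusp N oo by a bounded amount when nu N oo is small; since there are arbitrarily many
   such a, discreteness bounds nu N oo from below. *)
Lemma cusp_bound : exists2 kp : R, 0 < kp <= 1 &
  forall N, Mod N -> xmob N None <> None -> kp <= nu N None.
Proof.
have sq2 (c : R) : c ^- 2 = c^-1 * c^-1 by rewrite -exprVn expr2.
have r0 : 0 < 663 * (80 * 26) :> R by rewrite !mulr_gt0 ?ltr0n.
have [m hm] := bounded_finite r0 Mod_subgroup A_discrete.
(* One lattice element more than discreteness allows among bounded operators; [b] bounds the
   translation of 0 by each of them. *)
have [B BZ mB] := infinite_set_fset m.+1 Z_infinite.
pose b := \sum_(g <- enum_fset B) gauge (mob g 0 : kpoint R k n).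
have b0 : 0 <= b by apply: sumr_ge0 => g _; exact: gauge_ge0.
have hb g : g \in enum_fset B -> gauge (mob g 0) <= b.
  by move=> gs; rewrite /b (big_rem g) //= lerDl sumr_ge0 // => h _; exact: gauge_ge0.
have b1 : 0 < 2 + b by rewrite ltr_wpDr.
exists (2 + b)^-1; first by rewrite invr_gt0 b1 invf_le1 // (le_trans (ler1n _ 2)) // lerDl.
move=> N0 MN0 N0inf.
(* normalisation: both N oo and N^-1 oo in the fundamental domain *)
have [N [MN eN [y Dy hy] [y' Dy' hy']]] : exists N, [/\ Mod N, nu N0 None = nu N None,
    exists2 y, D y & xmob N None = Some y & exists2 y, D y & xmob N^-1%g None = Some y].
  case e1: (xmob N0 None) N0inf => [z|//] _.
  have zX : in_X z.
    have := xht_xmob N0 good_inf; rewrite e1 /= => /eqP.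
    rewrite mulf_eq0 sqrf_eq0 (gt_eqF (nu_gt0 _ _)) // orbF => /eqP; exact.
  case e2: (xmob N0^-1%g None) => [z'|]; last first.
    by have := @xmobKV R k n N0 None good_inf; rewrite e2 e1.
  have zX' : in_X z'.
    have := xht_xmob N0^-1%g good_inf; rewrite e2 /= => /eqP.
    rewrite mulf_eq0 sqrf_eq0 (gt_eqF (nu_gt0 _ _)) // orbF => /eqP; exact.
  pose c := (cf_round A z)^-1%g; pose d := cf_round A z'.
  have Zc : Z c by apply: ZV; exact: round_Z.
  have Zd : Z d by exact: round_Z.
  exists (c * N0 * d)%g; split.
  - by apply: ModM; [apply: ModM => //|]; exact: Mod_Z.
  - rewrite !nuM // Z_inf // (Z_nu Zd) // mulr1 (Z_nu Zc) ?mul1r //.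
    by rewrite e1; exact: in_X_good.
  - exists (mob c z); first exact: round_D.
    by rewrite !xmobM // Z_inf // e1 Z_finite //; exact: in_X_good.
  exists (mob d^-1%g z'); first exact: round_D.
  rewrite !invgM !xmobM // (Z_inf (ZV Zc)) e2 Z_finite //; first exact: ZV.
  exact: in_X_good.
rewrite eN leNgt; apply/negP => cb.
have gI := good_inf.
have [c ec] : exists c, c = nu N None by exists (nu N None).
have c0 : 0 < c by rewrite ec; exact: nu_gt0.
rewrite -ec in cb.
(* The point above [y' = N^-1 oo] whose height [c ^- 2] is chosen so that its image under [N] has
   height 1. *)
have [h eh] : exists h : kpoint R k n, h = (y'.1, y'.2 + kreal k (c ^- 2)) by eexists.
have yX' := D_X Dy'; have yX := D_X Dy; have gy := in_X_good yX; have gy' := in_X_good yX'.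
have hh : ht h = c ^- 2 by rewrite eh /ht kreD kre_kreal; move: yX'; rewrite /in_X => ->; rewrite add0r.
have hH : in_H h by rewrite /in_H -/(ht h) hh invr_gt0 exprn_gt0.
have gh := in_H_good hH.
have prhy : pr (Some h) (Some y') = c ^- 2.
  have kre0' : kre y'.2 = 0 := yX'.
  have i0 : 0 <= c ^- 2 by rewrite invr_ge0 exprn_ge0 // ltW.
  rewrite pr_phi; have -> : hform (phi h) (phi y') = kreal k (- c ^- 2).
    rewrite eh; clear -kre0'.
    apply: (can_inj (@opprK K)); rewrite -krealN opprK.
    rewrite [LHS]kreimE [RHS]kreimE; congr (kreal k _ + _).
      by rewrite kreN kre_hform_phi /= subrr normsq0 kreD kre_kreal kre0'; ring.
    rewrite kim_kreal kimN kim_hform_phi /= hdot_normsq kim_kreal mul0rn sub0r kimD kim_kreal.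
    by rewrite addr0 addNr oppr0.
  by rewrite knorm_kreal normrN ger0_norm.
have Ny' : xmob N (Some y') = None by rewrite -hy' xmobKV.
have nuy' : nu N (Some y') = c^-1.
  have := pr_xmob N gy' gI; rewrite Ny' hy pr_inf prC pr_inf mul1r -ec => e.
  by rewrite -[LHS]mulr1 -(divff (lt0r_neq0 c0)) mulrA e mul1r.
have [q [Nh qH]] : exists q, xmob N (Some h) = Some q /\ in_H q.
  by exists (mob N h); exact: xmob_H.
have gq := in_H_good qH.
have nuh : nu N (Some h) = c^-1.
  have := pr_xmob N gh gy'; rewrite Ny' Nh prC pr_inf mul1r prhy nuy' => e.
  have c1 : 0 < c^-1 by rewrite invr_gt0.
  apply: (mulIf (lt0r_neq0 c1)); rewrite e; exact: sq2.
have hq : ht q = 1.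
  have := xht_xmob N gh; rewrite Nh /= nuh -/(ht q) -/(ht h) hh => e; rewrite exprVn in e.
  have ci : 0 < c ^- 2 by rewrite invr_gt0 exprn_gt0.
  by apply: (mulIf (lt0r_neq0 ci)); rewrite mul1r.
have prqy : pr (Some q) (Some y) = 1.
  have e := pr_xmob N gh gI; rewrite Nh hy nuh -ec (mulVf (lt0r_neq0 c0)) mulr1 in e.
  rewrite e prC; exact: pr_inf.
have bq : pr (Some q) (Some 0) <= 4.
  have := pr_triangle gq yX (in_X_good (@in_X0 R k n)); rewrite prqy sqrtr1 -(gauge_pr gy).
  have := D_gauge_lt1 Dy; have := pr_ge0 (Some q) (Some 0) => p0 y1 s1.
  have s0 := sqrtr_ge0 (pr (Some q) (Some 0)).
  rewrite -(sqr_sqrtr p0); move: s1 s0.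
  by move: (Num.sqrt _) => s s1 s0; clear -y1 s0 s1; nra.
have key g : g \in enum_fset B -> opbd (663 * (80 * 26)) (N * g * N^-1)%g.
  move=> gB; have Zg : Z g by exact: BZ.
  apply: (operator_bound hq bq).
  exact: (conj_displacement c0 b0 Zg gh yX' nuh Nh prhy (ltW (D_gauge_lt1 Dy')) (hb _ gB) (ltW cb)).
have := hm [seq (N * g * N^-1)%g | g <- enum_fset B]; rewrite size_map leqNgt mB.
move=> hf; suff : false by []; apply: hf => [|g /mapP[a aB ->]].
  by rewrite (map_inj_uniq (@conjg_inj2 N)) fset_uniq.
split; last exact: key.
apply: ModM; last exact: ModV.
by apply: (ModM MN); apply: Mod_Z; exact: BZ.
Qed.
End Proper.
End Algorithm.
End CFBasics.

(** * Geodesics ending at a finite point *)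

Section GeodesicFacts.
Context {R : realType} {k : scalars} {n : nat}.
Local Notation K := (scalar R k).
Local Notation G := (PUJ R k n).
Local Notation V := 'cV[K]_(1 + (n + 1)).
Local Notation ex := (@ex R k).
Implicit Types (X Y : V) (g h : G) (p q y : kpoint R k n) (s t eta : R)
  (gam : R -> kpoint R k n).

Lemma geodesic_gline gam : geodesic gam -> exists Y eta,
  [/\ ldata (homog (forward_end gam)) Y eta, gam = gline (homog (forward_end gam)) Y
    & if forward_end gam is Some q then in_X q else True].
Proof.
move=> /geodesic_pel[e [pe eg]].
have [x [Y [eta [dx l e1 xX]]]] := ldata_end (pe_ldata pe).
have fe : forward_end gam = x.
  by rewrite eg /pel e1 (forward_end_gline l) dehomog_homog.
by exists Y, eta; rewrite fe; split=> //; rewrite {1}eg /pel e1.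
Qed.

Lemma geodesic_mob g gam : geodesic gam -> geodesic (fun t => mob g (gam t)) /\
  forward_end (fun t => mob g (gam t)) = xmob g (forward_end gam).
Proof.
move=> /geodesic_gline[Y [eta [l e _]]]; move: (forward_end gam) l e => x l ->.
have [l' ->] := gline_mob g l.
split; first exact: gline_geodesic l'.
exact: (forward_end_gline l').
Qed.

Lemma geodesic_shift_end gam s : geodesic gam ->
  forward_end (fun t => gam (t + s)) = forward_end gam.
Proof.
move=> /geodesic_gline[Y [eta [l e _]]]; rewrite {1}e.
move: (forward_end gam) l => x l.
have [l' ->] := gline_shift s l; rewrite (forward_end_gline l') dehomog_rsc ?dehomog_homog //.
by rewrite kreal_neq0 // ex_neq0.
Qed.

Lemma ex_sqr_surj (T : R) : 0 < T -> exists t, ex t ^+ 2 = T.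
Proof.
move=> T0; exists (kap R k * (ln T / 2)); rewrite /ex.
have k0 : kap R k != 0 by rewrite gt_eqF // kap_gt0.
have -> : kap R k * (ln T / 2) / kap R k = ln T / 2 by field.
by rewrite expr2 -expRD -splitr lnK.
Qed.

Lemma ex2_lt s t : (ex s ^+ 2 < ex t ^+ 2) = (s < t).
Proof. by rewrite ltr_pXn2r ?nnegrE ?(ltW (ex_gt0 _)) // ex_lt. Qed.
Lemma ex2_le s t : (ex s ^+ 2 <= ex t ^+ 2) = (s <= t).
Proof. by rewrite ler_pXn2r ?nnegrE ?(ltW (ex_gt0 _)) // ex_le. Qed.

Lemma profile_gt0 (a b T : R) : 0 <= a -> 0 <= b -> 0 < T -> 0 < T + 2 * a + b / T.
Proof.
move=> a0 b0 T0; have : 0 <= b / T by rewrite divr_ge0 // ltW.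
by move: (b / T) => c; lra.
Qed.

Section FiniteForwardEnd.
Variables (gam : R -> kpoint R k n) (y : kpoint R k n).
Hypotheses (gg : geodesic gam) (gy : forward_end gam = Some y).

(* In the parameter T = ex t ^+ 2, the inverse height is proportional to T + 2 a + b / T. *)
Lemma end_profile : exists a b c eta : R, [/\ 0 <= a, 0 <= b, 0 < eta &
  [/\ forall t, ht (gam t) * (ex t ^+ 2 + 2 * a + b / ex t ^+ 2) = eta,
  forall t, pr (Some y) (Some (gam t)) ^+ 2 *
    ((ex t ^+ 2 + 2 * a + b / ex t ^+ 2) * ex t ^+ 2) = eta ^+ 2 &
  exists d : R, forall t, pr (Some (gam t)) (Some 0) ^+ 2 *
    (ex t ^+ 2 + 2 * a + b / ex t ^+ 2) * ex t ^+ 2 =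
    pr (Some y) (Some 0) ^+ 2 * (ex t ^+ 2) ^+ 2 + c * ex t ^+ 2 + d]].
Proof.
have [Y [eta [l e yX]]] := geodesic_gline gg; rewrite gy homog_some in l e yX.
exists (kre (vc0 Y)), (knsq (vc0 Y)), (2 * kre (kconj (vc2 (phi y)) * vc2 Y)), eta.
split; [exact: end_re_ge0 l|exact: knsq_ge0|by case: l|].
have pr0 p : pr (Some p) (Some 0) ^+ 2 = knsq (vc2 (phi p)).
  rewrite pr_phi knorm_sqr hformE (vc_phi 0).1.2 (vc_phi 0).1.1 (vc_phi 0).2 /=.
  rewrite (vc_phi p).1.1 normsq0 kreal0 addr0 scaler0 hdot0r kconj1 mulr0 subrr sub0r mulr1.
  by rewrite knsqN knsq_conj.
rewrite e; split=> [t|t|]; [exact: ht_gline l t|exact: pr_end l t|].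
exists (knsq (vc2 Y)) => t.
have [_ eL v0 _ _] := gline_lift t l.
have eD := vc0_glift y Y t; rewrite /vden in eD.
rewrite -eD !pr0 -knsqM -[vc2 _ * _](vc2Z (phi _)) -eL.
rewrite /glift vc2D !vc2Z knsqD !knsqM !knsq_kreal kconjM kconj_kreal.
have -> : kreal k (ex t) * kconj (vc2 (phi y)) * (vc2 Y * kreal k (ex t)^-1) =
    kconj (vc2 (phi y)) * vc2 Y.
  rewrite kreal_central -mulrA; congr (_ * _).
  by rewrite mulrA kreal_central -mulrA krealM mulfV ?kreal1 ?mulr1 //; exact: ex_neq0.
move: (kre _) (knsq _) (knsq _) => u v w; field; exact: ex_neq0.
Qed.

Lemma ht_unimodal m s t u : s <= t -> t <= u -> m <= ht (gam s) -> m <= ht (gam u) ->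
  m <= ht (gam t).
Proof.
have [a [b [_ [eta [a0 b0 eta0 [hh _ _]]]]]] := end_profile.
move=> st tu ms mu.
have [|m0] := lerP m 0.
  move/le_trans; apply; apply: ltW; exact: gg.1.
have := hh s; have := hh t; have := hh u.
have Es := exprn_gt0 2 (ex_gt0 (k := k) s); have Et := exprn_gt0 2 (ex_gt0 (k := k) t).
have Eu := exprn_gt0 2 (ex_gt0 (k := k) u).
move: st tu; rewrite -ex2_le -(ex2_le t).
move: (ht _) (ht (gam s)) (ht (gam u)) (ex s ^+ 2) (ex t ^+ 2) (ex u ^+ 2) ms mu Es Et Eu.
move=> H Hs Hu S T U ms mu S0 T0 U0 ST TU hu ht' hs.
have D0 : 0 < T + 2 * a + b / T.
  exact: profile_gt0.
rewrite -(ler_pM2r D0) ht'.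
(* the function T + b / T is convex *)
have key : m * (T + 2 * a + b / T) <= m * (S + 2 * a + b / S) \/
           m * (T + 2 * a + b / T) <= m * (U + 2 * a + b / U).
  have [h|h] := lerP b (S * T).
    right; rewrite ler_pM2l // -subr_ge0.
    have -> : U + 2 * a + b / U - (T + 2 * a + b / T) = (U - T) * (T * U - b) / (T * U).
      by field; rewrite !gt_eqF.
    rewrite divr_ge0 ?mulr_ge0 ?subr_ge0 ?(ltW T0) ?(ltW U0) //.
    by apply: le_trans h _; rewrite mulrC ler_pM2l // (le_trans ST).
  left; rewrite ler_pM2l // -subr_ge0.
  have -> : S + 2 * a + b / S - (T + 2 * a + b / T) = (T - S) * (b - S * T) / (S * T).
    by field; rewrite !gt_eqF.
  by rewrite divr_ge0 ?mulr_ge0 ?subr_ge0 ?(ltW T0) ?(ltW S0) // ltW.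
have DS : 0 <= S + 2 * a + b / S by apply/ltW/profile_gt0.
have DU : 0 <= U + 2 * a + b / U by apply/ltW/profile_gt0.
case: key => h; apply: (le_trans h); [rewrite -hs|rewrite -hu]; exact: ler_wpM2r.
Qed.

(** With [T = ex t ^+ 2], [ht * T] is [eta / (1 + 2 a / T + b / T^2)]. So the height falls at most
    exponentially, and descending from [h0] to 1 takes a definite time. *)
Lemma ht_growth s t : s <= t -> ht (gam s) * ex s ^+ 2 <= ht (gam t) * ex t ^+ 2.
Proof.
have [a [b [_ [eta [a0 b0 eta0 [hh _ _]]]]]] := end_profile.
have := hh s; have := hh t.
have Es := exprn_gt0 2 (ex_gt0 (k := k) s); have Et := exprn_gt0 2 (ex_gt0 (k := k) t).
rewrite -ex2_le; have : 0 < ht (gam t) := gg.1 t; have : 0 < ht (gam s) := gg.1 s.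
move: (ht (gam s)) (ht (gam t)) (ex s ^+ 2) (ex t ^+ 2) Es Et => H L S T S0 T0 H0 L0 hT hS ST.
have D : 0 < S + 2 * a + b / S.
  exact: profile_gt0.
suff h : H * S * (S + 2 * a + b / S) <= L * T * (S + 2 * a + b / S) by rewrite -(ler_pM2r D).
have -> : H * S * (S + 2 * a + b / S) = L * ((T + 2 * a + b / T) * S).
  by rewrite mulrAC hS -hT mulrA.
rewrite -(mulrA L) ler_pM2l //.
suff key : b * S / T <= b * T / S.
  have : a * S <= a * T by rewrite ler_wpM2l.
  have -> : (T + 2 * a + b / T) * S = T * S + 2 * (a * S) + b * S / T by ring.
  have -> : T * (S + 2 * a + b / S) = T * S + 2 * (a * T) + b * T / S by ring.
  by move: (b * S / T) (b * T / S) key => u v key; lra.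
rewrite ler_pdivrMr // mulrAC ler_pdivlMr // -!mulrA ler_wpM2l //.
by rewrite ler_pM // ltW.
Qed.

(** After clearing denominators, the square of the pairing times [T^2 + 2 a T + b] is constant. *)
Lemma pr_end_decr s t : s <= t ->
  pr (Some y) (Some (gam t)) <= pr (Some y) (Some (gam s)).
Proof.
have [a [b [_ [eta [a0 b0 eta0 [_ hh _]]]]]] := end_profile.
have := hh s; have := hh t.
have Es := exprn_gt0 2 (ex_gt0 (k := k) s); have Et := exprn_gt0 2 (ex_gt0 (k := k) t).
rewrite -ex2_le; have := pr_ge0 (Some y) (Some (gam t)); have := pr_ge0 (Some y) (Some (gam s)).
move: (pr _ _) (pr _ (Some (gam t))) (ex s ^+ 2) (ex t ^+ 2) Es Et.
move=> P Q S T S0 T0 P0 Q0.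
have eS : (S + 2 * a + b / S) * S = S * S + 2 * a * S + b by field; rewrite gt_eqF.
have eT : (T + 2 * a + b / T) * T = T * T + 2 * a * T + b by field; rewrite gt_eqF.
rewrite eS eT => hT hS ST; rewrite leNgt; apply/negP => PQ.
have DS : 0 < S * S + 2 * a * S + b.
  have : 0 <= a * S by rewrite mulr_ge0 // ltW.
  by have := mulr_gt0 S0 S0; lra.
have DD : S * S + 2 * a * S + b <= T * T + 2 * a * T + b.
  have : S * S <= T * T by rewrite ler_pM // ltW.
  have : a * S <= a * T by rewrite ler_wpM2l.
  lra.
have : P ^+ 2 * (S * S + 2 * a * S + b) < Q ^+ 2 * (T * T + 2 * a * T + b).
  apply: (@lt_le_trans _ _ (Q ^+ 2 * (S * S + 2 * a * S + b))).
    by rewrite ltr_pM2r // ltr_pXn2r ?nnegrE.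
  by apply: ler_wpM2l => //; exact: sqr_ge0.
by rewrite hS hT ltxx.
Qed.

Lemma quadratic_sign (al be de T0 : R) : 0 < al -> al * T0 ^+ 2 + be * T0 + de < 0 ->
  exists T1, [/\ T0 < T1, al * T1 ^+ 2 + be * T1 + de = 0,
    forall T, T0 <= T -> T < T1 -> al * T ^+ 2 + be * T + de < 0
  & forall T, T1 < T -> 0 < al * T ^+ 2 + be * T + de].
Proof.
move=> al0 q0; pose D := be ^+ 2 - 4 * al * de.
have sq T : 4 * al * (al * T ^+ 2 + be * T + de) = (2 * al * T + be) ^+ 2 - D.
  by rewrite /D; ring.
have al4 : 0 < 4 * al by rewrite mulr_gt0.
have h0 : (2 * al * T0 + be) ^+ 2 < D by rewrite -subr_lt0 -sq pmulr_rlt0.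
have D0 : 0 <= D by apply: le_trans (ltW h0); exact: sqr_ge0.
have s0 := sqrtr_ge0 D; have sD := sqr_sqrtr D0.
move: (Num.sqrt D) s0 sD => s s0 sD.
have /andP[b1 b2] : - s < 2 * al * T0 + be < s.
  rewrite -ltr_norml -(@ltr_pXn2r _ 2) ?nnegrE ?normr_ge0 //.
  by rewrite real_normK ?num_real // sD.
exists ((s - be) / (2 * al)).
have e1 T : T = (s - be) / (2 * al) + (2 * al * T + be - s) / (2 * al).
  by field; rewrite gt_eqF.
have a2 : 0 < 2 * al by rewrite mulr_gt0.
split.
- by rewrite ltr_pdivlMr //; lra.
- have := sq ((s - be) / (2 * al)).
  have -> : 2 * al * ((s - be) / (2 * al)) + be = s by field; rewrite gt_eqF.
  rewrite sD subrr => /eqP; rewrite mulf_eq0 (gt_eqF al4) /= => /eqP; exact.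
- move=> T T0T; rewrite ltr_pdivlMr // => h.
  have : (2 * al * T + be) ^+ 2 < D.
    have : 2 * al * T0 <= 2 * al * T by rewrite ler_pM2l.
    rewrite -sD -(real_normK (num_real (2 * al * T + be))) ltr_pXn2r ?nnegrE ?normr_ge0 //.
    by rewrite ltr_norml => ?; apply/andP; split; lra.
  by rewrite -subr_lt0 -sq pmulr_rlt0.
- move=> T; rewrite ltr_pdivrMr // => h.
  have : D < (2 * al * T + be) ^+ 2.
    by rewrite -sD ltr_pXn2r ?nnegrE //; lra.
  by rewrite -subr_gt0 -sq pmulr_rgt0.
Qed.

(** Up to a positive factor, [1 - gauge^4] is a quadratic polynomial in [T]. Its leading coefficient
    is positive since the end has gauge below 1; being negative at [t0], it has exactly one root
    afterwards. *)
Lemma sphere_crossing t0 : gauge y < 1 -> 1 < gauge (gam t0) ->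
  exists t1, [/\ t0 < t1, gauge (gam t1) = 1,
    forall t, t0 <= t -> t < t1 -> 1 < gauge (gam t)
  & forall t, t1 < t -> gauge (gam t) < 1].
Proof.
move=> y1 g1.
have [a [b [c [eta [a0 b0 eta0 [_ _ [d hh]]]]]]] := end_profile.
have yX : in_X y by have [Y [e [_ _]]] := geodesic_gline gg; rewrite gy.
have al : 0 < 1 - pr (Some y) (Some 0) ^+ 2.
  rewrite subr_gt0 (pr_gauge (in_X_good yX)) -exprM exprn_ilt1 //; exact: gauge_ge0.
have sgn t : exists2 D, 0 < D &
    (1 - gauge (gam t) ^+ 4) * D = (1 - pr (Some y) (Some 0) ^+ 2) * (ex t ^+ 2) ^+ 2 +
      (2 * a - c) * ex t ^+ 2 + (b - d).
  have gH : good (Some (gam t)) by apply: in_H_good; exact: gg.1.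
  have E := exprn_gt0 2 (ex_gt0 (k := k) t).
  exists ((ex t ^+ 2 + 2 * a + b / ex t ^+ 2) * ex t ^+ 2).
    by rewrite mulr_gt0 //; exact: profile_gt0.
  have := hh t; rewrite (pr_gauge gH) -exprM; move: (ex t ^+ 2) E (gauge _ ^+ 4) (pr _ _ ^+ 2).
  move=> T T0 g P h; rewrite mulrBl mul1r mulrA h; field; exact: lt0r_neq0.
have g4 t : (gauge (gam t) < 1) = (0 < 1 - gauge (gam t) ^+ 4).
  by rewrite subr_gt0 expr_lt1 //; exact: gauge_ge0.
have g4' t : (1 < gauge (gam t)) = (1 - gauge (gam t) ^+ 4 < 0).
  by rewrite subr_lt0 expr_gt1 //; exact: gauge_ge0.
have [D0 D00 eD0] := sgn t0.
have q0 : (1 - pr (Some y) (Some 0) ^+ 2) * (ex t0 ^+ 2) ^+ 2 +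
      (2 * a - c) * ex t0 ^+ 2 + (b - d) < 0.
  by rewrite -eD0 pmulr_llt0 // -g4'.
have [T1 [T01 z1 n1 p1]] := quadratic_sign al q0.
have [t1 et1] : exists t1, ex t1 ^+ 2 = T1.
  by apply: ex_sqr_surj; apply: lt_trans T01; rewrite exprn_gt0 // ex_gt0.
exists t1; split.
- by rewrite -ex2_lt et1.
- have [D D1 eD] := sgn t1; move: eD; rewrite et1 z1 => /eqP.
  rewrite mulf_eq0 (gt_eqF D1) orbF subr_eq0 eq_sym.
  by rewrite pexpr_eq1 ?gauge_ge0 // => /eqP.
- move=> t h1 h2; have [D D1 eD] := sgn t; rewrite g4' -(pmulr_llt0 _ D1) eD.
  by apply: n1; rewrite ?ex2_le // -et1 ex2_lt.
- move=> t h1; have [D D1 eD] := sgn t; rewrite g4 -(pmulr_lgt0 _ D1) eD.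
  by apply: p1; rewrite -et1 ex2_lt.
Qed.
End FiniteForwardEnd.
End GeodesicFacts.

(** * Continued fractions *)

Section LegendreNumerics.
Context {R : realType}.
(** In the application [X i] and [Q i] are the gauges of the [i]-th iterate of the end and of the
    base point pulled back by the [i]-th branch, and [S i] is the square root of their pairing.
    [D i] and [E i] are the square roots of their pairings with the pulled-back cusp, up to a common
    factor. [D] must grow geometrically, yet the hypotheses keep it below [delta]. *)
Variables (kp rho h0 delta : R) (D E S X Q : nat -> R).
Hypotheses (kp0 : 0 < kp) (rho1 : rho < 1) (delta0 : 0 < delta) (h00 : 0 < h0).
Hypotheses (delta_h0 : 4 <= delta ^+ 2 * kp ^+ 2 * h0)
  (delta_kp : delta * (3 - rho) < kp * (1 - rho)).
Hypotheses (D0 : forall i, 0 < D i) (E0 : forall i, 0 < E i).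
Hypotheses (X0 : forall i, 0 < X i <= rho) (Q0 : forall i, 0 < Q i).
Hypotheses (Ds : forall i, D i.+1 = D i / X i) (Es : forall i, E i.+1 = E i / Q i)
  (Ss : forall i, S i.+1 = S i / (X i * Q i)).
Hypotheses (Qle : forall i, Q i <= X i + S i) (S_ge : 1 - rho <= S 0%N).
Hypotheses (prodDE : forall i, h0 * (D i ^+ 2 * E i ^+ 2) <= S i ^+ 2)
  (sumDE : forall i, kp * S i <= D i + E i) (E0d : delta < E 0%N).

(** With [X i <= rho] and [Q i <= rho + S i], the next value is at least [s / (rho (rho + s))],
    which stays above [1 - rho] when [s] does. *)
Lemma legendre_S_ge i : 1 - rho <= S i.
Proof.
elim: i => // i IH; rewrite Ss.
have /andP[x0 xr] := X0 i; have q0 := Q0 i.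
rewrite ler_pdivlMr ?mulr_gt0 //.
have xq : X i * Q i <= rho * (X i + S i).
  by apply: ler_pM; [exact: ltW|exact: ltW|exact: xr|exact: Qle].
have s0 : 0 <= S i by apply: le_trans IH; rewrite subr_ge0 ltW.
have t0 : 0 <= rho by apply: le_trans xr; exact: ltW.
have xs : rho * (X i + S i) <= rho * (rho + S i) by rewrite ler_wpM2l // lerD2r.
apply: (@le_trans _ _ ((1 - rho) * (rho * (rho + S i)))).
  by rewrite ler_wpM2l ?subr_ge0 ?(ltW rho1) // (le_trans xq).
move: (S i) IH s0 rho1 t0 => s IH s0 r1 t0.
have e : s = (1 - rho) * (rho * (rho + s)) + (s * (1 - rho + rho ^+ 2) - (1 - rho) * rho ^+ 2).
  by ring.
rewrite [X in _ <= X]e lerDl subr_ge0.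
have e1 : (1 - rho) * rho ^+ 2 <= (1 - rho) * (1 - rho + rho ^+ 2).
  by rewrite ler_wpM2l ?subr_ge0 ?(ltW r1) // lerDr subr_ge0 ltW.
apply: le_trans e1 _; rewrite ler_wpM2r // addr_ge0 ?sqr_ge0 // subr_ge0; exact: ltW.
Qed.

(** By [sumDE] one of the two is at least [kp * S i / 2]. If the other exceeded [delta], their
    product would violate [prodDE]; this is the role of [delta_h0]. *)
Lemma legendre_dichotomy i : D i <= delta \/ E i <= delta.
Proof.
have s0 : 0 < S i by apply: lt_le_trans (legendre_S_ge i); rewrite subr_gt0.
have key (a b : R) : 0 < a -> delta < a -> kp * S i / 2 <= b ->
    S i ^+ 2 < h0 * (a ^+ 2 * b ^+ 2).
  move=> a0 da hb.
  have b2 : (kp * S i / 2) ^+ 2 <= b ^+ 2.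
    have k0 : 0 <= kp * S i / 2 by rewrite divr_ge0 // mulr_ge0 // ltW.
    by rewrite ler_pXn2r ?nnegrE // (le_trans k0).
  have b20 : 0 < (kp * S i / 2) ^+ 2 by rewrite exprn_gt0 // divr_gt0 // mulr_gt0.
  apply: (@le_lt_trans _ _ (h0 * (delta ^+ 2 * (kp * S i / 2) ^+ 2))).
    have -> : h0 * (delta ^+ 2 * (kp * S i / 2) ^+ 2) =
      (delta ^+ 2 * kp ^+ 2 * h0) * (S i ^+ 2 / 4) by field.
    have p0 : 0 <= S i ^+ 2 / 4 by rewrite divr_ge0 // sqr_ge0.
    have := ler_wpM2r p0 delta_h0.
    by have -> : 4 * (S i ^+ 2 / 4) = S i ^+ 2 by field.
  rewrite ltr_pM2l //; apply: (@lt_le_trans _ _ (a ^+ 2 * (kp * S i / 2) ^+ 2)).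
    by rewrite ltr_pM2r // ltr_pXn2r ?nnegrE // ltW.
  by rewrite ler_wpM2l // sqr_ge0.
have [hD|hD] := lerP (D i) delta; [by left|].
have [hE|hE] := lerP (E i) delta; [by right|exfalso].
have [h|h] := lerP (kp * S i / 2) (D i).
  have := key (E i) (D i) (E0 i) hE h; rewrite [E i ^+ 2 * _]mulrC.
  by move/lt_le_trans/(_ (prodDE i)); rewrite ltxx.
have hE2 : kp * S i / 2 <= E i by have := sumDE i; lra.
have := key (D i) (E i) (D0 i) hD hE2.
by move/lt_le_trans/(_ (prodDE i)); rewrite ltxx.
Qed.

(** The alternative cannot switch: if [D i <= delta], then [E i >= kp * S i - delta], which by
    [delta_kp] still exceeds [delta] after division by [Q i <= 1 + S i]. *)
Lemma legendre_D_le i : D i <= delta.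
Proof.
elim: i => [|i IH].
  by case: (legendre_dichotomy 0) => // /le_lt_trans/(_ E0d); rewrite ltxx.
case: (legendre_dichotomy i.+1) => // hE; exfalso.
have /andP[x0 xr] := X0 i; have q0 := Q0 i.
move: hE; rewrite Es ler_pdivrMr // leNgt => /negP; apply.
have h1 := sumDE i; have h2 := Qle i; have h3 := legendre_S_ge i.
apply: (@le_lt_trans _ _ (delta * (1 + S i))).
  by rewrite ler_wpM2l ?(ltW delta0) // (le_trans h2) // lerD2r (le_trans xr) // ltW.
have d1 : delta < kp by move: delta_kp kp0 delta0 rho1; nra.
have : 0 <= (kp - delta) * (S i - (1 - rho)).
  by rewrite mulr_ge0 // subr_ge0 // ltW.
move: h1 IH delta_kp; move: (S i) (D i) (E i) => s d e h1 IH h4 h5; lra.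
Qed.

(** Each step divides [D] by [X i <= rho < 1], so [D] grows at least linearly and eventually exceeds
    [delta]. *)
Lemma legendre_contra : False.
Proof.
have r0 : 0 < rho by have /andP[x0 xr] := X0 0%N; apply: lt_le_trans xr.
pose e := D 0%N * (rho^-1 - 1).
have e0 : 0 < e by rewrite mulr_gt0 // subr_gt0 invf_gt1.
have grow i : D 0%N + i%:R * e <= D i.
  elim: i => [|i IH]; first by rewrite mul0r addr0.
  have /andP[x0 xr] := X0 i.
  have Di : D 0%N <= D i by apply: le_trans IH; rewrite lerDl mulr_ge0 // ltW.
  have h : D 0%N * (rho^-1 - 1) <= D i * ((X i)^-1 - 1).
    apply: ler_pM => //; first exact: ltW.
      by rewrite subr_ge0 invf_ge1 // ltW.
    by rewrite lerD2r lef_pV2 ?posrE.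
  rewrite Ds -natr1 mulrDl mul1r addrA; apply: le_trans (lerD IH h) _.
  by rewrite mulrBr mulr1 addrC subrK.
have z0 : 0 <= delta / e by rewrite divr_ge0 // ltW.
have /andP[_ h] := truncn_itv z0; move: h; rewrite ltr_pdivrMr // => h.
have := le_trans (grow (Num.truncn (delta / e)).+1) (legendre_D_le _).
by rewrite leNgt (lt_trans h) // ltrDr.
Qed.
End LegendreNumerics.

(** * Branches of the shift map and approximation by convergents *)

Section ContinuedFractions.
Context {R : realType} {k : scalars} {n : nat} (n_gt0 : (0 < n)%N) (A : iwasawa_cf R k n).
Local Notation K := (scalar R k).
Local Notation G := (PUJ R k n).
Local Notation iota := (cf_inv A).
Local Notation Z := (cf_lattice A).
Local Notation Dm := (cf_domain A).
Local Notation Mod := (cf_modular A).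
Local Notation T := (cf_shift A).
Local Notation dg := (cf_digit A).
Implicit Types (x y p q : kpoint R k n) (g h N : G).
Lemma mob_None g p : xmob g (Some p) = None -> mob g p = 0.
Proof. by rewrite /mob => ->. Qed.
#[local] Opaque gauge mob xmob cdist.

Definition branch i x : G := (\prod_(1 <= j < i.+1) (iota^-1 * dg j x))%g.

Lemma branch0 x : branch 0 x = 1%g. Proof. by rewrite /branch big_geq. Qed.
Lemma branchS i x : branch i.+1 x = (branch i x * (iota^-1 * dg i.+1 x))%g.
Proof. by rewrite /branch big_nat_recr. Qed.
Lemma branch_agree i x y : (forall j, (0 < j <= i)%N -> dg j x = dg j y) ->
  branch i x = branch i y.
Proof.
elim: i => [|i IH] h; first by rewrite !branch0.
have e1 : branch i x = branch i y.
  by apply: IH => j /andP[j0 ji]; apply: h; rewrite j0 leqW.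
have e2 : dg i.+1 x = dg i.+1 y by apply: h; rewrite ltnSn.
rewrite !branchS e1 e2; reflexivity.
Qed.

Lemma digit_shift d l x : (0 < l)%N -> dg (d + l) x = dg l (iter d T x).
Proof.
move=> l0; have e : (d + l).-1 = (l.-1 + d)%N by rewrite -subn1 -addnBA // subn1 addnC.
rewrite /cf_digit e iterD; reflexivity.
Qed.
Lemma branchD d l x : branch (d + l) x = (branch d x * branch l (iter d T x))%g.
Proof.
elim: l => [|l IH]; first by rewrite addn0 branch0 mulg1.
rewrite addnS !branchS IH -addnS (@digit_shift d l.+1 x (ltn0Sn l)).
by move: (branch d x) (branch l _) (iota^-1 * _)%g => a b c; rewrite mulgA.
Qed.

Lemma inv_X x : in_X x -> in_X (mob iota x).
Proof.
move=> xX; have [->|x0] := eqVneq x 0.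
  have [i0 _ _] := cf_invP A.
  by rewrite (mob_None i0); exact: in_X0.
exact: xmob_X xX (inv_finite (cf_invP A) (in_X_good xX) x0).
Qed.
Lemma shift_neq0 x : x != 0 -> T x = mob (cf_round A (mob iota x))^-1%g (mob iota x).
Proof. by rewrite /cf_shift => /negPf->. Qed.

Lemma shift_D x : Dm x -> Dm (T x).
Proof.
move=> Dx; have [x0|x0] := eqVneq x 0; first by rewrite /cf_shift x0 eqxx -x0.
by rewrite shift_neq0 //; apply: round_D; apply: inv_X; exact: D_X Dx.
Qed.
Lemma iter_D i x : Dm x -> Dm (iter i T x).
Proof. by move=> Dx; elim: i => //= i; exact: shift_D. Qed.
Lemma digit_Z i x : Dm x -> Z (dg i x).
Proof. by move=> Dx; apply: round_Z; apply: inv_X; apply: D_X; exact: iter_D. Qed.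
Lemma branch_Mod i x : Dm x -> Mod (branch i x).
Proof.
move=> Dx; elim: i => [|i IH]; first by rewrite branch0; exact: Mod1.
rewrite branchS.
have h1 : Mod (dg i.+1 x) := Mod_Z (digit_Z i.+1 Dx).
have h2 : Mod iota^-1%g := ModV (@Mod_inv _ _ _ A).
have h3 : Mod (iota^-1 * dg i.+1 x)%g := ModM h2 h1.
exact: ModM IH h3.
Qed.

Lemma shift_mob x : Dm x -> x != 0 ->
  xmob (iota^-1 * dg 1 x)^-1%g (Some x) = Some (T x).
Proof.
move=> Dx x0; have xX := D_X Dx; have gx := in_X_good xX.
have mX := inv_X xX; have gm := in_X_good mX.
rewrite invgM invgK (xmobM _ _ gx) (inv_finite (cf_invP A) gx x0) (shift_neq0 x0).
exact: (Z_finite (ZV (round_Z A mX)) gm).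
Qed.

Lemma shift_nu p x : Dm x -> good (Some p) -> p != 0 ->
  nu (iota^-1 * dg 1 x)^-1%g (Some p) = pr (Some p) (Some 0).
Proof.
move=> Dx gp p0; rewrite invgM invgK (nuM _ _ gp).
rewrite (Z_nu n_gt0 (ZV (digit_Z 1 Dx)) (good_xmob iota gp)) mul1r.
exact: (nu_inv n_gt0 (cf_invP A)).
Qed.

Lemma legendre_core (kp rho h0 h2 delta : R) (X g : nat -> kpoint R k n) (hN : nat -> G) y w :
  0 < kp -> kp <= 1 -> rho < 1 ->
  0 < delta -> 4 <= delta ^+ 2 * kp ^+ 2 * h0 -> delta * (3 - rho) < kp * (1 - rho) ->
  0 < h0 -> delta ^+ 2 < h2 * kp ->
  (forall i, in_X (X i)) -> (forall i, gauge (X i) <= rho) ->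
  (forall i, 0 < pr (Some (X i)) (Some 0)) -> (forall i, in_H (g i)) ->
  good (Some y) -> good (Some w) ->
  (forall i, xmob (hN i) (Some y) = Some (X i)) ->
  (forall i, xmob (hN i) (Some w) = Some (g i)) ->
  (forall i, nu (hN i.+1) (Some y) = gauge (X i) ^+ 2 * nu (hN i) (Some y)) ->
  (forall i, nu (hN i.+1) (Some w) = pr (Some (g i)) (Some 0) * nu (hN i) (Some w)) ->
  (forall i, exists2 p, xmob (hN i) None = Some p & in_X p /\ kp <= nu (hN i) None) ->
  gauge (g 0%N) = 1 -> h2 <= ht (g 0%N) -> h0 <= pr (Some y) (Some w) -> False.
Proof.
move=> kp0 kp1 rho1 d0 dh0 dkp h00 dh2 XX Xr pX0 gH gy gw hy hw nyS nwS cge gg0 hg0 big.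
(* By [prD] below, [D i] and [E i] are the square roots of the pairings of [X i] and [g i] with
   [hN i oo], both scaled by the square root of [nu (hN i) None]. *)
pose D i := Num.sqrt (nu (hN i) (Some y))^-1.
pose E i := Num.sqrt (nu (hN i) (Some w))^-1.
pose S i := Num.sqrt (pr (Some (X i)) (Some (g i))).
pose Q i := Num.sqrt (pr (Some (g i)) (Some 0)).
have gX i : good (Some (X i)) := in_X_good (XX i).
have gg i : good (Some (g i)) := in_H_good (gH i).
have gI := @good_inf R k n.
have ny i : 0 < nu (hN i) (Some y) := nu_gt0 (hN i) gy.
have nw i : 0 < nu (hN i) (Some w) := nu_gt0 (hN i) gw.
have D0 i : 0 < D i by rewrite sqrtr_gt0 invr_gt0.
have E0 i : 0 < E i by rewrite sqrtr_gt0 invr_gt0.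
have D2 i : D i ^+ 2 = (nu (hN i) (Some y))^-1 by rewrite sqr_sqrtr // invr_ge0 ltW.
have E2 i : E i ^+ 2 = (nu (hN i) (Some w))^-1 by rewrite sqr_sqrtr // invr_ge0 ltW.
have Q0' i : 0 < pr (Some (g i)) (Some 0).
  apply: pr0_gt0; first exact: gg.
  by apply: contraTneq (gH i) => ->; rewrite /in_H kre0 ltxx.
have X0 i : 0 < gauge (X i) <= rho.
  rewrite Xr andbT; have := pX0 i; rewrite (pr_gauge (gX i)) exprn_even_gt0 //= => h.
  by rewrite lt0r h gauge_ge0.
have Q0 i : 0 < Q i by rewrite sqrtr_gt0.
have Q2 i : Q i ^+ 2 = pr (Some (g i)) (Some 0) by rewrite sqr_sqrtr // ltW.
have Ds i : D i.+1 = D i / gauge (X i).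
  have /andP[x0 _] := X0 i.
  apply/eqP; rewrite -(@eqrXn2 _ 2) ?(ltW (D0 _)) ?divr_ge0 ?(ltW (D0 _)) ?(ltW x0) //.
  by rewrite expr_div_n !D2 nyS invfM mulrC.
have Es i : E i.+1 = E i / Q i.
  apply/eqP; rewrite -(@eqrXn2 _ 2) ?(ltW (E0 _)) ?divr_ge0 ?(ltW (E0 _)) ?(ltW (Q0 _)) //.
  by rewrite expr_div_n !E2 nwS invfM mulrC Q2.
have prS i : pr (Some (X i)) (Some (g i)) = pr (Some y) (Some w) * (D i ^+ 2 * E i ^+ 2).
  have e := pr_xmob (hN i) gy gw; rewrite hy hw in e.
  by rewrite D2 E2 -e -invfM mulfK // gt_eqF // mulr_gt0.
have S0 i : 0 <= S i by exact: sqrtr_ge0.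
have S2 i : S i ^+ 2 = pr (Some y) (Some w) * (D i ^+ 2 * E i ^+ 2).
  by rewrite -prS sqr_sqrtr // pr_ge0.
have Ss i : S i.+1 = S i / (gauge (X i) * Q i).
  have /andP[x0 _] := X0 i; have q0 := Q0 i.
  apply/eqP; rewrite -(@eqrXn2 _ 2) ?S0 ?divr_ge0 ?S0 ?mulr_ge0 ?(ltW x0) ?(ltW q0) //.
  apply/eqP; rewrite expr_div_n !S2 Ds Es; move: (D i) (E i) (pr _ _) (gauge _) (Q i) x0 q0.
  by move=> d e P xx q x0 q0; field; rewrite !gt_eqF.
have Qle i : Q i <= gauge (X i) + S i.
  have t := pr_triangle (gg i) (XX i) (in_X_good (@in_X0 R k n)).
  apply: (le_trans t).
  by rewrite [pr (Some (g i)) _]prC -(gauge_pr (gX i)) addrC.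
have Q01 : Q 0%N = 1 by rewrite /Q -(gauge_pr (gg 0%N)).
have S_ge : 1 - rho <= S 0%N.
  by have := Qle 0%N; have /andP[_ xr] := X0 0%N; rewrite Q01; lra.
have prD i p (z : kpoint R k n) (q : xkpoint R k n) : xmob (hN i) None = Some p ->
    good (Some z) -> xmob (hN i) (Some z) = q ->
    pr q (Some p) * nu (hN i) None = (nu (hN i) (Some z))^-1.
  move=> ep gz eq; have e := pr_xmob (hN i) gz gI.
  rewrite ep eq [pr _ None]prC pr_inf in e.
  have nz := nu_gt0 (hN i) gz.
  by apply: (mulIf (lt0r_neq0 nz)); rewrite mulVf ?gt_eqF // -e -mulrA [nu _ None * _]mulrC.
have prodDE i : h0 * (D i ^+ 2 * E i ^+ 2) <= S i ^+ 2.
  by rewrite S2 ler_wpM2r // mulr_ge0 // sqr_ge0.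
(* The triangle inequality through the cusp [hN i oo]. Since [kp <= 1], the square root of the
   multiplier at oo is at least [kp]. *)
have sumDE i : kp * S i <= D i + E i.
  have [p ep [pX ck]] := cge i.
  have t := pr_triangle (gX i) pX (gg i).
  have e1 := prD i p y _ ep gy (hy i); have e2 := prD i p w _ ep gw (hw i).
  rewrite /D /E -e1 -e2.
  have c0 : 0 <= nu (hN i) None by apply: le_trans ck; exact: ltW.
  rewrite !sqrtrM ?pr_ge0 // -mulrDl.
  apply: (@le_trans _ _ (S i * Num.sqrt (nu (hN i) None))).
    rewrite mulrC; apply: ler_wpM2l; first exact: sqrtr_ge0.
    rewrite -(@ler_pXn2r _ 2) ?nnegrE ?sqrtr_ge0 ?(ltW kp0) // sqr_sqrtr //.
    apply: le_trans ck; rewrite expr2 -[leRHS]mulr1; apply: ler_wpM2l => //; exact: ltW.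
  apply: ler_wpM2r; first exact: sqrtr_ge0.
  by rewrite [pr (Some (g i)) _]prC.
have E0d : delta < E 0%N.
  have [p ep [pX ck]] := cge 0%N.
  have e2 := prD 0%N p w _ ep gw (hw 0%N).
  rewrite -(@ltr_pXn2r _ 2) ?nnegrE ?(ltW d0) ?(ltW (E0 _)) // E2 -e2.
  apply: lt_le_trans dh2 _; have h20 : 0 <= ht (g 0%N) := ltW (gH 0%N).
  have hp := pr_htl (gg 0%N) (in_X_good pX).
  have [h2p|h2n] := lerP 0 h2.
    by apply: ler_pM => //; [exact: ltW|exact: le_trans hp].
  apply: (@le_trans _ _ 0); first by rewrite mulr_le0_ge0 // ltW.
  by rewrite mulr_ge0 ?pr_ge0 // (le_trans (ltW kp0)).
exact: (@legendre_contra R kp rho h0 delta D E S (fun i => gauge (X i)) Q).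
Qed.

Section Orbit.
Variable x : kpoint R k n.
Hypotheses (Dx : Dm x) (x_neq0 : forall i, iter i T x != 0).
Local Notation X i := (iter i T x).

Let gX i : good (Some (X i)). Proof. by apply/in_X_good/D_X; exact: iter_D. Qed.

Lemma branch_digit i : branch i.+1 x = (branch i x * (iota^-1 * dg 1 (X i)))%g.
Proof. by rewrite branchS -addn1 (digit_shift i x (ltn0Sn 0)). Qed.

Lemma branch_mob i : xmob (branch i x)^-1%g (Some x) = Some (X i).
Proof.
elim: i => [|i IH]; first by rewrite branch0 invg1 xmob1.
rewrite branch_digit invgM (xmobM _ _ (gX 0)) IH.
exact: (shift_mob (iter_D i Dx) (x_neq0 i)).
Qed.

Lemma branch_nuS i y : good (Some y) -> xmob (branch i x)^-1%g (Some y) <> Some 0 ->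
  xmob (branch i x)^-1%g (Some y) <> None ->
  nu (branch i.+1 x)^-1%g (Some y) =
  pr (xmob (branch i x)^-1%g (Some y)) (Some 0) * nu (branch i x)^-1%g (Some y).
Proof.
move=> gy; have := good_xmob (branch i x)^-1%g gy.
rewrite branch_digit invgM (nuM _ _ gy); case: (xmob _ (Some y)) => [q|]; last by [].
move=> gq q0 _; congr (_ * _); apply: (shift_nu (iter_D i Dx) gq).
by apply/eqP => e; apply: q0; rewrite e.
Qed.

Lemma branch_nu_x i : nu (branch i.+1 x)^-1%g (Some x) =
  gauge (X i) ^+ 2 * nu (branch i x)^-1%g (Some x).
Proof.
rewrite (branch_nuS (i := i) (gX 0)) ?branch_mob.
- by rewrite (pr_gauge (gX i)).
- by case=> h; have := x_neq0 i; rewrite h eqxx.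
- by [].
Qed.

(** Each step multiplies the multiplier at [x] by the square of a gauge below 1. Distinct branch
    indices therefore give distinct maps, which later fixes the number of digits between
    crossings. *)
Lemma branch_nu_lt (A_proper : cf_proper A) i j : (i < j)%N ->
  nu (branch j x)^-1%g (Some x) < nu (branch i x)^-1%g (Some x).
Proof.
have st m : nu (branch m.+1 x)^-1%g (Some x) < nu (branch m x)^-1%g (Some x).
  have n0 := nu_gt0 (branch m x)^-1%g (gX 0).
  rewrite branch_nu_x -[ltRHS]mul1r (ltr_pM2r n0) expr_lt1 ?gauge_ge0 //.
  exact: (D_gauge_lt1 A_proper (iter_D m Dx)).
elim: j => [//|j IH]; rewrite ltnS leq_eqVlt => /orP[/eqP->|/IH h]; first exact: st.
exact: lt_trans (st j) h.
Qed.
Lemma branch_inj (A_proper : cf_proper A) i j : branch i x = branch j x -> i = j.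
Proof.
move=> e; case: (ltngtP i j) => [||//] /(branch_nu_lt A_proper); by rewrite e ltxx.
Qed.

(* A cusp whose horoball is met by a geodesic ending at [x] is the image of oo under one of
   the branches at [x]. *)
Lemma legendre (A_proper : cf_proper A) (kp rho h0 h2 delta : R) (g0 : kpoint R k n) N y :
  0 < kp -> rho < 1 -> (forall p, Dm p -> gauge p <= rho) ->
  (forall M, Mod M -> xmob M None <> None -> kp <= nu M None) -> kp <= 1 ->
  0 < delta -> 4 <= delta ^+ 2 * kp ^+ 2 * h0 -> delta * (3 - rho) < kp * (1 - rho) ->
  0 < h0 -> delta ^+ 2 < h2 * kp ->
  in_H g0 -> gauge g0 = 1 -> h2 <= ht g0 ->
  Mod N -> xmob N^-1%g (Some x) = Some y -> xmob N None <> None ->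
  h0 <= pr (Some y) (xmob N^-1%g (Some g0)) ->
  exists2 i, (0 < i)%N & xmob ((branch i x)^-1 * N)%g None = None.
Proof.
move=> kp0 rho1 Drho cusp kp1 d0 dh0 dkp h00 dh2 Hg0 gg0 hg0 MN Ny Ninf big.
(* If no branch fits, all the maps [(branch i x)^-1 * N] move oo, so [cusp] applies to each of them
   and the numerical argument runs through every [i]. *)
apply: contrapT => nex.
have gx := gX 0; rewrite /= in gx; have gg := in_H_good Hg0; have gI := @good_inf R k n.
have [eg' Hg'] := xmob_H N^-1%g Hg0.
move: (mob N^-1%g g0) eg' Hg' => w eg' Hg'; have gw := in_H_good Hg'.
rewrite eg' in big.
have gy : good (Some y) by rewrite -Ny; exact: good_xmob.
have Nyx : xmob N (Some y) = Some x by rewrite -Ny xmobKV.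
have Nw : xmob N (Some w) = Some g0 by rewrite -eg' xmobKV.
pose hN i := ((branch i x)^-1 * N)%g.
have MhN i : Mod (hN i) by apply: ModM => //; apply: ModV; exact: branch_Mod.
have hinf i : xmob (hN i) None <> None.
  case: i => [|i]; first by rewrite /hN branch0 invg1 mul1g.
  by move=> h; apply: nex; exists i.+1.
pose gi i := xmob (branch i x)^-1%g (Some g0).
have giP i : exists2 p, gi i = Some p & in_H p.
  by exists (mob (branch i x)^-1%g g0); have [] := xmob_H (branch i x)^-1%g Hg0.
have hy i : xmob (hN i) (Some y) = Some (X i).
  have e1 := xmobM (branch i x)^-1%g N gy; rewrite Nyx branch_mob in e1; exact: e1.
have hw i : xmob (hN i) (Some w) = gi i.
  have e1 := xmobM (branch i x)^-1%g N gw; rewrite Nw in e1; exact: e1.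
have ny i : 0 < nu (hN i) (Some y) := nu_gt0 (hN i) gy.
have nw i : 0 < nu (hN i) (Some w) := nu_gt0 (hN i) gw.
have nyS i : nu (hN i.+1) (Some y) = gauge (X i) ^+ 2 * nu (hN i) (Some y).
  have e1 := nuM (branch i.+1 x)^-1%g N gy; have e2 := nuM (branch i x)^-1%g N gy.
  rewrite Nyx branch_nu_x in e1; rewrite Nyx in e2.
  rewrite /hN e1 e2 mulrA; reflexivity.
have nwS i : nu (hN i.+1) (Some w) = pr (gi i) (Some 0) * nu (hN i) (Some w).
  have [p ep pH] := giP i; rewrite /gi in ep.
  have q0 : xmob (branch i x)^-1%g (Some g0) <> Some 0.
    by rewrite ep => -[e0]; move: pH; rewrite e0 /in_H kre0 ltxx.
  have qN : xmob (branch i x)^-1%g (Some g0) <> None by rewrite ep.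
  have e3 := branch_nuS gg q0 qN.
  have e1 := nuM (branch i.+1 x)^-1%g N gw; have e2 := nuM (branch i x)^-1%g N gw.
  rewrite Nw e3 in e1; rewrite Nw in e2.
  rewrite /hN /gi e1 e2 mulrA; reflexivity.
have Q0' i : 0 < pr (gi i) (Some 0).
  have [p -> pH] := giP i; apply: pr0_gt0; first exact: in_H_good.
  by apply: contraTneq pH => ->; rewrite /in_H kre0 ltxx.
have gi0 : gi 0%N = Some g0 by rewrite /gi branch0 invg1 xmob1.
have gX' i : good (Some (X i)) := gX i.
have XX i : in_X (X i) := D_X (iter_D i Dx).
have pX0 i : 0 < pr (Some (X i)) (Some 0) := pr0_gt0 (gX i) (x_neq0 i).
have Xr i : gauge (X i) <= rho := Drho _ (iter_D i Dx).
have cge i : exists2 p, xmob (hN i) None = Some p & in_X p /\ kp <= nu (hN i) None.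
  have := hinf i; have ck := cusp _ (MhN i) (hinf i).
  have := xht_xmob (hN i) gI; move: ck; case: (xmob (hN i) None) => [p|] ck e f; last by case: f.
  exists p; first by [].
  split; last exact: ck.
  move/eqP: e; rewrite /= mulf_eq0 sqrf_eq0 (gt_eqF (nu_gt0 _ gI)) orbF => /eqP; exact.
have [g eg] : exists g : nat -> kpoint R k n, forall i, gi i = Some (g i) /\ in_H (g i).
  by exists (fun i => mob (branch i x)^-1%g g0) => i; exact: (xmob_H (branch i x)^-1%g Hg0).
have eg0 : g 0%N = g0 by have := (eg 0%N).1; rewrite gi0 => -[].
apply: (@legendre_core kp rho h0 h2 delta (fun i => X i) g hN y w kp0 kp1 rho1 d0 dh0 dkp h00
  dh2 XX Xr pX0 (fun i => (eg i).2) gy gw hy _ nyS _ cge _ _ big).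
- by move=> i; rewrite hw (eg i).1.
- by move=> i; rewrite nwS (eg i).1.
- by rewrite eg0.
- by rewrite eg0.
Qed.
End Orbit.
End ContinuedFractions.

(** * Sequences of times *)

Section BiInfiniteSequences.
Context {R : realType}.
Implicit Types (S : set R) (s t b : R) (i j l : int).

Lemma finite_bounded S : finite_set S -> exists b, forall s, S s -> `|s| <= b.
Proof.
move=> /finite_seqP[r ->]; exists (\sum_(s <- r) `|s|) => s /= sr.
by rewrite (big_rem s) //= lerDl sumr_ge0.
Qed.

(** A markable geodesic is only known to have infinitely many crossings on either side of 0. Spacing
    prevents accumulation, so the crossing times are unbounded in both directions. *)
Lemma spaced_unbounded S (c : R) : 0 < c -> infinite_set S ->
  (forall s t, S s -> S t -> s < t -> s + c <= t) ->
  forall b, exists2 s, S s & b < `|s|.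
Proof.
move=> c0 Sinf sp b; apply: contrapT => nb.
have Sb s : S s -> `|s| <= `|b|.
  move=> Ss; rewrite leNgt; apply/negP => h; apply: nb; exists s => //.
  by apply: le_lt_trans h; exact: ler_norm.
pose m := Num.truncn (2 * `|b| / c).
pose cell s : 'I_m.+1 := inord (Num.truncn ((s + `|b|) / c)).
have Tr (z : R) : `|z| <= `|b| -> (Num.truncn ((z + `|b|) / c) < m.+1)%N /\
    (Num.truncn ((z + `|b|) / c))%:R * c <= z + `|b| < (Num.truncn ((z + `|b|) / c)).+1%:R * c.
  rewrite ler_norml => /andP[z1 z2]; split.
    by rewrite ltnS; apply: le_truncn; rewrite ler_pM2r ?invr_gt0 //; lra.
  have z0 : 0 <= (z + `|b|) / c by rewrite divr_ge0 ?(ltW c0) //; lra.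
  by have := truncn_itv z0; rewrite ler_pdivlMr // ltr_pdivrMr.
have cinj s t : S s -> S t -> cell s = cell t -> s = t.
  move=> Ss St /(congr1 (@nat_of_ord _)).
  have [ts hs] := Tr s (Sb s Ss); have [tt ht] := Tr t (Sb t St).
  rewrite /cell !inordK // => e; move: hs ht; rewrite e.
  move: (Num.truncn _) => q; rewrite -natr1 mulrDl mul1r => /andP[u1 u2] /andP[v1 v2].
  case: (ltgtP s t) => // st; have := sp _ _ _ _ st; rewrite ?Ss ?St; move=> h; exfalso.
    by have := h Ss St; lra.
  by have := h St Ss; lra.
have [B BS Bm] := infinite_set_fset m.+2 Sinf.
have : (size (map cell (enum_fset B)) <= #|{: 'I_m.+1}|)%N.
  have u : uniq (map cell (enum_fset B)).
    rewrite map_inj_in_uniq ?fset_uniq // => s t sB tB; apply: cinj; exact: BS.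
  by move/card_uniqP: u => <-; exact: max_card.
by rewrite size_map card_ord leqNgt Bm.
Qed.

Lemma least_above S (c : R) t s0 : 0 < c ->
  (forall s t, S s -> S t -> s < t -> s + c <= t) -> S s0 -> t < s0 ->
  exists s, [/\ S s, t < s & forall s', S s' -> t < s' -> s <= s'].
Proof.
move=> c0 sp; move: {2}(Num.truncn ((s0 - t) / c)).+1 (ltnSn (Num.truncn ((s0 - t) / c))) => m.
elim: m s0 => // m IH s0; rewrite ltnS => hm Ss0 ts0.
have [[s1 [Ss1 ts1 s10]]|nex] := pselect (exists s1, [/\ S s1, t < s1 & s1 < s0]); last first.
  exists s0; split=> // s' Ss' ts'; rewrite leNgt; apply/negP => h; apply: nex.
  by exists s'.
apply: (IH s1) => //; apply: leq_trans hm.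
have h := sp _ _ Ss1 Ss0 s10.
have d0 : 0 <= (s1 - t) / c by apply: divr_ge0; rewrite ?subr_ge0; exact: ltW.
have d1 : 0 <= (s0 - t) / c by apply: divr_ge0; rewrite ?subr_ge0; exact: ltW.
rewrite truncn_ge_nat // -natr1 ler_pdivlMr // mulrDl mul1r.
have /andP[+ _] := truncn_itv d0; rewrite ler_pdivlMr //; lra.
Qed.

Lemma greatest_below S (c : R) t s0 : 0 < c ->
  (forall s t, S s -> S t -> s < t -> s + c <= t) -> S s0 -> s0 < t ->
  exists s, [/\ S s, s < t & forall s', S s' -> s' < t -> s' <= s].
Proof.
move=> c0 sp Ss0 s0t.
have [|||s [Ss ts hs]] := @least_above [set s | S (- s)] c (- t) (- s0) c0.
- by move=> s s' /= Ss Ss' ss'; have := sp _ _ Ss' Ss; rewrite ltrN2 => /(_ ss'); lra.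
- by rewrite /= opprK.
- by rewrite ltrN2.
exists (- s); split; [exact: Ss|by rewrite ltrNl|move=> s' Ss' s't].
by rewrite lerNr; apply: hs; rewrite /= ?opprK // ltrN2.
Qed.

Lemma int_seq (T : Type) (x0 : T) (next prev : T -> T) : exists f : int -> T,
  [/\ f 0 = x0, forall m : nat, f m.+1%:Z = next (f m%:Z) &
      forall m : nat, f (- m.+1%:Z) = prev (f (- m%:Z))].
Proof.
exists (fun j => match j with Posz m => iter m next x0 | Negz m => iter m.+1 prev x0 end).
by split=> // -[|m] //.
Qed.

Lemma int_step (P : int -> Prop) : (forall m : nat, P m%:Z) ->
  (forall m : nat, P (- m.+1%:Z)) -> forall j, P j.
Proof. by move=> h1 h2 [m|m]; [exact: h1|rewrite NegzE; exact: h2]. Qed.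

Lemma homo_succ d (T : porderType d) (f : int -> T) : (forall j, (f j < f (j + 1))%O) ->
  {homo f : j l / j < l >-> (j < l)%O}.
Proof.
move=> h j l jl; have -> : l = j + (absz (l - j - 1)%R).+1%:Z by lia.
elim: (absz _) => [|m IH]; first exact: h.
by apply: lt_trans IH _; have := h (j + m.+1%:Z); congr (_ < _)%O; congr f; lia.
Qed.

Section Spaced.
Variables (tm : int -> R) (c : R).
Hypotheses (c0 : 0 < c) (t0 : tm 0 = 0) (sp : forall j, tm j + c <= tm (j + 1)).

Lemma spaced_homo : {homo tm : j l / j < l}.
Proof. by apply: homo_succ => j; apply: lt_le_trans (sp j); rewrite ltrDl. Qed.

Lemma spaced_pos (m : nat) : m%:R * c <= tm m%:Z.
Proof.
elim: m => [|m IH]; first by rewrite mul0r t0.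
rewrite -natr1 mulrDl mul1r; have -> : m.+1%:Z = m%:Z + 1 by lia.
by apply: le_trans (sp _); rewrite lerD2r.
Qed.
Lemma spaced_neg (m : nat) : tm (- m%:Z) <= - (m%:R * c).
Proof.
elim: m => [|m IH]; first by rewrite oppr0 t0 mul0r oppr0.
have := sp (- m.+1%:Z); have -> : - m.+1%:Z + 1 = - m%:Z :> int by lia.
rewrite -natr1 mulrDl mul1r; move: IH; lra.
Qed.

Lemma spaced_cover t : exists j, tm j <= t < tm (j + 1).
Proof.
have z0 : 0 <= `|t| / c by rewrite divr_ge0 // ltW.
pose m := (Num.truncn (`|t| / c)).+1.
have tm0 : `|t| < m%:R * c by have /andP[_] := truncn_itv z0; rewrite ltr_pdivrMr.
have ex : exists i : nat, t < tm (- m%:Z + i%:Z).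
  exists (m + m)%N; apply: le_lt_trans (ler_norm t) _; apply: lt_le_trans tm0 _.
  have -> : - m%:Z + (m + m)%N%:Z = m%:Z by lia.
  exact: spaced_pos.
have [i hi mi] := ex_minnP ex.
have i0 : (0 < i)%N.
  rewrite lt0n; apply/eqP => i0; move: hi; rewrite i0 addr0 => h.
  have := spaced_neg m; have := ler_norm (- t); rewrite normrN; move: tm0 h; lra.
exists (- m%:Z + i.-1%:Z); apply/andP; split.
  by rewrite leNgt; apply/negP => /mi; rewrite -ltnS prednK // ltnn.
by have -> : - m%:Z + i.-1%:Z + 1 = - m%:Z + i%:Z by lia.
Qed.
Lemma spaced_infinite (S : set R) : (forall j, S (tm j)) ->
  infinite_set (S `&` [set t | t < 0]) /\ infinite_set (S `&` [set t | 0 < t]).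
Proof.
move=> inS.
have big (b : R) : exists q : nat, b < q.+1%:R * c.
  have [q hq] : exists q : nat, b / c < q.+1%:R.
    exists (Num.truncn `|b / c|); apply: le_lt_trans (ler_norm _) _.
    by have /andP[_] := truncn_itv (normr_ge0 (b / c)).
  by exists q; rewrite -ltr_pdivrMr.
split=> /finite_bounded[b hb]; have [q hq] := big b.
  have sn := spaced_neg q.+1.
  have n0 : tm (- q.+1%:Z) < 0.
    by apply: le_lt_trans sn _; rewrite oppr_lt0 mulr_gt0 ?ltr0n.
  have := hb _ (conj (inS _) n0); rewrite ltr0_norm //; move: sn hq; lra.
have sn := spaced_pos q.+1.
have n0 : 0 < tm q.+1%:Z by apply: lt_le_trans sn; rewrite mulr_gt0 ?ltr0n.
have := hb _ (conj (inS _) n0); rewrite gtr0_norm //; move: sn hq; lra.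
Qed.
End Spaced.

Lemma enumerate_spaced S (c : R) : 0 < c -> S 0 ->
  (forall s t, S s -> S t -> s < t -> s + c <= t) ->
  (forall b, exists2 s, S s & b < s) -> (forall b, exists2 s, S s & s < b) ->
  exists tm : int -> R, [/\ tm 0 = 0, forall j, tm j + c <= tm (j + 1)
    & forall t, S t <-> exists j, t = tm j].
Proof.
move=> c0 S0 sp ub lb.
have nextP t : exists s, S s /\ t < s /\ forall s', S s' -> t < s' -> s <= s'.
  by have [s0 Ss0 ts0] := ub t; have [s [? ? ?]] := least_above c0 sp Ss0 ts0; exists s.
have prevP t : exists s, S s /\ s < t /\ forall s', S s' -> s' < t -> s' <= s.
  by have [s0 Ss0 ts0] := lb t; have [s [? ? ?]] := greatest_below c0 sp Ss0 ts0; exists s.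
have [nx nxP] := choice nextP; have [pv pvP] := choice prevP.
have [tm [t0 tS tN]] := int_seq 0 nx pv.
have Stm : forall j, S (tm j).
  apply: int_step => m.
    by elim: m => [|m IH]; rewrite ?t0 // tS; case: (nxP (tm m)).
  by rewrite tN; case: (pvP (tm (- m%:Z))).
have gap : forall j, tm j < tm (j + 1) /\ forall s, S s -> tm j < s -> tm (j + 1) <= s.
  apply: int_step => m.
    have -> : m%:Z + 1 = m.+1%:Z by lia.
    by rewrite tS; case: (nxP (tm m)) => _ [].
  have -> : - m.+1%:Z + 1 = - m%:Z by lia.
  rewrite tN; case: (pvP (tm (- m%:Z))) => Sp [lp hp]; split=> // s Ss h.
  by rewrite leNgt; apply/negP => /(hp _ Ss); rewrite leNgt h.
have sp' j : tm j + c <= tm (j + 1) by apply: sp => //; case: (gap j).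
exists tm; split=> // t; split=> [St|[j ->] //].
have [j /andP[h1 h2]] := spaced_cover c0 t0 sp' t.
exists j; apply/eqP; rewrite eq_le h1 andbT leNgt; apply/negP => h.
by have := (gap j).2 t St h; rewrite leNgt h2.
Qed.

Lemma partial_sums (d : int -> int) : exists f : int -> int,
  f 0 = 0 /\ forall j, f (j + 1) = f j + d j.
Proof.
have [f [f0 fS fN]] := int_seq (0, 0 : int) (fun p => (p.1 + 1, p.2 + d p.1))
  (fun p => (p.1 - 1, p.2 - d (p.1 - 1))).
have f1 : forall j, (f j).1 = j.
  apply: int_step => m.
    by elim: m => [|m IH]; rewrite ?f0 // fS /= IH; lia.
  by elim: m => [|m IH]; rewrite fN /= ?f0 ?IH /=; lia.
exists (fun j => (f j).2); split; first by rewrite f0.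
apply: int_step => m.
  have -> : m%:Z + 1 = m.+1%:Z by lia.
  by rewrite fS /= f1.
have -> : - m.+1%:Z + 1 = - m%:Z by lia.
rewrite fN /= f1; have -> : - m%:Z - 1 = - m.+1%:Z by lia.
by rewrite subrK.
Qed.
Lemma enumeration_unique (f g : int -> R) : {homo f : j l / j < l} -> {homo g : j l / j < l} ->
  f 0 = g 0 -> (forall t, (exists j, t = f j) <-> (exists j, t = g j)) -> forall j, f j = g j.
Proof.
have up (u v : int -> R) j : {homo u : j l / j < l} -> {homo v : j l / j < l} ->
    (forall t, (exists j, t = u j) -> (exists j, t = v j)) -> u j = v j ->
    v (j + 1) <= u (j + 1).
  move=> hu hv uv e; have [l el] := uv (u (j + 1)) (ex_intro _ _ erefl).
  have jl : j < l.
    rewrite ltNge le_eqVlt; apply/negP => /orP[/eqP lj|/hv lj].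
      by have := hu j (j + 1); rewrite el lj e ltxx => h; suff : false by []; apply: h; lia.
    have : u j < u (j + 1) by apply: hu; lia.
    by rewrite el e ltNge (ltW lj).
  rewrite el; have : j + 1 <= l by lia.
  by rewrite le_eqVlt => /orP[/eqP->//|/hv/ltW].
have dn (u v : int -> R) j : {homo u : j l / j < l} -> {homo v : j l / j < l} ->
    (forall t, (exists j, t = u j) -> (exists j, t = v j)) -> u j = v j ->
    u (j - 1) <= v (j - 1).
  move=> hu hv uv e; have [l el] := uv (u (j - 1)) (ex_intro _ _ erefl).
  have jl : l < j.
    rewrite ltNge le_eqVlt; apply/negP => /orP[/eqP lj|/hv lj].
      by have := hu (j - 1) j; rewrite el -lj e ltxx => h; suff : false by []; apply: h; lia.
    have : u (j - 1) < u j by apply: hu; lia.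
    by rewrite el e ltNge (ltW lj).
  rewrite el; have : l <= j - 1 by lia.
  by rewrite le_eqVlt => /orP[/eqP->//|/hv/ltW].
move=> hf hg e0 fg; have fg1 t := (fg t).1; have fg2 t := (fg t).2.
apply: int_step.
  elim=> [|m IH]; first exact: e0.
  have -> : m.+1%:Z = m%:Z + 1 by lia.
  by apply/eqP; rewrite eq_le !up.
elim=> [|m IH].
  have -> : - 1%:Z = 0 - 1 :> int by lia.
  by apply/eqP; rewrite eq_le !dn.
have -> : - m.+2%:Z = - m.+1%:Z - 1 :> int by lia.
by apply/eqP; rewrite eq_le !dn.
Qed.

Lemma int_gap i j : i < j -> exists2 l : nat, (0 < l)%N & j = i + l%:Z.
Proof. by move=> ij; exists (absz (j - i)%R); lia. Qed.

Lemma homo_unbounded_below (f : int -> int) : f 0 = 0 -> {homo f : j l / j < l} ->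
  forall i, exists j, f j < i.
Proof.
move=> f0 hf i.
have h (m : nat) : f (- m%:Z) <= - m%:Z.
  elim: m => [|m IH]; first by rewrite f0.
  have : f (- m.+1%:Z) < f (- m%:Z) by apply: hf; lia.
  by move: IH; move: (f _) (f _) => u v; lia.
exists (- (absz i).+1%:Z); have := h (absz i).+1; move: (f _) => u; lia.
Qed.

Lemma int_eq_step (f g d : int -> int) : f 0 = g 0 ->
  (forall j, f (j + 1) = f j + d j) -> (forall j, g (j + 1) = g j + d j) ->
  forall j, f j = g j.
Proof.
move=> e0 hf hg; apply: int_step.
  elim=> [|m IH]; first exact: e0.
  have -> : m.+1%:Z = m%:Z + 1 by lia.
  by rewrite hf hg IH.
have dn j : f (j + 1) = g (j + 1) -> f j = g j by rewrite hf hg => /addIr.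
elim=> [|m IH]; apply: dn; first by rewrite subrr.
by have -> : - m.+2%:Z + 1 = - m.+1%:Z :> int by lia.
Qed.
Lemma marking_data (G : groupType) (Y D : Type) (T : Y -> Y) (dg : nat -> Y -> D)
    (br : nat -> Y -> G) (N : int -> G) (y : int -> Y) (d : int -> nat) :
  (forall u, br 0%N u = 1%g) ->
  (forall e (l : nat) u, br (e + l)%N u = (br e u * br l (iter e T u))%g) ->
  (forall e (l : nat) u, (0 < l)%N -> dg (e + l)%N u = dg l (iter e T u)) ->
  (forall j, (0 < d j)%N) -> (forall j, N (j + 1) = (N j * br (d j) (y j))%g) ->
  (forall j, y (j + 1) = iter (d j) T (y j)) ->
  exists (ix : int -> int) (a : int -> D) (M : int -> G),
  [/\ ix 0 = 0, {homo ix : j l / j < l}, forall j, M (ix j) = N j &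
    forall j (l : nat), (0 < l)%N ->
      a (ix j + l%:Z) = dg l (y j) /\ M (ix j + l%:Z) = (N j * br l (y j))%g].
Proof.
move=> br0 brD dgD d0 NS yS.
have [ix [i0 iS]] := partial_sums (fun j => (d j)%:Z).
have ihomo : {homo ix : j l / j < l}.
  by apply: homo_succ => j; rewrite iS; have := d0 j; lia.
have step j (m : nat) : exists e : nat, [/\ ix (j + m%:Z) = ix j + e%:Z,
    N (j + m%:Z) = (N j * br e (y j))%g & y (j + m%:Z) = iter e T (y j)].
  elim: m => [|m [e [e1 e2 e3]]].
    by exists 0%N; rewrite !addr0 br0 mulg1.
  have -> : j + m.+1%:Z = j + m%:Z + 1 by lia.
  exists (d (j + m%:Z)%R + e)%N; split.
  - by rewrite iS e1 PoszD -addrA [e%:Z + _]addrC.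
  - by rewrite NS e2 e3 addnC brD mulgA.
  - by rewrite yS e3 iterD.
(* The crossing lies strictly before the index: the offset [L i] is then positive, as digits are
   numbered from 1. *)
have [j0 hj0] := choice (homo_unbounded_below i0 ihomo).
have LP i : exists l : nat, (0 < l)%N /\ i = ix (j0 i) + l%:Z.
  by have [l l0 el] := int_gap (hj0 i); exists l.
have [L hL] := choice LP.
exists ix, (fun i => dg (L i) (y (j0 i))), (fun i => N (j0 i) * br (L i) (y (j0 i)))%g.
have rule j (l : nat) : (N (j0 (ix j + l%:Z)) * br (L (ix j + l%:Z)) (y (j0 (ix j + l%:Z))) =
     N j * br l (y j))%g /\
    ((0 < l)%N -> dg (L (ix j + l%:Z)) (y (j0 (ix j + l%:Z))) = dg l (y j)).
  have := hL (ix j + l%:Z); move: (j0 _) (L _) => q Li [L0 eL].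
  have [qj|jq] := leP q j.
    have [b eb] : exists b : nat, j = q + b%:Z by exists (absz (j - q)%R); lia.
    have [e [e1 e2 e3]] := step q b; rewrite -eb in e1 e2 e3.
    have -> : Li = (e + l)%N by move: eL; rewrite e1; lia.
    by rewrite e2 e3 brD mulgA; split=> // l0; exact: dgD.
  have [b b0 eb] := int_gap jq.
  have [e [e1 e2 e3]] := step j b; rewrite -eb in e1 e2 e3.
  have -> : l = (e + Li)%N by move: eL; rewrite e1; lia.
  by rewrite e2 e3 brD mulgA; split=> // l0; rewrite dgD.
split; [exact: i0|exact: ihomo| |].
  by move=> j; have [+ _] := rule j 0%N; rewrite addr0 br0 mulg1.
by move=> j l l0; have [r1 r2] := rule j l; split; [exact: r2|exact: r1].
Qed.
End BiInfiniteSequences.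

(** * The marking *)

Section Crossings.
Context {R : realType} {k : scalars} {n : nat} (n_gt0 : (0 < n)%N) (A : iwasawa_cf R k n).
Local Notation K := (scalar R k).
Local Notation G := (PUJ R k n).
Local Notation iota := (cf_inv A).
Local Notation Z := (cf_lattice A).
Local Notation Dm := (cf_domain A).
Local Notation Mod := (cf_modular A).
Local Notation T := (cf_shift A).
Local Notation dg := (cf_digit A).
Local Notation br := (branch A).
Local Notation ex := (@ex R k).
Implicit Types (p q y : kpoint R k n) (x : xkpoint R k n) (g M N : G) (s t : R)
  (gam : R -> kpoint R k n).


#[local] Opaque gauge mob xmob cdist.

(* The images of the cusp oo and of the points of [K] that the rounding does not determine. *)
Definition exceptional : set (xkpoint R k n) :=
  \bigcup_(M in Mod) (xmob M @` (None |` Some @` overlap Z Dm)).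

Lemma exceptional_inf M : Mod M -> exceptional (xmob M None).
Proof. by move=> MM; exists M => //; exists None => //; left. Qed.

Lemma exceptional_mob M x : Mod M -> good x -> exceptional (xmob M x) -> exceptional x.
Proof.
move=> MM gx [N MN [u Lu eu]]; exists (M^-1 * N)%g; first exact: ModM (ModV MM) MN.
exists u; first exact: Lu.
have gu : good u.
  case: Lu => [->//|[q [Dq _] <-]]; exact: in_X_good (D_X Dq).
by rewrite (xmobM _ _ gu) eu (xmobK M gx).
Qed.

Lemma exceptional_overlap M q : Mod M -> overlap Z Dm q -> exceptional (xmob M (Some q)).
Proof. by move=> MM oq; exists M => //; exists (Some q) => //; right; exists q. Qed.

(** Completeness puts [M^-1 N] into the lattice. If it were not the identity, it would map the point
    [y'] of the domain to the point [y], so [y] would lie in the overlap and the end would be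
    exceptional. *)
Lemma cusp_unique (A_complete : cf_complete A) M N x y y' : ~ exceptional x -> good x ->
  Mod M -> Mod N -> xmob M^-1%g x = Some y -> Dm y -> xmob N^-1%g x = Some y' -> Dm y' ->
  xmob (M^-1 * N)%g None = None -> M = N.
Proof.
move=> nx gx MM MN hy Dy hy' Dy' inf.
have Za : Z (M^-1 * N)%g.
  by rewrite -A_complete; split; [exact: ModM (ModV MM) MN|exact: inf].
have [e|ne] := eqVneq (M^-1 * N)%g (1%g : G).
  by rewrite -[M]mulg1 -e mulgA mulgV mul1g.
exfalso; apply: nx.
have ex1 : x = xmob M (Some y) by rewrite -hy xmobKV.
rewrite ex1; apply: exceptional_overlap; first exact: MM.
split; first exact: Dy.
have gy' := in_X_good (D_X Dy').
exists (M^-1 * N)%g; first by split; [exact: Za|exact/eqP].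
exists y'; first exact: Dy'.
apply: mob_some; rewrite (xmobM _ _ gy').
have -> : xmob N (Some y') = x by rewrite -hy' xmobKV.
exact: hy.
Qed.

(** * Crossings of translates of the section *)

Section OnSection.
Variables (h2 h0 : R).

Definition on_section gam : Prop := [/\ geodesic gam,
  cf_wall h2 (gam 0) /\ (forall t, 0 < t -> ~ cf_wall h2 (gam t)),
  ((Some @` Dm) `\` exceptional) (forward_end gam)
  & exists2 t, t < 0 & h0 < ht (gam t)].

Lemma section_tangent gam : geodesic gam ->
  section_W A h2 h0 (tangent gam 0) <-> on_section gam.
Proof.
move=> gg; split=> [[gam1 h1 e]|h]; last by exists gam.
have g1 : geodesic gam1 by case: h1.
by rewrite -(geodesic_tangent_inj g1 gg e).
Qed.

(** The crossing is seen in the frame of [N], where the translated section becomes the section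
    itself; see [crosses_translate]. *)
Definition crosses gam N t : Prop := on_section (fun s => mob N^-1%g (gam (s + t))).

Lemma geodesic_frame gam N t : geodesic gam ->
  geodesic (fun s => mob N^-1%g (gam (s + t))) /\
  forward_end (fun s => mob N^-1%g (gam (s + t))) = xmob N^-1%g (forward_end gam).
Proof.
move=> gg; have [h1 h2'] := geodesic_mob N^-1%g (geodesic_shift t gg).
split; first exact: h1.
exact: (etrans h2' (congr1 (xmob N^-1%g) (geodesic_shift_end t gg))).
Qed.

Lemma crosses_translate gam N t : geodesic gam ->
  ttranslate N (section_W A h2 h0) (tangent gam t) <-> crosses gam N t.
Proof.
move=> gg; have gs := geodesic_shift t gg; split.
  move=> [gam1 [g1 s1] e]; rewrite (tangent_shift gam t) in e.
  have [g2 _] := geodesic_mob N g1.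
  have e2 := geodesic_tangent_inj g2 gs e.
  rewrite /crosses; have -> : (fun s => mob N^-1%g (gam (s + t))) = gam1.
    by apply/funext => s; rewrite -(congr1 (fun f => f s) e2) (mobK_H N (g1.1 _)).
  by case: (section_tangent g1) => + _; apply.
move=> h; have [g1 _] := geodesic_frame N t gg.
exists (fun s => mob N^-1%g (gam (s + t))).
  split; first exact: g1.
  by case: (section_tangent g1) => _; apply.
rewrite (tangent_shift gam t).
suff -> : (fun s => mob N (mob N^-1%g (gam (s + t)))) = (fun s => gam (s + t)) by [].
by apply/funext => s; rewrite (mobKV_H N (gg.1 _)).
Qed.

Lemma crossing_timesE gam : geodesic gam ->
  crossing_times A h2 h0 gam = [set t | exists2 N, Mod N & crosses gam N t].
Proof.
move=> gg; apply/seteqP; split=> t [N MN h]; exists N; first exact: MN.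
  by case: (crosses_translate N t gg) => + _; apply.
exact: MN.
by case: (crosses_translate N t gg) => _; apply.
Qed.

Lemma crosses_shift gam M N s t : geodesic gam ->
  crosses (fun r => mob M^-1%g (gam (r + s))) N t <-> crosses gam (M * N)%g (t + s).
Proof.
move=> gg; rewrite /crosses.
have e : (fun r => mob N^-1%g (mob M^-1%g (gam (r + t + s)))) =
    (fun r => mob (M * N)^-1%g (gam (r + (t + s)))).
  by apply/funext => r; rewrite invgM addrA (mobM_H _ _ (gg.1 _)).
exact: (eq_ind _ (fun f => on_section _ <-> on_section f) (iff_refl _) _ e).
Qed.
End OnSection.

(** * Visits to horoballs, crossings and markings *)

Section Dynamics.
Hypotheses (A_complete : cf_complete A) (A_proper : cf_proper A).
Variables (eps h2 h0 kp rho delta : R).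
Hypotheses (eps_gt0 : 0 < eps) (h2P : wall_height A eps h2).
Hypotheses (kp0 : 0 < kp) (kp1 : kp <= 1)
  (cusp : forall N, Mod N -> xmob N None <> None -> kp <= nu N None).
Hypotheses (rho1 : rho < 1) (Drho : forall p, Dm p -> gauge p <= rho).
(** [h0_eps] makes points above [h0] have gauge at least [1 + eps], [h0_h2] separates visits to
    different cusps, and the conditions on [delta] are those of the approximation lemma
    [legendre]. *)
Hypotheses (h0_eps : (1 + eps) ^+ 2 <= h0) (h0_h2 : 1 <= h0 * h2 * kp ^+ 2)
  (delta0 : 0 < delta) (h0_delta : 4 <= delta ^+ 2 * kp ^+ 2 * h0)
  (delta_kp : delta * (3 - rho) < kp * (1 - rho)) (delta_h2 : delta ^+ 2 < h2 * kp).
Local Notation crosses := (crosses h2 h0).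
Local Notation on_section := (on_section h2 h0).

Let h20 : 0 < h2. Proof. by case: h2P => /andP[]. Qed.
Let h21 : h2 < 1. Proof. by case: h2P => /andP[]. Qed.
Let h01 : 1 < h0.
Proof.
by apply: lt_le_trans h0_eps; rewrite expr_gt1 ?ltrDl ?addr_ge0 ?(ltW eps_gt0).
Qed.
Let h00 : 0 < h0. Proof. exact: lt_trans h01. Qed.

Lemma height_product_gt1 (H L : R) : h0 < H -> h2 <= L -> 1 < H * L * kp ^+ 2.
Proof.
move=> hc h.
have H0 : 0 < H := lt_trans h00 hc.
apply: (le_lt_trans h0_h2); rewrite ltr_pM2r ?exprn_gt0 //.
apply: (@lt_le_trans _ _ (H * h2)); first by rewrite ltr_pM2r.
by rewrite ler_pM2l.
Qed.

Lemma height_spacing (a b c s t : R) : ex c ^+ 2 <= h0 -> h0 < a -> b <= 1 ->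
  a * ex s ^+ 2 <= b * ex t ^+ 2 -> c + s <= t.
Proof.
move=> hc a0 b1 h; rewrite -(@ex2_le R k).
have e0 := exprn_gt0 2 (ex_gt0 (k := k) s); have e1 := exprn_gt0 2 (ex_gt0 (k := k) t).
rewrite exD exprMn; apply: (@le_trans _ _ (a * ex s ^+ 2)).
  by rewrite ler_pM2r //; apply: le_trans hc _; exact: ltW.
by apply: le_trans h _; rewrite -[leRHS]mul1r ler_pM2r.
Qed.

Lemma gauge_ht p : in_H p -> ht p <= gauge p ^+ 2.
Proof.
move=> pH; have gp := in_H_good pH; rewrite -(pr_gauge gp).
exact: pr_htl gp (in_X_good (@in_X0 R k n)).
Qed.

Section Along.
Variable gam : R -> kpoint R k n.
Hypotheses (gg : geodesic gam) (gne : ~ exceptional (forward_end gam)).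
Local Notation x := (forward_end gam).

Let gx : good x.
Proof.
have [Y [eta [_ _]]] := geodesic_gline gg; case: (forward_end gam) => [q /in_X_good|] //.
Qed.

Definition visits N t : Prop := Mod N /\ (Some @` Dm) (xmob N^-1%g x) /\
  h0 < ht (mob N^-1%g (gam t)).

Lemma crosses_data N t : Mod N -> crosses gam N t ->
  [/\ gauge (mob N^-1%g (gam t)) = 1, h2 <= ht (mob N^-1%g (gam t)),
      (Some @` Dm) (xmob N^-1%g x) & exists2 th, th < t & visits N th].
Proof.
move=> MN [_ [[[_ w1] w2] _] he [th th0 hth]].
have [_ fe] := geodesic_frame N t gg; rewrite fe in he.
rewrite add0r in w1 w2; case: he => he _.
split; [exact: w1|exact: w2|exact: he|].
exists (th + t); first by rewrite gtrDr.
split; first exact: MN.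
by split; [exact: he|exact: hth].
Qed.

Lemma crosses_time N s t : Mod N -> crosses gam N s -> crosses gam N t -> s = t.
Proof.
have key s' t' : Mod N -> crosses gam N s' -> crosses gam N t' -> ~ s' < t'.
  move=> MN [_ [_ ns] _ _] [_ [wt _] _ _] st.
  have d0 : 0 < t' - s' by rewrite subr_gt0.
  by apply: (ns _ d0); rewrite subrK; rewrite add0r in wt.
by move=> MN cs ct; case: (ltgtP s t) => // h; case: (key _ _ MN _ _ h).
Qed.

(** In the frame of [N], height above [h0] forces gauge at least [1 + eps]. The geodesic then
    crosses the sphere once and stays inside, and [wall_height] places the crossing on the wall. *)
Lemma visits_crosses N th : visits N th -> exists2 t, th < t & crosses gam N t.
Proof.
move=> [MN [[y Dy ey] hth]].
have [g1 fe1] := geodesic_frame N 0 gg; rewrite -ey in fe1.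
have y1 := D_gauge_lt1 A_proper Dy.
set gam1 := (fun s => mob N^-1%g (gam (s + 0))) in g1 fe1.
have hth1 : h0 < ht (gam1 th) by rewrite /gam1 addr0.
have E : (1 + eps) <= gauge (gam1 th).
  have e0 : 0 <= 1 + eps by rewrite addr_ge0 // ltW.
  rewrite -(@ler_pXn2r _ 2) ?nnegrE ?gauge_ge0 //.
  by apply: (le_trans h0_eps); apply: ltW; apply: lt_le_trans hth1 _; apply: gauge_ht; exact: g1.1.
have E1 : 1 < gauge (gam1 th) by apply: lt_le_trans E; rewrite ltrDl.
have [t1 [tht1 s1 _ aft]] := sphere_crossing g1 fe1 y1 E1.
exists t1; first exact: tht1.
have [g2 fe2] := geodesic_frame N t1 gg.
have e12 s : mob N^-1%g (gam (s + t1)) = gam1 (s + t1) by rewrite /gam1 addr0.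
split; first exact: g2.
- split.
    rewrite e12 add0r; split; first by split; [exact: g1.1|exact: s1].
    have [_ wh] := h2P.
    have := wh (fun s => gam1 (s + th)) _ _ _ (t1 - th); rewrite subrK; apply.
    + have gs := geodesic_shift th g1.
      by split=> [s _|s t _ _]; [exact: gs.1|exact: gs.2].
    + by rewrite add0r.
    + by rewrite (geodesic_shift_end th g1) fe1; exists y.
    + by rewrite subr_ge0 ltW.
    + by split; [exact: g1.1|exact: s1].
  move=> s s0 [[_ h] _]; move: h; rewrite e12 => h.
  have := aft (s + t1); rewrite h ltxx ltrDr => /(_ s0); exact: notF.
- split; first by rewrite fe2 -ey; exists y.
  rewrite fe2 => /(exceptional_mob (ModV MN) gx); exact: gne.
by exists (th - t1); [rewrite subr_lt0|rewrite subrK].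
Qed.


(** The height is above [h2] at both ends of the interval, and it is unimodal. *)
Lemma visit_ht N th t s : visits N th -> crosses gam N t -> th <= s -> s <= t ->
  h2 <= ht (mob N^-1%g (gam s)).
Proof.
move=> v c ths st; have [MN [[y Dy ey] hth]] := v.
have [g1 fe1] := geodesic_frame N 0 gg; rewrite -ey in fe1.
have [_ ht2 _ _] := crosses_data MN c.
have := @ht_unimodal R k n _ y g1 fe1 h2 th s t ths st.
rewrite !addr0; apply; [|exact: ht2].
exact: (ltW (lt_trans (lt_trans h21 h01) hth)).
Qed.

(** For [q = N^-1 p] the left side is the square of [ht q * nu N q^-1 * kp], that is of
    [ht p * nu N q * kp]. As [ht p <= pr p (N oo)] and [kp <= nu N oo], the base is at most the
    pairing of [q] with oo, which is 1. *)
Lemma ht_product N p : Mod N -> xmob N None <> None -> in_H p ->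
  ht (mob N^-1%g p) * ht p * kp ^+ 2 <= 1.
Proof.
move=> MN Ninf pH; have gI := @good_inf R k n; have gp := in_H_good pH.
have [e1 H1] := xmob_H N^-1%g pH; have ck := cusp MN Ninf.
have g1 := in_H_good H1.
have e2 : xmob N (Some (mob N^-1%g p)) = Some p by rewrite -e1 xmobKV.
move: (mob N^-1%g p) e1 H1 g1 e2 => q e1 H1 g1 e2.
have h1 := xht_xmob N g1; rewrite e2 /= in h1.
have h3 := pr_xmob N g1 gI; rewrite e2 prC in h3.
move: Ninf ck h3 (xht_xmob N gI); case: (xmob N None) => [z|] // _ ck h3 hz.
have zX : in_X z.
  move/eqP: hz; rewrite /= mulf_eq0 sqrf_eq0 (gt_eqF (nu_gt0 N gI)) orbF => /eqP; exact.
rewrite [pr _ None]prC pr_inf in h3.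
have hp := pr_htl gp (in_X_good zX); rewrite prC in hp.
have p0 : 0 < ht p := pH; have n0 := nu_gt0 N g1; have c0 := nu_gt0 N gI.
rewrite -/(ht p) -/(ht q) in h1; rewrite -h1.
move: (ht p) (pr _ _) (nu N (Some q)) (nu N None) p0 hp n0 c0 ck h3 {h1}.
move=> h P a c p0 hp a0 c0 ck h3.
have -> : h * a ^+ 2 * h * kp ^+ 2 = (h * (a * kp)) ^+ 2 by ring.
have u0 : 0 <= h * (a * kp) by rewrite !mulr_ge0 // ltW.
rewrite expr_le1 // -h3; apply: ler_pM => //; first exact: ltW.
  by rewrite mulr_ge0 // ltW.
by rewrite ler_pM2l.
Qed.

(** If a visit to [M] fell between a visit to [N] and its crossing, the height over one cusp would
    exceed [h0] while that over the other is at least [h2]. This contradicts [ht_product] for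
    [N^-1 M], which moves oo by [cusp_unique]. *)
Lemma visits_disjoint N M a b c d : N <> M ->
  visits N a -> crosses gam N b -> visits M c -> crosses gam M d -> b < c \/ d < a.
Proof.
have key N' M' a' b' c' : N' <> M' -> visits N' a' -> crosses gam N' b' -> visits M' c' ->
    ~ (a' <= c' <= b').
  move=> NM v1 c1 v2 /andP[ac cb]; have h := visit_ht v1 c1 ac cb.
  have [MN [[y Dy ey] _]] := v1; have [MM [[y' Dy' ey'] hc]] := v2.
  have ninf : xmob (N'^-1 * M')%g None <> None.
    move=> e; apply: NM.
    exact: (cusp_unique A_complete gne gx MN MM (esym ey) Dy (esym ey') Dy' e).
  have pH : in_H (mob N'^-1%g (gam c')) by apply: mob_H; exact: gg.1.
  have := ht_product (ModM (ModV MN) MM) ninf pH.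
  rewrite invgM invgK mobM_H // mobKV_H; last exact: gg.1.
  rewrite leNgt => /negP; apply.
  exact: (height_product_gt1 hc h).
move=> NM vN cN vM cM; have MN : M <> N by move=> e; apply: NM.
have [bc|cb] := ltP b c; first by left.
have [da|ad] := ltP d a; first by right.
exfalso; have [ac|ca] := leP a c.
  by apply: (key _ _ _ _ _ NM vN cN vM); rewrite ac cb.
by apply: (key _ _ _ _ _ MN vM cM vN); rewrite (ltW ca) ad.
Qed.

Lemma crosses_unique N M t : Mod N -> Mod M -> crosses gam N t -> crosses gam M t -> N = M.
Proof.
move=> MN MM cN cM; apply: contrapT => NM.
have [_ _ _ [a at_ vN]] := crosses_data MN cN; have [_ _ _ [c ct vM]] := crosses_data MM cM.
by case: (visits_disjoint NM vN cN vM cM) => h;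
  [have := lt_trans h ct|have := lt_trans h at_]; rewrite ltxx.
Qed.

Lemma crosses_visit_after N M s t c : s < t -> visits M c -> Mod N ->
  crosses gam N s -> crosses gam M t -> s < c.
Proof.
move=> st vM MN cN cM.
have NM : N <> M by move=> e; rewrite e in cN; move: st; rewrite (crosses_time vM.1 cN cM) ltxx.
have [_ _ _ [a as_ vN]] := crosses_data MN cN.
case: (visits_disjoint NM vN cN vM cM) => // ta; exfalso.
by have := lt_trans (lt_trans st ta) as_; rewrite ltxx.
Qed.

(** After the earlier crossing comes the visit to the later cusp, at height above [h0]; on its wall
    the height is at most 1. [ht_growth] turns this drop into time at least [c]. *)
Lemma crossing_spacing (c : R) N M s t : ex c ^+ 2 <= h0 -> Mod N -> Mod M -> s < t ->
  crosses gam N s -> crosses gam M t -> s + c <= t.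
Proof.
move=> hc MN MM st cN cM.
have [g1 _ [y Dy ey] [th tht vM]] := crosses_data MM cM.
have sth := crosses_visit_after st vM MN cN cM.
have [gf fe] := geodesic_frame M 0 gg; rewrite -ey in fe.
have := @ht_growth R k n _ y gf fe th t (ltW tht); rewrite !addr0.
have tH : in_H (mob M^-1%g (gam t)) by apply: mob_H; exact: gg.1.
have t1 : ht (mob M^-1%g (gam t)) <= 1 by have := gauge_ht tH; rewrite g1 expr1n.
have [_ [_ hth]] := vM.
move=> h; apply: le_trans (height_spacing hc hth t1 h).
by rewrite addrC lerD2l; exact: ltW.
Qed.
End Along.

Lemma on_section_start gam : on_section gam -> crosses gam 1%g 0.
Proof.
move=> h; suff e : (fun s => mob 1^-1%g (gam (s + 0))) = gam.
  by rewrite -e in h; exact: h.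
by apply/funext => s; rewrite invg1 mob1 addr0.
Qed.
(** Zero is the image of oo under the inversion, so a vanishing iterate would make [p] a cusp, hence
    exceptional. *)
Lemma orbit_neq0 p : Dm p -> ~ exceptional (Some p) -> forall i, iter i T p != 0.
Proof.
move=> Dp ne i; elim: i p Dp ne => [|i IH] p Dp ne.
  apply/eqP => /= p0; apply: ne; rewrite p0.
  have [_ <- _] := cf_invP A; apply: exceptional_inf; exact: Mod_inv.
have p0 : p != 0.
  apply/eqP => p0; apply: ne; rewrite p0.
  have [_ <- _] := cf_invP A; apply: exceptional_inf; exact: Mod_inv.
rewrite iterSr; apply: IH; first exact: shift_D.
rewrite -(shift_mob Dp p0) => h; apply: ne; apply: exceptional_mob h.
  have h1 : Mod (dg 1 p) := Mod_Z (digit_Z 1 Dp).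
  have h2' : Mod iota^-1%g := ModV (@Mod_inv _ _ _ A).
  have h3 : Mod (iota^-1 * dg 1 p)%g := ModM h2' h1.
  exact: ModV h3.
exact: in_X_good (D_X Dp).
Qed.

Lemma branch_mob_fin i p : Dm p -> (forall j, (j < i)%N -> iter j T p != 0) ->
  xmob (br i p)^-1%g (Some p) = Some (iter i T p).
Proof.
move=> Dp; elim: i => [|i IH] h; first by rewrite branch0 invg1 xmob1.
have gp := in_X_good (D_X Dp).
rewrite branch_digit invgM (xmobM _ _ gp) IH; last by move=> j ji; apply: h; exact: ltnW.
exact: (shift_mob (iter_D i Dp) (h i (ltnSn i))).
Qed.

Lemma branch_is_branch i p : Dm p -> is_branch A i (br i p) p.
Proof.
move=> Dp y Dy h.
have e : br i p = br i y.
  by apply: branch_agree => j /h[_ ->].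
have y0 j : (j < i)%N -> iter j T y != 0 by move=> ji; have [] := h j.+1 ji.
have e2 := branch_mob_fin Dy y0.
rewrite e; apply: mob_some; rewrite -e2; apply: xmobKV.
exact: in_X_good (D_X Dy).
Qed.

Lemma section_end gam : on_section gam ->
  exists p, [/\ forward_end gam = Some p, Dm p & ~ exceptional (Some p)].
Proof. by move=> [_ _ [[p Dp <-] ne] _]; exists p. Qed.

Lemma section_not_exceptional gam : on_section gam -> ~ exceptional (forward_end gam).
Proof. by move=> /section_end[p [-> _]]. Qed.

Lemma section_geodesic gam : on_section gam -> geodesic gam.
Proof. by case. Qed.

Lemma end_good gam : geodesic gam -> good (forward_end gam).
Proof.
move=> gg; have [Y [eta [_ _]]] := geodesic_gline gg.
by case: (forward_end gam) => [q /in_X_good|].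
Qed.

(** The start on the section supplies the base point for [legendre], which finds a branch with the
    same image of oo as [N]. [cusp_unique] upgrades this to equality of the maps. *)
Lemma section_first_branch gam N t p : on_section gam -> Mod N -> crosses gam N t -> 0 < t ->
  forward_end gam = Some p -> exists2 i, (0 < i)%N & N = br i p.
Proof.
move=> os MN cN t0 ep; have gg := section_geodesic os; have ne := section_not_exceptional os.
have [p' [ep' Dp nep]] := section_end os; rewrite ep in ep'; case: ep' => ep'; subst p'.
have gx := end_good gg.
have c1 := on_section_start os.
have [_ _ [y Dy ey] [th tht vN]] := crosses_data gg MN cN.
have th0 := crosses_visit_after gg ne t0 vN (@Mod1 _ _ _ A) c1 cN.
have p0 := orbit_neq0 Dp nep.
rewrite ep in gx ey.
have e1 : xmob 1^-1%g (forward_end gam) = Some p by rewrite invg1 xmob1 ep.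
have Ninf : xmob N None <> None.
  move=> inf; have N1 : 1%g = N.
    apply: (cusp_unique A_complete nep gx (@Mod1 _ _ _ A) MN _ Dp (esym ey) Dy).
      by rewrite invg1 xmob1.
    by rewrite invg1 mul1g.
  rewrite -N1 in cN; have := crosses_time (@Mod1 _ _ _ A) c1 cN => t00.
  by rewrite -t00 ltxx in t0.
have [_ [[w1 w2] _] _ _] := os; case: w1 => H0 g1.
(* The visit occurs at [th > 0] and the pairing with the end decreases along the geodesic, so at
   time 0 it is at least the height reached at the visit. *)
have big : h0 <= pr (Some y) (xmob N^-1%g (Some (gam 0))).
  have [gf fe] := geodesic_frame N 0 gg; rewrite ep -ey in fe.
  have := @pr_end_decr R k n _ y gf fe 0 th (ltW th0); rewrite !addr0.
  have [-> Hm] := xmob_H N^-1%g H0.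
  apply: le_trans; have [_ [_ hth]] := vN.
  apply: (le_trans (ltW hth)); rewrite prC; apply: pr_htl; last exact: in_X_good (D_X Dy).
  by apply: in_H_good; apply: mob_H; exact: gg.1.
have [i i0 inf] := legendre n_gt0 Dp p0 A_proper kp0 rho1 Drho cusp kp1 delta0 h0_delta
  delta_kp h00 delta_h2 H0 g1 w2 MN (esym ey) Ninf big.
exists i; first exact: i0.
have bm := branch_mob Dp p0 i.
exact: esym (cusp_unique A_complete nep gx (branch_Mod i Dp) MN bm (iter_D i Dp) (esym ey) Dy inf).
Qed.

Definition end_in gam N : kpoint R k n := odflt 0 (xmob N^-1%g (forward_end gam)).

Lemma crosses_end gam N t : geodesic gam -> ~ exceptional (forward_end gam) -> Mod N ->
  crosses gam N t -> [/\ xmob N^-1%g (forward_end gam) = Some (end_in gam N),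
    Dm (end_in gam N), forall i, iter i T (end_in gam N) != 0
    & ~ exceptional (Some (end_in gam N))].
Proof.
move=> gg ne MN cN; have [_ _ [y Dy ey] _] := crosses_data gg MN cN.
have e : end_in gam N = y by rewrite /end_in -ey.
have ney : ~ exceptional (Some y).
  by rewrite ey => /(exceptional_mob (ModV MN) (end_good gg)).
rewrite e; split; [exact: esym ey|exact: Dy|exact: orbit_neq0|exact: ney].
Qed.

Lemma next_branch gam N M s t : geodesic gam -> Mod N -> Mod M ->
  crosses gam N s -> crosses gam M t -> s < t -> ~ exceptional (forward_end gam) ->
  exists2 i, (0 < i)%N & M = (N * br i (end_in gam N))%g.
Proof.
move=> gg MN MM cN cM st ne.
have [ey Dy y0 _] := crosses_end gg ne MN cN.
have [gf fe] := geodesic_frame N s gg.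
have d0 : 0 < t - s by rewrite subr_gt0.
have MNM : Mod (N^-1 * M)%g := ModM (ModV MN) MM.
have cM' : crosses (fun r => mob N^-1%g (gam (r + s))) (N^-1 * M)%g (t - s).
  case: (crosses_shift h2 h0 N (N^-1 * M)%g s (t - s) gg) => _; apply.
  by rewrite mulgA mulgV mul1g subrK.
have [i i0 e] := section_first_branch cN MNM cM' d0 (etrans fe ey).
by exists i; rewrite // -e mulgA mulgV mul1g.
Qed.

Definition marks gam (m : marking R k n) : Prop :=
  [/\ [/\ mk_i m 0 = 0, mk_t m 0 = 0, {homo mk_i m : j l / j < l}
       & {homo mk_t m : j l / j < l}],
    forall N t, Mod N -> crosses gam N t <-> exists j, t = mk_t m j /\ N = mk_M m (mk_i m j),
    forall j, Mod (mk_M m (mk_i m j))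
  & forall j (l : nat), (0 < l)%N ->
      mk_a m (mk_i m j + l%:Z) = dg l (end_in gam (mk_M m (mk_i m j))) /\
      mk_M m (mk_i m j + l%:Z) =
        (mk_M m (mk_i m j) * br l (end_in gam (mk_M m (mk_i m j))))%g].

(** * Uniqueness, existence and shifts of the marking *)

Section MarksUnique.
Variables (gam : R -> kpoint R k n) (m m' : marking R k n).
Hypotheses (os : on_section gam) (hm : marks gam m) (hm' : marks gam m').

(** The times agree as increasing enumerations of one set with the same value at 0, and the maps at
    crossings by [crosses_unique]. Injectivity of the branches in their index gives equally many
    digits between consecutive crossings. *)
Lemma marks_unique : [/\ forall j, mk_t m j = mk_t m' j, forall j, mk_i m j = mk_i m' j,
  forall i, mk_a m i = mk_a m' i & forall i, mk_M m i = mk_M m' i].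
Proof.
have gg := section_geodesic os; have ne := section_not_exceptional os.
have [[i0 t0 hi ht_] cr MM rule] := hm; have [[i0' t0' hi' ht_'] cr' MM' rule'] := hm'.
have et : forall j, mk_t m j = mk_t m' j.
  apply: enumeration_unique => //; first by rewrite t0 t0'.
  move=> t; split=> -[j ej].
    have [_ c1] := cr _ t (MM j); have c := c1 (ex_intro _ j (conj ej erefl)).
    by have [h _] := cr' _ t (MM j); have [l [el _]] := h c; exists l.
  have [_ c1] := cr' _ t (MM' j); have c := c1 (ex_intro _ j (conj ej erefl)).
  by have [h _] := cr _ t (MM' j); have [l [el _]] := h c; exists l.
have cM j : crosses gam (mk_M m (mk_i m j)) (mk_t m j).
  have [_ c1] := cr _ (mk_t m j) (MM j).
  exact: c1 (ex_intro _ j (conj erefl erefl)).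
have cM' j : crosses gam (mk_M m' (mk_i m' j)) (mk_t m j).
  have [_ c1] := cr' _ (mk_t m j) (MM' j).
  exact: c1 (ex_intro _ j (conj (et j) erefl)).
have eN j : mk_M m (mk_i m j) = mk_M m' (mk_i m' j).
  exact: (crosses_unique gg ne (MM j) (MM' j) (cM j) (cM' j)).
have st j : exists l : nat, [/\ (0 < l)%N, mk_i m (j + 1) = mk_i m j + l%:Z
    & mk_i m' (j + 1) = mk_i m' j + l%:Z].
  have jj : j < j + 1 by rewrite ltrDl.
  have h1 := hi _ _ jj; have h2' := hi' _ _ jj.
  have [l l0 el] := int_gap h1; have [l' l0' el'] := int_gap h2'.
  have [_ r1] := rule j l l0; have [_ r2] := rule' j l' l0'.
  rewrite -el in r1; rewrite -el' -(eN j) in r2.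
  have [_ Dy y0 _] := crosses_end gg ne (MM j) (cM j).
  have eb : br l (end_in gam (mk_M m (mk_i m j))) = br l' (end_in gam (mk_M m (mk_i m j))).
    have e3 : (mk_M m (mk_i m j) * br l (end_in gam (mk_M m (mk_i m j))) =
        mk_M m (mk_i m j) * br l' (end_in gam (mk_M m (mk_i m j))))%g.
      by rewrite -r1 -r2; exact: eN.
    have := congr1 (fun g : G => (mk_M m (mk_i m j))^-1 * g)%g e3.
    by rewrite !mulgA mulVg !mul1g.
  have := branch_inj n_gt0 Dy y0 A_proper eb => ll; rewrite -ll in el'.
  by exists l.
have ei : forall j, mk_i m j = mk_i m' j.
  have [d hd] := choice st.
  apply: (int_eq_step (d := fun j => (d j)%:Z)); first by rewrite i0 i0'.
    by move=> j; case: (hd j).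
  by move=> j; case: (hd j).
have low i : exists j (l : nat), (0 < l)%N /\ i = mk_i m j + l%:Z.
  have [j hj] := homo_unbounded_below i0 hi i.
  by have [l l0 el] := int_gap hj; exists j, l.
have agree j (l : nat) : (0 < l)%N -> mk_a m (mk_i m j + l%:Z) = mk_a m' (mk_i m j + l%:Z) /\
    mk_M m (mk_i m j + l%:Z) = mk_M m' (mk_i m j + l%:Z).
  move=> l0; have [a1 r1] := rule j l l0; have [a2 r2] := rule' j l l0.
  have eN' := eN j; rewrite -(ei j) in a2 r2 eN'; rewrite -eN' in a2 r2.
  by split; [exact: etrans a1 (esym a2)|exact: etrans r1 (esym r2)].
split; [exact: et|exact: ei| |] => i; have [j [l [l0 ->]]] := low i;
  by have [h1 h2'] := agree j l l0.
Qed.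
End MarksUnique.
Section MarksExist.
Variables (gam : R -> kpoint R k n) (c : R).
Hypotheses (os : on_section gam) (hmk : markable A h2 h0 gam) (c0 : 0 < c) (hc : ex c ^+ 2 <= h0).

Lemma marks_exist : exists m, marks gam m /\ forall j, mk_t m j + c <= mk_t m (j + 1).
Proof.
have gg := section_geodesic os; have ne := section_not_exceptional os.
have c1 := on_section_start os.
pose S := [set t | exists2 N, Mod N & crosses gam N t].
have S0 : S 0 by exists 1%g; [exact: (@Mod1 _ _ _ A)|exact: c1].
have sp s t : S s -> S t -> s < t -> s + c <= t.
  by move=> [N MN cN] [M MM cM] st; exact: (crossing_spacing gg ne hc MN MM st cN cM).
have [_ i1 i2] := hmk; rewrite crossing_timesE // -/S in i1 i2.
have ub b : exists2 s, S s & b < s.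
  have [|s [Ss s0] h] := @spaced_unbounded R _ c c0 i2 _ b.
    by move=> s t [Ss _] [St _]; exact: sp.
  by exists s => //; move: h; rewrite ger0_norm // ltW.
have lb b : exists2 s, S s & s < b.
  have [|s [Ss s0] h] := @spaced_unbounded R _ c c0 i1 _ (- b).
    by move=> s t [Ss _] [St _]; exact: sp.
  by exists s => //; move: h; rewrite ltr0_norm // ltrN2.
have [tm [t0 tsp tS]] := enumerate_spaced c0 S0 sp ub lb.
have NP j : exists N, Mod N /\ crosses gam N (tm j).
  by have [_ h] := tS (tm j); have [N MN cN] := h (ex_intro _ j erefl); exists N.
have [N hN] := choice NP.
have MN j : Mod (N j) := (hN j).1; have cN j : crosses gam (N j) (tm j) := (hN j).2.
have N0 : N 0 = 1%g.
  have := cN 0; rewrite t0 => h; exact: (crosses_unique gg ne (MN 0) (@Mod1 _ _ _ A) h c1).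
have yP j := crosses_end gg ne (MN j) (cN j).
have ht_ : {homo tm : j l / j < l} := spaced_homo c0 tsp.
have dP j : exists d : nat, (0 < d)%N /\ N (j + 1) = (N j * br d (end_in gam (N j)))%g.
  have lt1 : tm j < tm (j + 1) by apply: ht_; rewrite ltrDl.
  have [d d0 e] := next_branch gg (MN j) (MN (j + 1)) (cN j) (cN (j + 1)) lt1 ne.
  by exists d.
have [d hd] := choice dP.
have yS j : end_in gam (N (j + 1)) = iter (d j) T (end_in gam (N j)).
  have [ej Dj y0 _] := yP j; have [eM _ _ _] := yP (j + 1).
  have e2 : xmob (N (j + 1))^-1%g (forward_end gam) = Some (iter (d j) T (end_in gam (N j))).
    have -> := (hd j).2; rewrite invgM (xmobM _ _ (end_good gg)) ej.
    exact: (branch_mob Dj y0).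
  by have := etrans (esym eM) e2 => -[].
have [ix [a [M [i0 ihomo mN rule]]]] := marking_data (@branch0 _ _ _ A) (@branchD _ _ _ A)
  (@digit_shift _ _ _ A) (fun j => (hd j).1) (fun j => (hd j).2) yS.
pose m := Marking a M ix tm.
exists m; split; last exact: tsp.
split=> /=.
- by split.
- move=> P t MP; split=> [cM|[j [-> ->]]]; last by rewrite mN; exact: cN.
  have [h _] := tS t; have [j ej] := h (ex_intro2 _ _ P MP cM).
  exists j; split; first exact: ej.
  rewrite ej in cM; rewrite mN; exact: (crosses_unique gg ne MP (MN j) cM (cN j)).
- by move=> j; rewrite mN; exact: MN.
- by move=> j l l0; rewrite mN; exact: rule.
Qed.
End MarksExist.

Section MarksShift.
Variables (gam : R -> kpoint R k n) (m : marking R k n) (l : int).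
Hypotheses (os : on_section gam) (hm : marks gam m).
Let N := mk_M m (mk_i m l).
Let gam' := fun t => mob N^-1%g (gam (t + mk_t m l)).

Lemma shift_crosses M t : Mod M ->
  crosses gam' M t <-> exists j, t = mk_t m (j + l) - mk_t m l /\ M = (N^-1 * mk_M m (mk_i m (j + l)))%g.
Proof.
move=> MM; have gg := section_geodesic os; have [_ cr MN _] := hm.
have MNM : Mod (N * M)%g := ModM (MN l) MM.
have h1 := crosses_shift h2 h0 N M (mk_t m l) t gg.
have h3 := cr (N * M)%g (t + mk_t m l) MNM.
split.
  case: h1 => h1 _ /h1; case: h3 => h3 _ /h3[j [e1 e2]].
  exists (j - l); rewrite subrK -e1 addrK; split; first by [].
  by rewrite -e2 mulgA mulVg mul1g.
move=> [j [e1 e2]]; case: h1 => _; apply; case: h3 => _; apply.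
by exists (j + l); rewrite e1 subrK e2 mulgA mulgV mul1g.
Qed.

Lemma shift_on_section : on_section gam'.
Proof.
have [_ cr MN _] := hm; have [_ h] := cr N (mk_t m l) (MN l).
exact: h (ex_intro _ l (conj erefl erefl)).
Qed.

Lemma shift_marks : marks gam' (Marking (fun i => mk_a m (i + mk_i m l))
  (fun i => N^-1 * mk_M m (i + mk_i m l))%g
  (fun j => mk_i m (j + l) - mk_i m l) (fun j => mk_t m (j + l) - mk_t m l)).
Proof.
have gg := section_geodesic os; have [[i0 t0 hi ht_] cr MN rule] := hm.
have fe : forward_end gam' = xmob N^-1%g (forward_end gam) := (geodesic_frame N (mk_t m l) gg).2.
have ee j : end_in gam' (N^-1 * mk_M m (mk_i m (j + l)))%g = end_in gam (mk_M m (mk_i m (j + l))).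
  have gx := good_xmob N^-1%g (end_good gg); rewrite /end_in fe invgM invgK (xmobM _ _ gx).
  by rewrite xmobKV //; exact: end_good.
split=> /=.
- split=> /=; rewrite ?add0r ?subrr //.
    by move=> j1 j2 jj; rewrite ltrD2r; apply: hi; rewrite ltrD2r.
  by move=> j1 j2 jj; rewrite ltrD2r; apply: ht_; rewrite ltrD2r.
- move=> M t MM; have [h1 h2'] := shift_crosses t MM; split.
    by move=> /h1[j [e1 e2]]; exists j; rewrite subrK.
  by move=> [j [e1 e2]]; rewrite subrK in e2; apply: h2'; exists j.
- by move=> j; rewrite subrK; exact: ModM (ModV (MN l)) (MN (j + l)).
- move=> j d d0; rewrite subrK ee; have [r1 r2] := rule (j + l) d d0.
  have e : mk_i m (j + l) - mk_i m l + d%:Z + mk_i m l = mk_i m (j + l) + d%:Z.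
    by rewrite addrAC subrK.
  by rewrite e r1 r2 mulgA.
Qed.

Lemma shift_markable (c : R) : 0 < c -> (forall j, mk_t m j + c <= mk_t m (j + 1)) ->
  markable A h2 h0 gam'.
Proof.
move=> c0 sp; have g' := section_geodesic shift_on_section.
have [[_ t0 _ _] cr MN _] := hm.
have inS j : crossing_times A h2 h0 gam' (mk_t m (j + l) - mk_t m l).
  rewrite (crossing_timesE _ _ g'); exists (N^-1 * mk_M m (mk_i m (j + l)))%g.
    exact: ModM (ModV (MN l)) (MN (j + l)).
  have MM := ModM (ModV (MN l)) (MN (j + l)).
  by have [_ h] := shift_crosses (mk_t m (j + l) - mk_t m l) MM; apply: h; exists j.
have f0 : mk_t m (0 + l) - mk_t m l = 0 by rewrite add0r subrr.
have fsp (j : int) : mk_t m (j + l) - mk_t m l + c <= mk_t m (j + 1 + l) - mk_t m l.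
  by rewrite addrAC lerD2r [j + 1 + l]addrAC; exact: sp.
have [i1 i2] := @spaced_infinite R (fun j => mk_t m (j + l) - mk_t m l) c c0 f0 fsp _ inS.
by split; [exact: g'|exact: i1|exact: i2].
Qed.
End MarksShift.
Lemma markings_exist :
  exists (mark : (R -> kpoint R k n) -> marking R k n) (c : R), 0 < c /\
  forall gam : R -> kpoint R k n,
    markable A h2 h0 gam -> section_W A h2 h0 (tangent gam 0) ->
  let a := mk_a (mark gam) in
  let M := mk_M (mark gam) in
  let ix := mk_i (mark gam) in
  let tm := mk_t (mark gam) in
  [/\ forall i, cf_lattice A (a i),
      forall i, cf_modular A (M i),
      {homo ix : j l / j < l} /\ {homo tm : j l / j < l}
    & ix 0 = 0 /\ tm 0 = 0] /\
  [/\ 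
      (forall j, c <= tm j - tm (j - 1)) /\
      (forall t : R, exists j, tm (j - 1) <= t <= tm j),
      exists2 x : kpoint R k n, forward_end gam = Some x &
        forall i : nat, (0 < i)%N ->
        [/\ a i%:Z = cf_digit A i x,
            M i%:Z = (\prod_(1 <= j < i.+1) ((cf_inv A)^-1 * a j%:Z))%g
          & is_branch A i (M i%:Z) x],
      forall (j : int) (t : R) (N : PUJ R k n),
        tm (j - 1) <= t <= tm j -> cf_modular A N -> h0 < ht_cusp N (gam t) ->
        (Some @` cf_domain A) (xmob N^-1%g (forward_end gam)) ->
        N = M (ix j),
      forall (N : PUJ R k n) (t : R), cf_modular A N ->
        (ttranslate N (section_W A h2 h0) (tangent gam t) <->
         exists j, t = tm j /\ N = M (ix j))
    & forall l : int,
        let gam' := fun t => mob (M (ix l))^-1%g (gam (t + tm l)) in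
        let m' := mark gam' in
        (markable A h2 h0 gam' /\ section_W A h2 h0 (tangent gam' 0)) /\
        [/\ forall j, mk_t m' j = tm (j + l) - tm l,
            forall j, mk_i m' j = ix (j + l) - ix l,
            forall i, mk_a m' i = a (i + ix l)
          & forall i, mk_M m' i = ((M (ix l))^-1 * M (i + ix l))%g]].
Proof.
(* The time which [ht_growth] requires for a descent from height [h0] to height 1; it is the spacing
   of the crossings. *)
have [c hc] := @ex_sqr_surj R k h0 h00.
have c0 : 0 < c by rewrite -(@ex2_lt R k) hc ex0 expr1n.
have hc' : ex c ^+ 2 <= h0 by rewrite hc.
have markP gam : exists m, markable A h2 h0 gam -> section_W A h2 h0 (tangent gam 0) ->
    marks gam m /\ forall j, mk_t m j + c <= mk_t m (j + 1).
  have [[hm hs]|no] := pselect (markable A h2 h0 gam /\ section_W A h2 h0 (tangent gam 0)).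
    have gg : geodesic gam by case: hm.
    have os : on_section gam by case: (section_tangent h2 h0 gg) => + _; apply.
    by have [m hm'] := marks_exist os hm c0 hc'; exists m.
  (* An arbitrary value for geodesics that are not markable or do not start on the section. *)
  exists (Marking (fun=> 1%g) (fun=> 1%g) (fun=> 0) (fun=> 0)) => hm hs.
  by case: no.
have [mark hmark] := choice markP; exists mark, c; split; first exact: c0.
move=> gam hm hs; have [mk sp] := hmark gam hm hs.
have gg : geodesic gam by case: hm.
have os : on_section gam by case: (section_tangent h2 h0 gg) => + _; apply.
have ne := section_not_exceptional os.
have eqv l : let gam' := fun t => mob (mk_M (mark gam) (mk_i (mark gam) l))^-1%g
      (gam (t + mk_t (mark gam) l)) in
    (markable A h2 h0 gam' /\ section_W A h2 h0 (tangent gam' 0)) /\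
    [/\ forall j, mk_t (mark gam') j = mk_t (mark gam) (j + l) - mk_t (mark gam) l,
        forall j, mk_i (mark gam') j = mk_i (mark gam) (j + l) - mk_i (mark gam) l,
        forall i, mk_a (mark gam') i = mk_a (mark gam) (i + mk_i (mark gam) l)
      & forall i, mk_M (mark gam') i = ((mk_M (mark gam) (mk_i (mark gam) l))^-1 *
                                       mk_M (mark gam) (i + mk_i (mark gam) l))%g].
  move=> gam'.
  have hm' : markable A h2 h0 gam' := shift_markable l os mk c0 sp.
  have os' : on_section gam' := shift_on_section l mk.
  have hs' : section_W A h2 h0 (tangent gam' 0).
    by case: (section_tangent h2 h0 (section_geodesic os')) => _; apply.
  split; first by split; [exact: hm'|exact: hs'].
  have [mk' _] := hmark gam' hm' hs'.
  have sm := shift_marks l os mk.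
  have [h1 h2' h3 h4] := marks_unique os' mk' sm.
  by split; [exact: h1|exact: h2'|exact: h3|exact: h4].
have hgood := end_good gg.
move: (mark gam) mk sp eqv => m mk sp eqv a M ix tm.
have [[i0 t0 hi ht_] cr MN rule] := mk.
have cM j : crosses gam (M (ix j)) (tm j).
  have [_ h] := cr (M (ix j)) (tm j) (MN j); exact: h (ex_intro _ j (conj erefl erefl)).
have low i : exists j (l : nat), (0 < l)%N /\ i = ix j + l%:Z.
  have [j hj] := homo_unbounded_below i0 hi i.
  by have [l l0 el] := int_gap hj; exists j, l.
have [x [ex_ Dx nx]] := section_end os.
have M0 : M 0 = 1%g.
  have := cM 0; rewrite /tm t0 /ix i0 => c1.
  have MM := MN 0; rewrite i0 in MM.
  exact: (crosses_unique gg ne MM (@Mod1 _ _ _ A) c1 (on_section_start os)).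
have end1 : end_in gam (M 0) = x by rewrite M0 /end_in invg1 xmob1 ex_.
have rule0 (i : nat) : (0 < i)%N -> a i%:Z = dg i x /\ M i%:Z = br i x.
  move=> ip; have := rule 0 i ip; rewrite i0 add0r -/M end1 M0 mul1g; exact: id.
split; split.
- move=> i; have [j [l [l0 ->]]] := low i; have [r1 _] := rule j l l0.
  have [_ Dy _ _] := crosses_end gg ne (MN j) (cM j).
  rewrite /a /ix r1; exact: digit_Z.
- move=> i; have [j [l [l0 ->]]] := low i; have [_ r1] := rule j l l0.
  have [_ Dy _ _] := crosses_end gg ne (MN j) (cM j).
  rewrite /M /ix r1; exact: ModM (MN j) (branch_Mod l Dy).
- by split; [exact: hi|exact: ht_].
- by split; [exact: i0|exact: t0].
- split=> [j|t]; first by have := sp (j - 1); rewrite subrK -lerBrDl; exact: id.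
  have [j /andP[h1 h2']] := spaced_cover c0 t0 sp t.
  by exists (j + 1); rewrite addrK h1 ltW.
- exists x => [//|i ip]; have [r1 r2] := rule0 i ip; split; first exact: r1.
    rewrite r2 /branch; apply: eq_big_nat => j /andP[j1 _].
    have [-> _] := rule0 j j1; reflexivity.
  rewrite r2; exact: branch_is_branch.
- move=> j t N /andP[t1 t2] MN' hN yN.
  have v : visits gam N t by split; [exact: MN'|split; [exact: yN|exact: hN]].
  have [t' tt' cN] := visits_crosses gg ne v.
  have [h _] := cr N t' MN'; have [l [el eN]] := h cN.
  (* The visit is followed by its crossing at [tm l]. A visit at or before [tm j] cannot belong to a
     later crossing, by [crosses_visit_after], and [tm (j - 1) <= t < tm l] excludes [l < j]. *)
  have [jl|lj|e] := ltgtP j l; last by rewrite eN e.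
    have jl' : tm j < tm l := ht_ _ _ jl.
    have := crosses_visit_after gg ne _ v (MN j) (cM j) cN; rewrite el => /(_ jl').
    by rewrite ltNge t2.
  exfalso; have lj' : l <= j - 1 by rewrite -ltzD1 subrK.
  have : tm l <= tm (j - 1) by move: lj'; rewrite le_eqVlt => /orP[/eqP->//|/ht_/ltW].
  rewrite leNgt => /negP; apply; rewrite -[tm l]/(mk_t m l) -el.
  exact: (le_lt_trans t1 tt').
- move=> N t MN'; have [h1 h1'] := crosses_translate h2 h0 N t gg.
  have [h3 h3'] := cr N t MN'; split; [by move=> h; exact: h3 (h1 h)|by move=> h; exact: h1' (h3' h)].
- exact: eqv.
Qed.
End Dynamics.
End Crossings.

(** * Lipschitz calculus *)

Section LipschitzCalculus.
Context {R : realType} {k : scalars}.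
Local Notation K := (scalar R k).
Variables (T : Type) (P : set T) (dd : T -> T -> R).
Hypothesis dd0 : forall a b, 0 <= dd a b.
Implicit Types (f g : T -> K) (a b : T) (B L : R).

(** Boundedness is included so that products remain in the class. The function [dd] is only assumed
    nonnegative: it will be a distance in coordinates, but also the pullback of [tdist] to the
    parameters of the section. *)
Definition lipK f := exists B L, [/\ 0 <= B, 0 <= L, forall a, P a -> knorm (f a) <= B
  & forall a b, P a -> P b -> knorm (f a - f b) <= L * dd a b].

Lemma lipK_ext f g : (forall a, P a -> f a = g a) -> lipK g -> lipK f.
Proof.
move=> fg [B [L [B0 L0 h1 h2]]]; exists B, L; split=> // [a Pa|a b Pa Pb].
  by rewrite fg //; exact: h1.
by rewrite !fg //; exact: h2.
Qed.

Lemma lipK_cst c : lipK (fun=> c).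
Proof.
exists (knorm c), 0; split=> // [|a b _ _]; first exact: knorm_ge0.
by rewrite subrr mul0r -kreal0 knorm_kreal normr0.
Qed.

Lemma lipK_add f g : lipK f -> lipK g -> lipK (fun a => f a + g a).
Proof.
move=> [B [L [B0 L0 h1 h2]]] [B' [L' [B0' L0' h1' h2']]].
exists (B + B'), (L + L').
split; [exact: addr_ge0|exact: addr_ge0|move=> a Pa|move=> a b Pa Pb].
  by apply: le_trans (knorm_triangle _ _) _; apply: lerD; [exact: h1|exact: h1'].
rewrite opprD addrACA mulrDl; apply: le_trans (knorm_triangle _ _) _.
by apply: lerD; [exact: h2|exact: h2'].
Qed.

Lemma lipK_opp f : lipK f -> lipK (fun a => - f a).
Proof.
move=> [B [L [B0 L0 h1 h2]]]; exists B, L; split=> // [a Pa|a b Pa Pb].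
  by rewrite knormN; exact: h1.
by rewrite -opprD knormN; exact: h2.
Qed.
Lemma lipK_sub f g : lipK f -> lipK g -> lipK (fun a => f a - g a).
Proof. by move=> hf hg; apply: lipK_add => //; exact: lipK_opp. Qed.

Lemma lipK_mul f g : lipK f -> lipK g -> lipK (fun a => f a * g a).
Proof.
move=> [B [L [B0 L0 h1 h2]]] [B' [L' [B0' L0' h1' h2']]].
exists (B * B'), (L * B' + B * L'); split.
- exact: mulr_ge0.
- by rewrite addr_ge0 // mulr_ge0.
- by move=> a Pa; rewrite knormM; apply: ler_pM; rewrite ?knorm_ge0 ?h1 ?h1'.
move=> a b Pa Pb.
have -> : f a * g a - f b * g b = (f a - f b) * g a + f b * (g a - g b).
  by rewrite mulrBl mulrBr addrA subrK.
apply: le_trans (knorm_triangle _ _) _; rewrite !knormM mulrDl; apply: lerD.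
  by rewrite mulrAC; apply: ler_pM; rewrite ?knorm_ge0 ?h2 ?h1'.
by rewrite -mulrA; apply: ler_pM; rewrite ?knorm_ge0 ?h1 ?h2'.
Qed.

Lemma lipK_conj f : lipK f -> lipK (fun a => kconj (f a)).
Proof.
move=> [B [L [B0 L0 h1 h2]]]; exists B, L; split=> // [a Pa|a b Pa Pb].
  by rewrite knorm_conj; exact: h1.
by rewrite -kconjB knorm_conj; exact: h2.
Qed.

Lemma lipK_kim f : lipK f -> lipK (fun a => kim (f a)).
Proof.
move=> [B [L [B0 L0 h1 h2]]]; exists B, L; split=> // [a Pa|a b Pa Pb].
  by apply: le_trans (kim_le _) _; exact: h1.
by rewrite -kimB; apply: le_trans (kim_le _) _; exact: h2.
Qed.

Lemma lipK_kre f : lipK f -> lipK (fun a => kreal k (kre (f a))).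
Proof.
move=> hf; apply: (@lipK_ext _ (fun a => f a - kim (f a))); last first.
  by apply: lipK_sub => //; exact: lipK_kim.
by move=> a _; rewrite {2}[f a]kreimE addrK.
Qed.

Lemma lipK_sum (I : finType) (F : T -> I -> K) : (forall i, lipK (fun a => F a i)) ->
  lipK (fun a => \sum_i F a i).
Proof.
move=> h; elim: (index_enum I) => [|i r IH].
  apply: (@lipK_ext _ (fun=> 0)); last exact: lipK_cst.
  by move=> a _; rewrite big_nil.
apply: (@lipK_ext _ (fun a => F a i + \sum_(j <- r) F a j)); last exact: lipK_add.
by move=> a _; rewrite big_cons.
Qed.

Lemma lipK_inv f (e : R) : 0 < e -> (forall a, P a -> e <= knorm (f a)) -> lipK f ->
  lipK (fun a => kinv (f a)).
Proof.
move=> e0 fe [B [L [B0 L0 h1 h2]]].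
have f0 a : P a -> f a != 0 by move=> Pa; rewrite -knorm_gt0; apply: lt_le_trans (fe a Pa).
have inv_le a : P a -> knorm (kinv (f a)) <= e^-1.
  move=> Pa; rewrite knorm_kinv ?f0 // lef_pV2 ?posrE ?fe //.
  by apply: lt_le_trans (fe a Pa).
have ei : 0 <= e^-1 by rewrite invr_ge0 ltW.
exists e^-1, (e^-1 * L * e^-1); split=> // [|a b Pa Pb]; first by rewrite !mulr_ge0.
have -> : kinv (f a) - kinv (f b) = kinv (f a) * (f b - f a) * kinv (f b).
  by rewrite mulrBr mulrBl kmulVl ?f0 // mul1r -mulrA kmulVr ?f0 // mulr1.
have hd : knorm (f b - f a) <= L * dd a b by rewrite -knormN opprB; exact: h2.
have -> : e^-1 * L * e^-1 * dd a b = e^-1 * (L * dd a b) * e^-1 by ring.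
have p1 := ler_pM (knorm_ge0 _) (knorm_ge0 _) (inv_le a Pa) hd.
rewrite 2!knormM.
exact: (ler_pM (mulr_ge0 (knorm_ge0 _) (knorm_ge0 _)) (knorm_ge0 _) p1 (inv_le b Pb)).
Qed.

Lemma le_sqr_add1 (v B : R) : v ^+ 2 <= B -> v <= 1 + B.
Proof. by have := sqr_ge0 (v - 1); rewrite !expr2; nra. Qed.

Lemma lipK_sqrt (u : T -> R) (e : R) : 0 < e -> (forall a, P a -> e <= u a) ->
  lipK (fun a => kreal k (u a ^+ 2)) -> lipK (fun a => kreal k (u a)).
Proof.
move=> e0 ue [B [L [B0 L0 h1 h2]]].
exists (1 + B), (L / e); split; [by rewrite addr_ge0|by rewrite divr_ge0 // ltW| |].
  move=> a Pa; have := h1 a Pa; rewrite !knorm_kreal.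
  have ua := lt_le_trans e0 (ue a Pa).
  rewrite (ger0_norm (sqr_ge0 _)) (ger0_norm (ltW ua)); exact: le_sqr_add1.
move=> a b Pa Pb; have := h2 a b Pa Pb.
have ua := lt_le_trans e0 (ue a Pa); have ub := lt_le_trans e0 (ue b Pb).
rewrite -!krealB !knorm_kreal subr_sqr normrM (ger0_norm (_ : 0 <= u a + u b)); last first.
  by rewrite addr_ge0 // ltW.
rewrite mulrAC ler_pdivlMr // => h; apply: le_trans h; rewrite ler_wpM2l //.
by apply: le_trans (ue a Pa) _; rewrite lerDl ltW.
Qed.

Lemma lipK_hdot m (z w : T -> 'cV[K]_m) : (forall i, lipK (fun a => z a i 0)) ->
  (forall i, lipK (fun a => w a i 0)) -> lipK (fun a => hdot (z a) (w a)).
Proof.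
move=> hz hw; apply: (@lipK_ext _ (fun a => \sum_i kconj (z a i 0) * w a i 0)).
  by move=> a _; rewrite hdot_sum.
by apply: lipK_sum => i; apply: lipK_mul => //; exact: lipK_conj.
Qed.

Lemma lipK_normsq m (z : T -> 'cV[K]_m) : (forall i, lipK (fun a => z a i 0)) ->
  lipK (fun a => kreal k (normsq (z a))).
Proof.
move=> hz; apply: (@lipK_ext _ (fun a => hdot (z a) (z a))); last exact: lipK_hdot.
by move=> a _; rewrite hdot_normsq.
Qed.

Lemma lipK_mulmx m q (A : 'M[K]_(m, q)) (v : T -> 'cV[K]_q) :
  (forall i, lipK (fun a => v a i 0)) -> forall i, lipK (fun a => (A *m v a) i 0).
Proof.
move=> hv i; apply: (@lipK_ext _ (fun a => \sum_j A i j * v a j 0)).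
  by move=> a _; rewrite mxE.
by apply: lipK_sum => j; apply: lipK_mul => //; exact: lipK_cst.
Qed.

Lemma lipK_vec n (a b : T -> K) (z : T -> 'cV[K]_n) : lipK a ->
  (forall i, lipK (fun t => z t i 0)) -> lipK b ->
  forall i, lipK (fun t => vec (a t) (z t) (b t) i 0).
Proof.
move=> ha hz hb i; rewrite /vec.
have [j ej|j ej] := splitP i.
  have -> : i = lshift (n + 1) j by apply: val_inj.
  by apply: lipK_ext ha => t _; rewrite col_mxEu (ord1 j) mxE eqxx.
have -> : i = rshift 1 j by apply: val_inj.
have [l el|l el] := splitP j.
  have -> : j = lshift 1 l by apply: val_inj.
  by apply: lipK_ext (hz l) => t _; rewrite col_mxEd col_mxEu.
have -> : j = rshift n l by apply: val_inj.
by apply: lipK_ext hb => t _; rewrite !col_mxEd (ord1 l) mxE eqxx.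
Qed.

Lemma lipK_phi n (p : T -> kpoint R k n) : (forall i, lipK (fun a => (p a).1 i 0)) ->
  lipK (fun a => (p a).2) -> forall i, lipK (fun a => phi (p a) i 0).
Proof.
move=> h1 h2.
have hz i : lipK (fun a => (kreal k (Num.sqrt 2) *: (p a).1) i 0).
  apply: (@lipK_ext _ (fun a => kreal k (Num.sqrt 2) * (p a).1 i 0)).
    by move=> a _; rewrite mxE.
  by apply: lipK_mul; [exact: lipK_cst|exact: h1].
have hw : lipK (fun a => (p a).2 + kreal k (normsq (p a).1)).
  by apply: lipK_add; [exact: h2|exact: lipK_normsq].
move=> i; have := lipK_vec (lipK_cst 1) hz hw i.
apply: lipK_ext => a _; congr (fun_of_matrix _ i 0).
Qed.

#[local] Transparent vc0 vc1 vc2.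
Lemma lipK_vc m (v : T -> 'cV[K]_(1 + (m + 1))) : (forall i, lipK (fun a => v a i 0)) ->
  [/\ lipK (fun a => vc0 (v a)), forall i, lipK (fun a => vc1 (v a) i 0)
    & lipK (fun a => vc2 (v a))].
Proof.
move=> h; split.
- apply: (@lipK_ext _ (fun a => v a (lshift _ 0) 0)); last exact: h.
  by move=> a _; rewrite /vc0 mxE.
- move=> i; apply: (@lipK_ext _ (fun a => v a (rshift 1 (lshift 1 i)) 0)); last exact: h.
  by move=> a _; rewrite /vc1 !mxE.
- apply: (@lipK_ext _ (fun a => v a (rshift 1 (rshift m 0)) 0)); last exact: h.
  by move=> a _; rewrite /vc2 !mxE.
Qed.
#[local] Opaque vc0 vc1 vc2.

End LipschitzCalculus.

(** * Real coordinates and Lipschitz bounds for Moebius maps *)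

Section Coordinates.
Context {R : realType} {k : scalars} {n : nat}.
Local Notation K := (scalar R k).
Local Notation G := (PUJ R k n).
Local Notation coords := (coord_index n).
Implicit Types (p q : kpoint R k n) (g : G) (ic : coords).

Definition kcoord (c : K) (l : 'I_4) : R :=
  nth 0 [:: qr (sval c); qi (sval c); qj (sval c); qk (sval c)] l.

Lemma coordE p ic : coord p ic = kcoord (if ic.1 is Some i then p.1 i 0 else p.2) ic.2.
Proof. by []. Qed.

Lemma kcoordB (c d : K) l : kcoord (c - d) l = kcoord c l - kcoord d l.
Proof. by rewrite /kcoord; case: l => -[|[|[|[|//]]]]. Qed.

Lemma kcoord_le (c : K) l : `|kcoord c l| <= knorm c.
Proof. by apply: comp_le_knsq; rewrite ?knorm_ge0 // knorm_sqr. Qed.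

Lemma knorm_le_kcoord (c : K) :
  knorm c <= \sum_(l < 4 | (l < kdim k)%N) `|kcoord c l|.
Proof.
have t (x : R) : 0 <= `|x| := normr_ge0 x.
have S0 : 0 <= \sum_(l < 4 | (l < kdim k)%N) `|kcoord c l| by apply: sumr_ge0.
rewrite -(@ler_pXn2r _ 2) ?nnegrE ?knorm_ge0 // knorm_sqr knsqE.
have sq (x : R) : x ^+ 2 = `|x| ^+ 2 by rewrite real_normK ?num_real.
rewrite !(sq (qr _)) !(sq (qi _)) !(sq (qj _)) !(sq (qk _)).
rewrite big_mkcond !big_ord_recl big_ord0 /= /kcoord /=.
have := valP c; rewrite /qin /qproj /=; case: (sval c) => a b x y /=.
have := t a; have := t b; have := t x; have := t y.
case: (k) => /= t1 t2 t3 t4.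
- move=> /eqP[<- <- <-]; rewrite normr0; move: (`|a|) t4 => u *; nra.
- move=> /eqP[<- <-]; rewrite normr0; move: (`|a|) (`|b|) t3 t4 => u v *; nra.
- move=> _; move: (`|a|) (`|b|) (`|x|) (`|y|) t1 t2 t3 t4 => u v w z *; nra.
Qed.

Lemma kcoord_kim (c : K) (l : 'I_4) : kcoord (kim c) l = if (0 < l)%N then kcoord c l else 0.
Proof. by rewrite /kcoord sval_kim; case: l => -[|[|[|[|//]]]]. Qed.

Definition ncoord : nat := #|[pred ic : coords | active k ic]|.

Definition cdd p q : R := \sum_(ic | active k ic) `|coord p ic - coord q ic|.
Lemma cdd_ge0 p q : 0 <= cdd p q. Proof. exact: sumr_ge0. Qed.

Lemma cdd_z p q i : knorm (p.1 i 0 - q.1 i 0) <= cdd p q.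
Proof.
apply: le_trans (knorm_le_kcoord _) _.
rewrite /cdd (bigID (fun ic : coords => ic.1 == Some i)) /= ler_wpDr ?sumr_ge0 //.
rewrite (reindex (fun l : 'I_4 => (Some i, l) : coords)) /=; last first.
  exists (fun ic : coords => ic.2) => [l _|[j l]] //=.
  by rewrite inE /= => /andP[_ /eqP->].
rewrite le_eqVlt; apply/orP; left; apply/eqP; apply: eq_big => l.
  by rewrite /active /= eqxx !andbT.
by move=> _; rewrite kcoordB.
Qed.

Lemma cdd_w p q : knorm (kim p.2 - kim q.2) <= cdd p q.
Proof.
apply: le_trans (knorm_le_kcoord _) _.
rewrite /cdd (bigID (fun ic : coords => ic.1 == None)) /= ler_wpDr ?sumr_ge0 //.
rewrite (reindex (fun l : 'I_4 => (None, l) : coords)) /=; last first.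
  exists (fun ic : coords => ic.2) => [l _|[j l]] //=.
  by rewrite inE /= => /andP[_ /eqP->].
rewrite [leLHS](bigID (fun l : 'I_4 => (0 < l)%N)) /= [X in _ + X]big1 ?addr0; last first.
  by move=> l /andP[_ /negPf h]; rewrite -kimB kcoord_kim h normr0.
rewrite le_eqVlt; apply/orP; left; apply/eqP; apply: eq_big => l.
  by rewrite /active /= eqxx andbT.
by move=> /andP[_ l0]; rewrite -kimB kcoord_kim l0 kcoordB.
Qed.

Lemma coord_bound p q (e : R) : (forall i, knorm (p.1 i 0 - q.1 i 0) <= e) ->
  knorm (p.2 - q.2) <= e -> forall ic, `|coord p ic - coord q ic| <= e.
Proof.
move=> h1 h2 [[i|] l]; rewrite !coordE /= -kcoordB; apply: le_trans (kcoord_le _ _) _.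
  exact: h1.
exact: h2.
Qed.

Lemma cdd_le p q (e : R) : (forall ic, active k ic -> `|coord p ic - coord q ic| <= e) ->
  cdd p q <= ncoord%:R * e.
Proof.
move=> h; apply: le_trans (ler_sum _ h) _.
by rewrite sumr_const -[leLHS]mulr_natl.
Qed.

(* The region of X where the image of [p] under [g] stays away from oo. *)
Definition mob_region g (B e : R) : set (kpoint R k n) := [set p | [/\ in_X p,
  forall ic, active k ic -> `|coord p ic| <= B & e <= knorm (vc0 (umx (repr g) *m phi p))]].

Lemma lipK_coord (P : set (kpoint R k n)) B : 0 <= B ->
  (forall p, P p -> in_X p /\ forall ic, active k ic -> `|coord p ic| <= B) ->
  (forall i, lipK P cdd (fun p => p.1 i 0)) /\ lipK P cdd (fun p => p.2).
Proof.
move=> B0 hP; have c0 ic : coord (0 : kpoint R k n) ic = 0.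
  by rewrite coordE; case: ic => -[i|] l /=; rewrite ?mxE /kcoord; case: l => -[|[|[|[|//]]]].
have bd p : P p -> cdd p 0 <= ncoord%:R * B.
  by move=> /hP[_ h]; apply: cdd_le => ic /h; rewrite c0 subr0.
split=> [i|]; exists (ncoord%:R * B), 1; split; rewrite ?mulr_ge0 //.
- move=> p Pp; have := cdd_z p 0 i; rewrite mxE subr0 => h; exact: le_trans h (bd p Pp).
- by move=> p q _ _; rewrite mul1r; exact: cdd_z.
- move=> p Pp; have := cdd_w p 0; have [pX _] := hP p Pp.
  have -> : kim (0 : kpoint R k n).2 = 0 by rewrite -[(0 : kpoint R k n).2]kreal0 kim_kreal.
  by rewrite subr0 kim_id // => h; exact: le_trans h (bd p Pp).
- move=> p q Pp Pq; have := cdd_w p q; have [pX _] := hP p Pp; have [qX _] := hP q Pq.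
  by rewrite mul1r !kim_id.
Qed.

#[local] Transparent xmob.
Lemma mob_vc g p : vc0 (umx (repr g) *m phi p) != 0 ->
  let v := umx (repr g) *m phi p in
  (mob g p).1 = kreal k (Num.sqrt 2)^-1 *: rsc (vc1 v) (kinv (vc0 v)) /\
  (mob g p).2 = vc2 v * kinv (vc0 v) - kreal k (normsq (mob g p).1).
Proof. by move=> /negPf v0; rewrite /mob /xmob homog_some dehomogE v0. Qed.
#[local] Opaque xmob.

(** On the region the first coordinate of the image vector is bounded away from 0, so dividing by it
    is a Lipschitz operation. *)
Lemma mob_lip g B e : 0 <= B -> 0 < e -> exists2 L, 0 <= L &
  forall p q (d : R), mob_region g B e p -> mob_region g B e q -> 0 <= d ->
  (forall ic, active k ic -> `|coord p ic - coord q ic| <= d) ->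
  forall ic, `|coord (mob g p) ic - coord (mob g q) ic| <= L * d.
Proof.
move=> B0 e0.
have [|h1 h2] := @lipK_coord (mob_region g B e) B B0; first by move=> p [pX pB _].
have [v0 v1 v2] := lipK_vc (lipK_mulmx (umx (repr g)) (lipK_phi h1 h2)).
have i0 := lipK_inv e0 (fun p (hp : mob_region g B e p) => let: And3 _ _ h := hp in h) v0.
have hz i : lipK (mob_region g B e) cdd (fun p => (mob g p).1 i 0).
  apply: (@lipK_ext _ _ _ _ _ _ (fun p => kreal k (Num.sqrt 2)^-1 *
     (vc1 (umx (repr g) *m phi p) i 0 * kinv (vc0 (umx (repr g) *m phi p))))).
    move=> p [_ _ hp]; have v00 : vc0 (umx (repr g) *m phi p) != 0.
      by rewrite -knorm_gt0 (lt_le_trans e0).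
    by have [-> _] := mob_vc v00; rewrite mxE rscE.
  by apply: lipK_mul; [exact: lipK_cst|exact: lipK_mul].
have hw : lipK (mob_region g B e) cdd (fun p => (mob g p).2).
  apply: (@lipK_ext _ _ _ _ _ _ (fun p => vc2 (umx (repr g) *m phi p) *
      kinv (vc0 (umx (repr g) *m phi p)) - kreal k (normsq (mob g p).1))).
    move=> p [_ _ hp]; have v00 : vc0 (umx (repr g) *m phi p) != 0.
      by rewrite -knorm_gt0 (lt_le_trans e0).
    by have [_ ->] := mob_vc v00.
  by apply: lipK_sub; [exact: lipK_mul|exact: lipK_normsq].
have [Lz hLz] : exists L, 0 <= L /\ forall i p q, mob_region g B e p -> mob_region g B e q ->
    knorm ((mob g p).1 i 0 - (mob g q).1 i 0) <= L * cdd p q.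
  have /choice[Lf hL] i : exists L, 0 <= L /\ forall p q, mob_region g B e p ->
      mob_region g B e q -> knorm ((mob g p).1 i 0 - (mob g q).1 i 0) <= L * cdd p q.
    by have [? [L [_ L0 _ h]]] := hz i; exists L.
  exists (\sum_i Lf i); split; first by apply: sumr_ge0 => i _; exact: (hL i).1.
  move=> i p q Pp Pq; apply: le_trans ((hL i).2 p q Pp Pq) _; rewrite ler_wpM2r ?cdd_ge0 //.
  by rewrite (bigD1 i) //= lerDl sumr_ge0 // => j _; exact: (hL j).1.
have [? [Lw [_ Lw0 _ hLw]]] := hw.
exists ((Lz + Lw) * ncoord%:R).
  by rewrite mulr_ge0 // addr_ge0 //; case: hLz.
have [Lz0 hLz'] := hLz.
move=> p q d Pp Pq d0 hd; have cd := cdd_le hd.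
apply: coord_bound => [i|].
  apply: le_trans (hLz' i p q Pp Pq) _; rewrite -mulrA.
  apply: (@le_trans _ _ (Lz * (ncoord%:R * d))); first by rewrite ler_wpM2l.
  by rewrite ler_wpM2r ?mulr_ge0 // lerDl.
apply: le_trans (hLw p q Pp Pq) _; rewrite -mulrA.
apply: (@le_trans _ _ (Lw * (ncoord%:R * d))); first by rewrite ler_wpM2l.
by rewrite ler_wpM2r ?mulr_ge0 // lerDr.
Qed.
End Coordinates.

(** * Coverings and null sets *)

Section Series.
Context {R : realType}.
Implicit Types (u : nat -> R) (e : R).

Lemma series_le u e : (forall m, 0 <= u m) -> (forall N, \sum_(m < N) u m <= e) ->
  (\sum_(0 <= m <oo) (u m)%:E <= e%:E)%E.
Proof.
move=> u0 h; apply: lime_le; first by apply: is_cvg_nneseries => m _; rewrite lee_fin.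
by apply: nearW => N /=; rewrite sumEFin lee_fin big_mkord.
Qed.

Lemma partial_le_series u N : (forall m, 0 <= u m) ->
  ((\sum_(m < N) u m)%:E <= \sum_(0 <= m <oo) (u m)%:E)%E.
Proof.
move=> u0; rewrite -(big_mkord xpredT) -sumEFin.
by apply: nneseries_lim_ge => m _ _; rewrite lee_fin.
Qed.

Lemma partial_le u e N : (forall m, 0 <= u m) ->
  (\sum_(0 <= m <oo) (u m)%:E <= e%:E)%E -> \sum_(m < N) u m <= e.
Proof. by move=> u0 h; rewrite -lee_fin; apply: le_trans (partial_le_series N u0) h. Qed.

Lemma sum_sub_seq (T : eqType) (r1 r2 : seq T) (f : T -> R) : (forall x, 0 <= f x) ->
  uniq r1 -> uniq r2 -> {subset r1 <= r2} -> \sum_(x <- r1) f x <= \sum_(x <- r2) f x.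
Proof.
move=> f0 u1 u2 sub.
have pe : perm_eq r1 [seq x <- r2 | x \in r1].
  apply: uniq_perm => //; first exact: filter_uniq.
  by move=> x; rewrite mem_filter; case xr: (x \in r1) => //=; rewrite sub.
rewrite (perm_big _ pe) big_filter big_mkcond; apply: ler_sum => x _.
by case: ifP.
Qed.

Definition pairs (i : nat) : option (nat * nat)%type := @choice.pickle_inv (nat * nat)%type i.

(** A partial sum over encoded pairs involves only indices below some [M], so an iterated sum over a
    square dominates it. *)
Lemma sum_pairs (u : nat -> nat -> R) (e : nat -> R) a : (forall m j, 0 <= u m j) ->
  (forall m N, \sum_(j < N) u m j <= e m) -> (forall N, \sum_(m < N) e m <= a) ->
  forall N, \sum_(i < N) (if pairs i is Some mj then u mj.1 mj.2 else 0) <= a.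
Proof.
move=> u0 hu he N.
pose r := pmap pairs (iota 0 N).
have -> : \sum_(i < N) (if pairs i is Some mj then u mj.1 mj.2 else 0) =
    \sum_(x <- r) u x.1 x.2.
  rewrite -(big_mkord xpredT (fun i => if pairs i is Some mj then u mj.1 mj.2 else 0)).
  rewrite /index_iota subn0 /r; elim: (iota 0 N) => [|i s IH]; first by rewrite !big_nil.
  rewrite big_cons IH /=; case: (pairs i) => [x|] /=; first by rewrite big_cons.
  by rewrite add0r.
have pK i x : pairs i = Some x -> i = choice.pickle x.
  by rewrite /pairs => e1; have := @choice.pickle_invK (nat * nat)%type i; rewrite e1.
have ur : uniq r.
  rewrite /r; have := iota_uniq 0 N; elim: (iota 0 N) => [//|i s IH] /= /andP[ni us].
  case ei: (pairs i) => [x|] /=; last exact: IH.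
  rewrite IH // andbT mem_pmap; apply: contra ni => /mapP[i' i's ei'].
  by rewrite (pK _ _ ei) -(pK _ _ (esym ei')).
pose M := (\sum_(x <- r) (x.1 + x.2).+1)%N.
have sub : {subset r <= [seq (m, j) | m <- iota 0 M, j <- iota 0 M]}.
  move=> [m j] mr; apply/allpairsP; exists (m, j) => /=.
  by split=> //; rewrite mem_iota add0n /= /M (big_rem (m, j)) //=; lia.
have uA : uniq [seq (m, j) | m <- iota 0 M, j <- iota 0 M].
  by apply: allpairs_uniq; rewrite ?iota_uniq // => -[? ?] [? ?] _ _ [-> ->].
apply: le_trans (sum_sub_seq _ ur uA sub) _ => [x|]; first exact: u0.
rewrite big_allpairs /=; apply: le_trans (he M).
rewrite -(big_mkord xpredT) /index_iota subn0; apply: ler_sum => m _.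
by apply: le_trans (hu m M); rewrite -(big_mkord xpredT (u m)) /index_iota subn0.
Qed.

Lemma sum_halves e N : 0 <= e -> \sum_(m < N) e / (2 ^ m.+1)%:R <= e.
Proof.
move=> e0; suff -> : \sum_(m < N) e / (2 ^ m.+1)%:R = e - e / (2 ^ N)%:R.
  by rewrite gerBl divr_ge0.
elim: N => [|N IH]; first by rewrite big_ord0 expn0 divr1 subrr.
rewrite big_ord_recr IH /= expnS natrM; field.
by rewrite pnatr_eq0 expn_eq0.
Qed.

End Series.

(** * Integration of covering inequalities *)

Section Fubini.
Context {R : realType}.
Definition near1 (x c r : R) : R := (`|x - c| <= r)%R%:R.
Lemma near1_ge0 x c r : 0 <= near1 x c r. Proof. exact: ler0n. Qed.
Local Notation mu := (@lebesgue_measure R).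

(** The hypothesis is integrated over [[lo, lo + l]], term by term since all terms are nonnegative;
    each indicator contributes at most the length [2 * r i]. *)
Lemma fubini_line (w c r : nat -> R) (lo l m : R) : 0 <= l ->
  (forall i, 0 <= w i) -> (forall i, 0 <= r i) ->
  (forall t, lo <= t <= lo + l ->
    (m%:E <= \sum_(0 <= i <oo) (w i * near1 t (c i) (r i))%:E)%E) ->
  ((m * l)%:E <= \sum_(0 <= i <oo) (w i * (2 * r i))%:E)%E.
Proof.
move=> l0 w0 r0 h.
pose D : set R := `[lo, lo + l]%classic.
pose B i : set R := `[c i - r i, c i + r i]%classic.
have mD : measurable D by exact: measurable_itv.
have mB i : measurable (B i) by exact: measurable_itv.
have muD : mu D = l%:E.
  rewrite /D lebesgue_measure_itv /=; case: ifP => [_|]; first by rewrite -EFinB addrAC subrr add0r.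
  by rewrite lte_fin ltrDl => /negbT; rewrite -leNgt => l1; congr EFin; apply/eqP; rewrite eq_le l0 l1.
have eB i t : \1_(B i) t = near1 t (c i) (r i).
  by rewrite /near1 indicE /B mem_setE in_itv /= ler_distl.
pose f i (t : R) : \bar R := (w i * \1_(B i) t)%:E.
pose F t : \bar R := (\sum_(0 <= i <oo) f i t)%E.
have f0 i t : (0 <= f i t)%E by rewrite lee_fin mulr_ge0.
have F0 t : (0 <= F t)%E by apply: nneseries_ge0 => i _ _; exact: f0.
have mI i : measurable_fun D (\1_(B i) : R -> R) by exact: measurable_indic.
have mf i : measurable_fun D (f i).
  by apply/measurable_EFinP/measurable_funM; [exact: measurable_cst|exact: (mI i)].
have mF : measurable_fun D F.
  by apply: ge0_emeasurable_sum => [i t _ _|i _]; [exact: f0|exact: mf].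
have h1 : ((m * l)%:E <= \int[mu]_(t in D) F t)%E.
  have [m0|m0] := lerP 0 m; last first.
    apply: (@le_trans _ _ (0%E : \bar R)); first by rewrite lee_fin nmulr_rle0.
    by apply: integral_ge0 => t _; exact: F0.
  rewrite EFinM -muD -integral_cst //.
  apply: ge0_le_integral => //= t.
  rewrite /D /= in_itv /= => /h h2.
  by rewrite /F (eq_eseriesr (g := fun i => (w i * near1 t (c i) (r i))%:E)) // => i _; rewrite /f eB.
apply: le_trans h1 _; rewrite /F integral_nneseries; [|exact: mD|exact: mf|by move=> i t _; exact: (f0 i t)].
apply: lee_nneseries => [i _ _|i _].
  by apply: integral_ge0 => t _; exact: (f0 i t).
have -> : (\int[mu]_(t in D) f i t = \int[mu]_(t in D) ((w i)%:E * (\1_(B i) t)%:E))%E.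
  by apply: eq_integral => t _; rewrite /f EFinM.
rewrite ge0_integralZl_EFin //; first last.
- by apply/measurable_EFinP; exact: (mI i).
rewrite integral_indic; [|exact: mD|exact: mB]; rewrite [in leRHS]EFinM; apply: lee_wpmul2l; first by rewrite lee_fin.
apply: (@le_trans _ _ (mu (B i))).
  by apply: le_measure; rewrite ?inE; [apply: measurableI; [exact: mB|exact: mD]|exact: mB|exact: subIsetl].
have -> : mu (B i) = (if (c i - r i < c i + r i)%R then (2 * r i)%:E else 0%E).
  rewrite /B lebesgue_measure_itv /= lte_fin; case: ifP => // _.
  by rewrite -EFinB; congr EFin; lra.
by case: ifP => // _; rewrite lee_fin mulr_ge0.
Qed.

(** One coordinate is integrated at a time and its factor [2 * r i] moves into the weight, so the
    one-dimensional Lebesgue measure suffices. *)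
Lemma fubini_box (I : eqType) (J : seq I) (w r : nat -> R) (c : nat -> I -> R)
    (lo : I -> R) (l m : R) : uniq J -> 0 <= l ->
  (forall i, 0 <= w i) -> (forall i, 0 <= r i) ->
  (forall t : I -> R, (forall j, lo j <= t j <= lo j + l) ->
    (m%:E <= \sum_(0 <= i <oo) (w i * \prod_(j <- J) near1 (t j) (c i j) (r i))%:E)%E) ->
  ((m * l ^+ size J)%:E <= \sum_(0 <= i <oo) (w i * (2 * r i) ^+ size J)%:E)%E.
Proof.
elim: J w m => [|j J IH] w m.
  move=> _ l0 w0 r0 h; rewrite /= expr0 mulr1.
  have := h lo (fun j => _); under eq_eseriesr do rewrite big_nil mulr1.
  under [X in _ -> (_ <= X)%E]eq_eseriesr do rewrite expr0 mulr1.
  by apply=> j; rewrite lexx lerDl.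
rewrite /= => /andP[nj uJ] l0 w0 r0 h; rewrite exprS mulrA.
under eq_eseriesr do rewrite exprS mulrA.
apply: IH => //; first by move=> i; rewrite !mulr_ge0.
move=> t ht.
have p0 i : 0 <= \prod_(j0 <- J) near1 (t j0) (c i j0) (r i) :> R.
  by apply: prodr_ge0 => j0 _; exact: near1_ge0.
rewrite (eq_eseriesr (g := fun i => ((w i * \prod_(j0 <- J) near1 (t j0) (c i j0) (r i)) *
    (2 * r i))%:E)); last by move=> i _; rewrite mulrAC.
apply: (@fubini_line _ (fun i => c i j) r (lo j)) => // [i|x hx]; first exact: mulr_ge0.
pose t' i := if i == j then x else t i.
have t'P j0 : lo j0 <= t' j0 <= lo j0 + l by rewrite /t'; case: eqP => [->|_].
apply: le_trans (h t' t'P) _; apply: lee_nneseries => i _.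
  move=> _; rewrite lee_fin mulr_ge0 //.
  by apply: prodr_ge0 => j0 _; exact: near1_ge0.
rewrite lee_fin big_cons {1}/t' eqxx mulrA [X in _ <= X]mulrAC.
rewrite (eq_big_seq (fun j0 => near1 (t j0) (c i j0) (r i))) //.
by move=> j0 j0J; rewrite /t'; case: eqP => // e; rewrite -e j0J in nj.
Qed.
End Fubini.

(** * Grids of cubes *)

Section Grid.
Context {R : realType} {I : eqType}.
Implicit Types (J : seq I) (lo hi l : I -> R) (s : R).

Lemma grid_line (lo hi s : R) : 0 < s -> exists M : nat,
  M%:R * s <= Num.max 0 (hi - lo) / 2 + s /\
  forall t, lo <= t <= hi -> exists2 i, (i < M)%N & `|t - (lo + (2 * i%:R + 1) * s)| <= s.
Proof.
move=> s0; set w := Num.max 0 (hi - lo).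
have w0 : 0 <= w by rewrite le_max lexx.
have wh : hi - lo <= w by rewrite le_max lexx orbT.
have v0 (x : R) : 0 <= x -> 0 <= x / (2 * s) by move=> x0; rewrite divr_ge0 // mulr_ge0 // ltW.
have vK (x : R) : x / (2 * s) * s = x / 2 by field; rewrite lt0r_neq0.
exists (Num.truncn (w / (2 * s))).+1; split.
  rewrite -natr1 mulrDl mul1r lerD2r -vK ler_wpM2r ?(ltW s0) //.
  by rewrite truncn_le v0.
move=> t /andP[lot thi]; exists (Num.truncn ((t - lo) / (2 * s))).
  rewrite ltnS truncn_ge_nat ?v0 // (le_trans (_ : _ <= (t - lo) / (2 * s))) //.
    by rewrite truncn_le v0 // subr_ge0.
  rewrite ler_pM2r ?invr_gt0 ?mulr_gt0 //; apply: le_trans wh.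
  by rewrite lerD2r.
have := truncn_itv (v0 (t - lo) _); rewrite subr_ge0 => /(_ lot).
set j := Num.truncn _ => /andP[]; rewrite -natr1 => h1 h2.
rewrite ler_pdivlMr ?mulr_gt0 // in h1; rewrite ltr_pdivrMr ?mulr_gt0 // in h2.
by rewrite ler_norml; apply/andP; split; lra.
Qed.

(** The cells are cubes of half-side [s], whence the halved side lengths in the bound. *)
Lemma grid J lo hi s : 0 < s -> uniq J -> exists l : seq (I -> R),
  (size l)%:R * s ^+ size J <= \prod_(j <- J) (Num.max 0 (hi j - lo j) / 2 + s) /\
  forall t : I -> R, (forall j, j \in J -> lo j <= t j <= hi j) ->
  exists2 i, (i < size l)%N & forall j, j \in J -> `|t j - nth (fun=> 0) l i j| <= s.
Proof.
move=> s0; elim: J => [_|j J IH /= /andP[nj uJ]].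
  exists [:: fun=> 0]; rewrite big_nil /= mulr1; split=> // t _; by exists 0%N.
have [l [hl cov]] := IH uJ; have [M [hM covM]] := grid_line (lo j) (hi j) s0.
pose f (c : I -> R) (i : nat) j' := if j' == j then lo j + (2 * i%:R + 1) * s else c j'.
exists [seq f c i | c <- l, i <- iota 0 M]; split.
  rewrite size_allpairs size_iota big_cons exprS natrM.
  rewrite [leLHS](_ : _ = (M%:R * s) * ((size l)%:R * s ^+ size J)); last by ring.
  by rewrite ler_pM // ?mulr_ge0 ?exprn_ge0 // ltW.
move=> t ht; have [|a al ha] := cov t; first by move=> j' j'J; apply: ht; rewrite inE j'J orbT.
have [|b bM hb] := covM (t j); first by apply: ht; rewrite inE eqxx.
have fm : (a * M + b < size [seq f c i | c <- l, i <- iota 0 M])%N.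
  by rewrite size_allpairs size_iota; nia.
exists (a * M + b)%N => // j' j'J.
have -> : nth (fun=> 0) [seq f c i | c <- l, i <- iota 0 M] (a * M + b) =
    f (nth (fun=> 0) l a) b.
  elim: l a al {ha cov hl fm} => // c l IHl [|a] al /=.
    by rewrite mul0n add0n nth_cat size_map size_iota bM (nth_map 0%N) ?size_iota // nth_iota.
  rewrite nth_cat size_map size_iota mulSn -addnA ltnNge leq_addr /= addKn.
  exact: IHl.
rewrite /f; move: j'J; rewrite inE; case: eqP => [->|_] //= j'J; exact: ha.
Qed.

(** The halves coming from the grid are given away, so that as [s] tends to 0 the cost of a grid on
    a box is at most its volume, with an error linear in [s]. *)
Lemma prod_shrink J (l : I -> R) : (forall j, 0 <= l j) -> exists2 C, 0 <= C &
  forall s, 0 <= s -> s <= 1 -> \prod_(j <- J) (l j / 2 + s) <= \prod_(j <- J) l j + C * s.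
Proof.
move=> l0; elim: J => [|j J [C C0 IH]].
  by exists 0 => // s _ _; rewrite !big_nil mul0r addr0.
have P0 : 0 <= \prod_(j0 <- J) l j0 by apply: prodr_ge0.
exists (\prod_(j0 <- J) l j0 + C * (l j + 1)).
  by rewrite addr_ge0 // mulr_ge0 // addr_ge0.
move=> s s0 s1; rewrite !big_cons; have lj := l0 j.
apply: (@le_trans _ _ ((l j / 2 + s) * (\prod_(j0 <- J) l j0 + C * s))).
  by rewrite ler_wpM2l ?IH // addr_ge0 // divr_ge0.
move: (\prod_(j0 <- J) l j0) P0 (l j) lj => P P0 x x0.
have h1 : 0 <= x * P by rewrite mulr_ge0.
have h2 : 0 <= C * s by rewrite mulr_ge0.
have h3 : 0 <= x * (C * s) by rewrite mulr_ge0.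
have h4 : s * (C * s) <= C * s by rewrite ler_piMl.
lra.
Qed.

Lemma sum_below (S N : nat) (a : R) : 0 <= a ->
  \sum_(m < N) (if (m < S)%N then a else 0) <= S%:R * a.
Proof.
move=> a0; suff -> : \sum_(m < N) (if (m < S)%N then a else 0) = (minn N S)%:R * a.
  by rewrite ler_wpM2r // ler_nat geq_minr.
elim: N => [|N IH]; first by rewrite big_ord0 min0n mul0r.
rewrite big_ord_recr /= IH; case: ltnP => h.
  by rewrite (minn_idPl h) -natr1 mulrDl mul1r.
by rewrite addr0 (minn_idPr (leqW h)).
Qed.
End Grid.

(** * Null sets of X *)

Section NullSets.
Context {R : realType} {k : scalars} {n : nat}.
Local Notation K := (scalar R k).
Local Notation G := (PUJ R k n).
Local Notation coords := (coord_index n).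
Local Notation d := (@ncoord k n).
Implicit Types (A B : set (kpoint R k n)) (e s : R) (c : coords -> R).

Definition actives : seq coords := enum (fun ic : coords => active k ic).
Lemma size_actives : size actives = d. Proof. by rewrite /actives -cardE. Qed.
Lemma mem_actives ic : (ic \in actives) = active k ic.
Proof. by rewrite mem_enum. Qed.

Definition cube c s : set (kpoint R k n) :=
  [set p | in_X p /\ forall ic, active k ic -> `|coord p ic - c ic| <= s].
(** A real-valued substitute for outer measure, by cubes and partial sums. Radii may vanish, so that
    a finite cover can be padded at no cost. *)
Definition cover_le A e := exists (c : nat -> coords -> R) (s : nat -> R),
  [/\ forall m, 0 <= s m, A `<=` \bigcup_m cube (c m) (s m) &
      forall N, \sum_(m < N) s m ^+ d <= e].
Definition cnull A := forall e, 0 < e -> cover_le A e.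

Lemma cover_le_sub A B e : A `<=` B -> cover_le B e -> cover_le A e.
Proof. by move=> AB [c [s [s0 h1 h2]]]; exists c, s; split=> //; exact: subset_trans h1. Qed.
Lemma cnull_sub A B : A `<=` B -> cnull B -> cnull A.
Proof. by move=> AB h e /h; exact: cover_le_sub. Qed.

Hypothesis d_gt0 : (0 < d)%N.

Lemma cover_finite A (l : seq (coords -> R)) s e : 0 <= s ->
  A `<=` [set p | exists2 i, (i < size l)%N & cube (nth (fun=> 0) l i) s p] ->
  (size l)%:R * s ^+ d <= e -> cover_le A e.
Proof.
move=> s0 h he; exists (fun m => nth (fun=> 0) l m), (fun m => if (m < size l)%N then s else 0).
split=> [m|p /h[i il hi]|N]; first by case: ifP.
  by exists i => //; rewrite il.
apply: le_trans he; rewrite (eq_bigr (fun m : 'I_N => if (m < size l)%N then s ^+ d else 0)).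
  exact/sum_below/exprn_ge0.
by move=> m _; case: ifP => // _; rewrite expr0n eqn0Ngt d_gt0.
Qed.

Lemma cover_bigcup (F : nat -> set (kpoint R k n)) (e : nat -> R) a :
  (forall m, cover_le (F m) (e m)) -> (forall N, \sum_(m < N) e m <= a) ->
  cover_le (\bigcup_m F m) a.
Proof.
move=> /choice[c /choice[s h]] ha.
pose c' i := if pairs i is Some mj then c mj.1 mj.2 else fun=> 0.
pose s' i := if pairs i is Some mj then s mj.1 mj.2 else 0.
exists c', s'; split.
- by move=> i; rewrite /s'; case: (pairs i) => [mj|//]; have [+ _ _] := h mj.1; apply.
- move=> p [m _ Fp]; have [_ /(_ p Fp)[j _ hj] _] := h m.
  have e1 : pairs (choice.pickle (m, j)) = Some (m, j) by exact: choice.pickleK_inv.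
  by exists (choice.pickle (m, j)) => //; rewrite /c' /s' e1.
- move=> N; have hu m j : 0 <= s m j ^+ d by apply: exprn_ge0; have [+ _ _] := h m; apply.
  have := sum_pairs hu (fun m => let: And3 _ _ h3 := h m in h3) ha N.
  apply: le_trans; apply: ler_sum => i _; rewrite /s'; case: (pairs i) => [mj|] //.
  by rewrite expr0n eqn0Ngt d_gt0.
Qed.

Lemma cnull_bigcup (F : nat -> set (kpoint R k n)) :
  (forall m, cnull (F m)) -> cnull (\bigcup_m F m).
Proof.
move=> h e e0; apply: (@cover_bigcup _ (fun m => e / (2 ^ m.+1)%:R)).
  by move=> m; apply: h; rewrite divr_gt0 // ltr0n expn_gt0.
by move=> N; apply: sum_halves; exact: ltW.
Qed.

Lemma cnull0 : cnull set0.
Proof.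
move=> e e0; apply: (@cover_finite _ [::] 0) => //=.
by rewrite mul0r ltW.
Qed.

Lemma cnull_countable_bigcup (T : Type) (S : set T) (F : T -> set (kpoint R k n)) :
  countable S -> (forall x, S x -> cnull (F x)) -> cnull (\bigcup_(x in S) F x).
Proof.
move=> /countable_injP[f finj] h.
apply: (@cnull_sub _ (\bigcup_m \bigcup_(x in [set x | S x /\ f x = m]) F x)).
  by move=> p [x Sx Fx]; exists (f x) => //; exists x.
apply: cnull_bigcup => m; have [[x [Sx fx]]|nx] := pselect (exists x, S x /\ f x = m).
  apply: cnull_sub (h x Sx) => p [y [Sy fy] Fy].
  by rewrite (finj x y) ?inE // fx.
by apply: cnull_sub cnull0 => p [x hx]; case: nx; exists x.
Qed.

Lemma cnull_setU A B : cnull A -> cnull B -> cnull (A `|` B).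
Proof.
move=> hA hB; apply: (@cnull_sub _ (\bigcup_m (if m is 0%N then A else B))).
  by move=> p [|] h; [exists 0%N|exists 1%N].
by apply: cnull_bigcup => -[].
Qed.

Lemma cnull1 p : in_X p -> cnull [set p].
Proof.
move=> pX e e0; apply: (@cover_finite _ [:: coord p] 0) => //.
  move=> _ ->; exists 0%N => //; split=> // ic _ /=; by rewrite subrr normr0.
by rewrite expr0n eqn0Ngt d_gt0 mulr0 ltW.
Qed.

Lemma box_grid (lo hi : coords -> R) s : 0 < s -> exists l : seq (coords -> R),
  (size l)%:R * s ^+ d <= \prod_(j <- actives) (Num.max 0 (hi j - lo j) / 2 + s) /\
  box lo hi `<=` [set p | exists2 i, (i < size l)%N & cube (nth (fun=> 0) l i) s p].
Proof.
move=> s0; have uA : uniq actives by exact: enum_uniq.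
have [l [hl cov]] := grid lo hi s0 uA; exists l; rewrite -size_actives; split=> //.
move=> p [pX hp]; have [|i il hi'] := cov (coord p).
  by move=> ic; rewrite mem_actives; exact: hp.
by exists i => //; split=> // ic hic; apply: hi'; rewrite mem_actives.
Qed.

Lemma box_cover (lo hi : coords -> R) e : 0 < e ->
  cover_le (box lo hi) (box_volume k lo hi + e).
Proof.
move=> e0; pose l j := Num.max 0 (hi j - lo j).
have l0 j : 0 <= l j by rewrite le_max lexx.
have [C C0 hC] := @prod_shrink R _ actives l l0.
pose s := Num.min 1 (e / (C + 1)).
have C1 : 0 < C + 1 by rewrite ltr_wpDl.
have s0 : 0 < s by rewrite lt_min ltr01 divr_gt0.
have s1 : s <= 1 by rewrite ge_min lexx.
have [r [hr cov]] := box_grid lo hi s0.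
apply: cover_finite cov _; first exact: ltW.
apply: le_trans hr _; apply: le_trans (hC s (ltW s0) s1) _.
rewrite /actives big_enum lerD2l.
apply: (@le_trans _ _ ((C + 1) * s)); first by rewrite ler_wpM2r ?lerDl // ltW.
by rewrite mulrC -ler_pdivlMr // ge_min lexx orbT.
Qed.

Lemma null_cnull A : lebesgue_outer A = 0%E -> cnull A.
Proof.
move=> h e e0; have e2 : 0 < e / 2 by rewrite divr_gt0.
have [|_ [lo [hi [cov ->]]] hx] := @lb_ereal_inf_adherent R [set x : \bar R | exists lo hi : nat -> coord_index n -> R,
    A `<=` \bigcup_m box (lo m) (hi m) /\
    x = (\sum_(0 <= m <oo) (box_volume k (lo m) (hi m))%:E)%E] _ e2 _.
  by rewrite -[ereal_inf _]/(lebesgue_outer A) h.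
rewrite -[ereal_inf _]/(lebesgue_outer A) h add0e in hx.
apply: cover_le_sub cov _.
apply: (@cover_bigcup _ (fun m => box_volume k (lo m) (hi m) + e / 2 / (2 ^ m.+1)%:R)).
  by move=> m; apply: box_cover; rewrite divr_gt0 // ltr0n expn_gt0.
move=> N; rewrite big_split /= [leRHS]splitr lerD //; last by apply: sum_halves; exact: ltW.
apply: partial_le (ltW hx) => m; apply: prodr_ge0 => j _; by rewrite le_max lexx.
Qed.
End NullSets.

(** * Moebius images of null sets and a cell of positive measure *)

Section PositiveCell.
Context {R : realType} {k : scalars} {n : nat} (n_gt0 : (0 < n)%N).
Local Notation K := (scalar R k).
Local Notation G := (PUJ R k n).
Local Notation coords := (coord_index n).
Local Notation d := (@ncoord k n).
Implicit Types (c : coords -> R) (g : G).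

Lemma ncoord_gt0 : (0 < d)%N.
Proof.
apply/card_gt0P; exists (Some (Ordinal n_gt0), ord0).
by rewrite inE /active /=; case: (k).
Qed.
Local Notation d_gt0 := ncoord_gt0.

Definition mkX (t : coords -> R) : kpoint R k n :=
  (\col_i kproj k (Quat (t (Some i, 0)) (t (Some i, 1)) (t (Some i, 2)) (t (Some i, 3))),
   kproj k (Quat 0 (t (None, 1)) (t (None, 2)) (t (None, 3)))).

Lemma mkX_in t : in_X (mkX t).
Proof. by rewrite /in_X kreE /mkX /= /qproj; case: (k). Qed.

Lemma mkX_coord t ic : active k ic -> coord (mkX t) ic = t ic.
Proof.
case: ic => -[i|] [[|[|[|[|//]]]] hl] //; rewrite /active /= ?andbF // => hk;
  rewrite /coord /= ?mxE /= /qproj; move: hk; case: (k) => //= _;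
  by congr (t (_, _)); apply: val_inj.
Qed.

Lemma term_le_series (u : nat -> R) i : (forall m, 0 <= u m) ->
  ((u i)%:E <= \sum_(0 <= m <oo) (u m)%:E)%E.
Proof.
move=> u0; apply: le_trans (partial_le_series i.+1 u0).
by rewrite lee_fin big_ord_recr /= lerDr sumr_ge0.
Qed.

(** Integration over the unit cube makes the sum of the [(2 s)^d] at least 1 for every cover,
    whereas covers of cost [2^-(d+1)] would give only one half. *)
Lemma not_cnull_X : ~ cnull (@in_X R k n).
Proof.
pose e : R := (2 ^+ d.+1)^-1; have e0 : 0 < e by rewrite invr_gt0 exprn_gt0.
move=> /(_ e e0)[c [s [s0 cov hs]]].
have := @fubini_box R _ (@actives k n) (fun=> 1) s c (fun=> 0) 1 1 _ ler01 (fun=> ler01) s0.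
rewrite size_actives expr1n mulr1 => /(_ (enum_uniq _)) h.
have {}h : ((1 : R)%:E <= \sum_(0 <= i <oo) (1 * (2 * s i) ^+ d)%:E)%E.
  apply: h => t _; have [i _ [_ hi]] := cov (mkX t) (mkX_in t).
  pose u i := 1 * \prod_(j <- @actives k n) near1 (t j) (c i j) (s i).
  have u0 m : 0 <= u m by rewrite /u mul1r; apply: prodr_ge0 => j _; exact: near1_ge0.
  apply: le_trans (term_le_series i u0); rewrite lee_fin /u mul1r big1_seq // => j /andP[_].
  by rewrite mem_actives => hj; rewrite /near1 -(mkX_coord t hj) hi.
have : ((1 : R)%:E <= (2 ^+ d * e)%:E)%E.
  apply: le_trans h _; apply: series_le => [m|N].
    by rewrite mul1r exprn_ge0 // mulr_ge0.
  under eq_bigr do rewrite mul1r exprMn.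
  by rewrite -mulr_sumr ler_wpM2l // exprn_ge0.
have p0 : 0 < 2 ^+ d :> R by rewrite exprn_gt0.
by rewrite lee_fin /e exprSr invfM mulrA divff ?lt0r_neq0 // => h1; lra.
Qed.

#[local] Transparent xmob.
Lemma xmob_vc0 g p : (xmob g (Some p) = None) <-> vc0 (umx (repr g) *m phi p) = 0.
Proof.
rewrite /xmob homog_some dehomogE; case: eqP => [->|//]; split=> // h.
Qed.
#[local] Opaque xmob.

Lemma xmob_mob g p : xmob g (Some p) <> None -> xmob g (Some p) = Some (mob g p).
Proof. by case e : (xmob g (Some p)) => [q|//] _; rewrite (mob_some e). Qed.

(** A cube that meets [S] is recentred at one of the points of [S] in it, because the Lipschitz
    bound holds only on the region. Recentring doubles the distances, hence the factor 2 in [C]. *)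
Lemma cnull_mob_region g B e0 (S : set (kpoint R k n)) : 0 <= B -> 0 < e0 ->
  S `<=` mob_region g B e0 -> cnull S -> cnull (mob g @` S).
Proof.
move=> B0 e00 SR nS e e_gt0; have [L L0 hL] := mob_lip g B0 e00.
pose C := (L + 1) * 2; have C0 : 0 < C by rewrite mulr_gt0 // ltr_wpDl.
have [|c [s [s0 cov hs]]] := nS (e / C ^+ d); first by rewrite divr_gt0 // exprn_gt0.
have /choice[a ha] m : exists a, forall p, S p -> cube (c m) (s m) p ->
    S a /\ cube (c m) (s m) a.
  have [[p [Sp cp]]|np] := pselect (exists p, S p /\ cube (c m) (s m) p).
    by exists p.
  by exists 0 => p Sp cp; case: np; exists p.
exists (fun m => coord (mob g (a m))), (fun m => C * s m); split.
- by move=> m; rewrite mulr_ge0 // ltW.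
- move=> _ [p Sp <-]; have [m _ cp] := cov p Sp; have [Sa ca] := ha m p Sp cp.
  exists m => //; have [pX _ hv] := SR p Sp; split.
    apply: (xmob_X pX (g := g)); apply: xmob_mob => /xmob_vc0 v0.
    by move: hv; rewrite v0 knorm0 leNgt e00.
  move=> ic hic; apply: le_trans (hL _ _ (2 * s m) (SR _ Sp) (SR _ Sa) _ _ ic) _.
  + by rewrite mulr_ge0.
  + move=> ic' hic'; have := ler_distD (c m ic') (coord p ic') (coord (a m) ic').
    move=> h; apply: le_trans h _; rewrite [X in _ + X]distrC mulr_natl mulr2n lerD //.
      by case: cp => _; apply.
    by case: ca => _; apply.
  + by rewrite mulrA ler_wpM2r // ler_wpM2r // lerDl.
- move=> N; under eq_bigr do rewrite exprMn.
  rewrite -mulr_sumr; have := hs N; rewrite ler_pdivlMr ?exprn_gt0 //.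
  by rewrite mulrC.
Qed.

Lemma cnull_mob g (S : set (kpoint R k n)) : S `<=` @in_X R k n -> cnull S ->
  cnull (mob g @` (S `&` [set p | xmob g (Some p) <> None])).
Proof.
move=> SX nS.
apply: (@cnull_sub _ _ _ _ (\bigcup_j mob g @` (S `&` mob_region g j%:R j.+1%:R^-1))).
  move=> _ [p [Sp hp] <-]; set v := vc0 (umx (repr g) *m phi p).
  have v0 : 0 < knorm v by rewrite knorm_gt0; apply/eqP => /xmob_vc0.
  pose b := \sum_(ic | active k ic) `|coord p ic| + (knorm v)^-1.
  have b0 : 0 <= b by rewrite addr_ge0 ?sumr_ge0 // invr_ge0 ltW.
  pose j := (Num.truncn b).+1; have hj : b <= j%:R by rewrite ltW // truncnS_gt.
  exists j => //; exists p => //; split=> //; split; first exact: SX.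
    move=> ic hic; apply: le_trans hj; rewrite /b (bigD1 ic) //= -addrA lerDl.
    by rewrite addr_ge0 ?sumr_ge0 // invr_ge0 ltW.
  rewrite -/v invf_ple ?posrE //; apply: le_trans (_ : j%:R <= _); last by rewrite ler_nat.
  by apply: le_trans hj; rewrite lerDr sumr_ge0.
apply: (cnull_bigcup d_gt0) => j; apply: (@cnull_mob_region _ j%:R j.+1%:R^-1) => //.
by apply: cnull_sub nS => p [].
Qed.

Section Algorithm.
Context (A : iwasawa_cf R k n).
Hypothesis A_discrete : cf_discrete A.
Local Notation Z := (cf_lattice A).
Local Notation Dm := (cf_domain A).
Local Notation Mod := (cf_modular A).

Lemma Mod_countable : countable Mod.
Proof. exact: discrete_countable (Mod_subgroup A) A_discrete. Qed.

Lemma exceptional_cnull :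
  cnull [set p | in_X p /\ exceptional A (Some p)].
Proof.
apply: (@cnull_sub _ _ _ _ (\bigcup_(M in Mod) ([set p | in_X p /\ xmob M None = Some p] `|`
    mob M @` (overlap Z Dm `&` [set p | xmob M (Some p) <> None])))).
  move=> p [pX [M hM [x hx e]]]; exists M => //.
  case: hx => [hx|[q hq hx]]; first by left; rewrite hx in e.
  right; exists q; last by apply: mob_some; rewrite hx.
  by split=> //=; rewrite hx e.
apply: (cnull_countable_bigcup d_gt0 Mod_countable) => M hM.
apply: (cnull_setU d_gt0).
  case e : (xmob M None) => [q|]; last first.
    by apply: cnull_sub (cnull0 d_gt0) => p [_].
  have [qX|qX] := pselect (in_X q); last first.
    by apply: cnull_sub (cnull0 d_gt0) => p [pX [qp]]; case: qX; rewrite qp.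
  by apply: cnull_sub (cnull1 d_gt0 qX) => p [_ [->]].
apply: cnull_mob; first by move=> p [Dp _]; exact: D_X Dp.
by apply: (null_cnull d_gt0); case: (cf_domainP A).
Qed.

Definition generic_end : set (kpoint R k n) := Dm `\` [set p | exceptional A (Some p)].

Lemma positive_cell s : 0 < s -> exists c (mu : R), 0 < mu /\
  ~ cover_le (generic_end `&` cube c s) mu.
Proof.
move=> s0; apply: contrapT => hn; apply: not_cnull_X.
have nc c : cnull (generic_end `&` cube c s).
  by move=> e e0; apply: contrapT => h; apply: hn; exists c, e.
have nE : cnull generic_end.
  have /choice[l hl] (j : nat) := @box_grid R k n (fun=> - j%:R) (fun=> j%:R) s s0.
  apply: (@cnull_sub _ _ _ _ (\bigcup_j \bigcup_i
      (generic_end `&` cube (nth (fun=> 0) (l j) i) s))).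
    move=> p Ep; pose b := \sum_(ic | active k ic) `|coord p ic|.
    have [_ /(_ p)] := hl (Num.truncn b).+1; case.
      split; first by case: Ep => /D_X.
      move=> ic hic; rewrite -ler_norml; apply: le_trans (ltW (truncnS_gt b)).
      by rewrite /b (bigD1 ic) //= lerDl sumr_ge0.
    by move=> i _ hi; exists (Num.truncn b).+1 => //; exists i.
  by do 2!apply: (cnull_bigcup d_gt0) => ?; exact: nc.
have nD : cnull Dm.
  apply: cnull_sub (cnull_setU d_gt0 nE exceptional_cnull) => p Dp.
  have [h|h] := pselect (exceptional A (Some p)); last by left.
  by right; split=> //; exact: D_X Dp.
apply: (@cnull_sub _ _ _ _ (\bigcup_(a in Z) (mob a @` (Dm `&` [set p | xmob a (Some p) <> None])))).
  move=> p pX; have [g Zg [q Dq <-]] := D_cover A pX; exists g => //; exists q => //; split=> //=.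
  by rewrite (Z_finite Zg (in_X_good (D_X Dq))).
apply: (cnull_countable_bigcup d_gt0).
  by apply: sub_countable Mod_countable; apply: subset_card_le => g; exact: Mod_Z.
by move=> g Zg; apply: cnull_mob => // p; exact: D_X.
Qed.
End Algorithm.
End PositiveCell.

(** * Dimension of the section *)

Section Chords.
Context {R : realType} {k : scalars} {n : nat}.
Local Notation K := (scalar R k).
Local Notation V := 'cV[K]_(1 + (n + 1)).
Local Notation ex := (@ex R k).
Local Notation ch := (@ch R k).
Local Notation sh := (@sh R k).
Implicit Types (p x : kpoint R k n).

(** The scalar that makes the lift of [x] pair with [phi p] to [- ht p], half of the square of
    [phi p]. It is 1 when [p] is the point of the sphere above [x]. *)
Definition chord_coef p x : K := kinv (hform (phi p) (phi x)) * kreal k (- ht p).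
(* The geodesic through [p] with forward end [x] is [pel p (chord p x)]. *)
Definition chord p x : V := rsc (phi x) (chord_coef p x + chord_coef p x) - phi p.

Section Chord.
Variables (p x : kpoint R k n).
Hypotheses (hp : in_H p) (hx : in_X x).

Lemma chord_den : ht p <= knorm (hform (phi p) (phi x)).
Proof. by rewrite -pr_phi; exact: pr_htl (in_H_good hp) (in_X_good hx). Qed.

Lemma chord_den_neq0 : hform (phi p) (phi x) != 0.
Proof. by rewrite -knorm_gt0; apply: lt_le_trans chord_den. Qed.

Lemma chord_coefE : hform (phi p) (phi x) * chord_coef p x = kreal k (- ht p).
Proof. by rewrite /chord_coef mulrA (kmulVr chord_den_neq0) mul1r. Qed.

Lemma chord_coef_neq0 : chord_coef p x != 0.
Proof.
by apply: kmulf_neq0; [exact/kinv_neq0/chord_den_neq0|apply: kreal_neq0; rewrite oppr_eq0 gt_eqF].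
Qed.

Lemma hform_end : hform (phi x) (phi x) = 0.
Proof. by rewrite hform_phi_self (hx : kre x.2 = 0) mulr0 kreal0. Qed.

Lemma chord_pedata : pedata p (chord p x).
Proof.
have pp := hform_phi_self p; have xx := hform_end.
have e1 : hform (phi p) (rsc (phi x) (chord_coef p x + chord_coef p x)) = kreal k (- 2 * ht p).
  by rewrite hformZr mulrDr chord_coefE -krealD; congr kreal; ring.
have e2 : hform (rsc (phi x) (chord_coef p x + chord_coef p x)) (phi p) = kreal k (- 2 * ht p).
  by rewrite -hform_conj e1 kconj_kreal.
split; first exact: hp.
  by rewrite /chord hformBr e1 pp subrr.
rewrite /chord hformBr !hformBl e1 e2 pp hformZr hformZl xx mulr0 mul0r -[0]kreal0 -!krealB.
by congr kreal; rewrite /ht; ring.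
Qed.

Lemma chord_peX : peX p (chord p x) = rsc (phi x) (chord_coef p x).
Proof. by rewrite /peX /chord addrC subrK rscDr rsc_half. Qed.

Lemma chord_end : forward_end (pel p (chord p x)) = Some x.
Proof.
rewrite /pel (forward_end_gline (pe_ldata chord_pedata)) chord_peX.
by rewrite dehomog_rsc ?chord_coef_neq0 // -homog_some dehomog_homog.
Qed.

Lemma chord_geodesic : geodesic (pel p (chord p x)).
Proof. exact: gline_geodesic (pe_ldata chord_pedata). Qed.

Lemma pel_at0 e : pedata p e -> pel p e 0 = p.
Proof. by move=> pe; have := tangent_pel pe => /(congr1 fst). Qed.

Lemma chord_vc0 : vc0 (chord p x) = chord_coef p x + chord_coef p x - 1.
Proof. by rewrite /chord !vcE !vc_phi mul1r. Qed.

Lemma chord_b1 : pe_b1 p (chord p x) = rsc (x.1 - p.1) (chord_coef p x + chord_coef p x).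
Proof.
rewrite /pe_b1 chord_vc0 /chord !vcE !vc_phi; move: (chord_coef p x + chord_coef p x) => c.
apply/matrixP => i j; rewrite !(mxE, rscE) mulrBr !mulrA !krealM mulVf ?sqrt2_neq0 // kreal1.
by rewrite !mul1r mulrBr mulrBl mulr1 opprB addrA subrK.
Qed.


(** For negative [t] the growing exponential is multiplied by [1 - chord_coef p x], so the geodesic
    comes from a great height when the coefficient is close to 1. *)
Lemma chord_ht t : ht (pel p (chord p x) t) *
  knsq (kreal k (ex t)^-1 * (1 - chord_coef p x) + chord_coef p x * kreal k (ex t)) = ht p.
Proof.
have [_ _ _ <-] := pel_lift chord_pedata t; congr (_ * knsq _).
rewrite /pe_den chord_vc0; move: (chord_coef p x) => c.
have -> : kreal k (ch t) = kreal k (ex t)^-1 + kreal k (sh t).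
  by rewrite -krealD; congr kreal; rewrite /ch /sh; lra.
have e : kreal k (ex t) = kreal k (ex t)^-1 + (kreal k (sh t) + kreal k (sh t)).
  by rewrite -!krealD; congr kreal; rewrite /sh; lra.
rewrite e mulrBr mulr1 [c * (_ + _)]mulrDr -[c * kreal k _^-1]kreal_central [LHS]addrA subrK.
by rewrite -addrA mulrBl mul1r mulrDl mulrDr; congr (_ + _); rewrite addrC subrK.
Qed.
End Chord.

Lemma chord_unique gam x : geodesic gam -> forward_end gam = Some x -> in_X x ->
  gam = pel (gam 0) (chord (gam 0) x).
Proof.
move=> gg fe hx; have hp : in_H (gam 0) by exact: gg.1.
have [e [pe ge]] := geodesic_pel gg; rewrite [LHS]ge; congr pel.
have de : dehomog (peX (gam 0) e) = Some x.
  by rewrite -fe [in RHS]ge (forward_end_gline (pe_ldata pe)).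
have [X0 _ _ _] := pe_ldata pe.
set p := gam 0 in hp pe X0 de *.
have Xn : peX p e != 0.
  apply/eqP => h; have [h1 h2 h3] := pe; have := hform_phi_self p.
  have -> : phi p = - e.
    apply/eqP; rewrite -addr_eq0; apply/eqP; apply: (@rsc_eq0 _ _ _ _ (kreal k 2^-1)) => //.
    by apply: kreal_neq0; rewrite invr_eq0 pnatr_eq0.
  rewrite hformNl hformNr opprK h3 => /kreal_inj; move: (hp : 0 < ht p); rewrite /ht; lra.
have [|c [cX _ _]] := homog_dehomog Xn; first by rewrite X0 kre0.
rewrite de homog_some in cX.
have eE : e = rsc (phi x) (c + c) - phi p.
  have -> : rsc (phi x) (c + c) = phi p + e by rewrite rscDr -cX /peX -rscDl rsc_half.
  by rewrite addrAC subrr add0r.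
suff ec : c = chord_coef p x by rewrite /chord -ec; exact: eE.
have [_ h2 _] := pe; rewrite eE hformBr hformZr hform_phi_self mulrDr in h2.
clear eE.
have e1 : hform (phi p) (phi x) * c = kreal k (- ht p).
  have := h2; set D := _ * c => /eqP; rewrite subr_eq0 => /eqP h.
  have : kreal k 2 * D = kreal k 2 * kreal k (- ht p).
    by rewrite krealM -[2]/(1 + 1) krealD kreal1 mulrDl !mul1r h; congr kreal; rewrite /ht; ring.
  move=> /(congr1 (fun z => kreal k 2^-1 * z)).
  by rewrite !mulrA !krealM mulVf ?pnatr_eq0 // kreal1 !mul1r.
by rewrite /chord_coef -e1 mulrA (kmulVl (chord_den_neq0 hp hx)) mul1r.
Qed.
End Chords.

(** * Tangent vectors of chords *)

Section TangentCoordinates.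
Context {R : realType} {k : scalars} {n : nat}.
Local Notation K := (scalar R k).
Local Notation cK := (@cK R k).
Implicit Types (p x : kpoint R k n).

Lemma zmod_cancel (M : zmodType) (a b c e : M) : e = a - b - c - (a - (e + b) - c).
Proof.
by rewrite [a - b - c]addrAC [a - (e + b) - c]addrAC opprB addrCA [X in _ + X]addrAC subrr sub0r addrK.
Qed.

Definition chord_v p x : kpoint R k n := (tangent (pel p (chord p x)) 0).2.

Lemma chord_vE p x : in_H p -> in_X x ->
  let c := chord_coef p x + chord_coef p x in
  [/\ tangent (pel p (chord p x)) 0 = (p, chord_v p x),
      (chord_v p x).1 = rsc (x.1 - p.1) (c * kreal k cK) &
      (chord_v p x).2 = (kim (hdot p.1 (chord_v p x).1) + kim (hdot p.1 (chord_v p x).1)) -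
        kreal k (2 * ht p * cK) * (c - 1)].
Proof.
move=> hp hx c; have pe := chord_pedata hp hx.
have t0 := tangent_pel pe; have [e2 _] := pe_perp pe.
have ev : chord_v p x = (rsc (pe_b1 p (chord p x)) (kreal k cK),
     kreal k (- (2 * ht p * kre (vc0 (chord p x)) * cK)) + kim (pe_b2 p (chord p x)) * kreal k cK).
  by rewrite /chord_v t0.
split; first by rewrite /chord_v t0.
  by rewrite ev /= chord_b1 rscA.
rewrite ev [LHS]/= e2 [X in hdot _ X]/= hdotZr -(chord_vc0 p x).
move: (vc0 _) (hdot _ _) (ht p) cK => e0 D t c'.
rewrite kimB kimZl (mulr2n D) kimD -kreal_central.
have -> : kim (D * kreal k c') = kreal k c' * kim D by rewrite -kreal_central kimZl.
rewrite {3}[e0]kreimE [kreal k (2 * t * c') * (_ + _)]mulrDr [kreal k (2 * t * c') * kreal k _]krealM.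
have -> : kreal k (2 * t * c') * kim e0 = kreal k c' * (kreal k (2 * t) * kim e0).
  by rewrite mulrA krealM; congr (kreal k _ * _); ring.
rewrite mulrBr mulrDr opprD addrC -!addrA; congr (_ + (_ + _)).
by rewrite [RHS]addrC; congr (_ + _); rewrite -krealN; congr kreal; ring.
Qed.

Section Lipschitz.
Variables (T : Type) (P : set T) (dd : T -> T -> R) (p x : T -> kpoint R k n) (h : R).
Hypothesis h0 : 0 < h.
Local Notation lipK := (@lipK R k T P dd).
Definition lip_pt (q : T -> kpoint R k n) :=
  (forall i, lipK (fun a => (q a).1 i 0)) /\ lipK (fun a => (q a).2).
Hypotheses (hp : forall a, P a -> h <= ht (p a)) (hx : forall a, P a -> in_X (x a)).
Hypothesis lp : lip_pt p.
Local Notation c a := (chord_coef (p a) (x a)).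
Local Notation v a := (chord_v (p a) (x a)).

Lemma chordP a : P a -> in_H (p a) /\ in_X (x a).
Proof. by move=> Pa; split; [exact: lt_le_trans h0 (hp Pa)|exact: hx]. Qed.

Lemma lip_ht : lipK (fun a => kreal k (ht (p a))).
Proof. by have [_ l2] := lp; exact: lipK_kre. Qed.

Lemma lip_hform : lip_pt x -> lipK (fun a => hform (phi (p a)) (phi (x a))).
Proof.
move=> lx; have [p0 p1 p2] := lipK_vc (lipK_phi lp.1 lp.2).
have [x0 x1 x2] := lipK_vc (lipK_phi lx.1 lx.2).
apply: (@lipK_ext _ _ _ _ _ _ (fun a => hdot (vc1 (phi (p a))) (vc1 (phi (x a))) -
  kconj (vc0 (phi (p a))) * vc2 (phi (x a)) - kconj (vc2 (phi (p a))) * vc0 (phi (x a)))).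
  by move=> a _; rewrite hformE.
apply: lipK_sub; last by apply: lipK_mul => //; exact: lipK_conj.
apply: lipK_sub; first exact: lipK_hdot.
by apply: lipK_mul => //; exact: lipK_conj.
Qed.

Lemma lip_coef : lip_pt x -> lipK (fun a => c a).
Proof.
move=> lx; apply: lipK_mul; last first.
  apply: (@lipK_ext _ _ _ _ _ _ (fun a => - kreal k (ht (p a)))); last exact/lipK_opp/lip_ht.
  by move=> a _; rewrite krealN.
apply: (lipK_inv h0); last exact: lip_hform.
by move=> a Pa; have [pH xX] := chordP Pa; apply: le_trans (hp Pa) (chord_den pH xX).
Qed.

Lemma lip_kim_hdot (z w : T -> 'cV[K]_n) : (forall i, lipK (fun a => z a i 0)) ->
  (forall i, lipK (fun a => w a i 0)) -> lipK (fun a => kim (hdot (z a) (w a)) + kim (hdot (z a) (w a))).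
Proof. by move=> hz hw; apply: lipK_add; apply/lipK_kim/lipK_hdot. Qed.

Lemma lip_scale (r : R) : lipK (fun a => kreal k (2 * ht (p a) * r)).
Proof.
apply: (@lipK_ext _ _ _ _ _ _ (fun a => kreal k (2 * r) * kreal k (ht (p a)))).
  by move=> a _; rewrite krealM; congr kreal; ring.
by apply: lipK_mul; [exact: lipK_cst|exact: lip_ht].
Qed.

Lemma lip_chord_v : lip_pt x -> lip_pt (fun a => v a).
Proof.
move=> lx; have lc := lip_coef lx.
have l2c : lipK (fun a => c a + c a) by exact: lipK_add.
have l1 i : lipK (fun a => (v a).1 i 0).
  apply: (@lipK_ext _ _ _ _ _ _ (fun a => ((x a).1 i 0 - (p a).1 i 0) * ((c a + c a) * kreal k cK))).
    by move=> a Pa; have [pH xX] := chordP Pa; have [_ -> _] := chord_vE pH xX; rewrite rscE !mxE.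
  apply: lipK_mul; first exact: lipK_sub (lx.1 i) (lp.1 i).
  by apply: lipK_mul => //; exact: lipK_cst.
split=> //.
apply: (@lipK_ext _ _ _ _ _ _ (fun a => (kim (hdot (p a).1 (v a).1) + kim (hdot (p a).1 (v a).1)) -
        kreal k (2 * ht (p a) * cK) * (c a + c a - 1))).
  by move=> a Pa; have [pH xX] := chordP Pa; have [_ _ ->] := chord_vE pH xX.
apply: lipK_sub; first exact: lip_kim_hdot lp.1 l1.
by apply: lipK_mul; [exact: lip_scale|apply: lipK_sub => //; exact: lipK_cst].
Qed.

(* The end [x] is recovered from the tangent vector. *)
Lemma lip_end : lip_pt (fun a => v a) -> (forall a, P a -> 1 / 2 <= knorm (c a)) -> lip_pt x.
Proof.
move=> lv c12; have cK0 := @cK_gt0 R k.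
pose s a : R := 2 * ht (p a) * cK.
have s0 a : P a -> 0 < s a.
  by move=> Pa; rewrite /s !mulr_gt0 //; exact: lt_le_trans h0 (hp Pa).
(* By [chord_vE] the last component of the vector is affine in the coefficient, which is recovered
   here. The first component then gives [x.1], and the value of the Hermitian form gives [x.2]. *)
have l2c : lipK (fun a => c a + c a).
  apply: (@lipK_ext _ _ _ _ _ _ (fun a => kinv (kreal k (s a)) *
      (kim (hdot (p a).1 (v a).1) + kim (hdot (p a).1 (v a).1) - (v a).2) + 1)).
    move=> a Pa; have [pH xX] := chordP Pa; have [_ _ e] := chord_vE pH xX.
    rewrite [X in _ - X]e opprB addrCA subrr addr0 mulrA kmulVl ?mul1r ?subrK //.
    by apply: kreal_neq0; rewrite lt0r_neq0 // s0.
  apply: lipK_add; last exact: lipK_cst.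
  apply: lipK_mul; last by apply: lipK_sub; [exact: lip_kim_hdot lp.1 lv.1|exact: lv.2].
  have hc : 0 < 2 * h * cK by rewrite !mulr_gt0.
  apply: (lipK_inv hc); last exact: lip_scale.
  move=> a Pa; rewrite knorm_kreal gtr0_norm ?s0 // /s.
  by rewrite ler_pM2r // ler_pM2l // hp.
have n2c a : P a -> 1 <= knorm (c a + c a).
  move=> Pa; have -> : c a + c a = kreal k 2 * c a by rewrite -[2]/(1 + 1) krealD kreal1 mulrDl mul1r.
  by rewrite knormM knorm_kreal gtr0_norm //; have := c12 a Pa; lra.
have i2c : lipK (fun a => kinv (c a + c a)) by exact: lipK_inv ltr01 n2c l2c.
have l1 i : lipK (fun a => (x a).1 i 0).
  apply: (@lipK_ext _ _ _ _ _ _ (fun a => (v a).1 i 0 * (kreal k cK^-1 * kinv (c a + c a)) + (p a).1 i 0)).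
    move=> a Pa; have [pH xX] := chordP Pa; have [_ -> _] := chord_vE pH xX; rewrite rscE !mxE.
    have c0 : c a + c a != 0 by rewrite -knorm_gt0; exact: lt_le_trans ltr01 (n2c a Pa).
    rewrite -mulrA -[(c a + c a) * _ * _]mulrA (mulrA (kreal k cK)) krealM divff ?lt0r_neq0 // kreal1.
    by rewrite mul1r kmulVr // mulr1 subrK.
  apply: lipK_add; last exact: lp.1.
  apply: lipK_mul; first exact: lv.1.
  by apply: lipK_mul => //; exact: lipK_cst.
split=> //.
have [p0 p1 p2] := lipK_vc (lipK_phi lp.1 lp.2).
apply: (@lipK_ext _ _ _ _ _ _ (fun a => hdot (p a).1 (x a).1 + hdot (p a).1 (x a).1 -
   kreal k (normsq (x a).1) - kconj (vc2 (phi (p a))) - kreal k (2 * ht (p a) * -1) * kinv (c a + c a))).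
  move=> a Pa; have [pH xX] := chordP Pa.
  have c0 : c a + c a != 0 by rewrite -knorm_gt0; exact: lt_le_trans ltr01 (n2c a Pa).
  have -> : kreal k (2 * ht (p a) * -1) = hform (phi (p a)) (phi (x a)) * (c a + c a).
    by rewrite mulrDr (chord_coefE pH xX) -krealD; congr kreal; ring.
  rewrite -mulrA kmulVr // mulr1 hform_phi vc_phi mulr2n.
  exact: zmod_cancel.
apply: lipK_sub.
  apply: lipK_sub; last exact: lipK_conj.
  apply: lipK_sub; last exact: lipK_normsq.
  by apply: lipK_add; apply: lipK_hdot => //; exact: lp.1.
by apply: lipK_mul => //; exact: lip_scale.
Qed.
End Lipschitz.
End TangentCoordinates.

(** * Parametrisation of the section *)

Section SectionCoordinates.
Context {R : realType} {k : scalars} {n : nat}.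
Local Notation K := (scalar R k).
Local Notation coords := (coord_index n).
Local Notation d := (@ncoord k n).
Local Notation pt := (kpoint R k n).
Implicit Types (p q x : pt).

Lemma gauge4 p : gauge p ^+ 4 = (normsq p.1 + `|kre p.2|) ^+ 2 + knsq (kim p.2).
Proof.
rewrite /gauge -[4%N]/(2 * 2)%N exprM sqr_sqrtr ?knorm_ge0 // knorm_sqr knsq_reim.
rewrite kreD kre_kreal kre_kim addr0 kimD kim_kreal add0r; congr (_ + knsq _).
by rewrite kim_id // kre_kim.
Qed.

Lemma gauge4_X p : in_X p -> gauge p ^+ 4 = normsq p.1 ^+ 2 + knsq p.2.
Proof. by move=> pX; rewrite gauge4 (pX : kre p.2 = 0) normr0 addr0 kim_id. Qed.

Lemma gauge_le1 p : in_X p -> gauge p <= 1 -> normsq p.1 <= 1 /\ knsq p.2 <= 1.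
Proof.
move=> pX g1; have := exprn_ile1 4 (gauge_ge0 p) g1; rewrite gauge4_X //.
have := knsq_ge0 p.2; have := normsq_ge0 p.1; move: (normsq _) (knsq _) => a b a0 b0 h.
by split; nra.
Qed.

(* The point of the unit sphere above [q]. *)
Definition top q : pt :=
  (q.1, kreal k (Num.sqrt (1 - knsq q.2) - normsq q.1) + q.2).

Lemma ht_top q : in_X q -> ht (top q) = Num.sqrt (1 - knsq q.2) - normsq q.1.
Proof. by move=> qX; rewrite /ht /top /= kreD kre_kreal (qX : kre q.2 = 0) addr0. Qed.

Lemma kim_top q : in_X q -> kim (top q).2 = q.2.
Proof. by move=> qX; rewrite /top /= kimD kim_kreal add0r kim_id. Qed.

Lemma gauge_top q : in_X q -> gauge q <= 1 -> in_H (top q) -> gauge (top q) = 1.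
Proof.
move=> qX g1 hH; have [n1 k1] := gauge_le1 qX g1.
apply/eqP; rewrite -(@eqrXn2 _ 4) ?gauge_ge0 // expr1n gauge4 kim_top //.
have e : normsq q.1 + ht (top q) = Num.sqrt (1 - knsq q.2) by rewrite ht_top // addrC subrK.
rewrite gtr0_norm // -[kre (top q).2]/(ht (top q)) -[normsq (top q).1]/(normsq q.1) e.
rewrite sqr_sqrtr ?subr_ge0 //.
by rewrite subrK.
Qed.

Lemma top_of_sphere p : in_H p -> gauge p = 1 ->
  let q := (p.1, kim p.2) : pt in [/\ in_X q, gauge q <= 1 & p = top q].
Proof.
move=> pH g1 q; have qX : in_X q by rewrite /in_X kre_kim.
have g4 := gauge4 p; rewrite g1 expr1n gtr0_norm // in g4.
have n0 := normsq_ge0 p.1; have k0 := knsq_ge0 (kim p.2).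
split; first exact: qX.
  rewrite -(@ler_pXn2r _ 4) ?nnegrE ?gauge_ge0 // expr1n gauge4_X // g4 /=.
  move: (pH : 0 < kre p.2) n0; move: (kre _) (normsq _) (knsq _) => a b c *; nra.
rewrite /top /= [LHS]surjective_pairing; congr (_, _).
rewrite [LHS]kreimE; congr (kreal k _ + _).
have -> : 1 - knsq (kim p.2) = (normsq p.1 + kre p.2) ^+ 2 by rewrite g4 addrK.
by rewrite sqrtr_sqr ger0_norm ?addr_ge0 ?(ltW pH) // addrC addKr.
Qed.

Lemma enormsq_le p (e : R) : 0 <= e -> (forall i, knorm (p.1 i 0) <= e) -> knorm p.2 <= e ->
  enormsq p <= n.+1%:R * e ^+ 2.
Proof.
move=> e0 h1 h2; rewrite /enormsq -natr1 mulrDl mul1r; apply: lerD; last first.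
  by rewrite ler_pXn2r ?nnegrE ?knorm_ge0.
rewrite normsqE; apply: le_trans (_ : \sum_(i < n) e ^+ 2 <= _).
  by apply: ler_sum => i _; rewrite -knorm_sqr ler_pXn2r ?nnegrE ?knorm_ge0.
by rewrite sumr_const card_ord mulr_natl.
Qed.

Section Uniform.
Variables (T : Type) (P : set T) (dd : T -> T -> R).
Hypothesis dd0 : forall a b, 0 <= dd a b.

Lemma lip_pt_uniform (u : T -> pt) : lip_pt P dd u -> exists2 L, 0 <= L &
  forall a b, P a -> P b -> (forall i, knorm ((u a - u b).1 i 0) <= L * dd a b) /\
    knorm (u a - u b).2 <= L * dd a b.
Proof.
move=> [hz [? [Lw [_ Lw0 _ hw]]]].
have /choice[Lf hL] i : exists L, 0 <= L /\ forall a b, P a -> P b ->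
    knorm ((u a).1 i 0 - (u b).1 i 0) <= L * dd a b.
  by have [? [L [_ L0 _ h]]] := hz i; exists L.
exists (\sum_i Lf i + Lw).
  by rewrite addr_ge0 // sumr_ge0 // => i _; exact: (hL i).1.
move=> a b Pa Pb; split=> [i|].
  have -> : (u a - u b).1 i 0 = (u a).1 i 0 - (u b).1 i 0 by rewrite !mxE.
  apply: le_trans ((hL i).2 a b Pa Pb) _; rewrite ler_wpM2r //.
  by rewrite (bigD1 i) //= -addrA lerDl addr_ge0 // sumr_ge0 // => j _; exact: (hL j).1.
apply: le_trans (hw a b Pa Pb) _; rewrite ler_wpM2r // lerDr.
by rewrite sumr_ge0 // => j _; exact: (hL j).1.
Qed.

Lemma lip_tdist (u v : T -> pt) : lip_pt P dd u -> lip_pt P dd v -> exists2 L, 0 <= L &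
  forall a b, P a -> P b -> tdist (u a, v a) (u b, v b) <= L * dd a b.
Proof.
move=> /lip_pt_uniform[L1 L10 h1] /lip_pt_uniform[L2 L20 h2].
exists ((n.+1%:R + n.+1%:R) * (L1 + L2)); first by rewrite mulr_ge0 // addr_ge0.
move=> a b Pa Pb; have [h1z h1w] := h1 a b Pa Pb; have [h2z h2w] := h2 a b Pa Pb.
set e := (L1 + L2) * dd a b; have e0 : 0 <= e by rewrite mulr_ge0 // addr_ge0.
have le1 : L1 * dd a b <= e by rewrite ler_wpM2r // lerDl.
have le2 : L2 * dd a b <= e by rewrite ler_wpM2r // lerDr.
have N1 : 1 <= n.+1%:R :> R by rewrite ler1n.
rewrite -mulrA -/e /tdist -[leRHS]ger0_norm; last by rewrite mulr_ge0 // addr_ge0.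
rewrite -sqrtr_sqr ler_wsqrtr //=.
have E1 := enormsq_le e0 (fun i => le_trans (h1z i) le1) (le_trans h1w le1).
have E2 := enormsq_le e0 (fun i => le_trans (h2z i) le2) (le_trans h2w le2).
apply: le_trans (lerD E1 E2) _; rewrite [leRHS]exprMn; move: N1 (sqr_ge0 e).
move: (n.+1%:R) (e ^+ 2) => N E N1 E0; have N0 : 0 <= N - 1 by rewrite subr_ge0.
have N2 : 0 <= N by exact: le_trans ler01 N1.
rewrite -subr_ge0 (_ : _ - _ = 4 * (N * (N - 1) * E) + 2 * (N * E)); last by ring.
by rewrite addr_ge0 // !mulr_ge0.
Qed.
End Uniform.

Lemma tdist_ge (u v : tvector R k n) :
  [/\ forall i, knorm (u.1.1 i 0 - v.1.1 i 0) <= tdist u v, knorm (u.1.2 - v.1.2) <= tdist u v,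
      forall i, knorm (u.2.1 i 0 - v.2.1 i 0) <= tdist u v & knorm (u.2.2 - v.2.2) <= tdist u v].
Proof.
have key (c : K) : knsq c <= enormsq (u.1 - v.1) + enormsq (u.2 - v.2) -> knorm c <= tdist u v.
  by move=> h; rewrite knormE /tdist; exact: ler_wsqrtr.
have t1 := enormsq_ge0 (u.1 - v.1); have t2 := enormsq_ge0 (u.2 - v.2).
have E (p : pt) : (forall i, knsq (p.1 i 0) <= enormsq p) /\ knsq p.2 <= enormsq p.
  rewrite /enormsq knorm_sqr; split=> [i|]; last by rewrite lerDr normsq_ge0.
  by rewrite ler_wpDr ?knsq_ge0 // normsq_coord.
have [E1 E1'] := E (u.1 - v.1); have [E2 E2'] := E (u.2 - v.2).
split=> [i||i|]; apply: key.
- by rewrite ler_wpDr //; have := E1 i; rewrite !mxE.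
- by rewrite ler_wpDr.
- by rewrite ler_wpDl //; have := E2 i; rewrite !mxE.
- by rewrite ler_wpDl.
Qed.

Definition pdd (a b : pt * pt) : R := cdd a.1 b.1 + cdd a.2 b.2.
Lemma pdd_ge0 a b : 0 <= pdd a b. Proof. by rewrite addr_ge0 ?cdd_ge0. Qed.

(** The bound [h] keeps the point above [a.1] away from the boundary, so that the square root in
    [top] and the inverse in the chord coefficient have uniform Lipschitz constants. *)
Definition dom (h : R) : set (pt * pt) := [set a | [/\ in_X a.1, in_X a.2, gauge a.1 <= 1,
  gauge a.2 <= 1 & h <= ht (top a.1)]].

Section Domain.
Variable h : R.
Hypothesis h0 : 0 < h.

Lemma knorm_le1 (c : K) : knsq c <= 1 -> knorm c <= 1.
Proof. by move=> c1; rewrite -(@ler_pXn2r _ 2) ?nnegrE ?knorm_ge0 // expr1n knorm_sqr. Qed.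

Lemma lip_bounded_X (T : Type) (P : set T) (dd : T -> T -> R) (u : T -> pt) :
  (forall a, P a -> in_X (u a) /\ gauge (u a) <= 1) -> (forall a b, cdd (u a) (u b) <= dd a b) ->
  lip_pt P dd u.
Proof.
move=> hP hd; split=> [i|]; exists 1, 1; split=> //.
- move=> a Pa; have [aX a1] := hP a Pa; apply: knorm_le1.
  exact: le_trans (normsq_coord _ _) (gauge_le1 aX a1).1.
- by move=> a b _ _; rewrite mul1r; apply: le_trans (hd a b); exact: cdd_z.
- by move=> a Pa; have [aX a1] := hP a Pa; apply: knorm_le1; exact: (gauge_le1 aX a1).2.
- move=> a b Pa Pb; have [aX _] := hP a Pa; have [bX _] := hP b Pb.
  rewrite mul1r; apply: le_trans (hd a b); have := cdd_w (u a) (u b).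
  by rewrite !kim_id.
Qed.

Lemma lip_fst : lip_pt (dom h) pdd fst.
Proof.
apply: lip_bounded_X => [a [aX _ a1 _ _]|a b]; first by split.
by rewrite lerDl cdd_ge0.
Qed.
Lemma lip_snd : lip_pt (dom h) pdd snd.
Proof.
apply: lip_bounded_X => [a [_ aX _ a1 _]|a b]; first by split.
by rewrite lerDr cdd_ge0.
Qed.

Lemma lip_top : lip_pt (dom h) pdd (fun a => top a.1).
Proof.
have [l1 l2] := lip_fst; split=> //.
apply: (@lipK_ext _ _ _ _ _ _ (fun a : pt * pt =>
   (kreal k (Num.sqrt (1 - knsq a.1.2)) - kreal k (normsq a.1.1)) + a.1.2)).
  by move=> a _; rewrite /top /= krealB.
apply: lipK_add => //; apply: lipK_sub; last exact: lipK_normsq.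
apply: (lipK_sqrt h0) => [a [aX _ a1 _]|].
  rewrite ht_top // => hh; have := normsq_ge0 a.1.1; lra.
apply: (@lipK_ext _ _ _ _ _ _ (fun a : pt * pt => 1 - kconj a.1.2 * a.1.2)).
  move=> a [aX _ a1 _ _]; have [_ k1] := gauge_le1 aX a1.
  by rewrite sqr_sqrtr ?subr_ge0 // krealB kreal1 kconj_mul.
apply: lipK_sub; first exact: lipK_cst.
by apply: lipK_mul => //; exact: lipK_conj.
Qed.

Definition to_section (a : pt * pt) : tvector R k n := (top a.1, chord_v (top a.1) a.2).

Lemma dom_ht a : dom h a -> h <= ht (top a.1). Proof. by case. Qed.
Lemma dom_X a : dom h a -> in_X a.2. Proof. by case. Qed.

Lemma lip_vector : lip_pt (dom h) pdd (fun a => chord_v (top a.1) a.2).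
Proof. exact: lip_chord_v h0 dom_ht dom_X lip_top lip_snd. Qed.

Lemma to_section_lip : exists2 L, 0 <= L & forall a b, dom h a -> dom h b ->
  tdist (to_section a) (to_section b) <= L * pdd a b.
Proof. by have [L L0 hL] := lip_tdist pdd_ge0 lip_top lip_vector; exists L. Qed.
End Domain.
End SectionCoordinates.

(** * Hausdorff content of Lipschitz images *)

Section Content.
Context {R : realType} {k : scalars} {n : nat}.
Local Notation coords := (coord_index n).
Local Notation d := (@ncoord k n).
Local Notation pt := (kpoint R k n).
Local Notation tv := (tvector R k n).
Implicit Types (A : set tv) (s r e : R).

Lemma content_ge0 s A : (0 <= hausdorff_content s A)%E.
Proof.
apply: le_ereal_inf_tmp => _ [c [r [r0 _ ->]]].
by apply: nneseries_ge0 => m _ _; rewrite lee_fin powR_ge0.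
Qed.

Lemma content_sub s A B : A `<=` B -> (hausdorff_content s A <= hausdorff_content s B)%E.
Proof.
move=> AB; apply: ereal_inf_le_tmp => _ [c [r [r0 h ->]]].
by exists c, r; split=> //; exact: subset_trans h.
Qed.

(** Radii in [hausdorff_content] are positive, so the finite cover is continued by balls whose
    contributions sum to at most [e]; this is the second [e] in the bound. *)
Lemma content_finite s A (l : seq tv) r e : 0 < s -> 0 < r -> 0 < e ->
  A `<=` [set v | exists2 i, (i < size l)%N & tdist (nth (0, 0) l i) v < r] ->
  (size l)%:R * r `^ s <= e -> (hausdorff_content s A <= (e + e)%:E)%E.
Proof.
move=> s0 r0 e0 cov hl.
have u0 m : 0 < e / (2 ^ m.+1)%:R by rewrite divr_gt0 // ltr0n expn_gt0.
pose rr (m : nat) := if (m < size l)%N then r else (e / (2 ^ m.+1)%:R) `^ s^-1.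
apply: (@le_trans _ _ (\sum_(0 <= m <oo) (rr m `^ s)%:E)%E).
  apply: ereal_inf_lbound; exists (fun m => nth (0, 0) l m), rr; split=> //.
    by move=> m; rewrite /rr; case: ifP => // _; exact: powR_gt0.
  by move=> v /cov[i il hi]; exists i => //=; rewrite /rr il.
apply: series_le => [m|N]; first exact: powR_ge0.
apply: (@le_trans _ _ (\sum_(m < N) ((if (m < size l)%N then r `^ s else 0) + e / (2 ^ m.+1)%:R))).
  apply: ler_sum => m _; rewrite /rr; case: ifP => _; first by rewrite lerDl ltW.
  by rewrite add0r -powRrM mulVf ?lt0r_neq0 // powRr1 // ltW.
rewrite big_split lerD //; last exact/sum_halves/ltW.
exact: le_trans (sum_below _ _ (powR_ge0 _ _)) hl.
Qed.

Lemma coord_le1 (p : pt) ic : in_X p -> gauge p <= 1 -> `|coord p ic| <= 1.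
Proof.
move=> pX g1; have [n1 k1] := gauge_le1 pX g1; rewrite coordE.
apply: le_trans (kcoord_le _ _) _; apply: knorm_le1; case: ic.1 => [i|] //.
exact: le_trans (normsq_coord _ _) n1.
Qed.

Lemma powR_small (a e : R) : 0 < a -> 0 < e -> exists s, [/\ 0 < s, s <= 1 & s `^ a <= e].
Proof.
move=> a0 e0; pose s := Num.min 1 (e `^ a^-1).
have s0 : 0 < s by rewrite lt_min ltr01 powR_gt0.
exists s; split=> //; first by rewrite ge_min lexx.
have -> : e = (e `^ a^-1) `^ a by rewrite -powRrM mulVf ?lt0r_neq0 // powRr1 // ltW.
apply: ge0_ler_powR; rewrite ?nnegrE ?powR_ge0 ?(ltW a0) ?(ltW s0) //.
by rewrite ge_min lexx orbT.
Qed.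

(** A grid of mesh [t] in the [2 d] coordinates has at most a constant times [t^(-2 d)] cells, each
    mapped into a ball of radius [C * t]. The total is [D * t^(s - 2 d)], which tends to 0 with
    [t]. *)
Lemma content_image (P : set (pt * pt)) (F : pt * pt -> tv) (L s : R) : 0 <= L ->
  (forall a, P a -> [/\ in_X a.1, in_X a.2, gauge a.1 <= 1 & gauge a.2 <= 1]) ->
  (forall a b, P a -> P b -> tdist (F a) (F b) <= L * pdd a b) ->
  (2 * d)%:R < s -> hausdorff_content s (F @` P) = 0%E.
Proof.
move=> L0 hP hF sd; apply/eqP; rewrite eq_le content_ge0 andbT.
have s0 : 0 < s by apply: le_lt_trans sd; exact: ler0n.
apply/lee_addgt0Pr => e e0; rewrite add0e.
have a0 : 0 < s - (2 * d)%:R by rewrite subr_gt0.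
(* Two points near one centre differ by at most [2 t] in each of the [2 d] coordinates, so [pdd] is
   at most [4 d t]; the summand 1 makes the inequality strict. *)
pose C : R := L * (d%:R * 4) + 1; have C0 : 0 < C by rewrite ltr_wpDl // !mulr_ge0.
pose D : R := 2 ^+ (2 * d) * C `^ s; have D0 : 0 < D by rewrite mulr_gt0 ?exprn_gt0 ?powR_gt0.
have e2 : 0 < e / 2 by rewrite divr_gt0.
have [t [t0 t1 ht]] := powR_small a0 (divr_gt0 e2 D0).
pose J : seq (coords + coords)%type := [seq inl ic | ic <- @actives k n] ++ [seq inr ic | ic <- @actives k n].
have uJ : uniq J.
  rewrite cat_uniq !map_inj_uniq ?enum_uniq /=; try by move=> ? ? [].
  by rewrite andbT; apply/hasPn => _ /mapP[ic _ ->]; apply/mapP => -[].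
have sJ : size J = (2 * d)%N by rewrite size_cat !size_map size_actives mul2n addnn.
have [l [hl cov]] := grid (fun=> -1) (fun=> 1 : R) t0 uJ.
pose co (a : pt * pt) (i : coords + coords) : R :=
  match i with inl ic => coord a.1 ic | inr ic => coord a.2 ic end.
have /choice[f hf] c : exists a, forall b, P b -> (forall i, i \in J -> `|co b i - c i| <= t) ->
    P a /\ forall i, i \in J -> `|co a i - c i| <= t.
  have [[b [Pb hb]]|nb] := pselect (exists b, P b /\ forall i, i \in J -> `|co b i - c i| <= t).
    by exists b.
  by exists (0, 0) => b Pb hb; case: nb; exists b.
rewrite [e]splitr.
apply: (@content_finite s _ [seq F (f c) | c <- l] (C * t)) => //; first exact: mulr_gt0.
  move=> _ [b Pb <-]; have [aX bX a1 b1] := hP b Pb.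
  have [|i il hi] := cov (co b).
    by move=> i _; rewrite -ler_norml; case: i => ic /=; exact: coord_le1.
  exists i; first by rewrite size_map.
  rewrite (nth_map (fun=> 0)) //; set c := nth _ l i in hi *.
  have [Pf hfc] := hf c b Pb hi.
  apply: le_lt_trans (hF _ _ Pf Pb) _.
  have close j : j \in J -> `|co (f c) j - co b j| <= t + t.
    move=> jJ; apply: le_trans (ler_distD (c j) _ _) _.
    by rewrite [X in _ + X]distrC lerD // ?hfc ?hi.
  have p1 : pdd (f c) b <= d%:R * (t + t) + d%:R * (t + t).
    apply: lerD; apply: cdd_le => ic hic.
      by apply: (close (inl ic)); rewrite mem_cat map_f // mem_actives.
    by apply: (close (inr ic)); rewrite mem_cat map_f ?orbT // mem_actives.
  apply: le_lt_trans (ler_wpM2l L0 p1) _; rewrite /C mulrDl mul1r.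
  by rewrite [ltLHS](_ : _ = L * (d%:R * 4) * t) ?ltrDl //; ring.
rewrite size_map powRM ?(ltW C0) ?(ltW t0) //.
have -> : t `^ s = t ^+ (2 * d) * t `^ (s - (2 * d)%:R).
  rewrite -powR_mulrn ?(ltW t0) // -powRD ?(addrC _ (s - _)) ?subrK //.
  by rewrite (gt_eqF t0) implybT.
have h1 : (size l)%:R * t ^+ (2 * d) <= 2 ^+ (2 * d).
  rewrite -sJ; apply: le_trans hl _; set w := _ / 2 + t.
  have w0 : 0 <= w by rewrite addr_ge0 ?(ltW t0) // divr_ge0 // le_max lexx.
  have w2 : w <= 2 by rewrite /w opprK max_r //; lra.
  elim: (J) => [|j J' IH]; first by rewrite big_nil.
  by rewrite big_cons exprS; apply: ler_pM => //; apply: prodr_ge0.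
have h2 : 0 <= t `^ (s - (2 * d)%:R) := powR_ge0 _ _.
apply: (@le_trans _ _ (2 ^+ (2 * d) * C `^ s * t `^ (s - (2 * d)%:R))).
  move: ((size l)%:R) (t ^+ (2 * d)) (2 ^+ (2 * d)) (t `^ _) h1 h2 (powR_ge0 C s) => u v w x h1 h2.
  move: (C `^ s) => y y0; rewrite -subr_ge0 [X in 0 <= X](_ : _ = (w - u * v) * (y * x)); last by ring.
  by rewrite mulr_ge0 ?mulr_ge0 // subr_ge0.
by rewrite -/D mulrC -ler_pdivlMr.
Qed.
End Content.

(** * Lower bound for the content by slices *)

Section LowerBound.
Context {R : realType} {k : scalars} {n : nat} (n_gt0 : (0 < n)%N).
Local Notation coords := (coord_index n).
Local Notation d := (@ncoord k n).
Local Notation pt := (kpoint R k n).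
Local Notation tv := (tvector R k n).

Lemma tdist_near (c u v : tv) r : tdist c u < r -> tdist c v < r -> tdist u v <= 2 * r.
Proof.
have e0 (w z : tv) : 0 <= enormsq (w.1 - z.1) + enormsq (w.2 - z.2).
  by rewrite addr_ge0 ?enormsq_ge0.
move=> hu hv; have r0 : 0 <= r by apply: le_trans (ltW hu); exact: sqrtr_ge0.
have sq (w z : tv) : tdist w z < r -> enormsq (w.1 - z.1) + enormsq (w.2 - z.2) <= r ^+ 2.
  by move=> /ltW h; rewrite -[leLHS]sqr_sqrtr // ler_pXn2r ?nnegrE ?sqrtr_ge0.
have tr (x y z : pt) : enormsq (y - z) <= 2 * enormsq (x - y) + 2 * enormsq (x - z).
  have -> : y - z = (x - z) + - (x - y) by rewrite opprB [RHS]addrC addrA subrK.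
  by apply: le_trans (enormsq_triangle _ _) _; rewrite enormsqN addrC.
have r20 : 0 <= 2 * r by rewrite mulr_ge0.
rewrite -[leRHS]ger0_norm // -sqrtr_sqr ler_wsqrtr //.
apply: le_trans (lerD (tr c.1 u.1 v.1) (tr c.2 u.2 v.2)) _.
have := sq _ _ hu; have := sq _ _ hv; rewrite exprMn; lra.
Qed.

Lemma top_coord (q : pt) ic : in_X q -> active k ic -> coord (top q) ic = coord q ic.
Proof.
move=> qX; rewrite !coordE; case: ic => -[i|] l //= /andP[_ /= l0].
have := kcoord_kim (top q).2 l; rewrite kim_top // l0 => ->.
by [].
Qed.

(** The lower bound on the coefficient is what [lip_end] requires to recover the end from the
    vector. It holds near the diagonal, where the coefficient is close to 1. *)
Definition good_dom (h : R) : set (pt * pt) :=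
  [set a | dom h a /\ 1 / 2 <= knorm (chord_coef (top a.1) a.2)].

Section Expansion.
Variable h : R.
Hypothesis h0 : 0 < h.
Let dd (a b : pt * pt) : R := tdist (to_section a) (to_section b).

Lemma lip_of_image (u : pt * pt -> pt) : lip_pt (dom h) pdd u ->
  (forall a b, (forall i, knorm ((u a).1 i 0 - (u b).1 i 0) <= dd a b) /\
    knorm ((u a).2 - (u b).2) <= dd a b) -> lip_pt (good_dom h) dd u.
Proof.
move=> [l1 l2] hu; split=> [i|].
  have [B [_ [B0 _ hB _]]] := l1 i; exists B, 1; split=> //; first by move=> a [] /hB.
  by move=> a b _ _; rewrite mul1r; have [+ _] := hu a b; apply.
have [B [_ [B0 _ hB _]]] := l2; exists B, 1; split=> //; first by move=> a [] /hB.
by move=> a b _ _; rewrite mul1r; have [_ +] := hu a b; apply.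
Qed.

Lemma end_lip : exists2 L, 0 < L & forall a b, good_dom h a -> good_dom h b ->
  forall ic, `|coord a.2 ic - coord b.2 ic| <= L * dd a b.
Proof.
have dd0 a b : 0 <= dd a b by exact: sqrtr_ge0.
have lt : lip_pt (good_dom h) dd (fun a => top a.1).
  apply: lip_of_image (lip_top h0) _ => a b.
  by have [h1 h2 _ _] := tdist_ge (to_section a) (to_section b).
have lv : lip_pt (good_dom h) dd (fun a => chord_v (top a.1) a.2).
  apply: lip_of_image (lip_vector h0) _ => a b.
  by have [_ _ h1 h2] := tdist_ge (to_section a) (to_section b).
have le : lip_pt (good_dom h) dd snd.
  by apply: (lip_end h0 _ _ lt lv) => [a [[]]|a [[]]|a []].
have [L L0 hL] := lip_pt_uniform dd0 le; exists (L + 1); first by rewrite ltr_wpDl.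
move=> a b Pa Pb ic; have [hz hw] := hL a b Pa Pb.
have LL : L * dd a b <= (L + 1) * dd a b by rewrite ler_wpM2r // lerDl.
apply: coord_bound => [i|]; last exact: le_trans hw LL.
by have := hz i; rewrite !mxE => hzi; exact: le_trans hzi LL.
Qed.
End Expansion.

Section Positive.
Variables (h : R) (c0 : coords -> R) (sg mu : R) (E : set pt) (W : set tv).
Hypotheses (h0 : 0 < h) (sg0 : 0 < sg) (mu0 : 0 < mu) (nE : ~ cover_le E mu).
Hypothesis EW : forall q x, cube c0 sg q -> E x ->
  good_dom h (q, x) /\ W (to_section (q, x)).

(** A ball that meets the slice over [q] has its centre within [r m] of [q] in base coordinates, and
    its trace on the ends lies in a cube of radius [L * (2 * r m)]. If the sum were below [mu],
    these cubes would contradict [nE]. *)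
Lemma slice_cover (L : R) (c : nat -> tv) (r : nat -> R) (q : pt) : 0 < L ->
  (forall a b, good_dom h a -> good_dom h b ->
    forall ic, `|coord a.2 ic - coord b.2 ic| <= L * tdist (to_section a) (to_section b)) ->
  (forall m, 0 < r m) -> W `<=` \bigcup_m [set v | tdist (c m) v < r m] -> cube c0 sg q ->
  (mu%:E <= \sum_(0 <= m <oo) ((L * (2 * r m)) ^+ d *
    \prod_(j <- @actives k n) near1 (coord q j) (coord (c m).1 j) (r m))%:E)%E.
Proof.
move=> L0 hL r0 cov qc; rewrite leNgt; apply/negP => hmu; apply: nE.
have [qX _] := qc.
pose near m := all (fun j => `|coord q j - coord (c m).1 j| <= r m) (@actives k n).
pose w m := (L * (2 * r m)) ^+ d *
    \prod_(j <- @actives k n) near1 (coord q j) (coord (c m).1 j) (r m).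
have rr m : 0 <= L * (2 * r m) by rewrite !mulr_ge0 ?(ltW L0) ?(ltW (r0 m)).
have w0 m : 0 <= w m.
  by rewrite mulr_ge0 ?exprn_ge0 //; apply: prodr_ge0 => j _; exact: near1_ge0.
have /choice[xc hxc] m : exists x, forall x', E x' -> tdist (c m) (to_section (q, x')) < r m ->
    E x /\ tdist (c m) (to_section (q, x)) < r m.
  have [[x hx]|nx] := pselect (exists x, E x /\ tdist (c m) (to_section (q, x)) < r m).
    by exists x.
  by exists 0 => x' Ex' hx'; case: nx; exists x'.
exists (fun m => coord (xc m)), (fun m => if near m then L * (2 * r m) else 0); split.
- by move=> m; case: ifP.
- move=> x Ex; have [Gx Wx] := EW qc Ex; have [m _ /= hm] := cov _ Wx; exists m => //.
  have [Exc hmc] := hxc m x Ex hm; have [Gc _] := EW qc Exc.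
  have -> : near m.
    apply/allP => j; rewrite mem_actives => hj; rewrite -(top_coord qX hj) distrC.
    have [h1 h2 _ _] := tdist_ge (c m) (to_section (q, x)).
    exact: coord_bound (fun i => le_trans (h1 i) (ltW hm)) (le_trans h2 (ltW hm)) j.
  have [[_ xX _ _ _] _] := Gx; split; first exact: xX.
  move=> ic _; apply: le_trans (hL _ _ Gx Gc ic) _; rewrite ler_pM2l //.
  exact: tdist_near hm hmc.
- move=> N; apply: le_trans (partial_le N w0 (ltW hmu)).
  apply: ler_sum => m _; rewrite /w; case: ifP => hn; last first.
    by rewrite expr0n eqn0Ngt (ncoord_gt0 n_gt0); exact: w0.
  have -> : \prod_(j <- @actives k n) near1 (coord q j) (coord (c m).1 j) (r m) = 1.
    by rewrite big1_seq // => j /andP[_ hj]; rewrite /near1 (allP hn j hj).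
  by rewrite mulr1.
Qed.

Lemma content_neq0 s : 0 <= s -> s < (2 * d)%:R -> hausdorff_content s W <> 0%E.
Proof.
move=> s0 sd hc0; have [L L0 hL] := end_lip h0.
pose M := mu * (2 * sg) ^+ d; have M0 : 0 < M by rewrite mulr_gt0 // exprn_gt0 // mulr_gt0.
pose C := (L * 2 * 2) ^+ d; have C0 : 0 < C by rewrite exprn_gt0 // !mulr_gt0.
(* [e <= 1] forces all radii to be at most 1, so that [r^(2 d) <= r^s]; the second bound contradicts
   the inequality [M <= C * e] obtained by integration. *)
pose e := Num.min 1 (M / (2 * C)).
have e0 : 0 < e by rewrite lt_min ltr01 divr_gt0 // mulr_gt0.
have [|_ [c [r [r0 cov ->]]] hx] := @lb_ereal_inf_adherent R [set x : \bar R |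
    exists (c : nat -> tv) (r : nat -> R), [/\ forall m, 0 < r m,
        W `<=` \bigcup_m [set v | tdist (c m) v < r m]
      & x = (\sum_(0 <= m <oo) (r m `^ s)%:E)%E]] _ e0 _.
  by rewrite -[ereal_inf _]/(hausdorff_content s W) hc0.
rewrite -[ereal_inf _]/(hausdorff_content s W) hc0 add0e in hx.
have p0 m : 0 <= r m `^ s := powR_ge0 _ _.
have r1 m : r m <= 1.
  rewrite leNgt; apply/negP => rm; have := le_lt_trans (term_le_series m p0) hx.
  rewrite lte_fin; apply/negP; rewrite -leNgt; apply: (@le_trans _ _ 1).
    by rewrite ge_min lexx.
  by rewrite -[leLHS](powRr0 (r m)); apply: ler_powR => //; exact: ltW.
have hr N : \sum_(m < N) r m ^+ (2 * d) <= e.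
  apply: le_trans (partial_le N p0 (ltW hx)); apply: ler_sum => m _.
  have r01 : 0 < r m <= 1 by rewrite r0 r1.
  by rewrite -powR_mulrn ?(ltW (r0 m)) //; exact: (ger_powR r01 (ltW sd)).
pose lo ic := c0 ic - sg.
have rr m : 0 <= L * (2 * r m) by rewrite !mulr_ge0 ?(ltW L0) ?(ltW (r0 m)).
have sg2 : 0 <= 2 * sg by rewrite mulr_ge0 // ltW.
have := @fubini_box R _ (@actives k n) (fun m => (L * (2 * r m)) ^+ d) r
  (fun m => coord (c m).1) lo (2 * sg) mu (enum_uniq _) sg2 (fun m => exprn_ge0 d (rr m))
  (fun m => ltW (r0 m)) _.
have slice (t : coords -> R) : (forall j, lo j <= t j <= lo j + 2 * sg) ->
    (mu%:E <= \sum_(0 <= m <oo) ((L * (2 * r m)) ^+ d *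
      \prod_(j <- @actives k n) near1 (t j) (coord (c m).1 j) (r m))%:E)%E.
  move=> ht; have qc : cube c0 sg (mkX t : pt).
    split=> [|ic hic]; first exact: mkX_in.
    by rewrite mkX_coord // ler_norml; have := ht ic; rewrite /lo => /andP[? ?]; apply/andP; split; lra.
  have := slice_cover L0 hL r0 cov qc.
  rewrite (eq_eseriesr (g := fun m => ((L * (2 * r m)) ^+ d *
      \prod_(j <- @actives k n) near1 (t j) (coord (c m).1 j) (r m))%:E)) // => m _.
  congr (_ * _)%:E; apply: eq_big_seq => j; rewrite mem_actives => hj.
  by rewrite mkX_coord.
move=> /(_ slice); rewrite size_actives -/M => h1.
have : (M%:E <= (C * e)%:E)%E.
  apply: le_trans h1 _; apply: series_le => [m|N].
    by rewrite mulr_ge0 ?exprn_ge0 // mulr_ge0 // ltW.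
  rewrite (eq_bigr (fun m : 'I_N => C * r m ^+ (2 * d))).
    by rewrite -mulr_sumr; apply: ler_wpM2l; [exact: ltW|exact: hr].
  move=> m _; rewrite /C mul2n -addnn exprD !exprMn.
  by move: (L ^+ d) (2 ^+ d) (r m ^+ d) => u v w; ring.
rewrite lee_fin leNgt => /negP; apply.
apply: le_lt_trans (_ : C * (M / (2 * C)) < M).
  by rewrite ler_pM2l // ge_min lexx orbT.
have -> : C * (M / (2 * C)) = M / 2 by field; rewrite lt0r_neq0.
by lra.
Qed.
End Positive.
End LowerBound.

(** * The section has codimension one *)

Section Dimension.
Context {R : realType} {k : scalars} {n : nat} (n_gt0 : (0 < n)%N) (A : iwasawa_cf R k n).
Local Notation K := (scalar R k).
Local Notation coords := (coord_index n).
Local Notation d := (@ncoord k n).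
Local Notation pt := (kpoint R k n).
Local Notation tv := (tvector R k n).
Local Notation Dm := (cf_domain A).
Local Notation ex := (@ex R k).

(** Among the real coordinates of the ambient space, the real part of the last scalar is the only
    one that is not active. *)
Lemma card_coords : (d.+1 = kdim k * n.+1)%N.
Proof.
have h4 : #|[pred l : 'I_4 | (l < kdim k)%N]| = kdim k.
  by rewrite -sum1_card big_mkcond !big_ord_recl big_ord0; case: (k).
have hn : #|{: option 'I_n}| = n.+1 by rewrite card_option card_ord.
rewrite mulnC -[X in (_ * X)%N]h4 -hn -cardX.
rewrite [RHS](cardD1 (None, ord0)) !inE /= (_ : (0 < kdim k)%N) ?add1n; last by case: (k).
congr _.+1; apply: eq_card => -[j l]; rewrite !inE /active /= andbC; congr (_ && _).
by case: j => [i|] //=; rewrite xpair_eqE eqxx /= -val_eqE /= lt0n.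
Qed.

Lemma dim_T1H_ncoord : dim_T1H k n = (2 * d).+1.
Proof. by rewrite /dim_T1H -card_coords; lia. Qed.

Section Upper.
Variables (h2 h0 : R).
Hypotheses (A_proper : cf_proper A) (h2_gt0 : 0 < h2).

Lemma section_subset : section_W A h2 h0 `<=` to_section @` dom h2.
Proof.
move=> _ [gam [gg [[[pH g1] hh] _] [[x Dx fe] _] _] <-].
have xX := D_X Dx; have [qX q1 pe] := top_of_sphere pH g1.
have gE := chord_unique gg (esym fe) xX.
have [t0 _ _] := chord_vE pH xX.
exists (((gam 0).1, kim (gam 0).2), x).
  split=> //; first exact/ltW/(D_gauge_lt1 A_proper Dx).
  by rewrite -[X in ht X]pe.
by rewrite /to_section -[top _]pe [in RHS]gE t0.
Qed.

Lemma section_content s : (2 * d)%:R < s -> hausdorff_content s (section_W A h2 h0) = 0%E.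
Proof.
move=> sd; have [L L0 hL] := @to_section_lip R k n h2 h2_gt0.
have h : hausdorff_content s ((@to_section R k n) @` dom h2) = 0%E.
  have hP (a : pt * pt) : dom h2 a -> [/\ in_X a.1, in_X a.2, gauge a.1 <= 1 & gauge a.2 <= 1] by case.
  by apply: (@content_image R k n (dom h2) (@to_section R k n) L s).
by apply/eqP; rewrite eq_le content_ge0 andbT -h; exact/content_sub/section_subset.
Qed.
End Upper.

Section Lower.
Variables (eps h2 h0 : R).
Hypotheses (A_proper : cf_proper A) (A_discrete : cf_discrete A) (eps_gt0 : 0 < eps)
  (h2P : wall_height A eps h2) (h0_eps : (1 + eps) ^+ 2 <= h0).

Lemma h0_gt1 : 1 < h0.
Proof. by apply: lt_le_trans h0_eps; rewrite expr_gt1 ?ltrDl // addr_ge0 // ltW. Qed.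

(** The visit at [th] produces a wall crossing afterwards. The geodesic meets the sphere only once
    after [th], and it does so at time 0, so the crossing is there. *)
Lemma on_section_high gam x th : geodesic gam -> forward_end gam = Some x -> Dm x ->
  ~ exceptional A (Some x) -> gauge (gam 0) = 1 -> th < 0 -> h0 < ht (gam th) ->
  on_section A h2 h0 gam.
Proof.
move=> gg fe Dx nx g1 th0 hth.
have e1 (s : R) : mob 1^-1%g (gam s) = gam s by rewrite invg1 mob1.
have vis : visits A h0 gam 1%g th.
  split; first exact: Mod1.
  by rewrite e1 invg1 xmob1 fe; split=> //; exists x.
have nx' : ~ exceptional A (forward_end gam) by rewrite fe.
have [t tht ct] := visits_crosses A_proper eps_gt0 h2P h0_eps gg nx' vis.
have m1 : cf_modular A 1%g by exact: Mod1.
have [gt1 _ _ _] := crosses_data gg m1 ct; rewrite e1 in gt1.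
have gth : 1 < gauge (gam th).
  rewrite ltNge; apply/negP => h; have := gauge_ht (gg.1 th).
  have := exprn_ile1 2 (gauge_ge0 _) h; move: hth h0_gt1; lra.
have [t1 [_ _ bef aft]] := sphere_crossing gg fe (D_gauge_lt1 A_proper Dx) gth.
have uniq s : th < s -> gauge (gam s) = 1 -> s = t1.
  move=> ths gs; case: (ltgtP s t1) => // h.
    by have := bef s (ltW ths) h; rewrite gs ltxx.
  by have := aft s h; rewrite gs ltxx.
move: ct; rewrite (uniq t tht gt1) -(uniq 0 th0 g1) /crosses.
by congr on_section; apply/funext => s; rewrite e1 addr0.
Qed.

Lemma chord_coef_above (x : pt) : in_X x -> in_H (top x) -> chord_coef (top x) x = 1.
Proof.
move=> xX hH; rewrite /chord_coef.
have -> : hform (phi (top x)) (phi x) = kreal k (- ht (top x)).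
  rewrite [LHS]kreimE kim_hform_phi kim_top // (kim_id xX) hdot_normsq kim_kreal mul0rn sub0r addNr addr0.
  have := kre_hform_phi (top x) x; rewrite subrr normsq0 add0r (xX : kre x.2 = 0) addr0 => h.
  by congr kreal; rewrite -[LHS]opprK h.
by apply: kmulVl; apply: kreal_neq0; rewrite oppr_eq0 gt_eqF.
Qed.

(** On X this is the fourth power of the gauge, in polynomial form and therefore locally Lipschitz
    in the coordinates. *)
Definition g4 (p : pt) : R := normsq p.1 ^+ 2 + knsq p.2.

(** With [N = normsq q.1] and [s] the square root of [1 - knsq q.2], the hypothesis reads
    [2 e <= (s - N) (s + N)], and [s + N <= 2]. *)
Lemma top_height (q : pt) (e : R) : in_X q -> 0 < e -> g4 q <= 1 - 2 * e ->
  gauge q <= 1 /\ e <= ht (top q).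
Proof.
move=> qX e0 hg; have g1 : gauge q <= 1.
  rewrite -(@ler_pXn2r _ 4) ?nnegrE ?gauge_ge0 // expr1n gauge4_X //.
  by apply: le_trans hg _; rewrite gerBl mulr_ge0 // ltW.
split=> //; rewrite ht_top //; have [n1 k1] := gauge_le1 qX g1.
move: hg (normsq_ge0 q.1) (knsq_ge0 q.2); rewrite /g4.
have s2 : Num.sqrt (1 - knsq q.2) ^+ 2 = 1 - knsq q.2 by rewrite sqr_sqrtr ?subr_ge0.
move: n1 k1 s2 (sqrtr_ge0 (1 - knsq q.2)); set s := Num.sqrt _.
clearbody s; move: (normsq q.1) (knsq q.2) => N w N1 w1 s2 s0 hg N0 w0.
have s1 : s <= 1 by rewrite leNgt; apply/negP => h; nra.
have h1 : 2 * e <= (s - N) * (s + N) by rewrite -subr_sqr s2; lra.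
have h2' : 0 < s - N.
  rewrite ltNge; apply/negP => h; have := mulr_le0_ge0 h (addr_ge0 s0 N0); lra.
have : (s - N) * (s + N) <= (s - N) * 2 by apply: ler_wpM2l; [exact: ltW|lra].
lra.
Qed.

Lemma g4_lip : exists2 L, 0 <= L & forall p q : pt, in_X p -> in_X q -> gauge p <= 1 ->
  cdd q p <= 1 -> `|g4 q - g4 p| <= L * cdd q p.
Proof.
pose P : set pt := [set p | [/\ in_X p, forall i, knorm (p.1 i 0) <= 2 & knorm p.2 <= 2]].
have lp : lip_pt P cdd id.
  split=> [i|]; exists 2, 1; split=> //; first by move=> p [].
  - by move=> p q _ _; rewrite mul1r; exact: cdd_z.
  - by move=> p [].
  - move=> p q [pX _ _] [qX _ _]; rewrite mul1r; have := cdd_w p q.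
    by rewrite (kim_id pX) (kim_id qX).
have lg : lipK P cdd (fun p => kreal k (g4 p)).
  apply: (@lipK_ext _ _ _ _ _ _ (fun p : pt => kreal k (normsq p.1) * kreal k (normsq p.1) + kconj p.2 * p.2)).
    by move=> p _; rewrite krealM kconj_mul -krealD.
  have ln := lipK_normsq lp.1.
  by apply: lipK_add; apply: lipK_mul => //; [apply: lipK_conj|]; exact: lp.2.
have [B [L [_ L0 _ hL]]] := lg; exists L => // p q pX qX p1 qp.
have [n1 k1] := gauge_le1 pX p1.
have b1 i : knorm (p.1 i 0) <= 1 by apply: knorm_le1; apply: le_trans (normsq_coord _ _) n1.
have b2 := knorm_le1 k1.
have Pp : P p.
  by split=> // [i|]; [apply: le_trans (b1 i) _|apply: le_trans b2 _]; rewrite ler1n.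
have Pq : P q.
  split=> // [i|].
    rewrite -[q.1 i 0](subrK (p.1 i 0)); apply: le_trans (knorm_triangle _ _) _.
    by rewrite -[2]/(1 + 1) lerD //; apply: le_trans (cdd_z q p i) qp.
  rewrite -[q.2](subrK p.2); apply: le_trans (knorm_triangle _ _) _.
  rewrite -[2]/(1 + 1) lerD //; have := cdd_w q p; rewrite (kim_id pX) (kim_id qX) => h.
  exact: le_trans h qp.
by have := hL q p Pq Pp; rewrite -krealB knorm_kreal.
Qed.

(* Near the diagonal of [K * K], the chord from the point above [q] to [x] is nearly
   vertical, hence comes from a great height. *)
Lemma near_diagonal : exists h, 0 < h /\ exists2 eta, 0 < eta & forall q x,
  in_X q -> generic_end A x -> cdd q x <= eta ->
  good_dom h (q, x) /\ section_W A h2 h0 (to_section (q, x)).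
Proof.
have [rho /andP[rho0 rho1] hrho] := rad_bound A_proper.
(* On the domain [g4 x <= rho^4 = 1 - 4 h]. Half of this margin pays for moving from [x] to [q], and
   [top_height] converts the other half into height [h]. *)
pose h := (1 - rho ^+ 4) / 4; have r4 : rho ^+ 4 < 1 by rewrite exprn_ilt1 ?(ltW rho0).
have h_gt0 : 0 < h by rewrite divr_gt0 // subr_gt0.
have [L0 L00 hL0] := g4_lip.
have [B [L1 [_ L10 _ hL1]]] := lip_coef h_gt0 (@dom_ht R k n h) (@dom_X R k n h) (lip_top h_gt0) (lip_snd h).
have h0p : 0 < h0 := lt_trans ltr01 h0_gt1.
(* [q0] is [ex t] for the time by which the geodesic is followed backwards. There the factor [w] of
   [chord_ht] has norm at most [4 / q0], so the height is at least [h * q0^2 / 16], which exceeds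
   [h0]. *)
pose q0 := 16 * h0 / h + 2; have S2 : 2 <= q0 
  by rewrite /q0 lerDr; apply: divr_ge0; [apply: mulr_ge0 => //; exact: ltW|exact: ltW].
have S_gt0 : 0 < q0 by apply: lt_le_trans S2.
have S1 : 1 < q0 by apply: lt_le_trans S2; rewrite ltr1n.
(* The tolerance for the distance of the chord coefficient from 1: multiplied by [q0] it contributes
   only [2 / q0] to the norm of [w]. *)
pose dl := 2 / q0 ^+ 2; have dl0 : 0 < dl by rewrite divr_gt0 // exprn_gt0.
exists h; split=> //.
pose eta := Num.min 1 (Num.min (2 * h / (L0 + 1)) (dl / (L1 + 1))).
have L0p : 0 < L0 + 1 by rewrite ltr_wpDl.
have L1p : 0 < L1 + 1 by rewrite ltr_wpDl.
have eta0 : 0 < eta by rewrite !lt_min ltr01 !divr_gt0 // mulr_gt0.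
exists eta => // q x qX [Dx nx] qx; have xX := D_X Dx.
have [qx1 qx2 qx3] : [/\ cdd q x <= 1, (L0 + 1) * cdd q x <= 2 * h & (L1 + 1) * cdd q x <= dl].
  move: qx; rewrite !le_min => /andP[-> /andP[]]; rewrite (ler_pdivlMr _ _ L0p) (ler_pdivlMr _ _ L1p) => u v.
  by split=> //; rewrite mulrC.
have c0 := cdd_ge0 q x.
have x1 : gauge x <= 1 by exact/ltW/(D_gauge_lt1 A_proper Dx).
have gx : g4 x <= 1 - 4 * h.
  rewrite /g4 -gauge4_X // (_ : 1 - 4 * h = rho ^+ 4); last by rewrite /h; lra.
  by rewrite ler_pXn2r ?nnegrE ?gauge_ge0 ?(ltW rho0) // hrho.
have gq : g4 q <= 1 - 2 * h.
  have := hL0 x q xX qX x1 qx1; rewrite ler_norml => /andP[_ hh].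
  move: qx2; rewrite mulrDl mul1r; lra.
have [q1 hq] := top_height qX h_gt0 gq.
have [_ hx] : gauge x <= 1 /\ h <= ht (top x) by apply: top_height => //; lra.
have dq : dom h (q, x) by [].
have dx : dom h (x, x) by [].
have topH : in_H (top q) by exact: lt_le_trans h_gt0 hq.
have topHx : in_H (top x) by exact: lt_le_trans h_gt0 hx.
set c := chord_coef (top q) x.
have cd : knorm (c - 1) <= dl.
  have := hL1 _ _ dq dx; rewrite /= (chord_coef_above xX topHx) -/c => h1.
  apply: le_trans h1 _; apply: le_trans qx3; rewrite /pdd /=.
  have -> : cdd x x = 0 by rewrite /cdd big1 // => ic _; rewrite subrr normr0.
  by rewrite addr0 ler_wpM2r // lerDl.
have dl2 : dl <= 1 / 2.
  rewrite /dl ler_pdivrMr ?exprn_gt0 //.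
  have : 2 ^+ 2 <= q0 ^+ 2 by rewrite ler_pXn2r ?nnegrE // ltW.
  rewrite expr2; lra.
have c1 : 1 / 2 <= knorm c.
  have := knorm_triangle2 1 (1 - c); rewrite knorm1 (_ : 1 - (1 - c) = c) => [h1|]; last by rewrite opprB addrCA subrr addr0.
  have := knormB 1 c; lra.
split; first by split; [exact: dq|exact: c1].
have [t1 _ _] := chord_vE topH xX; rewrite /to_section -t1.
set gam := pel (top q) (chord (top q) x).
have gg : geodesic gam by exact: chord_geodesic.
exists gam => //; have fe := chord_end topH xX; rewrite -/gam in fe.
have [t et] := @ex_sqr_surj R k _ (exprn_gt0 2 S_gt0).
have etS : ex t = q0.
  by apply/eqP; rewrite -(@eqrXn2 _ 2) ?et // ltW // ex_gt0.
have t0 : 0 < t by rewrite -(@ex_lt R k) ex0 etS.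
apply: (on_section_high gg fe Dx nx (th := - t)).
- by rewrite /gam (pel_at0 (chord_pedata topH xX)) gauge_top.
- by rewrite oppr_lt0.
have := chord_ht topH xX (- t); rewrite -/gam -/c exN etS invrK.
set w := kreal k q0 * _ + _ => hw; clearbody c.
have nw : knorm w <= 4 / q0.
  apply: le_trans (knorm_triangle _ _) _; rewrite !knormM !knorm_kreal.
  rewrite !ger0_norm ?invr_ge0 ?(ltW S_gt0) // knormB.
  have cn : knorm c <= 1 + dl.
    by rewrite -[c](subrK 1) addrC; apply: le_trans (knorm_triangle _ _) _; rewrite knorm1 lerD2l.
  apply: (@le_trans _ _ (q0 * dl + (1 + dl) * q0^-1)).
    apply: lerD; first by apply: ler_wpM2l => //; exact: ltW.
    by apply: ler_wpM2r => //; rewrite invr_ge0 ltW.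
  have -> : q0 * dl = 2 * q0^-1 by rewrite /dl; field; rewrite lt0r_neq0.
  have Si : 0 < q0^-1 by rewrite invr_gt0.
  have := ler_wpM2r (ltW Si) dl2; lra.
have nw2 : knsq w <= 16 / q0 ^+ 2.
  rewrite -knorm_sqr (_ : 16 / q0 ^+ 2 = (4 / q0) ^+ 2); last by field; rewrite lt0r_neq0.
  have q4 : 0 <= 4 / q0 by apply: divr_ge0 => //; exact: ltW.
  by rewrite ler_pXn2r ?nnegrE ?knorm_ge0.
rewrite ltNge; apply/negP => hle.
have : ht (top q) <= h0 * (16 / q0 ^+ 2).
  rewrite -hw; apply: ler_pM => //; [exact/ltW/gg.1|exact: knsq_ge0].
apply/negP; rewrite -ltNge; apply: lt_le_trans hq.
rewrite mulrA ltr_pdivrMr ?exprn_gt0 //.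
have hS : 16 * h0 < h * q0.
  rewrite /q0 mulrDr mulrCA mulfV ?lt0r_neq0 // mulr1 ltrDl mulr_gt0 //.
have : h * q0 <= h * q0 ^+ 2 by rewrite ler_pM2l // expr2 ler_peMl // ltW.
by rewrite [h0 * 16]mulrC; move: hS; lra.
Qed.

Lemma section_content_neq0 s : 0 <= s -> s < (2 * d)%:R ->
  hausdorff_content s (section_W A h2 h0) <> 0%E.
Proof.
have [h [h_gt0 [eta eta0 hN]]] := near_diagonal.
have dp : 0 < d%:R :> R by rewrite ltr0n (ncoord_gt0 n_gt0).
(* Two points of a cube of half-side [sg] differ by at most [2 * sg] in each of the [d] coordinates,
   hence by at most [eta] in [cdd]. *)
pose sg := eta / (2 * d%:R); have sg0 : 0 < sg by rewrite divr_gt0 // mulr_gt0.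
have [c [mu [mu0 hmu]]] := positive_cell n_gt0 A_discrete sg0.
apply: (content_neq0 (c0 := c) n_gt0 h_gt0 sg0 mu0 hmu) => q x [qX hq] [gx [xX hx]].
apply: hN => //; apply: (@le_trans _ _ (d%:R * (sg + sg))).
  apply: cdd_le => ic hic; apply: le_trans (ler_distD (c ic) _ _) _.
  by rewrite lerD ?hq // distrC hx.
by rewrite /sg le_eqVlt; apply/orP; left; apply/eqP; field; rewrite lt0r_neq0.
Qed.
End Lower.

Lemma section_codimension_one eps h2 h0 : cf_proper A -> cf_discrete A -> 0 < eps ->
  wall_height A eps h2 -> (1 + eps) ^+ 2 <= h0 -> codimension_one (section_W A h2 h0).
Proof.
move=> A_proper A_discrete e0 h2P he; have [/andP[h20 _] _] := h2P.
split; first by move=> _ [gam [gg _ _ _] <-]; exists gam.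
suff -> : hausdorff_dim (section_W A h2 h0) = (2 * d)%:R%:E.
  by rewrite dim_T1H_ncoord -EFinD natr1.
apply/eqP; rewrite eq_le; apply/andP; split.
  apply/lee_addgt0Pr => e e_gt0; apply: ereal_inf_lbound; exists ((2 * d)%:R + e); last by [].
  split; first by rewrite addr_ge0 // ltW.
  by apply: section_content => //; rewrite ltrDl.
apply: le_ereal_inf_tmp => _ [s [s0 hs] <-]; rewrite lee_fin leNgt; apply/negP => sd.
exact: section_content_neq0 A_proper A_discrete e0 h2P he s s0 sd hs.
Qed.
End Dimension.

Theorem theorem5p1 (R : realType) (k : scalars) (n : nat) (n_gt0 : (0 < n)%N)
    (A : iwasawa_cf R k n)
    (A_complete : cf_complete A) (A_proper : cf_proper A)
    (A_discrete : cf_discrete A)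
    (eps h2 : R) (eps_gt0 : 0 < eps)
    (eps_rad : ((1 + eps)%:E < (cf_rad A)^-1)%E)
    (h2P : wall_height A eps h2) :
  exists h0 : R, [/\ 1 < h0, codimension_one (section_W A h2 h0) &
  exists (mark : (R -> kpoint R k n) -> marking R k n) (c : R), 0 < c /\
  forall gam : R -> kpoint R k n,
    markable A h2 h0 gam -> section_W A h2 h0 (tangent gam 0) ->
  let a := mk_a (mark gam) in
  let M := mk_M (mark gam) in
  let ix := mk_i (mark gam) in
  let tm := mk_t (mark gam) in
  [/\ forall i, cf_lattice A (a i),
      forall i, cf_modular A (M i),
      {homo ix : j l / j < l} /\ {homo tm : j l / j < l}
    & ix 0 = 0 /\ tm 0 = 0] /\
  [/\ (* full coverage *)
      (forall j, c <= tm j - tm (j - 1)) /\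
      (forall t : R, exists j, tm (j - 1) <= t <= tm j),
      (* relation to the shift map *)
      exists2 x : kpoint R k n, forward_end gam = Some x &
        forall i : nat, (0 < i)%N ->
        [/\ a i%:Z = cf_digit A i x,
            M i%:Z = (\prod_(1 <= j < i.+1) ((cf_inv A)^-1 * a j%:Z))%g
          & is_branch A i (M i%:Z) x],
      (* cusp detection *)
      forall (j : int) (t : R) (N : PUJ R k n),
        tm (j - 1) <= t <= tm j -> cf_modular A N -> h0 < ht_cusp N (gam t) ->
        (Some @` cf_domain A) (xmob N^-1%g (forward_end gam)) ->
        N = M (ix j),
      (* intersection detection *)
      forall (N : PUJ R k n) (t : R), cf_modular A N ->
        (ttranslate N (section_W A h2 h0) (tangent gam t) <->
         exists j, t = tm j /\ N = M (ix j))
    & (* shifted Gauss equivariance *)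
      forall l : int,
        let gam' := fun t => mob (M (ix l))^-1%g (gam (t + tm l)) in
        let m' := mark gam' in
        (markable A h2 h0 gam' /\ section_W A h2 h0 (tangent gam' 0)) /\
        [/\ forall j, mk_t m' j = tm (j + l) - tm l,
            forall j, mk_i m' j = ix (j + l) - ix l,
            forall i, mk_a m' i = a (i + ix l)
          & forall i, mk_M m' i = ((M (ix l))^-1 * M (i + ix l))%g]]].
Proof.
have [rho /andP[rho0 rho1] hrho] := rad_bound A_proper.
have [kp /andP[kp0 kp1] cusp] := cusp_bound n_gt0 A_proper A_discrete.
have [/andP[h20 h21] _] := h2P.
pose x := h2 * kp; have x0 : 0 < x by rewrite mulr_gt0.
have x1 : x < 1.
  by apply: le_lt_trans h21; rewrite /x -[leRHS]mulr1 ler_wpM2l // ltW.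
have r0 : 0 < 1 - rho by rewrite subr_gt0.
pose y := kp * (1 - rho); have y0 : 0 < y by rewrite mulr_gt0.
(* The quarter of [y] absorbs the factor [3 - rho], which is at most 3. Since [x < 1], the half of
   [x] gives [delta < 1] and so [delta^2 <= delta < x]. *)
have [delta [delta0 delta_y delta_x]] : exists dl, [/\ 0 < dl, dl <= y / 4 & dl <= x / 2].
  exists (Num.min (y / 4) (x / 2)); split; last by rewrite ge_min lexx orbT.
    by rewrite lt_min !divr_gt0.
  by rewrite ge_min lexx.
have delta_kp : delta * (3 - rho) < kp * (1 - rho).
  have : delta * (3 - rho) <= delta * 3 by rewrite ler_wpM2l ?(ltW delta0) // gerBl ltW.
  rewrite -/y; lra.
have delta_h2 : delta ^+ 2 < h2 * kp.
  have : delta ^+ 2 <= delta * 1 by rewrite expr2 ler_wpM2l ?(ltW delta0) //; lra.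
  rewrite -/x; lra.
pose u := h2 * kp ^+ 2; have u0 : 0 < u by rewrite mulr_gt0 // exprn_gt0.
pose v := delta ^+ 2 * kp ^+ 2; have v0 : 0 < v by rewrite mulr_gt0 // exprn_gt0.
(* The three requirements are positive lower bounds, so their sum satisfies all of them. *)
have [h0 [he hu hv]] : exists h0 : R, [/\ (1 + eps) ^+ 2 <= h0, u^-1 <= h0 & 4 / v <= h0].
  have a0 : 0 < (1 + eps) ^+ 2 by rewrite exprn_gt0 // addr_gt0.
  have b0 : 0 < u^-1 by rewrite invr_gt0.
  have c0 : 0 < 4 / v by rewrite divr_gt0.
  by exists ((1 + eps) ^+ 2 + u^-1 + 4 / v); split; lra.
exists h0; split.
- exact: h0_gt1 eps_gt0 he.
- exact: (section_codimension_one n_gt0 A_proper A_discrete eps_gt0 h2P he).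
apply: (markings_exist n_gt0 A_complete A_proper eps_gt0 h2P kp0 kp1 cusp rho1 hrho he _
  delta0 _ delta_kp delta_h2).
  by rewrite -mulrA -/u -ler_pdivrMr // mul1r.
by rewrite -/v mulrC -ler_pdivrMr.
Qed.
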